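(* Let $2<\alpha<\infty$, let $\Omega_1,\Omega_2\subset\mathbb C$ be a conformal $\alpha$-regular pair, and let $\varphi_1,\varphi_2$ be conformal mappings of the unit disc $\mathbb D$ with $\Omega_1=\varphi_1(\mathbb D)$, $\Omega_2=\varphi_2(\mathbb D)$. Then for any $n\in\mathbb N$ $$ |\lambda_{n}[\Omega_{1}]-\lambda_{n}[\Omega_{2}]|\leq 2c_n \left[C\left(\frac{4\alpha}{\alpha-2}\right)\right]^2 E_{\alpha}(\varphi_1,\varphi_2)\,\big\|\,|\varphi_1'|-|\varphi_2'|\,\big\|_{L^{2}(\mathbb D)}, $$ where $c_{n}=\max\{\lambda_{n}^{2}[\Omega_{1}],\lambda_{n}^{2}[\Omega_{2}]\}$.
   Context: Conformal mappings are conformal homeomorphisms onto the indicated domain (univalent holomorphic maps). A domain $\Omega\subset\mathbb C$ is conformal $\alpha$-regular ($\alpha>2$) if there is a conformal mapping $\varphi$ of the unit disc $\mathbb D$ onto $\Omega$ with $\varphi'\in L^{\alpha}(\mathbb D)$ (this does not depend on the choice of $\varphi$). Two conformal $\alpha$-regular domains $\Omega_1,\Omega_2$ form a conformal $\alpha$-regular pair if there exists a conformal mapping $\psi:\Omega_1\to\Omega_2$ (onto) such that $\iint_{\Omega_1}|\psi'(z)|^{\alpha}\,dxdy<\infty$ and $\iint_{\Omega_2}|(\psi^{-1})'(w)|^{\alpha}\,dudv<\infty$. For a conformal regular domain $\Omega$ (i.e. conformal $\alpha$-regular for some $\alpha>2$) the embedding $W^{1,2}(\Omega)\to L^2(\Omega)$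 is compact, and $0=\lambda_1[\Omega]<\lambda_2[\Omega]\le\dots\le\lambda_n[\Omega]\le\dots$ denote the eigenvalues of the Neumann Laplacian $-\Delta$ in $\Omega$ (weak formulation in $W^{1,2}(\Omega)$), repeated according to multiplicity; equivalently $$\lambda_n[\Omega]=\inf_{L\subset W^{1,2}(\Omega),\ \dim L=n}\ \sup_{f\in L,\ f\neq0}\frac{\iint_\Omega|\nabla f|^2\,dxdy}{\iint_\Omega|f|^2\,dxdy}.$$ Energy functional: $$E_{\alpha}(\varphi_1,\varphi_2)=\left(\iint_{\mathbb D}\max\left\{\frac{|\varphi_1'(z)|^{\alpha}}{|\varphi_2'(z)|^{\alpha-2}},\frac{|\varphi_2'(z)|^{\alpha}}{|\varphi_1'(z)|^{\alpha-2}}\right\}dxdy\right)^{1/\alpha}.$$ Constant $C(q)$, $2\le q<\infty$: put $h_k=|\varphi_k'|^2$ and $f_{\mathbb D,h_k}=\big(\iint_{\mathbb D}h_k\,dxdy\big)^{-1}\iint_{\mathbb D}f h_k\,dxdy$ for $k=1,2$. Let $C_k(q)$ be the best possible constant in $$\Big(\iint_{\mathbb D}|f-f_{\mathbb D,h_k}|^q h_k\,dxdy\Big)^{1/q}\le C_k(q)\Big(\iint_{\mathbb D}|\nabla f|^2dxdy\Big)^{1/2}\quad\text{for all } f\in W^{1,2}(\mathbb D,h_k,1),$$ where $W^{1,2}(\mathbb D,h,1)$ is the space of locally integrable weakly differentiable $f:\mathbb D\to\mathbb R$ with $\big(\iint_{\mathbb D}|f|^2h\big)^{1/2}+\big(\iint_{\mathbb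 D}|\nabla f|^2\big)^{1/2}<\infty$. Then $C(q)=\max\{C_1(q),C_2(q)\}$. *)

(* Defs.v *)
From HB Require Import structures.
From mathcomp Require Import all_boot all_order all_algebra.
From mathcomp Require Export complex.
From mathcomp Require Import all_classical all_reals all_analysis.

Set Implicit Arguments.
Unset Strict Implicit.
Unset Printing Implicit Defensive.

Import Order.TTheory GRing.Theory Num.Theory.
Import numFieldNormedType.Exports.

Local Open Scope classical_set_scope.
Local Open Scope ring_scope.

(* The complex plane appears as R[i] for holomorphy and as R * R for
   integration and Sobolev spaces; [toC] and [region] pass from one to the
   other. *)
Definition toC (R : realType) (p : R * R) : R[i] := Complex p.1 p.2.

Definition region (R : realType) (Omega : set R[i]) : set (R * R) :=
  @toC R @^-1` Omega.

Definition area (R : realType) := (@lebesgue_measure R \x @lebesgue_measure R)%E.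

Definition unit_disc (R : realType) : set R[i] := [set z | Normc.normc z < 1].

(* The library puts a topology and a normed module structure over R[i] on the
   alias R[i]^o only; there [derivable] and [derive1] are complex
   differentiability and the complex derivative. *)
Definition domain (R : realType) (Omega : set R[i]) : Prop :=
  [/\ Omega !=set0, open (Omega : set R[i]^o) & connected (Omega : set R[i]^o)].

Definition conformal (R : realType) (U V : set R[i]) (f : R[i] -> R[i]) : Prop :=
  [/\ (forall z, U z -> derivable (f : R[i]^o -> R[i]^o) z 1),
      (forall z w, U z -> U w -> f z = f w -> z = w) &
      f @` U = V].

(* |f'(z)| as an element of R, with z = p.1 + i p.2 *)
Definition abs_deriv (R : realType) (f : R[i] -> R[i]) (p : R * R) : R :=
  Normc.normc (derive1 (f : R[i]^o -> R[i]^o) (toC p)).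

Definition deriv_power_integrable (R : realType) (alpha : R) (U : set R[i])
    (f : R[i] -> R[i]) : Prop :=
  (\int[@area R]_(p in region U) (abs_deriv f p `^ alpha)%:E < +oo)%E.

Definition conformal_regular (R : realType) (alpha : R) (Omega : set R[i]) :
    Prop :=
  domain Omega /\
  exists phi, conformal (@unit_disc R) Omega phi /\
    deriv_power_integrable alpha (@unit_disc R) phi.

Definition conformal_regular_pair (R : realType) (alpha : R)
    (Omega1 Omega2 : set R[i]) : Prop :=
  [/\ conformal_regular alpha Omega1, conformal_regular alpha Omega2 &
      exists psi psi_inv : R[i] -> R[i],
        [/\ conformal Omega1 Omega2 psi,
            (forall z, Omega1 z -> psi_inv (psi z) = z),
            deriv_power_integrable alpha Omega1 psi &
            deriv_power_integrable alpha Omega2 psi_inv]].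

Fixpoint Ck (R : realType) (k : nat) (f : R * R -> R) : Prop :=
  continuous f /\
  if k is k'.+1 then
    [/\ forall p, derivable f p (1, 0), forall p, derivable f p (0, 1),
        Ck k' ('D_(1, 0) f) & Ck k' ('D_(0, 1) f)]
  else True.

Definition test_function (R : realType) (U : set (R * R)) (eta : R * R -> R) :
    Prop :=
  (forall k, Ck k eta) /\
  exists K : set (R * R),
    [/\ compact K, K `<=` U & forall p, ~ K p -> eta p = 0].

Definition locally_integrable2 (R : realType) (U : set (R * R))
    (f : R * R -> R) : Prop :=
  measurable_fun (U : set (measurableTypeR R * measurableTypeR R)) f /\
  forall K : set (R * R), K `<=` U -> compact K ->
    (\int[@area R]_(p in K) `|f p|%:E < +oo)%E.

Definition weak_gradient (R : realType) (U : set (R * R))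
    (f g1 g2 : R * R -> R) : Prop :=
  [/\ locally_integrable2 U f, locally_integrable2 U g1,
      locally_integrable2 U g2 &
      forall eta, test_function U eta ->
        (\int[@area R]_(p in U) (f p * 'D_(1, 0) eta p))
          = - (\int[@area R]_(p in U) (g1 p * eta p)) /\
        (\int[@area R]_(p in U) (f p * 'D_(0, 1) eta p))
          = - (\int[@area R]_(p in U) (g2 p * eta p))].

(* f belongs to W^{1,2}(U, h, 1) and (g1, g2) is its weak gradient.  Functions
   stand for their almost everywhere classes, so the gradient is carried along
   instead of being selected.  The weight h = 1 gives W^{1,2}(U). *)
Definition W12 (R : realType) (U : set (R * R)) (h f g1 g2 : R * R -> R) :
    Prop :=
  [/\ weak_gradient U f g1 g2,
      (\int[@area R]_(p in U) (f p ^+ 2 * h p)%:E < +oo)%E &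
      (\int[@area R]_(p in U) (g1 p ^+ 2 + g2 p ^+ 2)%:E < +oo)%E].

Definition dirichlet (R : realType) (U : set (R * R)) (g1 g2 : R * R -> R) : R :=
  \int[@area R]_(p in U) (g1 p ^+ 2 + g2 p ^+ 2).

Definition lin_comb (R : realType) (n : nat) (c : 'I_n -> R)
    (u : 'I_n -> R * R -> R) (p : R * R) : R :=
  \sum_(i < n) c i * u i p.

(* u is a basis of an n-dimensional subspace of W^{1,2}(U); linear independence
   is that of almost everywhere classes. *)
Definition W12_basis (R : realType) (U : set (R * R)) (n : nat)
    (u : 'I_n -> R * R -> R) : Prop :=
  (forall i, exists g1 g2, W12 U (cst 1) (u i) g1 g2) /\
  forall c : 'I_n -> R,
    {ae @area R, forall p, U p -> lin_comb c u p = 0} -> forall i, c i = 0.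

Definition rayleigh_set (R : realType) (U : set (R * R)) (n : nat)
    (u : 'I_n -> R * R -> R) : set (\bar R) :=
  [set x | exists (c : 'I_n -> R) (g1 g2 : R * R -> R),
    [/\ exists i, c i != 0, W12 U (cst 1) (lin_comb c u) g1 g2 &
        x = (dirichlet U g1 g2
              / \int[@area R]_(p in U) (lin_comb c u p ^+ 2))%:E]].

(* n-th Neumann eigenvalue, n >= 1, by the min-max formula. *)
Definition neumann_eigenvalue (R : realType) (Omega : set R[i]) (n : nat) :
    \bar R :=
  ereal_inf [set ereal_sup (rayleigh_set (region Omega) u) |
             u in [set u : 'I_n -> R * R -> R | W12_basis (region Omega) u]].

Definition energy (R : realType) (alpha : R) (phi1 phi2 : R[i] -> R[i]) :
    \bar R :=
  ((\int[@area R]_(p in region (@unit_disc R))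
     (Num.max
       (abs_deriv phi1 p `^ alpha / abs_deriv phi2 p `^ (alpha - 2))
       (abs_deriv phi2 p `^ alpha / abs_deriv phi1 p `^ (alpha - 2)))%:E)
    `^ alpha^-1)%E.

Definition deriv_L2_dist (R : realType) (phi1 phi2 : R[i] -> R[i]) : \bar R :=
  ((\int[@area R]_(p in region (@unit_disc R))
     (`|abs_deriv phi1 p - abs_deriv phi2 p| ^+ 2)%:E) `^ 2^-1)%E.

Definition weighted_mean (R : realType) (U : set (R * R)) (h f : R * R -> R) : R :=
  (\int[@area R]_(p in U) h p)^-1 * \int[@area R]_(p in U) (f p * h p).

(* Best constant of the weighted Poincare-Sobolev inequality; +oo when the
   inequality holds with no finite constant. *)
Definition poincare_sobolev_const (R : realType) (U : set (R * R))
    (h : R * R -> R) (q : R) : \bar R :=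
  ereal_inf [set K%:E | K in [set K : R | 0 <= K /\
    forall f g1 g2, W12 U h f g1 g2 ->
      ((\int[@area R]_(p in U)
          (`|f p - weighted_mean U h f| `^ q * h p)%:E) `^ q^-1
        <= (K * Num.sqrt (dirichlet U g1 g2))%:E)%E]].

Definition conformal_weight (R : realType) (phi : R[i] -> R[i]) (p : R * R) : R :=
  abs_deriv phi p ^+ 2.

Definition C_const (R : realType) (phi1 phi2 : R[i] -> R[i]) (q : R) : \bar R :=
  Order.max
    (poincare_sobolev_const (region (@unit_disc R)) (conformal_weight phi1) q)
    (poincare_sobolev_const (region (@unit_disc R)) (conformal_weight phi2) q).

(* Main.v *)
Require Import Defs.
From HB Require Import structures.
From mathcomp Require Import all_boot all_order all_algebra.
From mathcomp Require Import all_classical all_reals all_analysis.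
From mathcomp Require Import measurable_realfun simple_functions measurable_fun_approximation.
From mathcomp Require Import ring lra.

(* Transplanted to the unit disc by [phi1] and [phi2], the two Neumann problems
   have the same Dirichlet integral, which is conformally invariant, and only
   differ by the weights [h_k = |phi_k'|^2].  For [f] with mean [m] for one of the
   weights, Hoelder's inequality and the Poincare-Sobolev inequality with exponent
   [4 alpha / (alpha - 2)] bound the integral of [(f - m)^2 |h1 - h2|] by [B] times
   the Dirichlet integral of [f], where [B = 2 C^2 E dist].  A subspace spanned by
   the constants and by functions of mean zero for one weight is therefore a test
   space for the other one, and the min-max formula gives
   [lambda_n - lambda_n' <= B lambda_n lambda_n'].

   Complex analysis is needed for the conformal invariance: the derivative of a
   univalent map does not vanish, its inverse is holomorphic, and both are
   smooth. *)

Set Implicit Arguments.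
Unset Strict Implicit.
Unset Printing Implicit Defensive.

Import Order.TTheory GRing.Theory Num.Theory.
Import numFieldNormedType.Exports.

Local Open Scope classical_set_scope.
Local Open Scope ring_scope.

(** The weights are compared through [|h1 - h2| = (a + b) |a - b|] with [a = |phi1'|],
    [b = |phi2'|]. Cauchy-Schwarz splits off the distance and leaves the integral of
    [(f - m)^4 (a + b)^2]. Since [(a + b)^2 <= 4 a^(2 (alpha - 2) / alpha) e^(2 / alpha)] for the
    energy density [e], Hoelder with exponents [alpha / (alpha - 2)] and [alpha / 2] produces
    [|f - m|^q a^2] with [q = 4 alpha / (alpha - 2)], and the factor 2 is the square root of this 4.
    Eigenvalues enter as infima approached from above by bounds [L] that come with a test space, and
    [c_n] appears through [lambda_n lambda_n' <= c_n]. All contours are rectangles, and [2 pi i] is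
    never computed: the winding integral is only shown to have derivative zero and no zeros, which
    is enough to divide by it. The right-hand side is a product of extended reals, where
    [0 * +oo = 0]. An infinite factor settles the inequality only if the others are positive, so the
    Poincare-Sobolev constants and the energy are proved positive, and a vanishing distance is a
    case of its own. *)

Notation nc := Normc.normc.
Notation Re := complex.Re.
Notation Im := complex.Im.

(** * Complex differentiability *)

Section complex_basics.
Variable R : realType.
Implicit Types (z w : R[i]) (f g : R[i] -> R[i]).

(** Radii are real here, whereas the normed structure of [R[i]^o] measures distances by complex
    numbers. *)
Definition ccont f z := forall e : R, 0 < e ->
  exists2 d, 0 < d & forall w, nc (w - z) < d -> nc (f w - f z) < e.

Lemma normE z : `|z| = (nc z)%:C%C.
Proof. by rewrite normc_def; case: z. Qed.

Lemma ncR (x : R) : nc x%:C%C = `|x|.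
Proof. by rewrite /= expr0n /= addr0 sqrtr_sqr. Qed.

Lemma nc_ge0 z : 0 <= nc z.
Proof. by case: z => a b; exact: sqrtr_ge0. Qed.

Lemma ncN z : nc (- z) = nc z.
Proof. by case: z => a b /=; rewrite !sqrrN. Qed.

Lemma ncD z w : nc (z + w) <= nc z + nc w.
Proof. exact: le_normcD. Qed.

Lemma ncB z w : nc (z - w) = nc (w - z).
Proof. by rewrite -ncN opprB. Qed.

Lemma nc_le_add z w : nc z <= nc w + nc (z - w).
Proof. by rewrite -[in leLHS](subrK w z) addrC ncD. Qed.

Lemma ncBD z w v : nc (z - w) <= nc (z - v) + nc (v - w).
Proof. by rewrite -(subrKA v) ncD. Qed.

Lemma nc_eq0 z : (nc z == 0) = (z == 0).
Proof.
apply/eqP/eqP => [/Normc.eq0_normc //|->]; exact: Normc.normc0.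
Qed.

Lemma nc_gt0 z : (0 < nc z) = (z != 0).
Proof. by rewrite lt_neqAle nc_ge0 andbT eq_sym nc_eq0. Qed.

Lemma ncX z n : nc (z ^+ n) = nc z ^+ n.
Proof.
by elim: n => [|n ih]; rewrite ?expr0 ?Normc.normc1// !exprS Normc.normcM ih.
Qed.

Lemma nc_Re z : `|Re z| <= nc z.
Proof.
by case: z => a b /=; rewrite -sqrtr_sqr ler_wsqrtr// lerDl sqr_ge0.
Qed.

Lemma nc_Im z : `|Im z| <= nc z.
Proof.
by case: z => a b /=; rewrite -sqrtr_sqr ler_wsqrtr// lerDr sqr_ge0.
Qed.

Lemma nc_le z : nc z <= `|Re z| + `|Im z|.
Proof.
case: z => a b /=; rewrite -(@ger0_norm _ (`|a| + `|b|)) ?addr_ge0//.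
rewrite -sqrtr_sqr ler_wsqrtr// sqrrD !real_normK ?num_real//.
by rewrite lerD2r lerDl mulrn_wge0// mulr_ge0.
Qed.

Lemma sqr_nc z : nc z ^+ 2 = Re z ^+ 2 + Im z ^+ 2.
Proof. by case: z => a b /=; rewrite sqr_sqrtr// addr_ge0// sqr_ge0. Qed.

Lemma ReD z w : Re (z + w) = Re z + Re w. Proof. by case: z; case: w. Qed.
Lemma ImD z w : Im (z + w) = Im z + Im w. Proof. by case: z; case: w. Qed.
Lemma ReB z w : Re (z - w) = Re z - Re w. Proof. by case: z; case: w. Qed.
Lemma ImB z w : Im (z - w) = Im z - Im w. Proof. by case: z; case: w. Qed.
Lemma ReM z w : Re (z * w) = Re z * Re w - Im z * Im w.
Proof. by case: z; case: w. Qed.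
Lemma ImM z w : Im (z * w) = Re z * Im w + Im z * Re w.
Proof. by case: z; case: w. Qed.
Lemma ReV z : Re z^-1 = Re z / nc z ^+ 2.
Proof. by rewrite sqr_nc; case: z. Qed.
Lemma ImV z : Im z^-1 = - Im z / nc z ^+ 2.
Proof. by rewrite sqr_nc; case: z => a b /=; rewrite mulNr. Qed.

Lemma complex_eq z w : Re z = Re w -> Im z = Im w -> z = w.
Proof. by case: z w => a b [c d] /= -> ->. Qed.

Lemma ltc_real (x : R) (e : R[i]) : 0 < e -> (x%:C%C < e) = (x < Re e).
Proof.
by case: e => a b; rewrite !ltcE/= => /andP[/eqP-> _]; rewrite eqxx.
Qed.

Lemma ccontP f z : {for z, continuous (f : R[i]^o -> R[i]^o)} <-> ccont f z.
Proof.
split.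
  move=> /cvgrPdist_lt h e e0.
  have ec0 : 0 < e%:C%C :> R[i] by rewrite ltcR.
  have /nbhs_ballP[d /= d0 dh] := h _ ec0.
  have d0' : 0 < Re d by move: d0; rewrite ltcE => /andP[_].
  exists (Re d) => // w wz; have := dh w.
  rewrite /ball/= normE ltc_real// (ncB z) => /(_ wz).
  by rewrite normE ltcR (ncB (f z)).
move=> h; apply/(@cvgrPdist_lt _ (R[i]^o) _ (nbhs (z : R[i]^o))) => e e0.
have e0' : 0 < Re e by move: e0; rewrite ltcE => /andP[_].
have [d d0 dh] := h _ e0'.
apply/nbhs_ballP; exists d%:C%C => /=; first by rewrite ltcR.
move=> w; rewrite /ball/= normE ltcR (ncB z) => /dh.
by rewrite normE ltc_real// (ncB (f z)).
Qed.

Lemma ccontD f g z : ccont f z -> ccont g z -> ccont (fun w => f w + g w) z.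
Proof. by move=> /ccontP cf /ccontP cg; apply/ccontP; exact: (cvgD cf cg). Qed.

Lemma ccontB f g z : ccont f z -> ccont g z -> ccont (fun w => f w - g w) z.
Proof. by move=> /ccontP cf /ccontP cg; apply/ccontP; exact: (cvgB cf cg). Qed.

Lemma ccontM f g z : ccont f z -> ccont g z -> ccont (fun w => f w * g w) z.
Proof. by move=> /ccontP cf /ccontP cg; apply/ccontP; exact: (cvgM cf cg). Qed.

Lemma ccontN f z : ccont f z -> ccont (fun w => - f w) z.
Proof. by move=> /ccontP cf; apply/ccontP; exact: (cvgN cf). Qed.

Lemma ccontV f z : f z != 0 -> ccont f z -> ccont (fun w => (f w)^-1) z.
Proof. by move=> fz /ccontP cf; apply/ccontP; exact: (cvgV fz cf). Qed.

Lemma ccont_cst c z : ccont (fun=> c) z.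
Proof. by move=> e e0; exists e => // w _; rewrite subrr Normc.normc0. Qed.

Lemma ccont_id z : ccont id z.
Proof. by move=> e e0; exists e. Qed.

Lemma ccont_sub c z : ccont (fun w => w - c) z.
Proof. by move=> e e0; exists e => // w; rewrite opprB addrA subrK. Qed.

Lemma ccont_comp f g z : ccont f z -> ccont g (f z) -> ccont (fun w => g (f w)) z.
Proof.
move=> cf cg e /cg[d d0 dh]; have [d' d'0 dh'] := cf _ d0.
by exists d' => // w /dh' /dh.
Qed.

Lemma ccont_near f g z d : 0 < d -> (forall w, nc (w - z) < d -> f w = g w) ->
  ccont f z -> ccont g z.
Proof.
move=> d0 fg h e /h[d1 d10 h1].
exists (Num.min d d1); first by rewrite lt_min d0.
move=> w; rewrite lt_min => /andP[wd wd1].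
by rewrite -!fg ?h1// subrr Normc.normc0.
Qed.

Lemma ccontX f z n : ccont f z -> ccont (fun w => f w ^+ n) z.
Proof.
move=> cf; elim: n => [|n ih]; first exact: ccont_cst.
apply: (ccont_near ltr01 _ (ccontM cf ih)) => w _.
by rewrite exprS.
Qed.

Lemma ccont_gt0 f z : ccont f z -> f z != 0 ->
  exists2 d, 0 < d & forall w, nc (w - z) < d -> f w != 0.
Proof.
move=> h fz; have [|d d0 dh] := h (nc (f z)); first by rewrite nc_gt0.
exists d => // w /dh; apply: contraTneq => ->.
by rewrite sub0r ncN ltxx.
Qed.

(* Caratheodory's formulation of complex differentiability, which makes the
   product, quotient and chain rules algebraic. *)
Definition cdiff f z d := exists q : R[i] -> R[i],
  [/\ forall w, f w = f z + q w * (w - z), ccont q z & q z = d].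

Lemma cdiff_cont f z d : cdiff f z d -> ccont f z.
Proof.
move=> [q [fq cq _]].
have : ccont (fun w => f z + q w * (w - z)) z.
  apply: ccontD; first exact: ccont_cst.
  apply: ccontM => //.
  exact: ccont_sub.
by apply: (ccont_near ltr01) => w _; rewrite -fq.
Qed.

Lemma cdiff_cst c z : cdiff (fun=> c) z 0.
Proof.
by exists (fun=> 0); split=> // [w|]; [rewrite mul0r addr0|exact: ccont_cst].
Qed.

Lemma cdiff_id z : cdiff id z 1.
Proof.
by exists (fun=> 1); split=> // [w|]; [rewrite mul1r addrC subrK|exact: ccont_cst].
Qed.

Lemma cdiffD f g z a b : cdiff f z a -> cdiff g z b ->
  cdiff (fun w => f w + g w) z (a + b).
Proof.
move=> [p [fp cp <-]] [q [gq cq <-]]; exists (fun w => p w + q w); split => //.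
- by move=> w; rewrite fp gq; ring.
- exact: ccontD.
Qed.

Lemma cdiffM f g z a b : cdiff f z a -> cdiff g z b ->
  cdiff (fun w => f w * g w) z (a * g z + f z * b).
Proof.
move=> cf cg; have gc := cdiff_cont cg.
move: cf cg => [p [fp cp <-]] [q [gq cq <-]].
exists (fun w => p w * g w + f z * q w); split => //.
- by move=> w; rewrite [f w]fp [g w]gq; ring.
- by apply: ccontD; apply: ccontM => //; exact: ccont_cst.
Qed.

Lemma cdiffV f z a : f z != 0 -> cdiff f z a ->
  cdiff (fun w => (f w)^-1) z (- a / f z ^+ 2).
Proof.
move=> fz cf; have fc := cdiff_cont cf.
have [d d0 fd] := ccont_gt0 fc fz.
case: cf => [p [fp cp <-]].
pose q w := if w == z then - p z / f z ^+ 2 else ((f w)^-1 - (f z)^-1) / (w - z).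
exists q; split; last by rewrite /q eqxx.
- move=> w; rewrite /q; have [->|wz] := eqVneq w z.
    by rewrite subrr mulr0 addr0.
  by rewrite divfK ?subr_eq0// addrC subrK.
- have : ccont (fun w => - p w / (f w * f z)) z.
    apply: ccontM; first exact: ccontN.
    apply: ccontV; first by rewrite mulf_neq0.
    by apply: ccontM => //; exact: ccont_cst.
  apply: (ccont_near d0) => w /fd fw; rewrite /q.
  have [->//|wz] := eqVneq w z.
  have wz' : w - z != 0 by rewrite subr_eq0.
  have -> : p w = (f w - f z) / (w - z) by rewrite fp addrAC subrr add0r mulfK.
  by field; rewrite fw fz wz'.
Qed.

Lemma cdiff_comp f g z a b : cdiff f z a -> cdiff g (f z) b ->
  cdiff (fun w => g (f w)) z (b * a).
Proof.
move=> cf cg; have fc := cdiff_cont cf.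
move: cf cg => [p [fp cp <-]] [q [gq cq <-]].
exists (fun w => q (f w) * p w); split => //.
- by move=> w /=; rewrite [g (f w)]gq (fp w); ring.
- by apply: ccontM => //; exact: (ccont_comp (f := f) (g := q)).
Qed.

(** The slope function in [cdiff] must satisfy its identity at every [w], so it is rebuilt globally
    as the difference quotient of [g]; near [z] it agrees with the old one. *)
Lemma cdiff_near f g z a d : 0 < d -> (forall w, nc (w - z) < d -> f w = g w) ->
  cdiff f z a -> cdiff g z a.
Proof.
move=> d0 fg [p [fp cp pa]].
pose q w := if w == z then a else (g w - g z) / (w - z).
exists q; split; last by rewrite /q eqxx.
- move=> w; rewrite /q; have [->|wz] := eqVneq w z.
    by rewrite subrr mulr0 addr0.
  by rewrite divfK ?subr_eq0// addrC subrK.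
- apply: (ccont_near d0 _ cp) => w wd; rewrite /q.
  have [->//|wz] := eqVneq w z.
  rewrite -!fg ?subrr ?Normc.normc0// fp addrAC subrr add0r mulfK//.
  by rewrite subr_eq0.
Qed.

Lemma cdiffP f z a : cdiff f z a <-> forall e : R, 0 < e -> exists2 d, 0 < d &
  forall w, nc (w - z) < d -> nc (f w - f z - a * (w - z)) <= e * nc (w - z).
Proof.
split.
  move=> [p [fp cp <-]] e /[dup] e0 /cp[d d0 dh].
  exists d => // w /dh /ltW pw.
  rewrite fp [X in nc X](_ : _ = (p w - p z) * (w - z)); last by ring.
  by rewrite Normc.normcM ler_wpM2r// nc_ge0.
move=> h.
pose q w := if w == z then a else (f w - f z) / (w - z).
exists q; split; last by rewrite /q eqxx.
- move=> w; rewrite /q; have [->|wz] := eqVneq w z.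
    by rewrite subrr mulr0 addr0.
  by rewrite divfK ?subr_eq0// addrC subrK.
(* Half of [e] turns the large inequality of the hypothesis into the strict one of continuity. *)
- move=> e e0; have [|d d0 dh] := h (e / 2); first by rewrite divr_gt0.
  exists d => // w /dh; rewrite /q eqxx; case: eqVneq => [_ _|wz].
    by rewrite subrr Normc.normc0.
  have wz' : w - z != 0 by rewrite subr_eq0.
  rewrite [X in nc X <= _](_ : _ = ((f w - f z) / (w - z) - a) * (w - z)); last by field.
  rewrite Normc.normcM ler_pM2r ?nc_gt0// => /le_lt_trans; apply.
  by rewrite ltr_pdivrMr// ltr_pMr// ltr1n.
Qed.

(** The passage from the derivative of the statement to the Caratheodory form, on which all the
    complex analysis below rests. *)
Lemma derivable_cdiff f z : derivable (f : R[i]^o -> R[i]^o) z 1 ->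
  cdiff f z (derive1 (f : R[i]^o -> R[i]^o) z).
Proof.
rewrite derive1E /derivable /derive; set D := lim _.
move=> /cvgrPdist_le; rewrite -/D => h.
apply/cdiffP => e e0.
have ec0 : 0 < e%:C%C :> R[i] by rewrite ltcR.
have /nbhs_ballP[d /= d0 dh] := h _ ec0.
have d0' : 0 < Re d by move: d0; rewrite ltcE => /andP[_].
exists (Re d) => // w wz; have [->|wz0] := eqVneq w z.
  by rewrite !subrr mulr0 subrr Normc.normc0 mulr0.
have wz' : w - z != 0 by rewrite subr_eq0.
have := dh (w - z).
rewrite /ball/= sub0r normE ncN ltc_real// => /(_ wz wz').
rewrite normE lecR => h1.
rewrite -ler_pdivrMr ?nc_gt0// -Normc.normcV -Normc.normcM ncB in h1 *.
apply: le_trans h1; rewrite /GRing.scale/= mulr1 subrK.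
rewrite le_eqVlt; apply/orP; left; apply/eqP.
by congr (nc _); rewrite mulrBl mulfK// mulrC.
Qed.

End complex_basics.

(** * Cauchy's theorem on rectangles *)

Section segment_integral.
Variable R : realType.
Implicit Types (a b c M : R) (f g : R -> R).
Local Notation mu := (@lebesgue_measure R).

Definition rint a b f : R := \int[mu]_(t in `[a, b]) f t.

(** Two-sided continuity at every point, endpoints included, which is stronger than continuity
    within the segment. Integrands below are continuous in the plane at each point of the contour,
    so they have it. *)
Definition segcont a b f := forall t, a <= t <= b -> {for t, continuous f}.

Lemma segcont_within a b f : segcont a b f -> {within `[a, b], continuous f}.
Proof.
move=> cf; apply: continuous_in_subspaceT => t.
by rewrite inE/= in_itv/= => /cf.
Qed.

Lemma segcont_integrable a b f : segcont a b f ->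
  mu.-integrable `[a, b] (EFin \o f).
Proof.
move=> /segcont_within cf; apply: continuous_compact_integrable => //.
exact: segment_compact.
Qed.

Lemma segcontD a b f g : segcont a b f -> segcont a b g ->
  segcont a b (fun t => f t + g t).
Proof. by move=> cf cg t tab; apply: continuousD; [exact: cf|exact: cg]. Qed.

Lemma segcontZ a b k f : segcont a b f -> segcont a b (fun t => k * f t).
Proof. by move=> cf t tab; apply: continuousM; [exact: cst_continuous|exact: cf]. Qed.

Lemma segcontB a b f g : segcont a b f -> segcont a b g ->
  segcont a b (fun t => f t - g t).
Proof. by move=> cf cg t tab; apply: continuousB; [exact: cf|exact: cg]. Qed.

Lemma rintD a b f g : segcont a b f -> segcont a b g ->
  rint a b (fun t => f t + g t) = rint a b f + rint a b g.
Proof. by move=> cf cg; apply: RintegralD => //; exact: segcont_integrable. Qed.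

Lemma rintB a b f g : segcont a b f -> segcont a b g ->
  rint a b (fun t => f t - g t) = rint a b f - rint a b g.
Proof. by move=> cf cg; apply: RintegralB => //; exact: segcont_integrable. Qed.

Lemma rintZ a b k f : segcont a b f ->
  rint a b (fun t => k * f t) = k * rint a b f.
Proof. by move=> cf; apply: RintegralZl => //; exact: segcont_integrable. Qed.

Lemma eq_rint a b f g : (forall t, a <= t <= b -> f t = g t) ->
  rint a b f = rint a b g.
Proof.
move=> fg; apply: eq_Rintegral => t; rewrite inE/= in_itv/=.
exact: fg.
Qed.

Lemma rint_cst a b k : a <= b -> rint a b (fun=> k) = k * (b - a).
Proof.
move=> ab; rewrite /rint Rintegral_cst//= lebesgue_measure_itv/= lte_fin.
case: ltP => //= ba; have -> : a = b by apply/eqP; rewrite eq_le ab ba.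
by rewrite subrr.
Qed.

Lemma ler_rint a b f g : segcont a b f -> segcont a b g ->
  (forall t, a <= t <= b -> f t <= g t) -> rint a b f <= rint a b g.
Proof.
move=> cf cg fg; apply: le_Rintegral => //; exact: segcont_integrable.
Qed.

Lemma rint_ge a b f M : a <= b -> segcont a b f ->
  (forall t, a <= t <= b -> M <= f t) -> M * (b - a) <= rint a b f.
Proof.
by move=> ab cf fM; rewrite -rint_cst//; apply: ler_rint => // t _; exact: cst_continuous.
Qed.

Lemma rint_le a b f M : a <= b -> segcont a b f ->
  (forall t, a <= t <= b -> `|f t| <= M) -> `|rint a b f| <= M * (b - a).
Proof.
move=> ab cf fM; rewrite ler_norml; apply/andP; split.
  by rewrite -mulNr; apply: rint_ge => // t /fM; rewrite ler_norml => /andP[].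
rewrite -rint_cst//; apply: ler_rint => //.
  by move=> t _; exact: cst_continuous.
by move=> t /fM; rewrite ler_norml => /andP[].
Qed.

Lemma rint_split a b c f : a <= b -> b <= c -> segcont a c f ->
  rint a c f = rint a b f + rint b c f.
Proof.
move=> ab bc /segcont_integrable cf.
have := @Rintegral_itvB R f (BLeft a) (BRight c) b cf.
rewrite !bnd_simp => /(_ ab bc) /eqP; rewrite subr_eq => /eqP.
rewrite Rintegral_itv_obnd_cbnd => [e|]; first by rewrite /rint e addrC.
apply: integrableS cf => // t /=; rewrite !in_itv/= => /andP[bt ->].
by rewrite (le_trans ab (ltW bt)).
Qed.

Lemma rint_FTC a b (F f : R -> R) : a <= b -> segcont a b f ->
  (forall t, a <= t <= b -> is_derive t 1 F (f t)) ->
  rint a b f = F b - F a.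
Proof.
rewrite le_eqVlt => /predU1P[-> cf dF|ab cf dF].
  by rewrite subrr /rint set_itv1 Rintegral_set1.
have cF t : a <= t <= b -> {for t, continuous F}.
  move=> /dF dFt; apply: differentiable_continuous; apply/derivable1_diffP.
  exact: ex_derive.
rewrite /rint /Rintegral (@continuous_FTC2 _ f F a b ab) => //.
- exact: segcont_within.
- split.
  + move=> t; rewrite in_itv/= => /andP[at_ tb].
    by apply: ex_derive; apply: dF; rewrite !ltW.
  + by apply: cvg_at_right_filter; apply: cF; rewrite lexx ltW.
  + by apply: cvg_at_left_filter; apply: cF; rewrite lexx ltW.
- move=> t; rewrite in_itv/= => /andP[at_ tb].
  by rewrite derive1E; apply: derive_val; apply: dF; rewrite !ltW.
Qed.

Lemma is_derive_eps (F : R -> R) t d :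
  (forall e, 0 < e -> exists2 r, 0 < r & forall s, `|s - t| < r ->
     `|F s - F t - d * (s - t)| <= e * `|s - t|) -> is_derive t 1 F d.
Proof.
move=> h.
have cvgF : h^-1 *: ((F \o shift t) (h *: 1) - F t) @[h --> 0^'] --> d.
  apply/cvgrPdist_le => e /h[r r0 rh].
  apply/nbhs_ballP; exists r => //= s; rewrite /ball/= sub0r normrN => sr s0.
  have := rh (s + t); rewrite addrK => /(_ sr).
  rewrite -ler_pdivrMr ?normr_gt0// -normfV -normrM => h1.
  apply: le_trans h1 => /=; rewrite /GRing.scale/= mulr1 distrC mulrBl.
  by rewrite mulfK// [_^-1 * _]mulrC.
apply: DeriveDef; first by apply/cvg_ex; exists d.
exact: cvg_lim cvgF.
Qed.

End segment_integral.

(** * Complex-valued integrals along segments *)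

Section complex_integral.
Variable R : realType.
Implicit Types (a b c d M : R) (f g : R -> R[i]).

Definition cseg a b g := segcont a b (fun t => Re (g t)) /\ segcont a b (fun t => Im (g t)).

Definition cint a b g : R[i] :=
  Complex (rint a b (fun t => Re (g t))) (rint a b (fun t => Im (g t))).

Lemma eq_cint a b f g : (forall t, a <= t <= b -> f t = g t) ->
  cint a b f = cint a b g.
Proof. by move=> fg; congr Complex; apply: eq_rint => t /fg ->. Qed.

Lemma csegZ a b k f : cseg a b f -> cseg a b (fun t => k * f t).
Proof.
move=> [f1 f2]; split.
  by under eq_fun do rewrite ReM; apply: segcontB; exact: segcontZ.
by under eq_fun do rewrite ImM; apply: segcontD; exact: segcontZ.
Qed.

Lemma cintD a b f g : cseg a b f -> cseg a b g ->
  cint a b (fun t => f t + g t) = cint a b f + cint a b g.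
Proof.
move=> [f1 f2] [g1 g2]; apply: complex_eq; rewrite ?ReD ?ImD/= -rintD//;
  by apply: eq_rint => t _; rewrite ?ReD ?ImD.
Qed.

Lemma cintZ a b k f : cseg a b f ->
  cint a b (fun t => k * f t) = k * cint a b f.
Proof.
move=> [f1 f2]; apply: complex_eq.
  rewrite ReM /= -!rintZ// -rintB//; [|exact: segcontZ..].
  by apply: eq_rint => t _; rewrite ReM.
rewrite ImM /= -!rintZ// -rintD//; [|exact: segcontZ..].
by apply: eq_rint => t _; rewrite ImM.
Qed.

(** Real and imaginary parts are estimated separately, which costs the factor 2. *)
Lemma cint_le a b M f : a <= b -> cseg a b f ->
  (forall t, a <= t <= b -> nc (f t) <= M) -> nc (cint a b f) <= 2 * M * (b - a).
Proof.
move=> ab [f1 f2] fM; apply: le_trans (nc_le _) _.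
rewrite -mulrA mulr_natl mulr2n lerD//; apply: rint_le => // t /fM.
  by apply: le_trans; exact: nc_Re.
by apply: le_trans; exact: nc_Im.
Qed.

Lemma cint_split a b c f : a <= b -> b <= c -> cseg a c f ->
  cint a c f = cint a b f + cint b c f.
Proof.
by move=> ab bc [f1 f2]; apply: complex_eq; rewrite ?ReD ?ImD; exact: rint_split.
Qed.

Lemma cont_eps (F : R -> R) t : (forall e, 0 < e -> exists2 r, 0 < r &
  forall s, `|s - t| < r -> `|F s - F t| < e) -> {for t, continuous F}.
Proof.
move=> h; apply/cvgrPdist_lt => e /h[r r0 rh]; apply/nbhs_ballP; exists r => //= s.
by rewrite /ball/= distrC => /rh; rewrite distrC.
Qed.

(** Unit-speed straight paths of direction [v]; horizontal sides have [v = 1] and vertical ones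
    [v = i], and both are treated at once. *)
Definition path_of (v : R[i]) (p : R -> R[i]) :=
  nc v = 1 /\ forall s t, p s - p t = (s - t)%:C%C * v.

Lemma path_dist v p s t : path_of v p -> nc (p s - p t) = `|s - t|.
Proof. by move=> [v1 ->]; rewrite Normc.normcM ncR v1 mulr1. Qed.

Lemma path_hor c : path_of 1 (fun x => Complex x c).
Proof.
split=> [|s t]; first by rewrite Normc.normc1.
by rewrite mulr1; apply: complex_eq => /=; rewrite ?subrr.
Qed.

Lemma path_ver c : path_of 'i%C (fun y => Complex c y).
Proof.
split=> [|s t]; first by rewrite /= expr0n/= add0r expr1n sqrtr1.
by apply: complex_eq => /=; ring.
Qed.

Lemma ccont_path v p (G : R[i] -> R[i]) a b : path_of v p ->
  (forall t, a <= t <= b -> ccont G (p t)) -> cseg a b (fun t => G (p t)).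
Proof.
move=> vp cG; split=> t /cG h; apply: cont_eps => e /h[r r0 rh];
    exists r => // s; rewrite -(path_dist s t vp) => /rh hs;
    apply: le_lt_trans hs.
  by rewrite -ReB nc_Re.
by rewrite -ImB nc_Im.
Qed.

Lemma cint_FTC v p (F f : R[i] -> R[i]) a b : path_of v p -> a <= b ->
  (forall t, a <= t <= b -> ccont f (p t)) ->
  (forall t, a <= t <= b -> cdiff F (p t) (f (p t))) ->
  v * cint a b (fun t => f (p t)) = F (p b) - F (p a).
Proof.
move=> vp ab cf dF; have cs := ccont_path vp cf.
rewrite -cintZ//; have [c1 c2] := csegZ v cs.
have key t e : a <= t <= b -> 0 < e -> exists2 r, 0 < r & forall s, `|s - t| < r ->
    nc (F (p s) - F (p t) - (s - t)%:C%C * (v * f (p t))) <= e * `|s - t|.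
  move=> tab e0; have /cdiffP /(_ e e0)[r r0 rh] := dF t tab; exists r => // s.
  rewrite -(path_dist s t vp) => /rh; case: (vp) => _ ->.
  by rewrite [_ * f _]mulrC mulrA [f _ * _]mulrC -!mulrA.
apply: complex_eq; rewrite /= ?ReB ?ImB.
  refine (@rint_FTC _ _ _ (fun t => Re (F (p t))) _ ab c1 _) => t tab.
  apply: is_derive_eps => e /(key _ _ tab)[r r0 rh]; exists r => // s /rh hs.
  apply: le_trans hs; apply: le_trans (nc_Re _); rewrite !ReB (ReM (s - t)%:C%C)/= mul0r subr0.
  by rewrite [_ * (s - t)]mulrC.
refine (@rint_FTC _ _ _ (fun t => Im (F (p t))) _ ab c2 _) => t tab.
apply: is_derive_eps => e /(key _ _ tab)[r r0 rh]; exists r => // s /rh hs.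
apply: le_trans hs; apply: le_trans (nc_Im _); rewrite !ImB (ImM (s - t)%:C%C)/= mul0r addr0.
by rewrite [_ * (s - t)]mulrC.
Qed.

End complex_integral.

(** * Contour integrals around rectangles *)

Section rectangle_integral.
Variable R : realType.
Implicit Types (a b c d M : R) (z w : R[i]) (f g F : R[i] -> R[i]).

Definition rbd a b c d z :=
  (a <= Re z <= b) && ((Im z == c) || (Im z == d)) ||
  (c <= Im z <= d) && ((Re z == a) || (Re z == b)).

Definition rcl a b c d z := (a <= Re z <= b) && (c <= Im z <= d).

Lemma rbd_rcl a b c d z : a <= b -> c <= d -> rbd a b c d z -> rcl a b c d z.
Proof.
move=> ab cd /orP[/andP[h]|/andP[h]]; rewrite /rcl h/= ?andbT => /orP[]/eqP ->;
  by rewrite lexx ?ab ?cd.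
Qed.

(** The counterclockwise contour integral; the factor ['i] is the velocity on the vertical sides. *)
Definition rectint g a b c d : R[i] :=
  cint a b (fun x => g (Complex x c)) - cint a b (fun x => g (Complex x d)) +
  'i%C * (cint c d (fun y => g (Complex b y)) - cint c d (fun y => g (Complex a y))).

Definition bdcont g a b c d := forall z, rbd a b c d z -> ccont g z.

Lemma bdcont_seg g a b c d : bdcont g a b c d ->
  [/\ cseg a b (fun x => g (Complex x c)), cseg a b (fun x => g (Complex x d)),
      cseg c d (fun y => g (Complex a y)) & cseg c d (fun y => g (Complex b y))].
Proof.
move=> cg; split; (apply: ccont_path; first by [exact: path_hor|exact: path_ver]);
  by move=> t /andP[h1 h2]; apply: cg; rewrite /rbd/= h1 h2 eqxx ?orbT.
Qed.

Lemma bdcontM f g a b c d : bdcont f a b c d -> bdcont g a b c d ->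
  bdcont (fun z => f z * g z) a b c d.
Proof. by move=> cf cg z zb; apply: ccontM; [exact: cf|exact: cg]. Qed.

Lemma bdcont_cst k a b c d : bdcont (fun=> k) a b c d.
Proof. by move=> z _; exact: ccont_cst. Qed.

Lemma bdcontV w n a b c d : ~~ rbd a b c d w ->
  bdcont (fun z => ((z - w) ^+ n)^-1) a b c d.
Proof.
move=> wb z zb; apply: ccontV; last by apply: ccontX; exact: ccont_sub.
by rewrite expf_neq0// subr_eq0; apply: contraNneq wb => <-.
Qed.

Lemma rectintD f g a b c d : bdcont f a b c d -> bdcont g a b c d ->
  rectint (fun z => f z + g z) a b c d = rectint f a b c d + rectint g a b c d.
Proof.
move=> /bdcont_seg[f1 f2 f3 f4] /bdcont_seg[g1 g2 g3 g4].
by rewrite /rectint !cintD//; ring.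
Qed.

Lemma rectintZ k f a b c d : bdcont f a b c d ->
  rectint (fun z => k * f z) a b c d = k * rectint f a b c d.
Proof.
by move=> /bdcont_seg[f1 f2 f3 f4]; rewrite /rectint !cintZ//; ring.
Qed.

Lemma eq_rectint f g a b c d : a <= b -> c <= d ->
  (forall z, rbd a b c d z -> f z = g z) -> rectint f a b c d = rectint g a b c d.
Proof.
move=> ab cd fg; congr (_ - _ + _ * (_ - _)); apply: eq_cint => t /andP[h1 h2];
  by apply: fg; rewrite /rbd/= h1 h2 eqxx ?orbT.
Qed.

Lemma rectintB f g a b c d : bdcont f a b c d -> bdcont g a b c d ->
  rectint (fun z => f z - g z) a b c d = rectint f a b c d - rectint g a b c d.
Proof.
move=> cf cg; rewrite -[- rectint g _ _ _ _]mulN1r -rectintZ//.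
have -> : (fun z => f z - g z) = (fun z => f z + -1 * g z).
  by apply: funext => z; rewrite mulN1r.
apply: rectintD => //; by apply: bdcontM => //; exact: bdcont_cst.
Qed.

(** Each side contributes [2 M] times its length, and opposite sides have equal length. *)
Lemma rectint_le g a b c d M : a <= b -> c <= d -> bdcont g a b c d ->
  (forall z, rbd a b c d z -> nc (g z) <= M) ->
  nc (rectint g a b c d) <= 4 * M * ((b - a) + (d - c)).
Proof.
move=> ab cd /bdcont_seg[g1 g2 g3 g4] gM.
have nci : nc ('i%C : R[i]) = 1 by rewrite /= expr0n/= add0r expr1n sqrtr1.
have h1 : nc (cint a b (fun x => g (Complex x c))) <= 2 * M * (b - a).
  by apply: cint_le => // t /andP[h1 h2]; apply: gM; rewrite /rbd/= h1 h2 eqxx ?orbT.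
have h2 : nc (cint a b (fun x => g (Complex x d))) <= 2 * M * (b - a).
  by apply: cint_le => // t /andP[h2 h3]; apply: gM; rewrite /rbd/= h2 h3 eqxx ?orbT.
have h3 : nc (cint c d (fun x => g (Complex a x))) <= 2 * M * (d - c).
  by apply: cint_le => // t /andP[h4 h3]; apply: gM; rewrite /rbd/= h4 h3 eqxx ?orbT.
have h4 : nc (cint c d (fun x => g (Complex b x))) <= 2 * M * (d - c).
  by apply: cint_le => // t /andP[h4 h5]; apply: gM; rewrite /rbd/= h4 h5 eqxx ?orbT.
apply: le_trans (ncD _ _) _; rewrite Normc.normcM nci mul1r.
have := ncD (cint a b (fun x => g (Complex x c))) (- cint a b (fun x => g (Complex x d))).
have := ncD (cint c d (fun x => g (Complex b x))) (- cint c d (fun x => g (Complex a x))).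
rewrite !ncN; lra.
Qed.

Lemma rectint_splitx g a m b c d : a <= m -> m <= b -> c <= d ->
  (forall z, rcl a b c d z -> ccont g z) ->
  rectint g a b c d = rectint g a m c d + rectint g m b c d.
Proof.
move=> am mb cd cg; rewrite /rectint.
rewrite (@cint_split _ a m b (fun x => g (Complex x c)))//; last first.
  by apply: ccont_path; [exact: path_hor|move=> t h; apply: cg; rewrite /rcl/= h lexx].
rewrite (@cint_split _ a m b (fun x => g (Complex x d)))//; last first.
  by apply: ccont_path; [exact: path_hor|move=> t h; apply: cg; rewrite /rcl/= h lexx cd].
by ring.
Qed.

Lemma rectint_splity g a b c m d : a <= b -> c <= m -> m <= d ->
  (forall z, rcl a b c d z -> ccont g z) ->
  rectint g a b c d = rectint g a b c m + rectint g a b m d.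
Proof.
move=> ab cm md cg; rewrite /rectint.
rewrite (@cint_split _ c m d (fun y => g (Complex a y)))//; last first.
  by apply: ccont_path; [exact: path_ver|move=> t h; apply: cg; rewrite /rcl/= h lexx ab].
rewrite (@cint_split _ c m d (fun y => g (Complex b y)))//; last first.
  by apply: ccont_path; [exact: path_ver|move=> t h; apply: cg; rewrite /rcl/= h lexx ab].
by ring.
Qed.

Lemma rectint_primitive F f a b c d : a <= b -> c <= d -> bdcont f a b c d ->
  (forall z, rbd a b c d z -> cdiff F z (f z)) -> rectint f a b c d = 0.
Proof.
move=> ab cd cf dF; rewrite /rectint mulrBr.
have h y : (y == c) || (y == d) -> cint a b (fun x => f (Complex x y)) =
    F (Complex b y) - F (Complex a y).
  move=> yc; rewrite -[LHS]mul1r; apply: (cint_FTC (path_hor y)) => // t tab;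
    by [apply: cf; rewrite /rbd/= tab yc|apply: dF; rewrite /rbd/= tab yc].
have v x : (x == a) || (x == b) -> 'i%C * cint c d (fun y => f (Complex x y)) =
    F (Complex x d) - F (Complex x c).
  move=> xa; apply: (cint_FTC (path_ver x)) => // t tab;
    by [apply: cf; rewrite /rbd/= tab xa orbT|apply: dF; rewrite /rbd/= tab xa orbT].
by rewrite !h ?v ?eqxx ?orbT//; ring.
Qed.

End rectangle_integral.

(** * Bisection of rectangles *)

Section bisection.
Variable R : realType.
Implicit Types (w h x y t : R).

Lemma nested_intervals (u t : nat -> R) : (forall n, 0 <= t n) ->
  (forall n, u n <= u n.+1) -> (forall n, u n.+1 + t n.+1 <= u n + t n) ->
  exists p, forall n, u n <= p <= u n + t n.
Proof.
move=> t0 u1 u2.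
have mu m k : u m <= u (m + k)%N.
  by elim: k => [|k ih]; rewrite ?addn0// addnS (le_trans ih).
have mv m k : u (m + k)%N + t (m + k)%N <= u m + t m.
  by elim: k => [|k ih]; rewrite ?addn0// addnS (le_trans _ ih).
have uv m n : u m <= u n + t n.
  case: (leqP m n) => [mn|/ltnW mn].
    by rewrite -(subnKC mn) (le_trans (mu m (n - m)%N))// lerDl.
  by rewrite -(subnKC mn) (le_trans _ (mv n (m - n)%N))// lerDl.
have ub n : ubound (range u) (u n + t n) by move=> _ [m _ <-].
exists (sup (range u)) => n; apply/andP; split.
  by apply: ub_le_sup; [exists (u 0 + t 0)%R; exact: ub|exists n].
by apply: ge_sup; [exists (u 0), 0%N|exact: ub].
Qed.

Lemma halves_lt (e : R) : 0 < e -> exists n, 2^-1 ^+ n < e.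
Proof.
move=> e0.
have /cvgrPdist_lt /(_ e e0)[N _ hN] : (2^-1 : R) ^+ n @[n --> \oo] --> (0 : R).
  by apply: cvg_expr; rewrite ger0_norm ?invr_ge0// invf_lt1// ltr1n.
exists N; have := hN N (leqnn N); rewrite /= sub0r normrN ger0_norm//.
Qed.

(** [k] selects the left or the right half of an interval of length [s + s]; one such choice per
    coordinate describes the four quarters. *)
Lemma half_step (k : bool) (u0 u v s : R) : 0 <= s -> u0 <= u -> u + (s + s) <= v ->
  [/\ u0 <= u + k%:R * s, u + k%:R * s + s <= v, u <= u + k%:R * s &
      u + k%:R * s + s <= u + (s + s)].
Proof. by move=> *; case: k; rewrite /= ?mul1r ?mul0r; split; lra. Qed.

(* Cousin's lemma: a property of cells [x, x + t w] * [y, y + t h] which is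
   inherited from the four quarters and holds for all small cells around each
   point holds for the whole rectangle. *)
Lemma bisection w h x0 y0 (P : R -> R -> R -> Prop) : 0 <= w -> 0 <= h ->
  let sub x y t := [/\ x0 <= x, x + t * w <= x0 + w, y0 <= y & y + t * h <= y0 + h] in
  (forall x y t, 0 < t -> sub x y t -> P x y (t / 2) -> P (x + t / 2 * w) y (t / 2) ->
     P x (y + t / 2 * h) (t / 2) -> P (x + t / 2 * w) (y + t / 2 * h) (t / 2) ->
     P x y t) ->
  (forall p q, x0 <= p <= x0 + w -> y0 <= q <= y0 + h ->
    exists2 d, 0 < d & forall x y t, 0 < t -> t < d -> sub x y t ->
      x <= p <= x + t * w -> y <= q <= y + t * h -> P x y t) ->
  P x0 y0 1.
Proof.
move=> w0 h0 sub quarter local; apply: contrapT => nP.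
pose T n : R := 2^-1 ^+ n.
have T0 n : 0 < T n by rewrite exprn_gt0// invr_gt0.
have TS n : T n.+1 = T n / 2 by rewrite /T exprSr.
pose good n (s : R * R) := sub s.1 s.2 (T n) /\ ~ P s.1 s.2 (T n).
pose rel n (s s' : R * R) := [/\ s.1 <= s'.1, s'.1 + T n.+1 * w <= s.1 + T n * w,
  s.2 <= s'.2 & s'.2 + T n.+1 * h <= s.2 + T n * h].
(* A bad cell has a bad quarter. Iterating yields a nested sequence of bad cells, which shrinks to a
   point where [local] is contradicted. *)
have step n s : good n s -> exists s', good n.+1 s' /\ rel n s s'.
  case: s => x y [sxy nPxy]; apply: contrapT => /forallNP none.
  have tw : 0 <= T n / 2 * w by rewrite mulr_ge0// divr_ge0// ltW.
  have th : 0 <= T n / 2 * h by rewrite mulr_ge0// divr_ge0// ltW.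
  have try (i j : bool) : P (x + i%:R * (T n / 2 * w)) (y + j%:R * (T n / 2 * h)) (T n / 2).
    apply: contrapT => nPij; case: sxy => /= s1 s2 s3 s4.
    have hx : T n * w = T n / 2 * w + T n / 2 * w by field.
    have hy : T n * h = T n / 2 * h + T n / 2 * h by field.
    apply: (none (x + i%:R * (T n / 2 * w), y + j%:R * (T n / 2 * h))).
    rewrite /good /rel /sub TS /= !hx !hy in s2 s4 *.
    move: tw th s2 s4; set a := T n / 2 * w; set b := T n / 2 * h => tw th s2 s4.
    have [X1 X2 X3 X4] := half_step i tw s1 s2.
    have [Y1 Y2 Y3 Y4] := half_step j th s3 s4.
    by split.
  apply: nPxy; apply: quarter => //.
  - by have := try false false; rewrite !mul0r !addr0.
  - by have := try true false; rewrite !mul0r !addr0 mul1r.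
  - by have := try false true; rewrite !mul0r !addr0 mul1r.
  - by have := try true true; rewrite !mul1r.
pose nx n s := if pselect (exists s', good n.+1 s' /\ rel n s s') is left e
  then projT1 (cid e) else s.
pose u := fix u n := if n is m.+1 then nx m (u m) else (x0, y0).
have gu n : good n (u n).
  elim: n => [|n ih]; first by rewrite /good /T expr0 /sub !mul1r !lexx.
  rewrite /= /nx; case: pselect => [e|]; last by move/(_ (step _ _ ih)).
  by case: (cid e) => s' [].
have ru n : rel n (u n) (u n.+1).
  rewrite /= /nx; case: pselect => [e|]; last by move/(_ (step _ _ (gu n))).
  by case: (cid e) => s' [].
have [p hp] : exists p, forall n, (u n).1 <= p <= (u n).1 + T n * w.
  apply: (@nested_intervals (fun n => (u n).1) (fun n => T n * w)) => n.
  - by rewrite mulr_ge0// ltW.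
  - by case: (ru n).
  - by case: (ru n).
have [q hq] : exists q, forall n, (u n).2 <= q <= (u n).2 + T n * h.
  apply: (@nested_intervals (fun n => (u n).2) (fun n => T n * h)) => n.
  - by rewrite mulr_ge0// ltW.
  - by case: (ru n).
  - by case: (ru n).
have := hp 0%N; have := hq 0%N; rewrite /T expr0 !mul1r /= => q0 p0.
have [d d0 dh] := local p q p0 q0; have [n nd] := halves_lt d0.
by case: (gu n) => s; apply; apply: dh.
Qed.

End bisection.

(** * Goursat's theorem *)

Section goursat.
Variable R : realType.
Implicit Types (a b c d M : R) (z w : R[i]) (f g F : R[i] -> R[i]).

Lemma rectint_cst k a b c d : a <= b -> c <= d -> rectint (fun=> k) a b c d = 0.
Proof.
move=> ab cd; apply: (@rectint_primitive _ (fun z => k * z)) => //.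
  exact: bdcont_cst.
move=> z _; have := cdiffM (cdiff_cst k z) (cdiff_id z).
by rewrite mul0r add0r mulr1.
Qed.

Lemma rectint_id a b c d : a <= b -> c <= d -> rectint id a b c d = 0.
Proof.
move=> ab cd; apply: (@rectint_primitive _ (fun z => 2^-1 * (z * z))) => //.
  by move=> z _; exact: ccont_id.
move=> z _; have := cdiffM (cdiff_cst 2^-1 z) (cdiffM (cdiff_id z) (cdiff_id z)).
rewrite mul0r add0r mulr1 mul1r; congr cdiff.
have two : (2 : R[i]) != 0 by rewrite pnatr_eq0.
by field.
Qed.

(** The bound [e * t ^+ 2] is stable under quartering because [4 (t / 2)^2 = t^2]. On a small cell
    around a point, [f] is an affine function up to an error [e' |z - p|]; the affine part has a
    primitive, and both the error and the perimeter are of order [t]. *)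
Lemma goursat f a b c d : a <= b -> c <= d ->
  (forall z, rcl a b c d z -> exists l, cdiff f z l) -> rectint f a b c d = 0.
Proof.
move=> ab cd df.
have cf z : rcl a b c d z -> ccont f z by move=> /df[l /cdiff_cont].
have sub_cf (x y t : R) : 0 < t -> a <= x -> x + t * (b - a) <= b -> c <= y ->
    y + t * (d - c) <= d ->
    forall z, rcl x (x + t * (b - a)) y (y + t * (d - c)) z -> ccont f z.
  move=> t0 ax xb cy yd z /andP[/andP[h1 h2] /andP[h3 h4]]; apply: cf.
  rewrite /rcl (le_trans ax h1) (le_trans h2 xb) (le_trans cy h3).
  by rewrite (le_trans h4 yd).
apply/eqP; rewrite -nc_eq0 eq_le nc_ge0 andbT; apply/ler_addgt0Pl => e e0.
rewrite addr0.
have w0 : 0 <= b - a by rewrite subr_ge0.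
have h0 : 0 <= d - c by rewrite subr_ge0.
suff : nc (rectint f a (a + 1 * (b - a)) c (c + 1 * (d - c))) <= e * 1 ^+ 2.
  by rewrite !mul1r expr1n mulr1 !(addrC _ (_ - _)) !subrK.
apply: (@bisection R (b - a) (d - c) a c (fun x y t =>
  nc (rectint f x (x + t * (b - a)) y (y + t * (d - c))) <= e * t ^+ 2)) => //.
  move=> x y t t0 [ax xb cy yd].
  rewrite !(addrC _ (_ - _)) !subrK in xb yd.
  have tw : 0 <= t / 2 * (b - a) by rewrite mulr_ge0// divr_ge0// ltW.
  have th : 0 <= t / 2 * (d - c) by rewrite mulr_ge0// divr_ge0// ltW.
  have ew : t * (b - a) = t / 2 * (b - a) + t / 2 * (b - a) by field.
  have eh : t * (d - c) = t / 2 * (d - c) + t / 2 * (d - c) by field.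
  have := sub_cf x y t t0 ax xb cy yd.
  rewrite ew eh !addrA; set W := t / 2 * (b - a); set H := t / 2 * (d - c) => cfz.
  have xW : x <= x + W by rewrite lerDl.
  have yH : y <= y + H by rewrite lerDl.
  have xWW : x + W <= x + W + W by rewrite lerDl.
  have yHH : y + H <= y + H + H by rewrite lerDl.
  have -> : rectint f x (x + W + W) y (y + H + H) =
      rectint f x (x + W) y (y + H + H) + rectint f (x + W) (x + W + W) y (y + H + H).
    by apply: rectint_splitx => //; exact: le_trans yH yHH.
  have -> : rectint f x (x + W) y (y + H + H) =
      rectint f x (x + W) y (y + H) + rectint f x (x + W) (y + H) (y + H + H).
    apply: rectint_splity => // z /andP[/andP[h1 h2] h3]; apply: cfz.
    by rewrite /rcl h3 h1 (le_trans h2).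
  have -> : rectint f (x + W) (x + W + W) y (y + H + H) =
      rectint f (x + W) (x + W + W) y (y + H) + rectint f (x + W) (x + W + W) (y + H) (y + H + H).
    apply: rectint_splity => // z /andP[/andP[h1 h2] h3]; apply: cfz.
    by rewrite /rcl h3 h2 (le_trans _ h1).
  have -> : e * t ^+ 2 = e * (t / 2) ^+ 2 + e * (t / 2) ^+ 2 +
     (e * (t / 2) ^+ 2 + e * (t / 2) ^+ 2) by field.
  move=> h1 h2 h3 h4.
  by apply: le_trans (ncD _ _) (lerD (le_trans (ncD _ _) (lerD _ _))
       (le_trans (ncD _ _) (lerD _ _))).
move=> p q; rewrite !(addrC _ (_ - _)) !subrK => pab qcd.
have pqr : rcl a b c d (Complex p q) by rewrite /rcl/= pab qcd.
have [l lf] := df _ pqr.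
pose L := (b - a) + (d - c).
have L0 : 0 <= L by rewrite addr_ge0.
(* Chosen so that [4 e' (t L) (t L) <= e t^2]; [1 + L] in place of [L] covers the degenerate
   rectangle with [L = 0]. *)
pose e' := e / (4 * (1 + L) ^+ 2).
have L1 : 0 < 1 + L by rewrite ltr_pwDl.
have e'0 : 0 < e' by rewrite divr_gt0// mulr_gt0// exprn_gt0.
move/cdiffP : lf => /(_ _ e'0)[r r0 rh].
exists (r / (1 + L)); first by rewrite divr_gt0.
move=> x y t t0; rewrite ltr_pdivlMr// => tr [ax xb cy yd] px qy.
have tw : 0 <= t * (b - a) by rewrite mulr_ge0// ltW.
have th : 0 <= t * (d - c) by rewrite mulr_ge0// ltW.
have cfz := sub_cf x y t t0 ax xb cy yd.
set X := x + t * (b - a); set Y := y + t * (d - c).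
have xX : x <= X by rewrite lerDl.
have yY : y <= Y by rewrite lerDl.
have bd k : bdcont (fun=> k) x X y Y by exact: bdcont_cst.
have bdi : bdcont id x X y Y by move=> z _; exact: ccont_id.
have bdf : bdcont f x X y Y by move=> z /(rbd_rcl xX yY) /cfz.
pose g z := f z - f (Complex p q) - l * (z - Complex p q).
have -> : rectint f x X y Y = rectint g x X y Y.
  rewrite /g rectintB//; last 2 first.
  - move=> z zb; apply: ccontB; [exact: bdf|exact: ccont_cst].
  - by apply: bdcontM => // z _; exact: ccont_sub.
  rewrite rectintB// rectint_cst// subr0 rectintZ; last first.
    by move=> z _; exact: ccont_sub.
  by rewrite (@rectintB _ id)// rectint_cst// rectint_id// subr0 mulr0 subr0.
apply: (@le_trans _ _ (4 * (e' * (t * L)) * ((X - x) + (Y - y)))); last first.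
  have -> : (X - x) + (Y - y) = t * L by rewrite /X /Y /L; ring.
  have -> : 4 * (e' * (t * L)) * (t * L) = (e * t ^+ 2) * (L / (1 + L)) ^+ 2.
    by rewrite /e'; field; rewrite gt_eqF.
  apply: ler_piMr; first by apply: mulr_ge0; [exact: ltW|apply: exprn_ge0; exact: ltW].
  apply: exprn_ile1; first by apply: divr_ge0 => //; exact: ltW.
  by rewrite ler_pdivrMr// mul1r lerDr.
apply: rectint_le => //.
  move=> z zb; apply: ccontB.
    by apply: ccontB; [exact: bdf|exact: ccont_cst].
  by apply: ccontM; [exact: ccont_cst|exact: ccont_sub].
move=> z /(rbd_rcl xX yY) /andP[/andP[h1 h2] /andP[h3 h4]].
have dz : nc (z - Complex p q) <= t * L.
  apply: le_trans (nc_le _) _; rewrite ReB ImB /L mulrDr lerD//=.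
    by rewrite ler_norml; move: px h2; rewrite /X => /andP[]; lra.
  by rewrite ler_norml; move: qy h4; rewrite /Y => /andP[]; lra.
apply: le_trans (rh z _) _.
  by rewrite (le_lt_trans dz)// (le_lt_trans _ tr)// ler_wpM2l ?ltW// ltrDr.
by rewrite ler_wpM2l// ltW.
Qed.

End goursat.

(** * Exceptional points and Cauchy's formula *)

Section cauchy.
Variable R : realType.
Implicit Types (a b c d M : R) (z w : R[i]) (f g F k : R[i] -> R[i]).

Definition rin a b c d z := (a < Re z < b) && (c < Im z < d).

Lemma rin_rcl a b c d z : rin a b c d z -> rcl a b c d z.
Proof. by move=> /andP[/andP[? ?] /andP[? ?]]; rewrite /rcl !ltW. Qed.

Lemma rin_rbd a b c d z : rin a b c d z -> ~~ rbd a b c d z.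
Proof.
move=> /andP[/andP[h1 h2] /andP[h3 h4]]; rewrite /rbd.
by rewrite (gt_eqF h1) (lt_eqF h2) (gt_eqF h3) (lt_eqF h4) !andbF.
Qed.

(** A square of half-side [t] around [w] is cut out. The four remaining rectangles avoid [w] and
    contribute nothing, and the square contributes [O(t)] because [f] is bounded near [w]. *)
Lemma goursat1 f w a b c d : rin a b c d w ->
  (forall z, rcl a b c d z -> ccont f z) ->
  (forall z, rcl a b c d z -> z != w -> exists l, cdiff f z l) ->
  rectint f a b c d = 0.
Proof.
move=> wi cf df; have [/andP[h1 h2] /andP[h3 h4]] := andP wi.
apply/eqP; rewrite -nc_eq0 eq_le nc_ge0 andbT; apply/ler_addgt0Pl => e e0.
rewrite addr0; have [r r0 rh] := cf w (rin_rcl wi) _ ltr01.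
pose M := nc (f w) + 1; have M0 : 0 < M by rewrite ltr_wpDl// nc_ge0.
(* [r / 3] keeps the square inside the disc where [|f| <= M], the second bound makes its
   contribution [16 M t] at most [e], and the others keep it inside the rectangle. *)
pose t := Num.min (Num.min (r / 3) (e / (16 * M))) (Num.min (Num.min (Re w - a) (b - Re w))
  (Num.min (Im w - c) (d - Im w))).
have t0 : 0 < t by rewrite !lt_min !subr_gt0 h1 h2 h3 h4 !divr_gt0// mulr_gt0.
have : [/\ t <= r / 3, t <= e / (16 * M), t <= Re w - a, t <= b - Re w &
        t <= Im w - c /\ t <= d - Im w].
  by rewrite /t; split; [..|split]; rewrite !ge_min lexx ?orbT.
move: t0; move: t => t t0 [t1 t2 t3 t4 [t5 t6]].
have [x1 x2 y1 y2] : [/\ a <= Re w - t, Re w + t <= b, c <= Im w - t & Im w + t <= d].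
  by split; lra.
have xx : Re w - t <= Re w + t by lra.
have yy : Im w - t <= Im w + t by lra.
have sub a' b' c' d' z : a <= a' -> b' <= b -> c <= c' -> d' <= d ->
    rcl a' b' c' d' z -> rcl a b c d z.
  move=> u1 u2 u3 u4 /andP[/andP[v1 v2] /andP[v3 v4]].
  by rewrite /rcl (le_trans u1) ?(le_trans v2) ?(le_trans u3) ?(le_trans v4).
have z0 a' b' c' d' : a <= a' -> a' <= b' -> b' <= b -> c <= c' -> c' <= d' -> d' <= d ->
    ~~ rcl a' b' c' d' w -> rectint f a' b' c' d' = 0.
  move=> u1 ab' u2 u3 cd' u4 nw; apply: goursat => // z zr; apply: df.
    exact: sub zr.
  by apply: contraNneq nw => <-.
have aw : a <= Re w by exact: ltW.
have bw : Re w <= b by exact: ltW.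
have cw : c <= Im w by exact: ltW.
have dw : Im w <= d by exact: ltW.
have cd : c <= d by exact: le_trans cw dw.
rewrite (@rectint_splitx _ f a (Re w - t) b c d)//; last by exact: le_trans xx x2.
rewrite (@rectint_splitx _ f (Re w - t) (Re w + t) b c d)//; last first.
  by move=> z /sub sz; apply: cf; apply: sz.
rewrite (@rectint_splity _ f (Re w - t) (Re w + t) c (Im w - t) d)//; last 2 first.
- exact: le_trans yy y2.
- by move=> z /sub sz; apply: cf; apply: sz.
rewrite (@rectint_splity _ f (Re w - t) (Re w + t) (Im w - t) (Im w + t) d)//; last first.
  by move=> z /sub sz; apply: cf; apply: sz.
rewrite (z0 a (Re w - t))//; last 2 first.
- exact: le_trans xx x2.
- by rewrite /rcl; apply/negP => /andP[/andP[]]; lra.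
rewrite (z0 (Re w + t) b)//; last 2 first.
- exact: le_trans x1 xx.
- by rewrite /rcl; apply/negP => /andP[/andP[]]; lra.
rewrite (z0 _ _ c (Im w - t))//; last 2 first.
- exact: le_trans yy y2.
- by rewrite /rcl; apply/negP => /andP[_ /andP[]]; lra.
rewrite (z0 _ _ (Im w + t) d)//; last 2 first.
- exact: le_trans y1 yy.
- by rewrite /rcl; apply/negP => /andP[_ /andP[]]; lra.
rewrite !add0r !addr0; apply: le_trans (_ : 4 * M * (2 * t + 2 * t) <= _).
  have -> : 2 * t + 2 * t = (Re w + t - (Re w - t)) + (Im w + t - (Im w - t)) by ring.
  apply: rectint_le => //.
    by move=> z /(rbd_rcl xx yy) /sub sz; apply: cf; apply: sz.
  move=> z /(rbd_rcl xx yy) /andP[/andP[u1 u2] /andP[u3 u4]].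
  apply: le_trans (nc_le_add _ (f w)) _; rewrite lerD2l; apply/ltW/rh.
  apply: le_lt_trans (nc_le _) _; rewrite ReB ImB.
  have : `|Re z - Re w| <= t by rewrite ler_norml; lra.
  have : `|Im z - Im w| <= t by rewrite ler_norml; lra.
  by lra.
have -> : 4 * M * (2 * t + 2 * t) = t * (16 * M) by ring.
by rewrite -ler_pdivlMr// mulr_gt0.
Qed.

(** A vertical or horizontal cut halfway between the two points leaves one exceptional point on each
    side. Two points are needed for the difference quotient at [w] of a function that may itself be
    singular at [w0]. *)
Lemma goursat2 f w1 w2 a b c d : rin a b c d w1 -> rin a b c d w2 ->
  (forall z, rcl a b c d z -> ccont f z) ->
  (forall z, rcl a b c d z -> z != w1 -> z != w2 -> exists l, cdiff f z l) ->
  rectint f a b c d = 0.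
Proof.
move=> i1 i2 cf df; have [e|] := eqVneq w1 w2.
  by apply: (goursat1 i1 cf) => z zr zw; apply: df => //; rewrite -e.
move=> w12; have [/andP[a1 b1] /andP[c1 d1]] := andP i1.
have [/andP[a2 b2] /andP[c2 d2]] := andP i2.
have ab : a <= b by exact/ltW/(lt_trans a1).
have cd : c <= d by exact/ltW/(lt_trans c1).
have [exy|] := eqVneq (Re w1) (Re w2).
  have : Im w1 != Im w2 by apply: contraNneq w12 => ?; apply/eqP/complex_eq.
  clear ab; wlog : w1 w2 i1 i2 df w12 a1 b1 c1 d1 a2 b2 c2 d2 exy / Im w1 < Im w2 => [hw|lt12] _.
    have [l|l|] := ltgtP (Im w1) (Im w2); first by apply: (hw w1 w2) => //; rewrite lt_eqF.
      by apply: (hw w2 w1) => //;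
    [move=> z zr z2 z1; exact: df|rewrite eq_sym|rewrite lt_eqF].
    by move=> e12; move: w12; rewrite (complex_eq exy e12) eqxx.
  have ab : a <= b by exact/ltW/(lt_trans a1).
  pose m := (Im w1 + Im w2) / 2.
  have m1 : Im w1 < m by rewrite /m; lra.
  have m2 : m < Im w2 by rewrite /m; lra.
  rewrite (@rectint_splity _ f a b c m d)//; [|by lra..].
  rewrite (@goursat1 f w1 a b c m) ?(@goursat1 f w2 a b m d) ?addr0//.
  - by rewrite /rin a2 b2 m2 d2.
  - move=> z /andP[z1 /andP[z2 z3]]; apply: cf; rewrite /rcl z1 z3 andbT /=; lra.
  - move=> z /andP[z1 /andP[z2 z3]] zw; apply: df => //.
      by rewrite /rcl z1 z3 andbT /=; lra.
    by apply: contraTneq z2 => ->; rewrite -ltNge.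
  - by rewrite /rin a1 b1 m1 c1.
  - move=> z /andP[z1 /andP[z2 z3]]; apply: cf; rewrite /rcl z1 z2 /=; lra.
  - move=> z /andP[z1 /andP[z2 z3]] zw; apply: df => //.
      by rewrite /rcl z1 z2 /=; lra.
    by apply: contraTneq z3 => ->; rewrite -ltNge.
wlog : w1 w2 i1 i2 df w12 a1 b1 c1 d1 a2 b2 c2 d2 / Re w1 < Re w2 => [hw|lt12] e12.
  move: (e12); rewrite neq_lt => /orP[l|l]; first by apply: (hw w1 w2).
  by apply: (hw w2 w1) => //;
    [move=> z zr z2 z1; exact: df|rewrite eq_sym|rewrite lt_eqF].
pose m := (Re w1 + Re w2) / 2.
have m1 : Re w1 < m by rewrite /m; lra.
have m2 : m < Re w2 by rewrite /m; lra.
rewrite (@rectint_splitx _ f a m b c d)//; [|by lra..].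
rewrite (@goursat1 f w1 a m c d) ?(@goursat1 f w2 m b c d) ?addr0//.
- by rewrite /rin c2 b2 m2 d2.
- move=> z /andP[/andP[z2 z3] z1]; apply: cf; rewrite /rcl z1 z3 !andbT /=; lra.
- move=> z /andP[/andP[z2 z3] z1] zw; apply: df => //.
    by rewrite /rcl z1 z3 !andbT /=; lra.
  by apply: contraTneq z2 => ->; rewrite -ltNge.
- by rewrite /rin a1 d1 m1 c1.
- move=> z /andP[/andP[z2 z3] z1]; apply: cf; rewrite /rcl z1 z2 /= andbT; lra.
- move=> z /andP[/andP[z2 z3] z1] zw; apply: df => //.
    by rewrite /rcl z1 z2 /= andbT; lra.
  by apply: contraTneq z3 => ->; rewrite -ltNge.
Qed.

(** The Cauchy integral of [k] for [n = 1] and its derivative in [w] for [n = 2], without the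
    normalization by [2 pi i]; [wind] plays the role of that constant. *)
Definition ker n k a b c d w := rectint (fun z => k z * ((z - w) ^+ n)^-1) a b c d.

Definition wind a b c d w := rectint (fun z => (z - w)^-1) a b c d.

Lemma bdcont_ker n k a b c d w : ~~ rbd a b c d w -> bdcont k a b c d ->
  bdcont (fun z => k z * ((z - w) ^+ n)^-1) a b c d.
Proof. by move=> wb ck; apply: bdcontM => //; exact: bdcontV. Qed.

Lemma bdcontV1 a b c d w : ~~ rbd a b c d w ->
  bdcont (fun z => (z - w)^-1) a b c d.
Proof. by move=> wb z zb; exact: (bdcontV 1 wb zb). Qed.

Lemma rin_ne_rbd a b c d w z : rin a b c d w -> rbd a b c d z -> z - w != 0.
Proof.
move=> wi zb; rewrite subr_eq0; apply: contraTneq zb => ->.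
exact: rin_rbd.
Qed.

(* Applied to the difference quotient of [f] at [w], with [w0] a possibly
   removable singularity of [f]. *)
Lemma cauchy_off f w0 w a b c d : rin a b c d w0 -> rin a b c d w -> w != w0 ->
  (forall z, rcl a b c d z -> ccont f z) ->
  (forall z, rcl a b c d z -> z != w0 -> exists l, cdiff f z l) ->
  ker 1 f a b c d w = f w * wind a b c d w.
Proof.
move=> i0 i1 w0w cf df.
have [l [q [fq cq ql]]] := df w (rin_rcl i1) w0w.
have [/andP[a1 b1] /andP[c1 d1]] := andP i1.
have ab : a <= b by exact/ltW/(lt_trans a1).
have cd : c <= d by exact/ltW/(lt_trans c1).
have qE z : z != w -> q z = (f z - f w) * (z - w)^-1.
  by move=> zw; rewrite fq addrAC subrr add0r mulfK// subr_eq0.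
have near z : z != w -> exists2 r, 0 < r & forall v, nc (v - z) < r ->
    (f v - f w) * (v - w)^-1 = q v.
  move=> zw; have [|r r0 rh] := @ccont_gt0 _ (fun v => v - w) z (ccont_sub _ _).
    by rewrite subr_eq0.
  by exists r => // v /rh; rewrite subr_eq0 => /qE.
have cq' z : rcl a b c d z -> ccont q z.
  move=> zr; have [->//|zw] := eqVneq z w; have [r r0 rh] := near z zw.
  apply: (ccont_near r0 rh); apply: ccontM.
    by apply: ccontB; [exact: cf|exact: ccont_cst].
  by apply: ccontV; [rewrite subr_eq0|exact: ccont_sub].
have : rectint q a b c d = 0.
  apply: (goursat2 i0 i1 cq') => z zr z0 zw; have [r r0 rh] := near z zw.
  have [m dm] := df z zr z0.
  eexists; apply: (cdiff_near r0 rh); apply: cdiffM.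
    apply: cdiffD; first exact: dm.
    exact: cdiff_cst.
  apply: cdiffV; first by rewrite subr_eq0.
  by apply: cdiffD; [exact: cdiff_id|exact: cdiff_cst].
have wb := rin_rbd i1.
rewrite (@eq_rectint _ _ (fun z => f z * ((z - w) ^+ 1)^-1 - f w * (z - w)^-1)) //.
  have cfb : bdcont f a b c d by move=> z /(rbd_rcl ab cd) /cf.
  rewrite rectintB ?rectintZ//; [|exact: bdcontV1|exact: bdcont_ker|].
    by move=> /eqP; rewrite subr_eq0 => /eqP.
  by apply: bdcontM; [exact: bdcont_cst|exact: bdcontV1].
by move=> z zb; rewrite qE ?mulrBl ?expr1// -subr_eq0 (rin_ne_rbd i1).
Qed.

End cauchy.

(** * Regularity of Cauchy integrals and the winding integral *)

Section cauchy_kernel.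
Variable R : realType.
Implicit Types (a b c d M : R) (z w h : R[i]) (f g F k : R[i] -> R[i]).

Lemma lerXl (x y : R) n : 0 < x -> x <= y -> x ^+ n <= y ^+ n.
Proof. by move=> x0 xy; rewrite lerXn2r// nnegrE ltW// (lt_le_trans x0). Qed.

Lemma nc_lip z w : `|nc z - nc w| <= nc (z - w).
Proof.
rewrite ler_norml; have := nc_le_add z w; have := nc_le_add w z.
by rewrite (ncB w); lra.
Qed.

Lemma path_bounded v p k a b : a <= b -> path_of v p ->
  (forall t, a <= t <= b -> ccont k (p t)) ->
  exists M, forall t, a <= t <= b -> nc (k (p t)) <= M.
Proof.
move=> ab vp ck.
have [|s _ hs] := @EVT_max R (fun t => nc (k (p t))) a b ab.
  apply: segcont_within => t /ck h; apply: cont_eps => e /h[r r0 rh].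
  exists r => // s; rewrite -(path_dist s t vp) => /rh; apply: le_lt_trans.
  exact: nc_lip.
by exists (nc (k (p s))) => t tab; apply: hs; rewrite in_itv.
Qed.

Lemma bdcont_bounded k a b c d : a <= b -> c <= d -> bdcont k a b c d ->
  exists2 M, 0 < M & forall z, rbd a b c d z -> nc (k z) <= M.
Proof.
move=> ab cd ck.
have [|M1 h1] := @path_bounded _ _ k a b ab (path_hor c).
  by move=> t tab; apply: ck; rewrite /rbd/= tab eqxx.
have [|M2 h2] := @path_bounded _ _ k a b ab (path_hor d).
  by move=> t tab; apply: ck; rewrite /rbd/= tab eqxx orbT.
have [|M3 h3] := @path_bounded _ _ k c d cd (path_ver a).
  by move=> t tab; apply: ck; rewrite /rbd/= tab eqxx !orbT.
have [|M4 h4] := @path_bounded _ _ k c d cd (path_ver b).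
  by move=> t tab; apply: ck; rewrite /rbd/= tab eqxx !orbT.
exists (1 + `|M1| + `|M2| + `|M3| + `|M4|); first by rewrite !ltr_wpDr.
have := (ler_norm M1, ler_norm M2, ler_norm M3, ler_norm M4).
have := (normr_ge0 M1, normr_ge0 M2, normr_ge0 M3, normr_ge0 M4).
move=> [[[n1 n2] n3] n4] [[[m1 m2] m3] m4].
move=> [x y] /orP[/andP[/= hx /orP[]/eqP->]|/andP[/= hy /orP[]/eqP->]].
- by have := h1 x hx; lra.
- by have := h2 x hx; lra.
- by have := h3 y hy; lra.
- by have := h4 y hy; lra.
Qed.

Lemma rbd_dist a b c d w z e : e <= Re w - a -> e <= b - Re w -> e <= Im w - c ->
  e <= d - Im w -> rbd a b c d z -> e <= nc (z - w).
Proof.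
move=> h1 h2 h3 h4 /orP[/andP[_ /orP[]/eqP e1]|/andP[_ /orP[]/eqP e1]].
- by apply: le_trans (nc_Im _); rewrite ImB e1 distrC (le_trans _ (ler_norm _)).
- by apply: le_trans (nc_Im _); rewrite ImB e1 (le_trans _ (ler_norm _)).
- by apply: le_trans (nc_Re _); rewrite ReB e1 distrC (le_trans _ (ler_norm _)).
- by apply: le_trans (nc_Re _); rewrite ReB e1 (le_trans _ (ler_norm _)).
Qed.

Lemma rin_dist a b c d w : rin a b c d w -> exists2 e, 0 < e &
  [/\ e <= Re w - a, e <= b - Re w, e <= Im w - c & e <= d - Im w].
Proof.
move=> /andP[/andP[h1 h2] /andP[h3 h4]].
exists (Num.min (Num.min (Re w - a) (b - Re w)) (Num.min (Im w - c) (d - Im w))).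
  by rewrite !lt_min !subr_gt0 h1 h2 h3.
by split; rewrite !ge_min lexx ?orbT.
Qed.

Lemma rcl_diam a b c d z w : rcl a b c d z -> rcl a b c d w ->
  nc (z - w) <= (b - a) + (d - c).
Proof.
move=> /andP[/andP[? ?] /andP[? ?]] /andP[/andP[? ?] /andP[? ?]].
apply: le_trans (nc_le _) _; rewrite ReB ImB lerD// ler_norml; lra.
Qed.

(** Differentiation under the integral sign: a remainder of the kernel that is quadratic in [h],
    uniformly on the boundary, stays quadratic after integration. *)
Lemma rectint_cdiff k (K : R[i] -> R[i] -> R[i]) (K' : R[i] -> R[i]) w a b c d r M :
  a <= b -> c <= d -> bdcont k a b c d -> 0 < r ->
  (forall v, nc (v - w) < r -> bdcont (K^~ v) a b c d) ->
  bdcont K' a b c d ->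
  (forall z h, rbd a b c d z -> nc h < r ->
     nc (K z (w + h) - K z w - h * K' z) <= M * nc h ^+ 2) ->
  cdiff (fun v => rectint (fun z => k z * K z v) a b c d) w
        (rectint (fun z => k z * K' z) a b c d).
Proof.
move=> ab cd ck r0 cK cK' hM; have [N N0 hN] := bdcont_bounded ab cd ck.
pose P := (b - a) + (d - c).
have P0 : 0 <= P by rewrite addr_ge0// subr_ge0.
(* The constant of the integrated quadratic remainder. [M] has no prescribed sign, whence the
   absolute value, and [+ 1] makes division by [L] possible. *)
pose L := 4 * (N * `|M|) * P + 1.
have L0 : 0 < L by rewrite ltr_wpDl// !mulr_ge0// ltW.
apply/cdiffP => e e0; exists (Num.min r (e / L)); first by rewrite lt_min r0 divr_gt0.
move=> v; rewrite lt_min => /andP[vr vL].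
have cKv := cK v vr.
have cKw : bdcont (K^~ w) a b c d by apply: cK; rewrite subrr Normc.normc0.
have c1 := bdcontM ck cKv; have c2 := bdcontM ck cKw; have c3 := bdcontM ck cK'.
have c4 := bdcontM (bdcont_cst (v - w) (a := a) (b := b) (c := c) (d := d)) c3.
rewrite [_ * (v - w)]mulrC -rectintZ// -rectintB// -rectintB//; last first.
  by move=> z zb; apply: ccontB; [exact: c1|exact: c2].
apply: (@le_trans _ _ (4 * (N * (`|M| * nc (v - w) ^+ 2)) * P)).
  apply: rectint_le => //.
    move=> z zb; apply: ccontB; last exact: c4.
    by apply: ccontB; [exact: c1|exact: c2].
  move=> z zb; have -> : k z * K z v - k z * K z w - (v - w) * (k z * K' z) =
     k z * (K z (w + (v - w)) - K z w - (v - w) * K' z).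
    by rewrite [w + _]addrC subrK; ring.
  rewrite Normc.normcM ler_pM ?nc_ge0 ?hN//.
  apply: le_trans (hM _ _ zb vr) _; apply: ler_wpM2r; last exact: ler_norm.
  by rewrite exprn_ge0// nc_ge0.
have -> : 4 * (N * (`|M| * nc (v - w) ^+ 2)) * P =
    (4 * (N * `|M|) * P * nc (v - w)) * nc (v - w) by ring.
apply: ler_wpM2r; first exact: nc_ge0.
move: vL; rewrite ltr_pdivlMr// mulrC => /ltW; apply: le_trans.
by apply: ler_wpM2r; [exact: nc_ge0|rewrite lerDl].
Qed.

Lemma ker1_cdiff k w a b c d : bdcont k a b c d -> rin a b c d w ->
  cdiff (ker 1 k a b c d) w (ker 2 k a b c d w).
Proof.
move=> ck wi; have [/andP[a1 b1] /andP[c1 d1]] := andP wi.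
have ab : a <= b by exact/ltW/(lt_trans a1).
have cd : c <= d by exact/ltW/(lt_trans c1).
have [e e0 [e1 e2 e3 e4]] := rin_dist wi.
have he z : rbd a b c d z -> e <= nc (z - w) by exact: rbd_dist.
have e20 : 0 < e / 2 by rewrite divr_gt0.
have he2 z h : rbd a b c d z -> nc h < e / 2 -> e / 2 <= nc (z - (w + h)).
  move=> /he ez hh; have := nc_le_add (z - w) (z - (w + h)).
  by rewrite (_ : z - w - _ = h); [lra|ring].
have ne z v : e / 2 <= nc (z - v) -> z - v != 0.
  by move=> h; rewrite -nc_gt0 (lt_le_trans e20).
(* The remainder is exactly [h^2 / ((z - w - h) (z - w)^2)], and on the boundary [|z - w| >= e] and
   [|z - w - h| >= e / 2]. *)
apply: (@rectint_cdiff k (fun z v => ((z - v) ^+ 1)^-1) _ w a b c d (e / 2) (2 / e ^+ 3)) => //.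
- move=> v vw z zb; apply: (@bdcontV _ v 1 a b c d _ z zb).
  apply/negP => vb; have := he2 v (v - w) vb vw.
  by rewrite [w + _]addrC subrK subrr Normc.normc0; lra.
- exact/bdcontV/rin_rbd.
move=> z h zb hh; have n1 := he2 z h zb hh.
have n2 := he z zb; have z1 := ne _ _ n1.
have z2 : z - w != 0 by rewrite -nc_gt0 (lt_le_trans e0).
have -> : ((z - (w + h)) ^+ 1)^-1 - ((z - w) ^+ 1)^-1 - h * ((z - w) ^+ 2)^-1 =
   h ^+ 2 * ((z - (w + h)) * (z - w) ^+ 2)^-1.
  by rewrite !expr1; field; rewrite z2 z1.
rewrite Normc.normcM ncX mulrC; apply: ler_wpM2r; first by rewrite exprn_ge0// nc_ge0.
rewrite Normc.normcV Normc.normcM ncX.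
have -> : 2 / e ^+ 3 = (e / 2 * e ^+ 2)^-1 by field; rewrite gt_eqF.
rewrite lef_pV2 ?posrE ?mulr_gt0 ?exprn_gt0 ?nc_gt0//.
by apply: ler_pM; [exact: ltW|apply: exprn_ge0; exact: ltW|by []|exact: lerXl].
Qed.

Lemma ker2_cdiff k w a b c d : bdcont k a b c d -> rin a b c d w ->
  exists l, cdiff (ker 2 k a b c d) w l.
Proof.
move=> ck wi; have [/andP[a1 b1] /andP[c1 d1]] := andP wi.
have ab : a <= b by exact/ltW/(lt_trans a1).
have cd : c <= d by exact/ltW/(lt_trans c1).
have [e e0 [e1 e2 e3 e4]] := rin_dist wi.
have he z : rbd a b c d z -> e <= nc (z - w) by exact: rbd_dist.
have e20 : 0 < e / 2 by rewrite divr_gt0.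
have he2 z h : rbd a b c d z -> nc h < e / 2 -> e / 2 <= nc (z - (w + h)).
  move=> /he ez hh; have := nc_le_add (z - w) (z - (w + h)).
  by rewrite (_ : z - w - _ = h); [lra|ring].
have ne z v : e / 2 <= nc (z - v) -> z - v != 0.
  by move=> h; rewrite -nc_gt0 (lt_le_trans e20).
pose D := (b - a) + (d - c).
exists (rectint (fun z => k z * (2 * ((z - w) ^+ 3)^-1)) a b c d).
(* The remainder is [h^2 (3 (z - w) - 2 h) / ((z - w - h)^2 (z - w)^3)]. Its numerator is at most
   [|h|^2 (3 D + e)], since [|z - w| <= D] and [2 |h| < e]. *)
apply: (@rectint_cdiff k (fun z v => ((z - v) ^+ 2)^-1) _ w a b c d (e / 2)
    ((3 * D + e) * (((e / 2) ^+ 2 * e ^+ 3)^-1))) => //.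
- move=> v vw; apply: bdcontV.
  apply/negP => vb; have := he2 v (v - w) vb vw.
  by rewrite [w + _]addrC subrK subrr Normc.normc0; lra.
- by apply: bdcontM; [exact: bdcont_cst|exact/bdcontV/rin_rbd].
move=> z h zb hh; have n1 := he2 z h zb hh.
have n2 := he z zb; have z1 := ne _ _ n1.
have z2 : z - w != 0 by rewrite -nc_gt0 (lt_le_trans e0).
have -> : ((z - (w + h)) ^+ 2)^-1 - ((z - w) ^+ 2)^-1 - h * (2 * ((z - w) ^+ 3)^-1) =
   h ^+ 2 * ((3 * (z - w) - 2 * h) * ((z - (w + h)) ^+ 2 * (z - w) ^+ 3)^-1).
  by field; rewrite z2 z1.
rewrite Normc.normcM ncX mulrC; apply: ler_wpM2r; first by rewrite exprn_ge0// nc_ge0.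
rewrite Normc.normcM; apply: ler_pM; rewrite ?nc_ge0//.
  have nat n : nc (n%:R : R[i]) = n%:R.
    by rewrite -(rmorph_nat (real_complex R)) ncR ger0_norm.
  apply: le_trans (ncD _ _) _; rewrite ncN !Normc.normcM !nat lerD//; last by lra.
  by rewrite ler_pM2l//; apply: rcl_diam (rbd_rcl ab cd zb) (rin_rcl wi).
rewrite Normc.normcV Normc.normcM !ncX.
rewrite lef_pV2 ?posrE ?mulr_gt0 ?exprn_gt0 ?nc_gt0//.
apply: ler_pM; [apply: exprn_ge0; exact: ltW|apply: exprn_ge0; exact: ltW| |];
  exact: lerXl.
Qed.

(** The derivative is the contour integral of [(z - w)^-2], which has the primitive [- (z - w)^-1]
    on the boundary. *)
Lemma wind_cdiff w a b c d : rin a b c d w -> cdiff (wind a b c d) w 0.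
Proof.
move=> wi; have [/andP[a1 b1] /andP[c1 d1]] := andP wi.
have ab : a <= b by exact/ltW/(lt_trans a1).
have cd : c <= d by exact/ltW/(lt_trans c1).
have := ker1_cdiff (bdcont_cst 1 (a := a) (b := b) (c := c) (d := d)) wi.
rewrite (_ : ker 2 _ _ _ _ _ _ = 0); last first.
  apply: (@rectint_primitive _ (fun z => - 1 * (z - w)^-1)) => //.
    by apply: bdcontM; [exact: bdcont_cst|exact/bdcontV/rin_rbd].
  move=> z zb; have zw := rin_ne_rbd wi zb.
  have := cdiffM (cdiff_cst (-1) z) (cdiffV (f := fun z => z - w) zw
    (cdiffD (cdiff_id z) (cdiff_cst (- w) z))).
  by congr cdiff; rewrite mul0r add0r addr0 mul1r mulN1r mulNr opprK mul1r.
suff -> : wind a b c d = ker 1 (fun=> 1) a b c d by [].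
apply: funext => v; rewrite /wind /ker.
suff -> : (fun z => 1 * ((z - v) ^+ 1)^-1) = (fun z => (z - v)^-1) by [].
by apply: funext => z; rewrite expr1 mul1r.
Qed.

(** All four sides contribute positively to the imaginary part: the relevant component of
    [(z - w)^-1] is a distance to a side, at least [e], divided by [|z - w|^2 <= D^2]. *)
Lemma wind_Im w a b c d e : 0 < e -> e <= Re w - a -> e <= b - Re w ->
  e <= Im w - c -> e <= d - Im w ->
  2 * e / ((b - a) + (d - c)) <= Im (wind a b c d w).
Proof.
move=> e0 e1 e2 e3 e4.
have wi : rin a b c d w by rewrite /rin; apply/andP; split; apply/andP; split; lra.
have ab : a <= b by lra.
have cd : c <= d by lra.
pose D := (b - a) + (d - c).
have D0 : 0 < D by rewrite /D; lra.
have [[_ B] [_ T] [L _] [Rt _]] := bdcont_seg (bdcontV1 (rin_rbd wi)).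
have key z x : rbd a b c d z -> e <= x -> e / D ^+ 2 <= x / nc (z - w) ^+ 2.
  move=> zb ex; apply: ler_pM => //; [exact: ltW|by rewrite invr_ge0 exprn_ge0// ltW|].
  rewrite lef_pV2 ?posrE ?exprn_gt0// ?nc_gt0 ?(rin_ne_rbd wi)//.
  apply: lerXl; first by rewrite nc_gt0 (rin_ne_rbd wi).
  by apply: rcl_diam (rbd_rcl ab cd zb) (rin_rcl wi).
have -> : Im (wind a b c d w) =
    rint a b (fun x => Im (Complex x c - w)^-1) - rint a b (fun x => Im (Complex x d - w)^-1) +
    (rint c d (fun y => Re (Complex b y - w)^-1) - rint c d (fun y => Re (Complex a y - w)^-1)).
  by rewrite /wind /rectint ImD ImB (ImM 'i%C) (ReB (cint _ _ _)) mul0r add0r mul1r.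
have hB : e / D ^+ 2 * (b - a) <= rint a b (fun x => Im (Complex x c - w)^-1).
  apply: rint_ge => // x xab; rewrite ImV ImB/= opprB; apply: key => //.
  by rewrite /rbd/= xab eqxx.
have hT : e / D ^+ 2 * (b - a) <= - rint a b (fun x => Im (Complex x d - w)^-1).
  rewrite -[leRHS]mulN1r -rintZ//; apply: rint_ge => //; first exact: segcontZ.
  move=> x xab; rewrite mulN1r ImV ImB/= mulNr opprK; apply: key => //.
  by rewrite /rbd/= xab eqxx orbT.
have hR : e / D ^+ 2 * (d - c) <= rint c d (fun y => Re (Complex b y - w)^-1).
  apply: rint_ge => // x xab; rewrite ReV ReB/=; apply: key => //.
  by rewrite /rbd/= xab eqxx !orbT.
have hL : e / D ^+ 2 * (d - c) <= - rint c d (fun y => Re (Complex a y - w)^-1).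
  rewrite -[leRHS]mulN1r -rintZ//; apply: rint_ge => //; first exact: segcontZ.
  move=> x xab; rewrite mulN1r ReV ReB/= -mulNr opprB; apply: key => //.
  by rewrite /rbd/= xab eqxx !orbT.
have -> : 2 * e / D = 2 * (e / D ^+ 2 * (b - a) + e / D ^+ 2 * (d - c)).
  by rewrite -mulrDr -/D; field; rewrite gt_eqF.
lra.
Qed.

Lemma wind_neq0 w a b c d : rin a b c d w -> wind a b c d w != 0.
Proof.
move=> wi; have [e e0 [e1 e2 e3 e4]] := rin_dist wi.
have h := wind_Im e0 e1 e2 e3 e4; apply/eqP => w0; move: h; rewrite w0 /=.
by apply/negP; rewrite -ltNge divr_gt0 ?mulr_gt0//; lra.
Qed.

End cauchy_kernel.

(** * Holomorphic and univalent functions *)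

Section holomorphic.
Variable R : realType.
Implicit Types (a b c d M s : R) (z w h p : R[i]) (f g F k : R[i] -> R[i]) (U : set R[i]).

Lemma exists_near z (r : R) : 0 < r -> exists2 w, w != z & nc (w - z) < r.
Proof.
move=> r0; exists (z + (r / 2)%:C%C); last first.
  by rewrite addrAC subrr add0r ncR ger0_norm; lra.
by rewrite -subr_eq0 addrAC subrr add0r -nc_eq0 ncR normr_eq0 gt_eqF// divr_gt0.
Qed.

Lemma ccont_eq_punctured f g z (r : R) : 0 < r -> ccont f z -> ccont g z ->
  (forall w, w != z -> nc (w - z) < r -> f w = g w) -> f z = g z.
Proof.
move=> r0 cf cg fg; apply/eqP; rewrite -subr_eq0; apply: contraT => fgz.
have [e e0 he] := ccont_gt0 (ccontB cf cg) fgz.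
have [|w wz] := @exists_near z (Num.min r e); first by rewrite lt_min r0.
rewrite lt_min => /andP[wr we]; have := he w we.
by rewrite fg// subrr eqxx.
Qed.

Lemma cdiff_unique f z (a b : R[i]) : cdiff f z a -> cdiff f z b -> a = b.
Proof.
move=> [p [fp cp <-]] [q [fq cq <-]]; apply: (ccont_eq_punctured ltr01 cp cq).
move=> w wz _; have wz' : w - z != 0 by rewrite subr_eq0.
have := fp w; rewrite fq => /addrI /(mulIf wz').
by [].
Qed.

(** At the exceptional point itself the formula follows from [cauchy_off], both sides being
    continuous in [w]. *)
Lemma cauchy f w0 w a b c d : rin a b c d w0 -> rin a b c d w ->
  (forall z, rcl a b c d z -> ccont f z) ->
  (forall z, rcl a b c d z -> z != w0 -> exists l, cdiff f z l) ->
  ker 1 f a b c d w = f w * wind a b c d w.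
Proof.
move=> i0 i1 cf df; have [e|] := eqVneq w w0; last by move=> ?; exact: (cauchy_off i0).
have [/andP[a1 b1] /andP[c1 d1]] := andP i1.
have ab : a <= b by exact/ltW/(lt_trans a1).
have cd : c <= d by exact/ltW/(lt_trans c1).
have cfb : bdcont f a b c d by move=> z /(rbd_rcl ab cd) /cf.
have [r r0 [r1 r2 r3 r4]] := rin_dist i1.
apply: (@ccont_eq_punctured _ (fun w => f w * wind a b c d w) w r r0).
- exact: cdiff_cont (ker1_cdiff cfb i1).
- by apply: ccontM; [exact/cf/rin_rcl|exact: cdiff_cont (wind_cdiff i1)].
move=> v vw vr; apply: (cauchy_off i0) => //; last by rewrite -e.
have := le_lt_trans (nc_Re _) vr; have := le_lt_trans (nc_Im _) vr.
rewrite ReB ImB !ltr_norml => /andP[? ?] /andP[? ?].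
by rewrite /rin; apply/andP; split; apply/andP; split; lra.
Qed.

Definition dker f a b c d w := ker 2 f a b c d w / wind a b c d w.

(** Inside the rectangle [f] is the quotient of [ker 1 f] by [wind], also at [w0]. The denominator
    has derivative zero, so the derivative of [f] is [dker f], which is differentiable again. *)
Lemma removable f w0 w a b c d : rin a b c d w0 -> rin a b c d w ->
  (forall z, rcl a b c d z -> ccont f z) ->
  (forall z, rcl a b c d z -> z != w0 -> exists l, cdiff f z l) ->
  cdiff f w (dker f a b c d w) /\ exists l, cdiff (dker f a b c d) w l.
Proof.
move=> i0 i1 cf df; have [/andP[a1 b1] /andP[c1 d1]] := andP i1.
have ab : a <= b by exact/ltW/(lt_trans a1).
have cd : c <= d by exact/ltW/(lt_trans c1).
have cfb : bdcont f a b c d by move=> z /(rbd_rcl ab cd) /cf.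
have [r r0 [r1 r2 r3 r4]] := rin_dist i1.
have wn := wind_neq0 i1; have wd := cdiffV wn (wind_cdiff i1).
split; last by have [l dl] := ker2_cdiff cfb i1; eexists; exact: cdiffM dl wd.
have := cdiffM (ker1_cdiff cfb i1) wd.
rewrite oppr0 mul0r mulr0 addr0; apply: (cdiff_near r0) => v vr.
have vi : rin a b c d v.
  have := le_lt_trans (nc_Re _) vr; have := le_lt_trans (nc_Im _) vr.
  rewrite ReB ImB !ltr_norml => /andP[? ?] /andP[? ?].
  by rewrite /rin; apply/andP; split; apply/andP; split; lra.
by rewrite (cauchy i0 vi cf df) mulfK// wind_neq0.
Qed.

Definition copen U := forall z, U z -> exists2 r, 0 < r &
  forall w, nc (w - z) < r -> U w.

(** The derivative [g] is part of the data, so that it can be differentiated and composed in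
    turn. *)
Definition hol U f g := forall z, U z -> cdiff f z (g z).

Definition sqr_cl p s z := rcl (Re p - s) (Re p + s) (Im p - s) (Im p + s) z.

Lemma sqr_cl_dist p s z : sqr_cl p s z -> nc (z - p) <= 2 * s.
Proof.
move=> /andP[/andP[? ?] /andP[? ?]]; apply: le_trans (nc_le _) _.
have h1 : `|Re (z - p)| <= s by rewrite ReB ler_norml; lra.
have h2 : `|Im (z - p)| <= s by rewrite ImB ler_norml; lra.
lra.
Qed.

Lemma sqr_in p s z : nc (z - p) < s ->
  rin (Re p - s) (Re p + s) (Im p - s) (Im p + s) z.
Proof.
move=> zs; have := le_lt_trans (nc_Re _) zs; have := le_lt_trans (nc_Im _) zs.
rewrite ReB ImB !ltr_norml => /andP[? ?] /andP[? ?].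
by rewrite /rin; apply/andP; split; apply/andP; split; lra.
Qed.

Lemma sqr_center p s : 0 < s -> rin (Re p - s) (Re p + s) (Im p - s) (Im p + s) p.
Proof. by move=> s0; apply: sqr_in; rewrite subrr Normc.normc0. Qed.

Lemma copen_sqr U p : copen U -> U p -> exists2 s, 0 < s &
  forall z, sqr_cl p s z -> U z.
Proof.
move=> oU /oU[r r0 rh]; exists (r / 3); first by rewrite divr_gt0.
by move=> z /sqr_cl_dist h; apply: rh; lra.
Qed.

(** On a small square, [g] coincides with the integral expression [dker f] by uniqueness of the
    derivative. *)
Lemma hol_deriv U f g : copen U -> hol U f g -> exists k, hol U g k.
Proof.
move=> oU hf; suff h z : exists l, U z -> cdiff g z l.
  by have [k hk] := choice h; exists k.
have [Uz|nUz] := pselect (U z); last by exists 0.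
have [s s0 sU] := copen_sqr oU Uz.
have zi := sqr_center z s0.
have cf v : sqr_cl z s v -> ccont f v by move=> /sU /hf /cdiff_cont.
have df v : sqr_cl z s v -> v != z -> exists l, cdiff f v l.
  by move=> /sU /hf fv _; exists (g v).
have [_ [l dl]] := removable zi zi cf df; exists l => _.
apply: (cdiff_near s0 _ dl) => v /sqr_in vi.
by have [dv _] := removable zi vi cf df; exact: cdiff_unique dv (hf _ (sU _ (rin_rcl vi))).
Qed.

Lemma wind_center p s : 0 < s ->
  2^-1 <= nc (wind (Re p - s) (Re p + s) (Im p - s) (Im p + s) p).
Proof.
move=> s0; apply: le_trans (nc_Im _); apply: le_trans (ler_norm _).
apply: (le_trans _ (@wind_Im _ p _ _ _ _ s s0 _ _ _ _)); [|by lra..].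
rewrite (_ : Re p + s - _ + _ = 4 * s); last by ring.
by rewrite [leRHS](_ : _ = 2^-1)//; field; rewrite gt_eqF.
Qed.

Lemma ker1_le f p s w e M : 0 < e -> 0 <= M -> nc (w - p) + e <= s ->
  bdcont f (Re p - s) (Re p + s) (Im p - s) (Im p + s) ->
  (forall z, rbd (Re p - s) (Re p + s) (Im p - s) (Im p + s) z -> nc (f z) <= M) ->
  nc (ker 1 f (Re p - s) (Re p + s) (Im p - s) (Im p + s) w) <= 16 * s / e * M.
Proof.
move=> e0 M0 wps cf fM.
have ws : nc (w - p) < s by lra.
have := le_trans (nc_Re (w - p)) (_ : _ <= s - e); have := le_trans (nc_Im (w - p)) (_ : _ <= s - e).
rewrite ReB ImB !ler_norml => hy hx.
have /andP[x1 x2] : - (s - e) <= Re w - Re p <= s - e by apply: hx; lra.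
have /andP[y1 y2] : - (s - e) <= Im w - Im p <= s - e by apply: hy; lra.
have s0 : 0 < s by apply: le_lt_trans ws; exact: nc_ge0.
have wi := sqr_in ws.
have -> : 16 * s / e * M = 4 * (M * e^-1) * ((Re p + s - (Re p - s)) + (Im p + s - (Im p - s))).
  by field; rewrite gt_eqF.
apply: rectint_le; [by lra..| |].
  by apply: bdcont_ker => //; exact: rin_rbd.
move=> z zb; rewrite Normc.normcM Normc.normcV expr1.
apply: ler_pM; rewrite ?nc_ge0 ?invr_ge0 ?nc_ge0 ?fM//.
rewrite lef_pV2 ?posrE// ?nc_gt0 ?(rin_ne_rbd wi)//.
by apply: rbd_dist zb; lra.
Qed.

(** A maximum principle up to a constant: Cauchy's formula at the centre bounds [|f p| |wind|] by
    [16 M], and [|wind| >= 1/2] there. *)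
Lemma max_principle f p s M : 0 < s -> 0 <= M ->
  (forall z, sqr_cl p s z -> exists l, cdiff f z l) ->
  (forall z, rbd (Re p - s) (Re p + s) (Im p - s) (Im p + s) z -> nc (f z) <= M) ->
  nc (f p) <= 32 * M.
Proof.
move=> s0 M0 df fM; have pi := sqr_center p s0.
have cf z : sqr_cl p s z -> ccont f z by move=> /df[l /cdiff_cont].
have cfb : bdcont f (Re p - s) (Re p + s) (Im p - s) (Im p + s).
  by move=> z zb; apply: cf; apply: rbd_rcl zb; lra.
have := @ker1_le f p s p s M s0 M0 _ cfb fM.
rewrite subrr Normc.normc0 add0r lexx => /(_ isT).
rewrite (cauchy pi pi cf); last by move=> z /df.
rewrite mulfK ?gt_eqF// Normc.normcM.
have h := wind_center p s0; have f0 := nc_ge0 (f p).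
move=> h2; have : nc (f p) * 2^-1 <= 16 * M by apply: le_trans h2; exact: ler_wpM2l.
lra.
Qed.

(* [f z = (z - p) ^ n g_n z] on the square, where [g_n] is the Cauchy integral of
   [f z / (z - p) ^ n]; this integral is [O (s ^ - n)]. *)
Lemma identity_principle f p s : 0 < s ->
  (forall z, sqr_cl p s z -> exists l, cdiff f z l) ->
  (forall e, 0 < e -> exists z, [/\ z != p, nc (z - p) < e & f z = 0]) ->
  forall z, nc (z - p) < s -> f z = 0.
Proof.
move=> s0 df zeros.
set a := Re p - s; set b := Re p + s; set c := Im p - s; set d := Im p + s.
have ab : a <= b by rewrite /a /b; lra.
have cd : c <= d by rewrite /c /d; lra.
have pi : rin a b c d p := sqr_center p s0.
have cf z : rcl a b c d z -> ccont f z by move=> /df[l /cdiff_cont].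
have cfb : bdcont f a b c d by move=> z /(rbd_rcl ab cd) /cf.
pose k n z := f z * ((z - p) ^+ n)^-1.
have ck n : bdcont (k n) a b c d by apply: bdcont_ker => //; exact: rin_rbd.
have claim n z : rin a b c d z ->
    f z * wind a b c d z = (z - p) ^+ n * ker 1 (k n) a b c d z.
  elim: n z => [|n ih] z zi.
    rewrite expr0 mul1r {1}/ker (@eq_rectint _ _ (fun z0 => f z0 * ((z0 - z) ^+ 1)^-1))//.
      by rewrite -[RHS]/(ker 1 f a b c d z) (cauchy pi zi)// => v /df.
    by move=> v _; rewrite /k expr0 invr1 mulr1.
  (* At the zeros of [f] near [p] the claim for [n] makes this Cauchy integral vanish, and it is
     continuous. Its vanishing at [p] allows one more factor [z - p] to be taken out. *)
  have kp : ker 1 (k n) a b c d p = 0.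
    apply/eqP; apply: contraT => kp.
    have [r r0 rh] := ccont_gt0 (cdiff_cont (ker1_cdiff (ck n) pi)) kp.
    have [|v [vp vr fv]] := zeros (Num.min r s); first by rewrite lt_min r0.
    move: vr; rewrite lt_min => /andP[vr vs].
    have := ih v (sqr_in vs); rewrite fv mul0r => /esym/eqP.
    by rewrite mulf_eq0 expf_eq0 subr_eq0 (negPf vp) andbF /= (negPf (rh v vr)).
  rewrite ih// exprSr -mulrA; congr (_ * _).
  rewrite -[LHS]subr0 -[X in _ - X]kp /ker -rectintB; last 2 first.
  - by apply: bdcont_ker => //; exact: rin_rbd.
  - by apply: bdcont_ker => //; exact: rin_rbd.
  rewrite -rectintZ; last by apply: bdcont_ker => //; exact: rin_rbd.
  apply: eq_rectint => // v vb; rewrite /k !expr1 exprS.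
  have vp := rin_ne_rbd pi vb; have vz := rin_ne_rbd zi vb.
  by field; rewrite vp vz expf_neq0.
move=> z zs; have zi : rin a b c d z := sqr_in zs.
have [M M0 hM] := bdcont_bounded ab cd cfb.
have wn := wind_neq0 zi.
apply/eqP; rewrite -nc_eq0 eq_le nc_ge0 andbT.
pose e := s - nc (z - p).
have e0 : 0 < e by rewrite subr_gt0.
pose C := 16 * s / e * M / nc (wind a b c d z).
have C0 : 0 <= C.
  by rewrite /C !mulr_ge0 ?invr_ge0 ?nc_ge0 ?ltW.
pose q := nc (z - p) / s.
have q0 : 0 <= q by rewrite divr_ge0 ?nc_ge0 ?ltW.
have q1 : q < 1 by rewrite ltr_pdivrMr// mul1r.
have bnd n : nc (f z) <= C * q ^+ n.
  have wz : 0 < nc (wind a b c d z) by rewrite nc_gt0.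
  rewrite -(ler_pM2r wz) -Normc.normcM (claim n)// Normc.normcM ncX.
  have -> : C * q ^+ n * nc (wind a b c d z) =
      nc (z - p) ^+ n * (16 * s / e * (M * (s ^+ n)^-1)).
    by rewrite /C /q expr_div_n; field; rewrite !gt_eqF// exprn_gt0.
  apply: ler_wpM2l; first by rewrite exprn_ge0// nc_ge0.
  apply: ker1_le => //.
  - by rewrite mulr_ge0 ?invr_ge0 ?exprn_ge0 ?ltW.
  - by rewrite /e addrC subrK.
  move=> v vb; rewrite Normc.normcM Normc.normcV ncX.
  apply: ler_pM; rewrite ?nc_ge0 ?hM// ?invr_ge0 ?exprn_ge0 ?nc_ge0//.
  have vp : s <= nc (v - p) by apply: rbd_dist vb; lra.
  by rewrite lef_pV2 ?posrE ?exprn_gt0 ?(lt_le_trans s0)//; exact: lerXl.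
have /cvgrPdist_lt lim : q ^+ n @[n --> \oo] --> (0 : R).
  by apply: cvg_expr; rewrite ger0_norm.
apply/ler_addgt0Pl => t t0; rewrite addr0.
have t0' : 0 < t / (C + 1) by rewrite divr_gt0// ltr_wpDl.
have [N _ hN] := lim _ t0'; have := hN N (leqnn N).
rewrite /= sub0r normrN ger0_norm ?exprn_ge0// ltr_pdivlMr ?ltr_wpDl// => h.
apply: le_trans (bnd N) _; apply: le_trans (ltW h).
by rewrite mulrC ler_wpM2l ?exprn_ge0// lerDl.
Qed.

End holomorphic.

(** * Univalent maps and their inverses *)

Section univalent.
Variable R : realType.
Implicit Types (z w p : R[i]) (U : set R[i]).
Variables (U : set R[i]) (f g chi : R[i] -> R[i]).
Hypotheses (oU : copen U) (hf : hol U f g).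
Hypothesis chiK : forall z, U z -> chi (f z) = z.

Let inj z w : U z -> U w -> f z = f w -> z = w.
Proof. by move=> Uz Uw e; rewrite -(chiK Uz) e chiK. Qed.

(** If [f] omitted on the square a value [w] close to [f p], then [1 / (f - w)] would be holomorphic
    there, and far larger at the centre than on the boundary, against [max_principle]. *)
Lemma univalent_open_map p s : 0 < s -> (forall z, sqr_cl p s z -> U z) ->
  exists2 r, 0 < r & forall w, nc (w - f p) < r -> exists2 z, sqr_cl p s z & f z = w.
Proof.
move=> s0 sU; have pi := sqr_center p s0.
set a := Re p - s in pi *; set b := Re p + s in pi *.
set c := Im p - s in pi *; set d := Im p + s in pi *.
have ab : a <= b by rewrite /a /b; lra.
have cd : c <= d by rewrite /c /d; lra.
have Up : U p by apply: sU; exact: rin_rcl.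
have ne z : rbd a b c d z -> f z - f p != 0.
  move=> zb; rewrite subr_eq0; apply/eqP => fzp.
  have e := inj (sU z (rbd_rcl ab cd zb)) Up fzp.
  by move: zb; rewrite e; exact/negP/rin_rbd.
have [M M0 hM] : exists2 M, 0 < M & forall z, rbd a b c d z -> nc (f z - f p)^-1 <= M.
  apply: bdcont_bounded => // z zb; apply: ccontV; first exact: ne.
  apply: ccontB; last exact: ccont_cst.
  by apply: cdiff_cont; apply: hf; exact: sU (rbd_rcl ab cd zb).
have M1 z : rbd a b c d z -> M^-1 <= nc (f z - f p).
  move=> zb; rewrite -[leRHS]invrK -Normc.normcV lef_pV2 ?posrE ?hM//.
  by rewrite nc_gt0 invr_eq0 ne.
(* On the boundary [|f - f p| >= 1 / M], hence [|f - w| >= 1 / (2 M)] for [w] within this radius.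
   The principle then gives [1 / |f p - w| <= 32 * 2 M], which contradicts
   [|f p - w| < 1 / (64 M)]. *)
have r0 : 0 < (64 * M)^-1 by rewrite invr_gt0 mulr_gt0.
exists (64 * M)^-1 => // w wr; apply: contrapT => nw.
have fw z : sqr_cl p s z -> f z - w != 0.
  by move=> zs; rewrite subr_eq0; apply/eqP => e; apply: nw; exists z.
have : nc (f p - w)^-1 <= 32 * (2 * M).
  apply: (@max_principle R (fun z => (f z - w)^-1) p s (2 * M) s0).
  - by rewrite mulr_ge0// ltW.
  - move=> z zs; eexists; apply: cdiffV; first exact: fw.
    by apply: cdiffD; [apply: hf; exact: sU|exact: cdiff_cst].
  - move=> z zb; rewrite Normc.normcV.
    have hinv : (64 * M)^-1 = 64^-1 * M^-1 by rewrite invfM.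
    rewrite -[leRHS]invrK lef_pV2 ?posrE ?nc_gt0 ?invr_gt0 ?mulr_gt0//; last first.
      exact: fw (rbd_rcl ab cd zb).
    rewrite invfM; rewrite hinv in wr r0.
    have := M1 z zb; have := ncBD (f z) (f p) w.
    by move: (M^-1) wr r0 => m; lra.
apply/negP; rewrite -ltNge Normc.normcV -[ltLHS]invrK.
rewrite ltf_pV2 ?posrE ?nc_gt0 ?fw ?invr_gt0 ?mulr_gt0//; last exact: rin_rcl.
by rewrite mulrA ncB (_ : 32 * 2 = 64)//; ring.
Qed.

Lemma sqr_shrink p (e : R) : U p -> 0 < e -> exists2 s, 0 < s &
  forall z, sqr_cl p s z -> U z /\ nc (z - p) < e.
Proof.
move=> Up e0; have [s s0 sU] := copen_sqr oU Up.
exists (Num.min s (e / 3)); first by rewrite lt_min s0 divr_gt0.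
set t := Num.min _ _; have /andP[ts te] : (t <= s) && (t <= e / 3).
  by rewrite /t !ge_min !lexx orbT.
move=> z zt; split; last by have := sqr_cl_dist zt; lra.
by apply: sU; move: zt => /andP[/andP[? ?] /andP[? ?]];
  apply/andP; split; apply/andP; split; lra.
Qed.

Lemma univalent_copen : copen (f @` U).
Proof.
move=> _ [p Up <-]; have [s s0 sU] := copen_sqr oU Up.
have [r r0 hr] := univalent_open_map s0 sU.
by exists r => // w /hr[z /sU Uz <-]; exists z.
Qed.

Lemma univalent_inv_cont p : U p -> ccont chi (f p).
Proof.
move=> Up e e0; have [s s0 hs] := sqr_shrink Up e0.
have [r r0 hr] : exists2 r, 0 < r & forall w, nc (w - f p) < r ->
    exists2 z, sqr_cl p s z & f z = w.
  by apply: univalent_open_map => // z /hs[].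
by exists r => // w /hr[z /hs[Uz zp] <-]; rewrite !chiK.
Qed.

(** The slope function of [chi] at [f p] is the reciprocal of that of [f] at [p], composed with
    [chi]; it is continuous because [chi] is. *)
Lemma univalent_inv_cdiff p : U p -> g p != 0 -> cdiff chi (f p) (g p)^-1.
Proof.
move=> Up gp; have [q [fq cq qg]] := hf Up.
have chic := univalent_inv_cont Up.
pose Q w := if w == f p then (g p)^-1 else (chi w - p) / (w - f p).
exists Q; split; last by rewrite /Q eqxx.
- move=> w; rewrite /Q chiK//; have [->|wp] := eqVneq w (f p).
    by rewrite chiK// subrr mulr0 addr0.
  by rewrite divfK ?subr_eq0// addrC subrK.
have [r r0 hr] := univalent_copen (ex_intro2 _ _ p Up erefl).
have : ccont (fun w => (q (chi w))^-1) (f p).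
  apply: ccontV; first by rewrite chiK// qg.
  by apply: ccont_comp => //; rewrite chiK.
apply: (ccont_near r0) => w /hr[z Uz <-]; rewrite /Q.
have [e|fzp] := eqVneq (f z) (f p); first by rewrite e chiK// qg.
rewrite chiK// fq addrAC subrr add0r invfM mulrCA divff ?mulr1//.
by rewrite subr_eq0; apply: contraNneq fzp => ->.
Qed.

(** Suppose [g p = 0]. If zeros of [g] accumulate at [p], then [g] vanishes on a disc around [p] and
    [f] is constant on a horizontal segment, against injectivity. Otherwise [chi] is differentiable
    around [f p] except possibly at [f p], where it is continuous; the singularity is removable, and
    the chain rule for [chi (f z) = z] gives [1 = 0]. *)
Lemma univalent_deriv_neq0 p : U p -> g p != 0.
Proof.
move=> Up; apply/eqP => gp; have [s s0 sU] := copen_sqr oU Up.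
have [k hk] := hol_deriv oU hf.
have [acc|] := pselect (forall e : R, 0 < e -> exists z, [/\ z != p, nc (z - p) < e & g z = 0]).
  have g0 : forall z, nc (z - p) < s -> g z = 0.
    by apply: identity_principle => // z /sU /hk; exists (k z).
  pose P t := Complex t (Im p).
  have hP : path_of 1 P by exact: path_hor.
  have tP t : Re p <= t <= Re p + s / 2 -> nc (P t - p) < s.
    move=> /andP[t1 t2]; have -> : P t - p = (t - Re p)%:C%C.
      by rewrite /P; apply: complex_eq; rewrite ?ReB ?ImB /= ?subrr.
    by rewrite ncR ltr_norml; lra.
  have PU t : Re p <= t <= Re p + s / 2 -> U (P t).
    by move=> /tP /sqr_in /rin_rcl /sU.
  have s2 : Re p <= Re p + s / 2 by lra.
  have : 1 * cint (Re p) (Re p + s / 2) (fun=> 0) = f (P (Re p + s / 2)) - f (P (Re p)).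
    apply: (@cint_FTC R 1 P f (fun=> 0) _ _ hP s2) => t tp; first exact: ccont_cst.
    by rewrite -(g0 (P t)) ?tP//; apply: hf; exact: PU.
  have -> : cint (Re p) (Re p + s / 2) (fun=> 0) = 0 :> R[i].
    by rewrite /cint /= !rint_cst// mul0r.
  rewrite mulr0 => /esym/eqP; rewrite subr_eq0 => /eqP /inj.
  have U1 : U (P (Re p + s / 2)) by apply: PU; rewrite s2 lexx.
  have U2 : U (P (Re p)) by apply: PU; rewrite s2 lexx.
  by move=> /(_ U1 U2) [] /eqP; rewrite -subr_eq0 addrAC subrr add0r gt_eqF// divr_gt0.
move=> /existsNP[e /not_implyP[e0 /forallNP he]].
have [t t0 ht] := sqr_shrink Up e0.
have [r r0 hr] : exists2 r, 0 < r & forall w, nc (w - f p) < r ->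
    exists2 z, sqr_cl p t z & f z = w.
  by apply: univalent_open_map => // z /ht[].
have hw w : sqr_cl (f p) (r / 3) w -> exists z, [/\ U z, nc (z - p) < e & f z = w].
  move=> /sqr_cl_dist wr; have [|z /ht[Uz zp] <-] := hr w; first by lra.
  by exists z.
have r3 : 0 < r / 3 by rewrite divr_gt0.
have pi := sqr_center (f p) r3.
have [||dl _] := removable (f := chi) pi pi.
- by move=> w /hw[z [Uz _ <-]]; exact: univalent_inv_cont.
- move=> w /hw[z [Uz zp <-]] zne; exists (g z)^-1; apply: univalent_inv_cdiff => //.
  by apply/eqP => gz; apply: (he z); split=> //; apply: contraNneq zne => ->.
have := cdiff_comp (hf Up) dl; rewrite gp mulr0 => d1.
have [r' r'0 hr'] := oU Up.
have : cdiff id p 0 by apply: (cdiff_near r'0 _ d1) => w /hr'; exact: chiK.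
by move=> /cdiff_unique /(_ (cdiff_id p)) /esym/eqP; rewrite oner_eq0.
Qed.

Lemma univalent_inv : hol (f @` U) chi (fun w => (g (chi w))^-1).
Proof.
move=> _ [z Uz <-]; rewrite chiK//; apply: univalent_inv_cdiff => //.
exact: univalent_deriv_neq0.
Qed.

End univalent.

(** * Conformal change of variables *)

Section density_measure.
Local Open Scope ereal_scope.
Context d (T : measurableType d) (R : realType) (mu : {measure set T -> \bar R}).
Variable h : T -> R.
Hypotheses (mh : measurable_fun setT h) (h0 : forall x, (0 <= h x)%R).

Definition density (A : set T) : \bar R := \int[mu]_(x in A) (h x)%:E.

Let density0 : density set0 = 0.
Proof. by rewrite /density integral_set0. Qed.

Let density_ge0 A : 0 <= density A.
Proof. by apply: integral_ge0 => x _; rewrite lee_fin. Qed.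

Let density_sigma_additive : semi_sigma_additive density.
Proof.
move=> F mF tF mUF; rewrite /density ge0_integral_bigcup//; last 2 first.
- by apply/measurable_EFinP; apply: measurable_funS mh.
- by move=> x _; rewrite lee_fin.
by apply: is_cvg_nneseries => n _ _; exact: density_ge0.
Qed.

HB.instance Definition _ := isMeasure.Build _ _ _ density
  density0 density_ge0 density_sigma_additive.

Definition density_measure : {measure set T -> \bar R} := density.

Import HBNNSimple.

Lemma integral_density (f : T -> \bar R) : measurable_fun setT f ->
  (forall x, 0 <= f x) ->
  \int[density]_x f x = \int[mu]_x (f x * (h x)%:E).
Proof.
move=> mf f0; pose f_ := nnsfun_approx measurableT mf.
transitivity (limn (fun n => \int[density]_x (f_ n x)%:E)).
  rewrite -monotone_convergence//=.
  - apply: eq_integral => x /[!inE] xD; apply/esym/cvg_lim => //=.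
    by apply: cvg_nnsfun_approx => // y _; exact: f0.
  - by move=> n; exact/measurable_EFinP.
  - by move=> n x _; rewrite lee_fin.
  - by move=> x _ a b ab; rewrite lee_fin//; exact/lefP/nd_nnsfun_approx.
rewrite [RHS](_ : _ = limn (fun n => \int[mu]_x ((f_ n x)%:E * (h x)%:E))); last first.
  rewrite -monotone_convergence//=.
  - apply: eq_integral => x /[!inE] xD; apply/esym/cvg_lim => //.
    apply: cvgeZr => //; apply: cvg_nnsfun_approx => // y _; exact: f0.
  - by move=> n; apply: emeasurable_funM; apply/measurable_EFinP.
  - by move=> n x _; rewrite mule_ge0// lee_fin.
  - move=> x _ a b ab; rewrite lee_wpmul2r ?lee_fin//.
    exact/lefP/nd_nnsfun_approx.
congr (limn _); apply/funext => n.
under [LHS]eq_integral do rewrite fimfunE -fsumEFin//.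
under [RHS]eq_integral do rewrite fimfunE -fsumEFin//.
rewrite [LHS]ge0_integral_fsum//; last 2 first.
  - by move=> r; exact/measurable_EFinP/measurableT_comp.
  - by move=> m x _; rewrite EFinM nnfun_muleindic_ge0.
under [RHS]eq_integral.
  move=> x xD; rewrite muleC ge0_mule_fsumr; last first.
    by move=> r; rewrite EFinM nnfun_muleindic_ge0.
  over.
rewrite [RHS]ge0_integral_fsum//; last 2 first.
  - move=> r; apply: emeasurable_funM; first exact/measurable_EFinP.
    exact/measurable_EFinP/measurableT_comp.
  - by move=> m x _; apply: mule_ge0; rewrite ?lee_fin// -lee_fin EFinM nnfun_muleindic_ge0.
apply: eq_fsbigr => r _.
have mE : measurable (f_ n @^-1` [set r]) by exact: measurable_funPTI.
have [r0|r0] := leP 0%R r; last first.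
  have e0 : f_ n @^-1` [set r] = set0.
    apply/seteqP; split => // x /= fx.
    by move: r0; rewrite -fx ltNge fun_ge0.
  by rewrite e0 !integral0_eq// => x _; rewrite indicE in_set0 mulr0 ?mule0.
under [LHS]eq_integral do rewrite EFinM.
rewrite ge0_integralZl//; last exact/measurable_EFinP.
under [RHS]eq_integral do rewrite EFinM muleCA.
rewrite [RHS]ge0_integralZl//; last 2 first.
  - by apply: emeasurable_funM; exact/measurable_EFinP.
  - by move=> x _; rewrite mule_ge0// lee_fin.
congr (_ * _); rewrite integral_indic// setIT /density [LHS]integral_mkcond.
apply: eq_integral => x _; rewrite /patch indicE.
by case: ifPn => _ /=; rewrite ?mule1 ?mule0.
Qed.

End density_measure.

(** The pushforward bundled as a measure, and kept transparent so that its value on a set still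
    unfolds. *)
Definition pushforward_measure d1 d2 (T1 : measurableType d1) (T2 : measurableType d2)
    (R : realType) (m : {measure set T1 -> \bar R}) (phi : T1 -> T2)
    (mphi : measurable_fun setT phi) : {measure set T2 -> \bar R}.
Proof.
pose m0 : {measure set T2 -> \bar R} := pushforward m phi.
exact: (m0 mphi).
Defined.

(** * Measurability of planar regions and maps *)

Section plane_measurability.
Variable R : realType.
Implicit Types (U : set R[i]) (z w : R[i]) (a b c d : R).
Local Notation MR := (measurableTypeR R).

Definition ofC z : R * R := (Re z, Im z).

Lemma toCK p : ofC (toC p) = p :> R * R. Proof. by case: p. Qed.
Lemma ofCK z : toC (ofC z) = z. Proof. by case: z. Qed.

(** Half-open, so that cutting a cell yields disjoint cells. *)
Definition cell a b c d : set (MR * MR) := `]a, b] `*` `]c, d].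

Lemma measurable_cell a b c d : measurable (cell a b c d).
Proof. exact: measurableX. Qed.

Lemma cellP a b c d p : cell a b c d p <-> (a < p.1 <= b) && (c < p.2 <= d).
Proof.
rewrite /cell /setX /= !in_itv/=; split=> [[-> ->]//|/andP[-> ->]//].
Qed.

(** An open set is a countable union of cells with rational corners. The closed rectangles are kept
    inside [U], so that a function continuous on [U] is bounded on each cell. *)
Lemma rat_cells U : copen U -> exists q : nat -> (R * R) * (R * R),
  (forall n z, rcl (q n).1.1 (q n).1.2 (q n).2.1 (q n).2.2 z -> U z) /\
  forall p, region U p -> exists n, cell (q n).1.1 (q n).1.2 (q n).2.1 (q n).2.2 p.
Proof.
move=> oU.
pose Q := ((rat * rat) * (rat * rat))%type.
pose emb (x : Q) : (R * R) * (R * R) :=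
  ((ratr x.1.1, ratr x.1.2), (ratr x.2.1, ratr x.2.2)).
pose ok (e : (R * R) * (R * R)) := forall z, rcl e.1.1 e.1.2 e.2.1 e.2.2 z -> U z.
(* Indices that do not code a rectangle inside [U] are sent to an empty one, with bounds 1 and 0 in
   both directions. *)
pose q n := if @unpickle Q n is Some x then
   (if pselect (ok (emb x)) then emb x else ((1, 0), (1, 0))) else ((1, 0), (1, 0)).
have empty z : rcl (1 : R) 0 1 0 z -> U z.
  by move=> /andP[/andP[h1 h2]]; have := le_trans h1 h2; rewrite ler10.
exists q; split.
  move=> n z; rewrite /q; case: unpickle => [x|]; last exact: empty.
  by case: pselect => [oke|?]; [exact: oke|exact: empty].
move=> [x y] /oU [r r0 rh].
have hr : 0 < r / 4 by rewrite divr_gt0.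
have between (t t' : R) : t < t' -> exists2 q : rat, t < ratr q & ratr q < t'.
  by move=> /rat_in_itvoo[e]; rewrite in_itv/= => /andP[? ?]; exists e.
have [|a a1 a2] := between (x - r / 4) x; first by lra.
have [|b b1 b2] := between x (x + r / 4); first by lra.
have [|c c1 c2] := between (y - r / 4) y; first by lra.
have [|d d1 d2] := between y (y + r / 4); first by lra.
have okx : ok (emb ((a, b), (c, d))).
  move=> z /andP[/=/andP[z1 z2] /andP[z3 z4]]; apply: rh.
  apply: le_lt_trans (nc_le _) _.
  have h1 : `|Re (z - toC (x, y))| <= r / 4 by rewrite ReB /= ler_norml; lra.
  have h2 : `|Im (z - toC (x, y))| <= r / 4 by rewrite ImB /= ler_norml; lra.
  by lra.
exists (@pickle Q ((a, b), (c, d))).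
rewrite /q pickleK; case: pselect => [oke|/(_ okx) //]; apply/cellP => /=.
by rewrite a2 (ltW b1) c2 (ltW d1).
Qed.

Lemma measurable_region U : copen U -> measurable (region U : set (MR * MR)).
Proof.
move=> /rat_cells[q [qU Uq]].
have -> : region U = \bigcup_n cell (q n).1.1 (q n).1.2 (q n).2.1 (q n).2.2.
  apply/seteqP; split => p; first by move=> /Uq[n]; exists n.
  move=> [n _ /cellP /andP[/andP[h1 h2] /andP[h3 h4]]]; apply: (qU n).
  by rewrite /rcl/= h2 h4 !ltW.
by apply: bigcup_measurable => n _; exact: measurable_cell.
Qed.

Definition rcont (u : R[i] -> R) z := forall e : R, 0 < e ->
  exists2 r, 0 < r & forall w, nc (w - z) < r -> `|u w - u z| < e.

Lemma rcont_measurable U (u : R[i] -> R) : copen U -> (forall z, U z -> rcont u z) ->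
  measurable_fun (region U : set (MR * MR)) (fun p => u (toC p)).
Proof.
move=> oU cu; apply: (measurability _ (RGenOInfty.measurableE R)).
move=> /= _ [_ [a ->]] <-.
have -> : region U `&` (fun p => u (toC p)) @^-1` `]a, +oo[ =
    region (U `&` [set z | a < u z]).
  by apply/seteqP; split => p [Up]; rewrite /= in_itv/= andbT.
apply: measurable_region => z [Uz az].
have [r r0 rU] := oU z Uz.
have [|r' r'0 hr'] := cu z Uz (u z - a); first by rewrite subr_gt0.
exists (Num.min r r'); first by rewrite lt_min r0.
move=> w; rewrite lt_min => /andP[wr /hr' wz]; split; first exact: rU.
by move: wz; rewrite /= ltr_norml; lra.
Qed.

Lemma rcont_Re f z : ccont f z -> rcont (fun w => Re (f w)) z.
Proof.
move=> cf e /cf[r r0 rh]; exists r => // w /rh; apply: le_lt_trans.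
by rewrite -ReB nc_Re.
Qed.

Lemma rcont_Im f z : ccont f z -> rcont (fun w => Im (f w)) z.
Proof.
move=> cf e /cf[r r0 rh]; exists r => // w /rh; apply: le_lt_trans.
by rewrite -ImB nc_Im.
Qed.

Lemma rcont_nc f z : ccont f z -> rcont (fun w => nc (f w)) z.
Proof.
move=> cf e /cf[r r0 rh]; exists r => // w /rh; apply: le_lt_trans.
exact: nc_lip.
Qed.

Definition plane (f : R[i] -> R[i]) (p : MR * MR) : MR * MR := ofC (f (toC p)).

(** Extended by the origin outside [U], which makes it measurable on the whole plane, as pushforward
    measures require. *)
Definition plane_on U f (p : MR * MR) : MR * MR :=
  ((fun p => Re (f (toC p))) \_ (region U) p, (fun p => Im (f (toC p))) \_ (region U) p).

Lemma plane_onE U f p : region U p -> plane_on U f p = plane f p.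
Proof. by move=> Up; rewrite /plane_on !patchE mem_set. Qed.

Lemma measurable_plane_on U f : copen U -> (forall z, U z -> ccont f z) ->
  measurable_fun setT (plane_on U f).
Proof.
move=> oU cf; have mU := measurable_region oU.
apply: measurable_fun_pair.
  apply/(measurable_restrictT (fun p => Re (f (toC p))) mU).
  by apply: (@rcont_measurable U (fun z => Re (f z)) oU) => z /cf; exact: rcont_Re.
apply/(measurable_restrictT (fun p => Im (f (toC p))) mU).
by apply: (@rcont_measurable U (fun z => Im (f z)) oU) => z /cf; exact: rcont_Im.
Qed.

End plane_measurability.

(** * Area under complex affine maps *)

Section affine_area.
Variable R : realType.
Local Notation MR := (measurableTypeR R).
Local Notation mu := (@lebesgue_measure R).
Local Open Scope ereal_scope.

Lemma measurable_affine (k m : R) : measurable_fun setT (fun x : MR => (k * x + m)%R : MR).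
Proof. by apply: measurable_funD => //; exact: measurable_funM. Qed.

(** The pushforward of Lebesgue measure by [x -> k x + m], multiplied by [|k|], gives every
    half-open interval its length, hence is Lebesgue measure. *)
Lemma integral_affine (k m : R) (F : MR -> \bar R) : k != 0%R ->
  measurable_fun setT F -> (forall x, 0 <= F x) ->
  `|k|%:E * \int[mu]_x F (k * x + m)%R = \int[mu]_x F x.
Proof.
move=> k0 mF F0.
pose phi (x : MR) : MR := (k * x + m)%R.
have mphi : measurable_fun setT phi := measurable_affine k m.
pose nu0 : {measure set MR -> \bar R} :=
  mscale (NngNum (normr_ge0 k)) (pushforward mu phi).
pose nu := nu0 mphi.
have kk : (`|k| * `|k|^-1 = 1)%R by rewrite divff// normr_eq0.
have nuE A : measurable A -> mu A = nu A.
  apply: lebesgue_measure_unique => _ [[a b] _ <-] /=.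
  rewrite /mscale /= lebesgue_measure_itv/= lte_fin.
  rewrite -[pushforward mu phi _]/(mu (phi @^-1` `]a, b])).
  have [k1|k1|k1] := ltgtP k 0%R; last by rewrite k1 eqxx in k0.
    have -> : phi @^-1` `]a, b] = `[((b - m) / k)%R, ((a - m) / k)%R[%classic.
      apply/seteqP; split => x; rewrite /phi /= !in_itv/=.
        rewrite ler_ndivrMr// ltr_ndivlMr// mulrC; move: (_ * _)%R => y.
        by move=> /andP[? ?]; apply/andP; split; lra.
      rewrite ler_ndivrMr// ltr_ndivlMr// mulrC; move: (_ * _)%R => y.
      by move=> /andP[? ?]; apply/andP; split; lra.
    rewrite lebesgue_measure_itv/= lte_fin ltr_nM2r ?invr_lt0// ltrD2r.
    case: ifPn => _; last by rewrite mule0.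
    rewrite -EFinD -EFinM; congr (_%:E); rewrite ltr0_norm//; field; lra.
  have -> : phi @^-1` `]a, b] = `]((a - m) / k)%R, ((b - m) / k)%R]%classic.
    apply/seteqP; split => x; rewrite /phi /= !in_itv/=.
      rewrite ler_pdivlMr// ltr_pdivrMr// mulrC; move: (_ * _)%R => y.
      by move=> /andP[? ?]; apply/andP; split; lra.
    rewrite ler_pdivlMr// ltr_pdivrMr// mulrC; move: (_ * _)%R => y.
    by move=> /andP[? ?]; apply/andP; split; lra.
  rewrite lebesgue_measure_itv/= lte_fin ltr_pM2r ?invr_gt0// ltrD2r.
  case: ifPn => _; last by rewrite mule0.
  rewrite -EFinD -EFinM; congr (_%:E); rewrite gtr0_norm//; field; lra.
transitivity (\int[nu]_x F x); last first.
  by apply: eq_measure_integral => A mA _; exact: esym (nuE A mA).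
transitivity (`|k|%:E * \int[pushforward mu phi]_x F x); last first.
  by rewrite [RHS]ge0_integral_mscale.
by rewrite ge0_integral_pushforward// preimage_setT.
Qed.

(** The similarity is split into two one-dimensional substitutions, one in each variable, with
    factors [p] and [(p^2 + q^2) / p]. *)
Lemma integral_complex_affine_neq0 (p q r s : R) (F : MR * MR -> \bar R) : p != 0%R ->
  measurable_fun setT F -> (forall x, 0 <= F x) ->
  (p ^+ 2 + q ^+ 2)%:E *
    \int[mu]_y \int[mu]_x F ((p * x - q * y + r)%R, (q * x + p * y + s)%R) =
  \int[mu]_x \int[mu]_y F (x, y).
Proof.
move=> p0 mF F0.
pose N := (p ^+ 2 + q ^+ 2)%R.
have N0 : (0 < N)%R.
  by rewrite /N ltr_wpDr ?sqr_ge0// exprn_even_gt0.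
(* [F] after the first substitution only: [z.1] is the new abscissa, and [q x + p y + s] is
   expressed by it and the old [y]. The coefficient of [y] is then [q^2 / p + p]. *)
pose H (z : MR * MR) := F (z.1, (q / p * (z.1 - r + q * z.2) + p * z.2 + s)%R).
have mH : measurable_fun setT H.
  apply: (measurableT_comp mF); apply: measurable_fun_pair => //.
  apply: measurable_funD => //; apply: measurable_funD; last exact: measurable_funM.
  apply: measurable_funM => //; apply: measurable_funD; last exact: measurable_funM.
  exact: measurable_funB.
have H0 z : 0 <= H z by exact: F0.
have -> : N%:E = `|N / p|%:E * `|p|%:E.
  by rewrite -EFinM -normrM divfK// gtr0_norm.
rewrite -muleA.
have m1 : measurable_fun setT (fun y : MR => \int[mu]_x H (x, y)).
  exact: (measurable_fun_fubini_tonelli_G _ mH H0).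
have e1 y : `|p|%:E * \int[mu]_x F ((p * x - q * y + r)%R, (q * x + p * y + s)%R) =
    \int[mu]_x H (x, y).
  rewrite -(@integral_affine p (r - q * y)%R (fun x => H (x, y)))//; last first.
    by apply: (measurableT_comp mH); exact: measurable_fun_pair.
  congr (_ * _); apply: eq_integral => x _; rewrite /H /=; congr (F (_, _)); first by ring.
  by field.
have e2 : `|p|%:E * \int[mu]_y \int[mu]_x F ((p * x - q * y + r)%R, (q * x + p * y + s)%R) =
    \int[mu]_y \int[mu]_x H (x, y).
  have m2 : measurable_fun setT (fun y : MR =>
      \int[mu]_x F ((p * x - q * y + r)%R, (q * x + p * y + s)%R)).
    pose G (z : MR * MR) := F ((p * z.1 - q * z.2 + r)%R, (q * z.1 + p * z.2 + s)%R).
    apply: (measurable_fun_fubini_tonelli_G G); last by move=> z; exact: F0.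
    apply: (measurableT_comp mF); apply: measurable_fun_pair.
      apply: measurable_funD => //; apply: measurable_funB; exact: measurable_funM.
    apply: measurable_funD => //; apply: measurable_funD; exact: measurable_funM.
  rewrite -ge0_integralZl//; last by move=> y _; apply: integral_ge0.
  by apply: eq_integral => y _; exact: e1.
rewrite e2 -(fubini_tonelli _ mH H0).
rewrite -ge0_integralZl//; last 2 first.
- exact: (measurable_fun_fubini_tonelli_F _ mH H0).
- by move=> x _; apply: integral_ge0.
apply: eq_integral => x _.
rewrite -(@integral_affine (N / p)%R (q / p * (x - r) + s)%R (fun y => F (x, y))).
- congr (_ * _); apply: eq_integral => y _; rewrite /H /=; congr (F (_, _)).
  by rewrite /N; field.
- by rewrite mulf_neq0 ?invr_eq0// gt_eqF.
- by apply: (measurableT_comp mF); exact: measurable_fun_pair.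
- by move=> y.
Qed.

Lemma area_integral_xy (F : MR * MR -> \bar R) : measurable_fun setT F ->
  (forall x, 0 <= F x) -> \int[@area R]_z F z = \int[mu]_x \int[mu]_y F (x, y).
Proof. by move=> mF F0; exact: fubini_tonelli1. Qed.

Lemma area_integral_yx (F : MR * MR -> \bar R) : measurable_fun setT F ->
  (forall x, 0 <= F x) -> \int[@area R]_z F z = \int[mu]_y \int[mu]_x F (x, y).
Proof. by move=> mF F0; exact: fubini_tonelli2. Qed.

(** For [p = 0] the map exchanges the axes, so the order of integration is exchanged and the two
    factors are [q] and [- q]. *)
Lemma integral_complex_affine (p q r s : R) (F : MR * MR -> \bar R) :
  (p != 0)%R || (q != 0)%R ->
  measurable_fun setT F -> (forall x, 0 <= F x) ->
  (p ^+ 2 + q ^+ 2)%:E *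
    \int[@area R]_z F ((p * z.1 - q * z.2 + r)%R, (q * z.1 + p * z.2 + s)%R) =
  \int[@area R]_z F z.
Proof.
move=> pq mF F0.
pose G (z : MR * MR) := F ((p * z.1 - q * z.2 + r)%R, (q * z.1 + p * z.2 + s)%R).
have mG : measurable_fun setT G.
  apply: (measurableT_comp mF); apply: measurable_fun_pair.
    apply: measurable_funD => //; apply: measurable_funB; exact: measurable_funM.
  apply: measurable_funD => //; apply: measurable_funD; exact: measurable_funM.
have G0 z : 0 <= G z by exact: F0.
rewrite -[X in _ * X]/(\int[@area R]_z G z) (area_integral_yx mG G0).
have [p0|p0] := eqVneq p 0%R; last first.
  by rewrite area_integral_xy// -(integral_complex_affine_neq0 q r s p0 mF F0).
move: pq; rewrite p0 eqxx /= => q0.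
have -> : (0 ^+ 2 + q ^+ 2 = `|q| * `|- q|)%R.
  by rewrite normrN -normrM expr0n add0r -expr2 ger0_norm// sqr_ge0.
rewrite EFinM -muleA area_integral_xy//.
have m2 : measurable_fun setT (fun y : MR => \int[mu]_x G (x, y)).
  exact: (measurable_fun_fubini_tonelli_G _ mG G0).
have m3 : measurable_fun setT (fun x : MR => \int[mu]_y F (x, y)).
  exact: (measurable_fun_fubini_tonelli_F _ mF F0).
rewrite -(@integral_affine (- q)%R r (fun u => \int[mu]_y F (u, y))) ?oppr_eq0//; last first.
  by move=> y; exact: integral_ge0.
rewrite muleCA; congr (_ * _).
rewrite -ge0_integralZl//; last by move=> y _; exact: integral_ge0.
apply: eq_integral => y _.
rewrite -[RHS](@integral_affine q s (fun x => F ((- q * y + r)%R, x)))//; last first.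
  by apply: (measurableT_comp mF); exact: measurable_fun_pair.
congr (_ * _); apply: eq_integral => x _; rewrite /G /= p0; congr (F (_, _)); ring.
Qed.

Lemma area_affine (a b : R[i]) (A : set (MR * MR)) : a != 0%R -> measurable A ->
  (nc a ^+ 2)%:E * @area R ((plane (fun z => a * z + b)%R) @^-1` A) = @area R A.
Proof.
move=> a0 mA.
have IA (B : set (MR * MR)) : measurable B -> @area R B = \int[@area R]_z (\1_B z)%:E.
  by move=> mB; rewrite integral_indic// setIT.
pose L (z : MR * MR) : MR * MR := plane (fun z => a * z + b)%R z.
have LE z : L z = ((Re a * z.1 - Im a * z.2 + Re b)%R, (Im a * z.1 + Re a * z.2 + Im b)%R).
  by rewrite /L /plane /ofC !(ReD, ImD, ReM, ImM) /=; congr (_, _); ring.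
have mL : measurable_fun setT L.
  rewrite (funext LE); apply: measurable_fun_pair.
    apply: measurable_funD => //; apply: measurable_funB; exact: measurable_funM.
  apply: measurable_funD => //; apply: measurable_funD; exact: measurable_funM.
have mLA : measurable (L @^-1` A) by rewrite -[X in measurable X]setTI; exact: mL.
rewrite (IA _ mA) -(@integral_complex_affine (Re a) (Im a) (Re b) (Im b)); last 3 first.
- by apply: contraNT a0; rewrite negb_or !negbK => /andP[/eqP ? /eqP ?]; apply/eqP/complex_eq.
- exact/measurable_EFinP.
- by move=> x; rewrite lee_fin.
rewrite -sqr_nc (IA _ mLA); congr (_ * _).
by apply: eq_integral => z _; rewrite -LE.
Qed.

End affine_area.

(** * Comparison of measures on cells *)

Section cell_measures.
Variable R : realType.
Implicit Types (a b c d e x y t w h : R).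
Local Notation MR := (measurableTypeR R).
Local Open Scope ereal_scope.

Lemma area_cell a b c d : (a <= b)%R -> (c <= d)%R ->
  area (cell a b c d) = ((b - a) * (d - c))%:E.
Proof.
move=> ab cd; rewrite /area /cell product_measure1E//= !lebesgue_measure_itv/= !lte_fin.
move: ab cd; rewrite !le_eqVlt => /predU1P[->|->] /predU1P[->|->];
  by rewrite ?ltxx ?subrr ?mul0e ?mule0 ?mulr0 ?mul0r// -?EFinD -?EFinM.
Qed.

Lemma measure_cell_splitx (m : {measure set (MR * MR) -> \bar R}) a b b' c d :
  (a <= b)%R -> (b <= b')%R ->
  m (cell a b' c d) = m (cell a b c d) + m (cell b b' c d).
Proof.
move=> ab bb'; rewrite -measureU//; [|exact: measurable_cell..|].
  congr (m _); apply/seteqP; split => -[x y].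
    move=> /cellP/= /andP[/andP[h1 h2] h3]; have [xb|xb] := leP x b.
      by left; apply/cellP; rewrite /= h1 xb.
    by right; apply/cellP; rewrite /= h2 xb.
  by case=> /cellP/= /andP[/andP[h1 h2] h3]; apply/cellP; rewrite /= h3 andbT;
    apply/andP; split; lra.
apply/seteqP; split => // -[x y] [/cellP/= /andP[/andP[_ h1] _]].
by move=> /cellP/= /andP[/andP[h2 _] _]; move: h1; rewrite leNgt h2.
Qed.

Lemma measure_cell_splity (m : {measure set (MR * MR) -> \bar R}) a b c d d' :
  (c <= d)%R -> (d <= d')%R ->
  m (cell a b c d') = m (cell a b c d) + m (cell a b d d').
Proof.
move=> ab bb'; rewrite -measureU//; [|exact: measurable_cell..|].
  congr (m _); apply/seteqP; split => -[x y].
    move=> /cellP/= /andP[h3 /andP[h1 h2]]; have [xb|xb] := leP y d.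
      by left; apply/cellP; rewrite /= h3 h1 xb.
    by right; apply/cellP; rewrite /= h3 h2 xb.
  by case=> /cellP/= /andP[h3 /andP[h1 h2]]; apply/cellP; rewrite /= h3 /=;
    apply/andP; split; lra.
apply/seteqP; split => // -[x y] [/cellP/= /andP[_ /andP[_ h1]]].
by move=> /cellP/= /andP[_ /andP[h2 _]]; move: h1; rewrite leNgt h2.
Qed.

Lemma measure_cell_quarter (m : {measure set (MR * MR) -> \bar R}) x y w h :
  (0 <= w)%R -> (0 <= h)%R ->
  m (cell x (x + (w + w)) y (y + (h + h))) =
  m (cell x (x + w) y (y + h)) + m (cell (x + w) (x + w + w) y (y + h)) +
  (m (cell x (x + w) (y + h) (y + h + h)) + m (cell (x + w) (x + w + w) (y + h) (y + h + h))).
Proof.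
move=> w0 h0; rewrite (addrA x) (addrA y).
rewrite (@measure_cell_splity m x (x + w + w) y (y + h)) ?lerDl//.
by rewrite !(@measure_cell_splitx m x (x + w) (x + w + w)) ?lerDl.
Qed.

(** A differentiation principle for measures: the error [e * t ^+ 2] is additive under quartering,
    so [bisection] passes the local inequality on to the whole cell, and [e] is arbitrary. *)
Lemma measure_cell_eq (m1 m2 : {measure set (MR * MR) -> \bar R}) x0 y0 w h :
  (0 <= w)%R -> (0 <= h)%R ->
  (forall p q e, (x0 <= p <= x0 + w)%R -> (y0 <= q <= y0 + h)%R -> (0 < e)%R ->
    exists2 d, (0 < d)%R & forall x y t, (0 < t)%R -> (t < d)%R ->
      (x <= p <= x + t * w)%R -> (y <= q <= y + t * h)%R ->
      m1 (cell x (x + t * w)%R y (y + t * h)%R) <=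
        m2 (cell x (x + t * w)%R y (y + t * h)%R) + (e * t ^+ 2)%:E) ->
  m1 (cell x0 (x0 + w)%R y0 (y0 + h)%R) <= m2 (cell x0 (x0 + w)%R y0 (y0 + h)%R).
Proof.
move=> w0 h0 H; apply/lee_addgt0Pr => e e0.
suff : m1 (cell x0 (x0 + 1 * w) y0 (y0 + 1 * h)) <=
    m2 (cell x0 (x0 + 1 * w) y0 (y0 + 1 * h)) + (e * 1 ^+ 2)%:E.
  by rewrite !mul1r expr1n mulr1.
apply: (@bisection R w h x0 y0 (fun x y t => m1 (cell x (x + t * w) y (y + t * h)) <=
        m2 (cell x (x + t * w) y (y + t * h)) + (e * t ^+ 2)%:E)) => //.
  move=> x y t t0 _.
  have tw : (0 <= t / 2 * w)%R by rewrite mulr_ge0// divr_ge0// ltW.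
  have th : (0 <= t / 2 * h)%R by rewrite mulr_ge0// divr_ge0// ltW.
  have -> : (t * w = t / 2 * w + t / 2 * w)%R by field.
  have -> : (t * h = t / 2 * h + t / 2 * h)%R by field.
  have -> : (e * t ^+ 2)%:E = (e * (t / 2) ^+ 2)%:E + (e * (t / 2) ^+ 2)%:E +
      ((e * (t / 2) ^+ 2)%:E + (e * (t / 2) ^+ 2)%:E).
    by rewrite -!EFinD; congr (_%:E); field.
  rewrite !measure_cell_quarter//; move: (e * (t / 2) ^+ 2)%:E => E h1 h2 h3 h4.
  by rewrite [leRHS]addeACA; apply: leeD; rewrite [leRHS]addeACA; apply: leeD.
move=> p q px qy; have [d d0 hd] := H p q e px qy e0.
by exists d => // x y t t0 td _; exact: hd.
Qed.

(* Half-open rectangles form a generating pi-system. *)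
Lemma measure_cells_unique (m1 m2 : {measure set (MR * MR) -> \bar R}) :
  (forall a b c d, m1 (cell a b c d) = m2 (cell a b c d)) ->
  m1 setT < +oo -> forall A, measurable A -> m1 A = m2 A.
Proof.
move=> m12 m1oo A mA.
pose G : set (set (MR * MR)) := [set X | exists q : (R * R) * (R * R),
  X = cell q.1.1 q.1.2 q.2.1 q.2.2].
pose gn n := cell (- n%:R) n%:R (- n%:R) (n%:R : R).
have gG n : G (gn n) by exists ((- n%:R, n%:R), (- n%:R, n%:R))%R.
have gcov : \bigcup_n gn n = setT.
  apply/seteqP; split => // -[x y] _.
  have [n hn] : exists n, (`|x| + `|y| < n%:R :> R)%R.
    by exists (Num.trunc (`|x| + `|y|)).+1; rewrite truncnS_gt.
  exists n => //; apply/cellP => /=.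
  have := normr_ge0 x; have := normr_ge0 y => y0 x0.
  have : (`|x| < n%:R)%R by lra.
  have : (`|y| < n%:R)%R by lra.
  by rewrite !ltr_norml => /andP[? ?] /andP[? ?]; apply/andP; split; apply/andP; split; lra.
have GI : setI_closed G.
  move=> _ _ [[[a b] [c d]] ->] [[[a' b'] [c' d']] ->] /=.
  exists ((Num.max a a', Num.min b b'), (Num.max c c', Num.min d d')).
  apply/seteqP; split => -[x y] /=.
    move=> [/cellP/= /andP[/andP[h1 h2] /andP[h3 h4]] /cellP/= /andP[/andP[k1 k2] /andP[k3 k4]]].
    by apply/cellP; rewrite /= !gt_max !le_min h1 h2 h3 h4 k1 k2 k3 k4.
  move=> /cellP; rewrite /= !gt_max !le_min.
  move=> /andP[/andP[/andP[h1 h2] /andP[h3 h4]] /andP[/andP[k1 k2] /andP[k3 k4]]].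
  by split; apply/cellP; rewrite /= ?h1 ?h2 ?h3 ?h4 ?k1 ?k2 ?k3 ?k4.
(* Each strip over a half-open interval is a countable union of cells, so both projections are
   measurable for the sigma-algebra generated by the cells. *)
have mG : measurable = <<s G >> :> set (set (MR * MR)).
  apply/seteqP; split; last first.
    apply: smallest_sub; first exact: sigma_algebra_measurable.
    by move=> _ [q ->]; exact: measurable_cell.
  have Gcell a b c d : <<s G >> (cell a b c d).
    by apply: sub_sigma_algebra; exists ((a, b), (c, d)).
  have mfst : measurable_fun setT (fst : g_sigma_algebraType G -> MR).
    apply: (measurability _ (erefl : _ = <<s @ocitv R >>)) => _ [_ [[a b] _ <-] <-].
    rewrite setTI (_ : _ @^-1` _ = \bigcup_n cell a b (- n%:R)%R n%:R).
      by apply: bigcup_measurable => n _; exact: Gcell.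
    apply/seteqP; split => -[x y] /=.
      rewrite in_itv/= => hx; have : (\bigcup_n gn n) (x, y) by rewrite gcov.
      move=> [n _ /cellP/= /andP[_ hy]]; exists n; first by [].
      by split; rewrite /= in_itv/=.
    by move=> [n _ [/=]]; rewrite !in_itv.
  have msnd : measurable_fun setT (snd : g_sigma_algebraType G -> MR).
    apply: (measurability _ (erefl : _ = <<s @ocitv R >>)) => _ [_ [[a b] _ <-] <-].
    rewrite setTI (_ : _ @^-1` _ = \bigcup_n cell (- n%:R)%R n%:R a b).
      by apply: bigcup_measurable => n _; exact: Gcell.
    apply/seteqP; split => -[x y] /=.
      rewrite in_itv/= => hx; have : (\bigcup_n gn n) (x, y) by rewrite gcov.
      move=> [n _ /cellP/= /andP[hy _]]; exists n; first by [].
      by split; rewrite /= in_itv/=.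
    by move=> [n _ [_ /=]]; rewrite in_itv.
  rewrite measurable_prod_measurableType; apply: smallest_sub.
    exact: smallest_sigma_algebra.
  move=> _ [X mX [Y mY <-]].
  rewrite (_ : X `*` Y = (setT `&` fst @^-1` X) `&` (setT `&` snd @^-1` Y)); last first.
    by rewrite !setTI; apply/seteqP; split => -[x y] [].
  have := @measurableI _ (g_sigma_algebraType G) _ _ (mfst measurableT X mX)
    (msnd measurableT Y mY).
  by [].
apply: (measure_unique G gn) => //; first by move=> _ [q ->]; exact: m12.
by move=> n; apply: le_lt_trans m1oo; apply: le_measure; rewrite ?inE//; exact: measurable_cell.
Qed.

End cell_measures.

Lemma measurable_plane (R : realType) (f : R[i] -> R[i]) : (forall z, ccont f z) ->
  measurable_fun setT (plane f).
Proof.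
move=> cf; have oT : copen (@setT R[i]) by move=> ? _; exists 1.
apply: measurable_fun_pair.
  by apply: (@rcont_measurable R setT (fun v => Re (f v)) oT) => z _; exact: rcont_Re.
by apply: (@rcont_measurable R setT (fun v => Im (f v)) oT) => z _; exact: rcont_Im.
Qed.

(** * Enlarged and shrunk intervals *)

Section interval_shift.
Variable R : realFieldType.
Implicit Types x X a s u v : R.

Lemma shift_out x X s u v : x < v <= X -> v - s <= u <= v + s -> x - s < u <= X + s.
Proof. by move=> /andP[? ?] /andP[? ?]; apply/andP; split; lra. Qed.

Lemma shift_in x X s u v : x + s < u <= X - s -> u - s <= v <= u + s -> x < v <= X.
Proof. by move=> /andP[? ?] /andP[? ?]; apply/andP; split; lra. Qed.

Lemma ler_grow x a s : 0 < a -> 0 < s -> x - s <= x + a + s.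
Proof. by move=> *; lra. Qed.

Lemma ler_shrink x a s : 0 < a -> s <= a / 4 -> x + s <= x + a - s.
Proof. by move=> *; lra. Qed.

Lemma lt_shrink x a s u : 0 < s -> x + s < u <= x + a - s -> x < u <= x + a.
Proof. by move=> s0 /andP[? ?]; apply/andP; split; lra. Qed.

Lemma itv_dist x a u v : x < u <= x + a -> x <= v <= x + a -> `|u - v| <= a.
Proof. by move=> /andP[? ?] /andP[? ?]; rewrite ler_norml; apply/andP; split; lra. Qed.

End interval_shift.

Lemma nc_coord (R : realType) (u v : R[i]) (s : R) : nc (u - v) <= s ->
  (Re v - s <= Re u <= Re v + s) /\ (Im v - s <= Im u <= Im v + s).
Proof.
move=> uv; have := le_trans (nc_Re _) uv; have := le_trans (nc_Im _) uv.
by rewrite ReB ImB !ler_norml => /andP[? ?] /andP[? ?]; split; lra.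
Qed.

(** Boundedness passes from the four quarters to a cell, and continuity gives it on small cells. *)
Lemma rcl_bounded (R : realType) (k : R[i] -> R[i]) (a b c d : R) :
  (forall z, rcl a b c d z -> ccont k z) ->
  exists M, forall z, rcl a b c d z -> nc (k z) <= M.
Proof.
move=> ck; have [ab|ba] := leP a b; last first.
  exists 0 => z /andP[/andP[h1 h2] _].
  by have := lt_le_trans ba (le_trans h1 h2); rewrite ltxx.
have [cd|dc] := leP c d; last first.
  exists 0 => z /andP[_ /andP[h1 h2]].
  by have := lt_le_trans dc (le_trans h1 h2); rewrite ltxx.
have w0 : 0 <= b - a by rewrite subr_ge0.
have h0 : 0 <= d - c by rewrite subr_ge0.
suff : exists M, forall z, rcl a (a + 1 * (b - a)) c (c + 1 * (d - c)) z -> nc (k z) <= M.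
  by rewrite !mul1r !(addrC _ (_ - _)) !subrK.
apply: (@bisection R (b - a) (d - c) a c (fun x y t =>
   exists M, forall z, rcl x (x + t * (b - a)) y (y + t * (d - c)) z -> nc (k z) <= M)) => //.
  move=> x y t t0 _ [M1 h1] [M2 h2] [M3 h3] [M4 h4].
  exists (Num.max (Num.max M1 M2) (Num.max M3 M4)) => z /andP[/andP[z1 z2] /andP[z3 z4]].
  have ew : t * (b - a) = t / 2 * (b - a) + t / 2 * (b - a) by field.
  have eh : t * (d - c) = t / 2 * (d - c) + t / 2 * (d - c) by field.
  rewrite ew addrA in z2; rewrite eh addrA in z4.
  rewrite !le_max; have [xl|xr] := leP (Re z) (x + t / 2 * (b - a));
    have [yl|yr] := leP (Im z) (y + t / 2 * (d - c)).
  - by rewrite h1// /rcl z1 xl z3 yl.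
  - by rewrite h3 ?orbT// /rcl z1 xl (ltW yr) z4.
  - by rewrite h2 ?orbT// /rcl (ltW xr) z2 z3 yl.
  - by rewrite h4 ?orbT// /rcl (ltW xr) z2 (ltW yr) z4.
move=> p q; rewrite !(addrC _ (_ - _)) !subrK => hp hq.
have [|r r0 hr] := ck (Complex p q) _ _ ltr01; first by rewrite /rcl/= hp hq.
pose L := (b - a) + (d - c).
have L0 : 0 <= L by rewrite addr_ge0.
exists (r / (L + 1)); first by rewrite divr_gt0// ltr_wpDl.
move=> x y t t0; rewrite ltr_pdivlMr ?ltr_wpDl// => tr _ px qy.
exists (nc (k (Complex p q)) + 1) => z zr.
apply: le_trans (nc_le_add _ (k (Complex p q))) _; rewrite lerD2l; apply/ltW/hr.
have pr : rcl x (x + t * (b - a)) y (y + t * (d - c)) (Complex p q) by rewrite /rcl/= px qy.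
apply: le_lt_trans (rcl_diam zr pr) _; apply: le_lt_trans tr.
have -> : x + t * (b - a) - x + (y + t * (d - c) - y) = t * L by rewrite /L; ring.
by rewrite ler_pM2l// lerDl.
Qed.

(** * Change of variables for univalent maps *)

Section change_of_variables.
Variable R : realType.
Implicit Types (a b c d e x y t w h : R).
Local Notation MR := (measurableTypeR R).
Local Open Scope ereal_scope.
Variables (U : set R[i]) (f g chi : R[i] -> R[i]).
Hypotheses (oU : copen U) (hf : hol U f g).
Hypothesis chiK : forall z, U z -> chi (f z) = z.

Let V := f @` U.

Let oV : copen V. Proof. exact: univalent_copen oU hf chiK. Qed.

Let g_neq0 z : U z -> g z != 0%R.
Proof. exact: univalent_deriv_neq0 oU hf chiK z. Qed.

Let hchi : hol V chi (fun v => (g (chi v))^-1)%R.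
Proof. exact: univalent_inv oU hf chiK. Qed.

Let fK v : V v -> f (chi v) = v.
Proof. by move=> [z Uz <-]; rewrite chiK. Qed.

Let chiU v : V v -> U (chi v).
Proof. by move=> [z Uz <-]; rewrite chiK. Qed.

Let gc z : U z -> ccont g z.
Proof. by move=> Uz; have [k hk] := hol_deriv oU hf; exact: cdiff_cont (hk z Uz). Qed.

Let mU : measurable (region U : set (MR * MR)) := measurable_region oU.
Let mV : measurable (region V : set (MR * MR)) := measurable_region oV.

Let jac (p : MR * MR) : R := ((fun p => nc (g (toC p)) ^+ 2)%R \_ (region U)) p.

Let jac_ge0 p : (0 <= jac p)%R.
Proof. by rewrite /jac patchE; case: ifP => // _; rewrite exprn_ge0// nc_ge0. Qed.

Let jacE p : region U p -> jac p = (nc (g (toC p)) ^+ 2)%R.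
Proof. by move=> Up; rewrite /jac patchE mem_set. Qed.

Let mjac : measurable_fun setT jac.
Proof.
apply/(measurable_restrictT (fun p => nc (g (toC p)) ^+ 2)%R mU).
apply: (@measurable_funX _ _ _ _ (fun p => nc (g (toC p)))).
by apply: (@rcont_measurable R U (fun z => nc (g z)) oU) => z /gc; exact: rcont_nc.
Qed.

(** The measure with density [|f'|^2] on [U]; the change of variables amounts to [nu = kappa]. *)
Let kappa : {measure set (MR * MR) -> \bar R} := density_measure (@area R) mjac jac_ge0.

Let mchi : measurable_fun setT (plane_on V chi).
Proof. by apply: measurable_plane_on => // z /hchi /cdiff_cont. Qed.

Let ind (p : MR * MR) : R := \1_(region V) p.

Let mind : measurable_fun setT ind. Proof. exact: measurable_indic. Qed.

Let ind_ge0 p : (0 <= ind p)%R. Proof. by rewrite /ind indicE. Qed.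

(** The image under [chi] of area on [V]: [nu A] is the area of [f] of the part of [A] inside
    [U]. *)
Let nu : {measure set (MR * MR) -> \bar R} :=
  pushforward_measure (density_measure (@area R) mind ind_ge0) mchi.

Let nuE A : measurable A -> nu A = area (plane_on V chi @^-1` A `&` region V).
Proof.
move=> mA; have mpA : measurable (plane_on V chi @^-1` A).
  by rewrite -[X in measurable X]setTI; exact: mchi.
rewrite -[nu A]/(\int[@area R]_(p in plane_on V chi @^-1` A) (\1_(region V) p)%:E).
by rewrite integral_indic// setIC.
Qed.

Let plane_chi (p : MR * MR) : region V p -> plane_on V chi p = plane chi p.
Proof. exact: plane_onE. Qed.

(* Near [z0], [f] differs from the similarity [z0 -> f z0 + g z0 (z - z0)] by a
   displacement that is small compared with the size of the cell. *)
Let local_area z0 w h e : U z0 -> (0 < w)%R -> (0 < h)%R -> (0 < e)%R ->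
  exists2 d, (0 < d)%R & forall x y t, (0 < t)%R -> (t < d)%R ->
    (x <= Re z0 <= x + t * w)%R -> (y <= Im z0 <= y + t * h)%R ->
    let Q := cell x (x + t * w)%R y (y + t * h)%R in
    nu Q <= kappa Q + (e * t ^+ 2)%:E /\ kappa Q <= nu Q + (e * t ^+ 2)%:E.
Proof.
move=> Uz0 w0 h0 e0.
pose a := g z0; have a0 : a != 0%R by exact: g_neq0.
pose A := (nc a ^+ 2)%R.
have na : (0 < nc a)%R by rewrite nc_gt0.
have A0 : (0 < A)%R by rewrite exprn_gt0.
pose L := (w + h)%R; have L0 : (0 < L)%R by rewrite addr_gt0.
(* Tolerance for the density: an error [e1] in [|g|^2] changes the [kappa]-mass of a cell of area
   [t^2 w h] by [e t^2 / 2]. *)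
pose e1 := (e / (2 * (w * h)))%R.
have e10 : (0 < e1)%R by rewrite divr_gt0// !mulr_gt0.
have e1E : (e1 * (w * h) = e / 2)%R by rewrite /e1; field; rewrite !gt_eqF.
(* Relative displacement: [f] moves points of the cell by at most [eta t] after normalization. The
   second bound keeps the area error within [e t^2 / 2], and the last two keep the shrunk cell
   nondegenerate. *)
pose eta := Num.min (Num.min 1 (e / (2 * (A * (2 * L + 4)))))%R (Num.min (w / 4) (h / 4))%R.
have [eta0 eta1 etae etaw etah] : [/\ 0 < eta, eta <= 1, A * (2 * L + 4) * eta <= e / 2,
    eta <= w / 4 & eta <= h / 4]%R.
  have B0 : (0 < 2 * (A * (2 * L + 4)))%R by rewrite !mulr_gt0// addr_gt0// mulr_gt0.
  split.
  - by rewrite !lt_min ltr01 !divr_gt0.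
  - by rewrite !ge_min lexx.
  - have : (eta <= e / (2 * (A * (2 * L + 4))))%R by rewrite !ge_min lexx orbT.
    by rewrite ler_pdivlMr//; lra.
  - by rewrite !ge_min lexx !orbT.
  - by rewrite !ge_min lexx !orbT.
have cA : rcont (fun z => nc (g z) ^+ 2)%R z0.
  have := rcont_nc (ccontX 2 (gc Uz0)); move=> cg e2 /cg[r r0 rh].
  by exists r => // v /rh; rewrite !ncX.
have [r0 r00 hr0] := cA _ e10.
have [r1 r10 hr1] := oU Uz0.
have e20 : (0 < eta * nc a / L)%R by rewrite divr_gt0// mulr_gt0.
have /cdiffP/(_ _ e20)[r2 r20 hr2] := hf Uz0.
have Vf : V (f z0) by exists z0.
have [r3 r30 hr3] := oV Vf.
have e30 : (0 < eta / (nc a * L))%R by rewrite divr_gt0// mulr_gt0.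
have /cdiffP/(_ _ e30)[r4 r40 hr4] := hchi Vf.
rewrite chiK// -/a in hr4.
pose r := Num.min (Num.min r0 (Num.min r1 r2)) (Num.min r3 r4 / nc a)%R.
have rr : [/\ 0 < r, r <= r0, r <= r1, r <= r2 & nc a * r <= r3 /\ nc a * r <= r4]%R.
  split; rewrite ?lt_min ?r00 ?r10 ?r20 ?divr_gt0 ?lt_min ?r30 ?r40//.
  - by rewrite !ge_min lexx.
  - by rewrite !ge_min lexx !orbT.
  - by rewrite !ge_min lexx !orbT.
  - have h1 : (r <= Num.min r3 r4 / nc a)%R by rewrite !ge_min lexx !orbT.
    by rewrite mulrC; split; rewrite -ler_pdivlMr//; apply: le_trans h1 _;
      rewrite ler_pM2r ?invr_gt0// ge_min lexx ?orbT.
move: r rr => r [r_gt0 rr0 rr1 rr2 [rr3 rr4]].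
exists (r / L)%R; first by rewrite divr_gt0.
move=> x y t t0; rewrite ltr_pdivlMr// => tL hx hy Q.
have tw : (0 < t * w)%R by rewrite mulr_gt0.
have th : (0 < t * h)%R by rewrite mulr_gt0.
have tLE : (t * L = t * w + t * h)%R by rewrite mulrDr.
have dist u v : (x < u <= x + t * w)%R -> (y < v <= y + t * h)%R ->
    (nc (Complex u v - z0) <= t * L)%R.
  move=> hu hv; apply: le_trans (nc_le _) _; rewrite ReB ImB tLE /=.
  by apply: lerD; [exact: itv_dist hu hx|exact: itv_dist hv hy].
have Qin p : Q p -> (nc (toC p - z0) <= t * L)%R.
  by move=> /cellP/andP[]; exact: dist.
have QU p : Q p -> region U p.
  by move=> /Qin h1; apply: hr1; apply: le_lt_trans h1 _; lra.
have areaQ : @area R Q = (t ^+ 2 * (w * h))%:E.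
  by rewrite area_cell ?lerDl ?ltW//; congr (_%:E); ring.
have mQ : measurable Q by exact: measurable_cell.
have jacQ p : Q p -> (A - e1 <= jac p <= A + e1)%R.
  move=> Qp; rewrite (jacE (QU p Qp)).
  have : (`|nc (g (toC p)) ^+ 2 - A| < e1)%R.
    by apply: hr0; apply: le_lt_trans (Qin p Qp) _; lra.
  by rewrite ltr_norml; lra.
have mjQ : measurable_fun Q (EFin \o jac).
  by apply/measurable_EFinP; exact: measurable_funTS.
have kappa_le : kappa Q <= ((A + e1) * (t ^+ 2 * (w * h)))%:E.
  rewrite EFinM -areaQ -integral_cst//.
  apply: ge0_le_integral => //.
  - by move=> p _; rewrite lee_fin.
  - by move=> p /jacQ /andP[_]; rewrite lee_fin.
have kappa_ge : ((A - e1) * (t ^+ 2 * (w * h)))%:E <= kappa Q.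
  have [Ae|Ae] := leP 0%R (A - e1)%R; last first.
    apply: le_trans (measure_ge0 _ _); rewrite lee_fin.
    apply: mulr_le0_ge0; first exact: ltW.
    by rewrite ltW// mulr_gt0 ?exprn_gt0 ?mulr_gt0.
  rewrite EFinM -areaQ -integral_cst//.
  by apply: ge0_le_integral => // p /jacQ /andP[h1 _]; rewrite lee_fin.
pose s := (eta * t)%R.
have s0 : (0 < s)%R by rewrite mulr_gt0.
have sw : (s <= t * w / 4)%R.
  by rewrite /s mulrC -mulrA ler_pM2l.
have sh : (s <= t * h / 4)%R.
  by rewrite /s mulrC -mulrA ler_pM2l.
(* The inverse of the similarity tangent to [f] at [z0]; preimages under [T] multiply area by
   [A]. *)
pose T := plane (fun v => (a^-1 * v + (z0 - a^-1 * f z0))%R).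
have TE v : (a^-1 * v + (z0 - a^-1 * f z0) = a^-1 * (v - f z0) + z0)%R by ring.
have mT0 : measurable_fun setT T.
  apply: measurable_plane => v; apply: ccontD; last exact: ccont_cst.
  by apply: ccontM; [exact: ccont_cst|exact: ccont_id].
have areaT B : measurable B -> @area R (T @^-1` B) = A%:E * @area R B.
  move=> mB; rewrite -(@area_affine R a^-1%R (z0 - a^-1 * f z0)%R B)//.
    by rewrite Normc.normcV muleA -EFinM exprVn divff ?mul1e// gt_eqF.
  by rewrite invr_eq0.
have nu_le : nu Q <= (A * (t * w + 2 * s) * (t * h + 2 * s))%:E.
  (* When [chi v] lies in [Q], the differentiability of [f] at [z0] puts [T v] within [s] of it,
     hence in the enlarged cell. *)
  pose Qp := cell (x - s)%R (x + t * w + s)%R (y - s)%R (y + t * h + s)%R.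
  have <- : @area R (T @^-1` Qp) = (A * (t * w + 2 * s) * (t * h + 2 * s))%:E.
    rewrite areaT; last exact: measurable_cell.
    by rewrite area_cell; [rewrite -EFinM; congr (_%:E); ring|exact: ler_grow|exact: ler_grow].
  have mT : measurable (T @^-1` Qp).
    have mf : measurable_fun setT T by exact: mT0.
    by rewrite -[X in measurable X]setTI; apply: mf => //; exact: measurable_cell.
  rewrite nuE//; apply: le_measure; rewrite ?inE//.
    by apply: measurableI => //; rewrite -[X in measurable X]setTI; exact: mchi.
  move=> p [/= Qc Vp]; rewrite plane_chi// in Qc.
  have Uc := chiU Vp; move: (Vp) => /fK; set v := toC p => fv.
  have := Qin _ Qc; rewrite /plane ofCK -/v => dv.
  have := hr2 (chi v); rewrite fv => /(_ _)/= hv.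
  have {hv}hv : (nc (v - f z0 - a * (chi v - z0)) <= eta * nc a / L * nc (chi v - z0))%R.
    by apply: hv; apply: le_lt_trans dv _; lra.
  have : (nc (a^-1 * v + (z0 - a^-1 * f z0) - chi v) <= s)%R.
    have -> : (a^-1 * v + (z0 - a^-1 * f z0) - chi v = a^-1 * (v - f z0 - a * (chi v - z0)))%R.
      by field.
    rewrite Normc.normcM Normc.normcV mulrC ler_pdivrMr//.
    apply: le_trans hv _; apply: le_trans (ler_wpM2l (ltW e20) dv) _.
    by rewrite le_eqVlt; apply/orP; left; apply/eqP; rewrite /s; field; rewrite gt_eqF.
  move=> /nc_coord[h1 h2].
  move: Qc => /cellP/=; rewrite -/v => /andP[k1 k2].
  by apply/cellP/andP; split; [exact: shift_out k1 h1|exact: shift_out k2 h2].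
have nu_ge : (A * (t * w - 2 * s) * (t * h - 2 * s))%:E <= nu Q.
  (* Conversely, when [T v] lies in the shrunk cell, the differentiability of [chi] at [f z0] puts
     [chi v] within [s] of it, hence in [Q]. *)
  pose Qm := cell (x + s)%R (x + t * w - s)%R (y + s)%R (y + t * h - s)%R.
  have <- : @area R (T @^-1` Qm) = (A * (t * w - 2 * s) * (t * h - 2 * s))%:E.
    rewrite areaT; last exact: measurable_cell.
    by rewrite area_cell; [rewrite -EFinM; congr (_%:E); ring|exact: ler_shrink|exact: ler_shrink].
  have mT : measurable (T @^-1` Qm).
    have mf : measurable_fun setT T by exact: mT0.
    by rewrite -[X in measurable X]setTI; apply: mf => //; exact: measurable_cell.
  rewrite nuE//; apply: le_measure; rewrite ?inE//.
    by apply: measurableI => //; rewrite -[X in measurable X]setTI; exact: mchi.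
  move=> p /= /cellP; set v := toC p; set u := (a^-1 * v + (z0 - a^-1 * f z0))%R.
  rewrite /T /plane /= -/v -/u => /andP[k1 k2].
  have du : (nc (u - z0) <= t * L)%R.
    have -> : u = Complex (Re u) (Im u) by exact: complex_eq.
    by apply: dist; [exact: lt_shrink k1|exact: lt_shrink k2].
  have vE : (v - f z0 = a * (u - z0))%R by rewrite /u; field.
  have dv : (nc (v - f z0) < nc a * r)%R.
    by rewrite vE Normc.normcM ltr_pM2l//; apply: le_lt_trans du _.
  have Vv : V v by apply: hr3; exact: lt_le_trans dv rr3.
  have := hr4 v (lt_le_trans dv rr4) => hv.
  have : (nc (chi v - u) <= s)%R.
    have -> : (chi v - u = chi v - z0 - a^-1 * (v - f z0))%R by rewrite /u; ring.
    apply: le_trans hv _; rewrite vE Normc.normcM.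
    apply: le_trans (ler_wpM2l (ltW e30) (ler_wpM2l (ltW na) du)) _.
    by rewrite le_eqVlt; apply/orP; left; apply/eqP; rewrite /s; field; rewrite !gt_eqF.
  move=> /nc_coord[h1 h2]; split=> //=; rewrite plane_chi//.
  by apply/cellP/andP; split; [exact: shift_in k1 h1|exact: shift_in k2 h2].
have t20 : (0 < t ^+ 2)%R by rewrite exprn_gt0.
have up : (A * (t * w + 2 * s) * (t * h + 2 * s) <= (A - e1) * (t ^+ 2 * (w * h)) + e * t ^+ 2)%R.
  have -> : (A * (t * w + 2 * s) * (t * h + 2 * s) =
     (A * (w * h) + A * (2 * L + 4 * eta) * eta) * t ^+ 2)%R by rewrite /s /L; ring.
  have -> : ((A - e1) * (t ^+ 2 * (w * h)) + e * t ^+ 2 =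
     (A * (w * h) - e1 * (w * h) + e) * t ^+ 2)%R by ring.
  rewrite ler_pM2r// e1E.
  have : (A * (2 * L + 4 * eta) * eta <= A * (2 * L + 4) * eta)%R.
    by rewrite ler_pM2r// ler_pM2l// lerD2l ler_piMr.
  by lra.
have dn : ((A + e1) * (t ^+ 2 * (w * h)) <= A * (t * w - 2 * s) * (t * h - 2 * s) + e * t ^+ 2)%R.
  have -> : (A * (t * w - 2 * s) * (t * h - 2 * s) + e * t ^+ 2 =
     (A * (w * h) - A * (2 * L - 4 * eta) * eta + e) * t ^+ 2)%R by rewrite /s /L; ring.
  have -> : ((A + e1) * (t ^+ 2 * (w * h)) = (A * (w * h) + e1 * (w * h)) * t ^+ 2)%R by ring.
  rewrite ler_pM2r// e1E.
  have : (A * (2 * L - 4 * eta) * eta <= A * (2 * L + 4) * eta)%R.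
    by rewrite ler_pM2r// ler_pM2l//; lra.
  by lra.
split.
  apply: le_trans nu_le _; apply: le_trans (leeD kappa_ge (lexx _)).
  by rewrite -EFinD lee_fin.
apply: le_trans kappa_le _; apply: le_trans (leeD nu_ge (lexx _)).
by rewrite -EFinD lee_fin.
Qed.

Let cell_area a b c d : (forall z, rcl a b c d z -> U z) -> nu (cell a b c d) = kappa (cell a b c d).
Proof.
move=> sU; have [ab|ba] := ltP a b; last first.
  rewrite (_ : cell _ _ _ _ = set0) ?measure0//; apply/seteqP; split => // p /cellP.
  by move=> /andP[/andP[h1 h2] _]; have := lt_le_trans h1 (le_trans h2 ba); rewrite ltxx.
have [cd|dc] := ltP c d; last first.
  rewrite (_ : cell _ _ _ _ = set0) ?measure0//; apply/seteqP; split => // p /cellP.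
  by move=> /andP[_ /andP[h1 h2]]; have := lt_le_trans h1 (le_trans h2 dc); rewrite ltxx.
have w0 : (0 < b - a)%R by rewrite subr_gt0.
have h0 : (0 < d - c)%R by rewrite subr_gt0.
have bE : (b = a + (b - a))%R by rewrite addrC subrK.
have dE : (d = c + (d - c))%R by rewrite addrC subrK.
apply/eqP; rewrite eq_le; apply/andP; split; rewrite bE dE;
  apply: measure_cell_eq => [||p q e hp hq e0]; rewrite ?ltW//;
  have Upq : U (Complex p q) by [apply: sU; rewrite /rcl/= bE hp dE hq];
  have [r r0 hr] := local_area Upq w0 h0 e0; exists r => // x y t t0 tr px qy;
  by have [] := hr x y t t0 tr px qy.
Qed.

(** Uniqueness on cells is for finite measures, so it is applied on each rational cell, on whose
    closure [g] is bounded. The pieces of [A] are then summed over a disjoint version of the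
    covering. *)
Let cov_subset A : measurable A -> A `<=` region U -> nu A = kappa A.
Proof.
move=> mA AU; have [q [qU Uq]] := rat_cells oU.
pose Q n := cell (q n).1.1 (q n).1.2 (q n).2.1 (q n).2.2.
have mQ n : measurable (Q n) by exact: measurable_cell.
have step n B : measurable B -> B `<=` Q n -> nu B = kappa B.
  move=> mB BQ.
  have -> : nu B = mrestr nu (mQ n) B by rewrite /mrestr setIidl.
  have -> : kappa B = mrestr kappa (mQ n) B by rewrite /mrestr setIidl.
  apply: measure_cells_unique => //.
    move=> a b c d; suff : nu (cell a b c d `&` Q n) = kappa (cell a b c d `&` Q n) by [].
    rewrite /Q.
    set a' := (q n).1.1; set b' := (q n).1.2; set c' := (q n).2.1; set d' := (q n).2.2.
    have -> : cell a b c d `&` cell a' b' c' d' =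
        cell (Num.max a a') (Num.min b b') (Num.max c c') (Num.min d d').
      apply/seteqP; split => p.
        move=> [/cellP /andP[/andP[h1 h2] /andP[h3 h4]] /cellP /andP[/andP[k1 k2] /andP[k3 k4]]].
        by apply/cellP; rewrite !gt_max !le_min h1 h2 h3 h4 k1 k2 k3 k4.
      move=> /cellP; rewrite !gt_max !le_min.
      move=> /andP[/andP[/andP[h1 h2] /andP[h3 h4]] /andP[/andP[k1 k2] /andP[k3 k4]]].
      by split; apply/cellP; rewrite ?h1 ?h2 ?h3 ?h4 ?k1 ?k2 ?k3 ?k4.
    apply: cell_area => z /andP[]; rewrite !ge_max !le_min.
    move=> /andP[/andP[_ h1] /andP[_ h2]] /andP[/andP[_ h3] /andP[_ h4]].
    by apply: (qU n); rewrite /rcl h1 h2 h3 h4.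
  suff : nu (setT `&` Q n) < +oo by [].
  rewrite setTI /Q cell_area; last exact: qU.
  have [M hM] := @rcl_bounded R g (q n).1.1 (q n).1.2 (q n).2.1 (q n).2.2
    (fun z zr => gc (qU n z zr)).
  have kle : kappa (Q n) <= \int[@area R]_(p in Q n) (M ^+ 2)%:E.
    apply: ge0_le_integral => //.
    - by move=> p _; rewrite lee_fin.
    - by apply/measurable_EFinP; exact: measurable_funTS.
    - move=> p /cellP /andP[/andP[h1 h2] /andP[h3 h4]].
      have pr : rcl (q n).1.1 (q n).1.2 (q n).2.1 (q n).2.2 (toC p).
        by rewrite /rcl /= h2 h4 !ltW.
      rewrite lee_fin jacE; last exact: (qU n).
      have := hM _ pr => hh.
      rewrite lerXn2r// ?nnegrE ?nc_ge0//; exact: le_trans (nc_ge0 _) hh.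
  apply: le_lt_trans kle _; rewrite integral_cst//.
  have [ab|ba] := leP (q n).1.1 (q n).1.2; last first.
    rewrite (_ : Q n = set0) ?measure0 ?mule0 ?ltry//; apply/seteqP; split => // p /cellP.
    by move=> /andP[/andP[h1 h2] _]; have := lt_le_trans h1 (le_trans h2 (ltW ba)); rewrite ltxx.
  have [cd|dc] := leP (q n).2.1 (q n).2.2; last first.
    rewrite (_ : Q n = set0) ?measure0 ?mule0 ?ltry//; apply/seteqP; split => // p /cellP.
    by move=> /andP[_ /andP[h1 h2]]; have := lt_le_trans h1 (le_trans h2 (ltW dc)); rewrite ltxx.
  by rewrite [X in _ * X](area_cell ab cd) -EFinM ltry.
pose D := seqDU Q.
have mD n : measurable (D n).
  by apply: measurableD => //; apply: bigsetU_measurable => k _.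
have AD : A = \bigcup_n (A `&` D n).
  rewrite -setI_bigcupr -seqDU_bigcup_eq; apply/esym/setIidl => p /AU /Uq[n Qp].
  by exists n.
have tAD : trivIset setT (fun n => A `&` D n).
  by apply: trivIset_setIl; exact: trivIset_seqDU.
rewrite AD !measure_bigcup//; try by move=> n _; exact: measurableI.
apply: eq_eseriesr => n _; apply: (step n); first exact: measurableI.
by move=> p [_ [Qp _]].
Qed.

(** Neither measure charges the complement of [U]: [chi] maps [V] into [U], and the density is zero
    outside [U]. *)
Let cov A : measurable A -> nu A = kappa A.
Proof.
move=> mA; have mAU : measurable (A `&` region U) by exact: measurableI.
have mAD : measurable (A `\` region U) by exact: measurableD.
have split (m : {measure set (MR * MR) -> \bar R}) :
    m (A `\` region U) = 0 -> m A = m (A `&` region U).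
  move=> m0; rewrite -[in LHS](setUIDK A (region U)) measureU//.
    by rewrite [X in (_ + X)%E]m0 adde0.
  by apply/seteqP; split => // p [[_ Up] [_ /(_ Up)]].
rewrite (split nu); last first.
  rewrite nuE// (_ : _ `&` _ = set0) ?measure0//; apply/seteqP; split => // p [[_ /=]].
  move=> h Vp; apply: h; rewrite plane_chi// /region /plane /= ofCK.
  exact: chiU.
rewrite (split kappa); first by apply: cov_subset => // p [].
apply: integral0_eq => p [_ nUp]; rewrite /jac patchE memNset//.
Qed.

(** Both sides are the integral of [F] composed with [f], with respect to [nu] on the left and to
    [kappa] on the right. *)
Lemma change_of_variables (F : MR * MR -> \bar R) :
  measurable_fun (region (f @` U) : set (MR * MR)) F ->
  (forall p, region (f @` U) p -> 0 <= F p) ->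
  \int[@area R]_(p in region (f @` U)) F p =
  \int[@area R]_(p in region U) (F (plane f p) * (nc (g (toC p)) ^+ 2)%:E).
Proof.
move=> mF F0; rewrite -/V in mF F0 *.
pose F' := F \_ (region V).
have mF' : measurable_fun setT F' by apply/(measurable_restrictT F mV).
have F'0 p : 0 <= F' p.
  by rewrite /F' patchE; case: ifPn => // /set_mem; exact: F0.
have mf : measurable_fun setT (plane_on U f).
  by apply: measurable_plane_on => // z /hf /cdiff_cont.
pose G p := F' (plane_on U f p).
have mG : measurable_fun setT G by exact: measurableT_comp.
have G0 p : 0 <= G p by exact: F'0.
transitivity (\int[nu]_p G p).
  rewrite ge0_integral_pushforward// preimage_setT integral_density//; last 2 first.
  - exact: measurableT_comp.
  - by move=> p; exact: G0.
  rewrite [LHS]integral_mkcond; apply: eq_integral => p _.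
  rewrite /ind indicE patchE; case: ifPn => [/set_mem Vp|_]; last by rewrite mule0.
  rewrite mule1 /= /G plane_chi// plane_onE; last first.
    by rewrite /region /plane /= ofCK; exact: chiU.
  by rewrite /plane /= ofCK fK// toCK /F' patchE mem_set.
rewrite (eq_measure_integral kappa); last by move=> A mA _; exact: cov.
rewrite integral_density// [RHS]integral_mkcond; apply: eq_integral => p _.
rewrite /jac !patchE; case: ifPn => [/set_mem Up|_]; last by rewrite mule0.
rewrite /G plane_onE// /F' patchE mem_set//.
by rewrite /region /plane /= ofCK; exists (toC p).
Qed.

End change_of_variables.

(** * Smooth functions and test functions *)

Section real_smoothness.
Variable R : realType.
Implicit Types (z w : R[i]) (A B : R[i] -> R) (V : set R[i]).

Lemma rcont_cst c z : rcont (fun=> c) z.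
Proof. by move=> e e0; exists 1 => // w _; rewrite subrr normr0. Qed.

Lemma rcontD A B z : rcont A z -> rcont B z -> rcont (fun w => A w + B w) z.
Proof.
move=> cA cB e e0; have e20 : 0 < e / 2 by rewrite divr_gt0.
have [r r0 hr] := cA _ e20; have [s s0 hs] := cB _ e20.
exists (Num.min r s); first by rewrite lt_min r0.
move=> w; rewrite lt_min => /andP[/hr h1 /hs h2].
rewrite (_ : A w + B w - _ = (A w - A z) + (B w - B z)); last by ring.
by apply: le_lt_trans (ler_normD _ _) _; lra.
Qed.

Lemma rcontM A B z : rcont A z -> rcont B z -> rcont (fun w => A w * B w) z.
Proof.
move=> cA cB e e0; have [r1 r10 hr1] := cA _ ltr01.
pose M := `|A z| + `|B z| + 2.
have M0 : 0 < M by rewrite ltr_wpDl// addr_ge0.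
have e20 : 0 < e / (2 * M) by rewrite divr_gt0// mulr_gt0.
have [r r0 hr] := cA _ e20; have [s s0 hs] := cB _ e20.
exists (Num.min r1 (Num.min r s)); first by rewrite !lt_min r10 r0.
move=> w; rewrite !lt_min => /andP[/hr1 h0 /andP[/hr h1 /hs h2]].
rewrite (_ : A w * B w - _ = A w * (B w - B z) + (A w - A z) * B z); last by ring.
apply: le_lt_trans (ler_normD _ _) _; rewrite !normrM.
have hAw : `|A w| <= `|A z| + 1.
  rewrite -[A w](subrK (A z)) addrC; apply: le_trans (ler_normD _ _) _.
  by rewrite lerD2l ltW.
have b1 : `|A w| * `|B w - B z| <= (`|A z| + 1) * (e / (2 * M)) by apply: ler_pM => //; exact: ltW.
have b2 : `|A w - A z| * `|B z| <= (e / (2 * M)) * `|B z| by apply: ler_pM => //; exact: ltW.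
apply: le_lt_trans (lerD b1 b2) _.
have -> : (`|A z| + 1) * (e / (2 * M)) + e / (2 * M) * `|B z| = e / 2 * ((`|A z| + `|B z| + 1) / M).
  by field; rewrite gt_eqF.
have : (`|A z| + `|B z| + 1) / M < 1 by rewrite ltr_pdivrMr// mul1r ltrD2l ltr1n.
by move: (_ / M) => q q1; have := mulr_gt0 e0 (_ : 0 < 1 - q); rewrite subr_gt0 => /(_ q1); lra.
Qed.

Lemma rcont_comp A (f : R[i] -> R[i]) z : ccont f z -> rcont A (f z) -> rcont (fun w => A (f w)) z.
Proof.
by move=> cf cA e /cA[r r0 hr]; have [s s0 hs] := cf _ r0; exists s => // w /hs /hr.
Qed.

Lemma rcont_near A B z d : 0 < d -> (forall w, nc (w - z) < d -> A w = B w) ->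
  rcont A z -> rcont B z.
Proof.
move=> d0 AB h e /h[d1 d10 h1].
exists (Num.min d d1); first by rewrite lt_min d0.
move=> w; rewrite lt_min => /andP[wd wd1].
by rewrite -!AB ?h1// subrr Normc.normc0.
Qed.

Lemma rcontP A (p : R * R) :
  rcont A (toC p) <-> {for p, continuous (fun q => A (toC q))}.
Proof.
split.
  move=> h; suff hh e : 0 < e -> \forall t \near p, `|A (toC p) - A (toC t)| < e.
    by apply/cvgrPdist_lt => e; exact: hh.
  (* Balls of [R * R] are squares, and the modulus is at most the sum of the two coordinates; hence
     half the radius. *)
  move=> /h[r r0 hr]; have r20 : 0 < r / 2 by rewrite divr_gt0.
  apply/nbhs_ballP; exists (r / 2) => //= q [/=]; rewrite /ball/= => b1 b2.
  rewrite distrC; apply: hr; apply: le_lt_trans (nc_le _) _.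
  by rewrite ReB ImB distrC [X in _ + X]distrC /=; lra.
move=> /cvgrPdist_lt h e /h /nbhs_ballP[r /= r0 hr]; exists r => // w wp.
have := hr (ofC w); rewrite /= ofCK distrC; apply; split; rewrite /ball/=.
  by apply: le_lt_trans wp; rewrite distrC; apply: le_trans (nc_Re _); rewrite ReB.
by apply: le_lt_trans wp; rewrite distrC; apply: le_trans (nc_Im _); rewrite ImB.
Qed.

(* Real differentiability with partial derivatives [a] and [b], in
   Caratheodory's form. *)
Definition rdiff A z (a b : R) := exists a' b' : R[i] -> R,
  [/\ forall w, A w = A z + a' w * Re (w - z) + b' w * Im (w - z),
      rcont a' z, rcont b' z & a' z = a /\ b' z = b].

Lemma rdiff_near A B z a b d : 0 < d -> (forall w, nc (w - z) < d -> A w = B w) ->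
  rdiff A z a b -> rdiff B z a b.
Proof.
move=> d0 AB [a' [b' [hA ca cb [az bz]]]].
have ABz : A z = B z by apply: AB; rewrite subrr Normc.normc0.
(* away from [z] the increment is distributed over the larger coordinate *)
pose out w := ~~ (nc (w - z) < d).
pose x w := if out w then (B w - B z) * Re (w - z) / nc (w - z) ^+ 2 else a' w.
pose y w := if out w then (B w - B z) * Im (w - z) / nc (w - z) ^+ 2 else b' w.
exists x, y; split.
- move=> w; rewrite /x /y; case: ifPn => [ow|].
    have n0 : nc (w - z) ^+ 2 != 0.
      rewrite expf_neq0//; apply: contraNneq ow => ->; exact: d0.
    have := sqr_nc (w - z); move: (nc _ ^+ 2) n0 => N n0 NE.
    by move: NE n0; move: (Re (w - z)) (Im (w - z)) => u v -> n0; field.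
  by rewrite negbK => /AB <-; rewrite hA ABz.
- by apply: (rcont_near d0 _ ca) => w wd; rewrite /x /out wd.
- by apply: (rcont_near d0 _ cb) => w wd; rewrite /y /out wd.
- by rewrite /x /y /out subrr Normc.normc0 d0.
Qed.

Lemma rdiff_cont A z a b : rdiff A z a b -> rcont A z.
Proof.
move=> [a' [b' [hA ca cb _]]].
have : rcont (fun w => A z + a' w * Re (w - z) + b' w * Im (w - z)) z.
  apply: rcontD; first apply: rcontD; first exact: rcont_cst.
    by apply: rcontM => //; apply: rcont_Re; exact: ccont_sub.
  by apply: rcontM => //; apply: rcont_Im; exact: ccont_sub.
by apply: (rcont_near ltr01) => w _; rewrite -hA.
Qed.

Lemma rdiffD A B z a b c d : rdiff A z a b -> rdiff B z c d ->
  rdiff (fun w => A w + B w) z (a + c) (b + d).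
Proof.
move=> [a' [b' [hA ca cb [<- <-]]]] [c' [d' [hB cc cd [<- <-]]]].
exists (fun w => a' w + c' w), (fun w => b' w + d' w); split=> //.
- by move=> w; rewrite [A w]hA [B w]hB; ring.
- exact: rcontD.
- exact: rcontD.
Qed.

Lemma rdiffM A B z a b c d : rdiff A z a b -> rdiff B z c d ->
  rdiff (fun w => A w * B w) z (a * B z + A z * c) (b * B z + A z * d).
Proof.
move=> dA dB; have cB := rdiff_cont dB.
move: dA dB => [a' [b' [hA ca cb [<- <-]]]] [c' [d' [hB cc cd [<- <-]]]].
exists (fun w => a' w * B w + A z * c' w), (fun w => b' w * B w + A z * d' w); split=> //.
- by move=> w; rewrite [A w]hA [B w]hB; ring.
- by apply: rcontD; apply: rcontM => //; exact: rcont_cst.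
- by apply: rcontD; apply: rcontM => //; exact: rcont_cst.
Qed.

Lemma rdiff_Re f z l : cdiff f z l -> rdiff (fun w => Re (f w)) z (Re l) (- Im l).
Proof.
move=> [q [hf cq <-]]; exists (fun w => Re (q w)), (fun w => - 1 * Im (q w)); split.
- by move=> w; rewrite [f w]hf (ReD (f z)) (ReM (q w)); ring.
- exact: rcont_Re.
- by apply: rcontM; [exact: rcont_cst|exact: rcont_Im].
- by rewrite mulN1r.
Qed.

Lemma rdiff_comp A f z l a b : cdiff f z l -> rdiff A (f z) a b ->
  rdiff (fun w => A (f w)) z (a * Re l + b * Im l) (b * Re l - a * Im l).
Proof.
move=> df; have cf := cdiff_cont df; move: df.
move=> [q [hf cq <-]] [a' [b' [hA ca cb [<- <-]]]].
have Rq := rcont_Re cq; have Iq := rcont_Im cq.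
have ca' := rcont_comp cf ca; have cb' := rcont_comp cf cb.
exists (fun w => a' (f w) * Re (q w) + b' (f w) * Im (q w)),
  (fun w => b' (f w) * Re (q w) + a' (f w) * (- 1 * Im (q w))); split.
- move=> w; rewrite hA; have -> : f w - f z = q w * (w - z) by rewrite [f w]hf addrAC subrr add0r.
  by rewrite (ReM (q w)) (ImM (q w)); ring.
- by apply: rcontD; exact: rcontM.
- by apply: rcontD; apply: rcontM => //; apply: rcontM => //; exact: rcont_cst.
- by split=> //; ring.
Qed.

Lemma rdiff_is_derive A (p : R * R) a b : rdiff A (toC p) a b ->
  is_derive p (1, 0) (fun q => A (toC q)) a /\ is_derive p (0, 1) (fun q => A (toC q)) b.
Proof.
move=> [a' [b' [hA ca cb [az bz]]]].
have key (v : R * R) (l : R) (m : R[i] -> R) : m (toC p) = l -> rcont m (toC p) ->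
    (forall h : R, A (toC (h *: v + p)) - A (toC p) = h * m (toC (h *: v + p))) ->
    nc (toC v) <= 1 -> is_derive p v (fun q => A (toC q)) l.
  move=> mz cm hm v1.
  have lim : h^-1 *: (((fun q => A (toC q)) \o shift p) (h *: v) - A (toC p)) @[h --> 0^'] --> l.
    apply/cvgrPdist_lt => e /cm[r r0 hr]; apply/nbhs_ballP; exists r => //= h.
    rewrite /ball/= sub0r normrN => hr' h0.
    rewrite hm /GRing.scale/= mulKf// -mz distrC; apply: hr.
    rewrite (_ : toC _ - toC p = h%:C%C * toC v).
      by rewrite Normc.normcM ncR (le_lt_trans _ hr')// ler_piMr.
    by apply: complex_eq; rewrite ?ReB ?ImB ?ReM ?ImM /= /GRing.scale /=; ring.
  by apply: DeriveDef; [apply/cvg_ex; exists l|exact: cvg_lim lim].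
split.
  apply: (key (1, 0) a a') => // [h|]; last by rewrite /= expr1n expr0n addr0 sqrtr1.
  by rewrite hA ReB ImB /= /GRing.scale /=; ring.
apply: (key (0, 1) b b') => // [h|]; last by rewrite /= expr1n expr0n add0r sqrtr1.
by rewrite hA ReB ImB /= /GRing.scale /=; ring.
Qed.

Lemma rdiff_unique A z a b c d : rdiff A z a b -> rdiff A z c d -> a = c /\ b = d.
Proof.
rewrite -[z]ofCK => /rdiff_is_derive[h1 h2] /rdiff_is_derive[h3 h4].
split; [rewrite -(@derive_val _ _ _ _ _ _ _ h1)|rewrite -(@derive_val _ _ _ _ _ _ _ h2)];
  exact: derive_val.
Qed.

(** The increment is taken along the vertical line through [p], then horizontally. The slopes are
    the two one-variable difference quotients, which the mean value theorem identifies with partial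
    derivatives at nearby points. *)
Lemma C1_rdiff (F : R * R -> R) p : Ck 1 F ->
  rdiff (fun z => F (ofC z)) (toC p) ('D_(1, 0) F p) ('D_(0, 1) F p).
Proof.
move=> [cF [d1 d2 [c1 _] [c2 _]]]; case: p => p1 p2.
pose F1 := 'D_(1, 0) F; pose F2 := 'D_(0, 1) F.
have dx (x y : R) : is_derive x 1 (fun t => F (t, y)) (F1 (x, y)).
  have h := derivableP (d1 (x, y)); apply: is_derive_eps => e e0.
  have /cvgrPdist_le/(_ e e0)/nbhs_ballP[r /= r0 hr] := d1 (x, y).
  exists r => // s sx; have [->|sx0] := eqVneq s x.
    by rewrite !subrr mulr0 subrr normr0 mulr0.
  have sx' : s - x != 0 by rewrite subr_eq0.
  have := hr (s - x); rewrite /ball/= sub0r normrN => /(_ sx sx').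
  rewrite (_ : (s - x) *: (1, 0) + (x, y) = (s, y)); last first.
    by apply: injective_projections; rewrite /= /GRing.scale /=; ring.
  rewrite /GRing.scale/= -/(derive F (x, y) (1, 0)) -/(F1 (x, y)) => hh.
  rewrite -ler_pdivrMr ?normr_gt0// -normfV -normrM; apply: le_trans hh.
  by rewrite le_eqVlt; apply/orP; left; apply/eqP; rewrite distrC; congr (`|_|); field.
have dy (x y : R) : is_derive y 1 (fun t => F (x, t)) (F2 (x, y)).
  have h := derivableP (d2 (x, y)); apply: is_derive_eps => e e0.
  have /cvgrPdist_le/(_ e e0)/nbhs_ballP[r /= r0 hr] := d2 (x, y).
  exists r => // s sx; have [->|sx0] := eqVneq s y.
    by rewrite !subrr mulr0 subrr normr0 mulr0.
  have sx' : s - y != 0 by rewrite subr_eq0.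
  have := hr (s - y); rewrite /ball/= sub0r normrN => /(_ sx sx').
  rewrite (_ : (s - y) *: (0, 1) + (x, y) = (x, s)); last first.
    by apply: injective_projections; rewrite /= /GRing.scale /=; ring.
  rewrite /GRing.scale/= -/(derive F (x, y) (0, 1)) -/(F2 (x, y)) => hh.
  rewrite -ler_pdivrMr ?normr_gt0// -normfV -normrM; apply: le_trans hh.
  by rewrite le_eqVlt; apply/orP; left; apply/eqP; rewrite distrC; congr (`|_|); field.
have mvt (G G' : R -> R) (s t : R) : (forall x : R, is_derive x 1 G (G' x)) ->
    exists2 x : R, `|x - s| <= `|t - s| & G t - G s = G' x * (t - s).
  move=> dG; have cG x : {for x, continuous G}.
    by apply: differentiable_continuous; apply/derivable1_diffP; apply: ex_derive.
  have [st|ts|->] := ltgtP s t.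
  - have [x|x xst e] := @MVT _ G G' s t st (fun x _ => dG x).
      by apply: continuous_in_subspaceT => y _; exact: cG.
    exists x => //; move: xst; rewrite in_itv/= => /andP[h1 h2].
    by rewrite !gtr0_norm ?subr_gt0// lerD2r ltW.
  - have [x|x xst e] := @MVT _ G G' t s ts (fun x _ => dG x).
      by apply: continuous_in_subspaceT => y _; exact: cG.
    exists x; last by rewrite -opprB e; ring.
    move: xst; rewrite in_itv/= => /andP[h1 h2].
    by rewrite !ltr0_norm ?subr_lt0// lerN2 lerD2r ltW.
  - by exists t; rewrite ?subrr ?mulr0.
have cF1 : rcont (fun z => F1 (ofC z)) (toC (p1, p2)).
  by apply/rcontP; under [X in {for _, continuous X}]eq_fun do rewrite toCK; exact: c1.
have cF2 : rcont (fun z => F2 (ofC z)) (toC (p1, p2)).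
  by apply/rcontP; under [X in {for _, continuous X}]eq_fun do rewrite toCK; exact: c2.
pose a w := if Re w == p1 then F1 (p1, p2) else
  (F (Re w, Im w) - F (p1, Im w)) / (Re w - p1).
pose b w := if Im w == p2 then F2 (p1, p2) else
  (F (p1, Im w) - F (p1, p2)) / (Im w - p2).
exists a, b; split; last by rewrite /a /b /= !eqxx.
- move=> w; rewrite /a /b ReB ImB /ofC /=.
  have [->|n1] := eqVneq (Re w) p1; have [->|n2] := eqVneq (Im w) p2;
    rewrite ?subrr ?mulr0 ?addr0// ?divfK ?subr_eq0//; ring.
- move=> e e0; have [r r0 hr] := cF1 _ e0; exists r => // w wp; rewrite /a /= eqxx.
  case: ifPn => [_|n1]; first by rewrite subrr normr0.
  have [x xd ->] := mvt (fun t => F (t, Im w)) (fun x => F1 (x, Im w)) p1 (Re w) (dx^~ _).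
  rewrite mulfK ?subr_eq0//; apply: (hr (Complex x (Im w))).
  apply: le_lt_trans wp; rewrite -(@ler_pXn2r _ 2) ?nnegrE ?nc_ge0// !sqr_nc !ReB !ImB /=.
  by rewrite lerD2r -[_ ^+ 2]real_normK ?num_real// -[leRHS]real_normK ?num_real// lerXn2r ?nnegrE.
- move=> e e0; have [r r0 hr] := cF2 _ e0; exists r => // w wp; rewrite /b /= eqxx.
  case: ifPn => [_|n1]; first by rewrite subrr normr0.
  have [x xd ->] := mvt (fun t => F (p1, t)) (fun x => F2 (p1, x)) p2 (Im w) (dy _).
  rewrite mulfK ?subr_eq0//; apply: (hr (Complex p1 x)).
  apply: le_lt_trans wp; rewrite -(@ler_pXn2r _ 2) ?nnegrE ?nc_ge0// !sqr_nc !ReB !ImB /=.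
  rewrite subrr expr0n add0r ler_wpDl ?sqr_ge0//.
  by rewrite -[_ ^+ 2]real_normK ?num_real// -[leRHS]real_normK ?num_real// lerXn2r ?nnegrE.
Qed.

End real_smoothness.

(** * Smoothness on open sets and extension by zero *)

Section smooth.
Variable R : realType.
Implicit Types (z w : R[i]) (A B : R[i] -> R) (V : set R[i]).

(** A version of [Ck] local to [V], with the partial derivatives given existentially: a test
    function composed with [chi] is controlled on [V] only, before its extension by zero. *)
Fixpoint smo k V A : Prop := (forall z, V z -> rcont A z) /\
  if k is k'.+1 then exists A1 A2, [/\ forall z, V z -> rdiff A z (A1 z) (A2 z),
    smo k' V A1 & smo k' V A2] else True.

Lemma smo_rcont k V A : smo k V A -> forall z, V z -> rcont A z.
Proof. by case: k => [|k] []. Qed.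

Lemma smoW k V A : smo k.+1 V A -> smo k V A.
Proof.
elim: k A => [|k ih] A; first by case.
by move=> [cA [A1 [A2 [dA /ih s1 /ih s2]]]]; split=> //; exists A1, A2.
Qed.

Lemma smo_cst k V c : smo k V (fun=> c).
Proof.
elim: k c => [|k ih] c; (split; first by move=> ? _; exact: rcont_cst) => //.
exists (fun=> 0), (fun=> 0); split=> // z _; exists (fun=> 0), (fun=> 0).
by split=> //; [move=> w; ring|exact: rcont_cst|exact: rcont_cst].
Qed.

Lemma smoD k V A B : smo k V A -> smo k V B -> smo k V (fun w => A w + B w).
Proof.
elim: k A B => [|k ih] A B [cA hA] [cB hB].
  by split=> // z Vz; apply: rcontD; [exact: cA|exact: cB].
split; first by move=> z Vz; apply: rcontD; [exact: cA|exact: cB].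
move: hA hB => [A1 [A2 [dA s1 s2]]] [B1 [B2 [dB t1 t2]]].
exists (fun w => A1 w + B1 w), (fun w => A2 w + B2 w); split; [|exact: ih|exact: ih].
by move=> z Vz; apply: rdiffD; [exact: dA|exact: dB].
Qed.

Lemma smoM k V A B : smo k V A -> smo k V B -> smo k V (fun w => A w * B w).
Proof.
elim: k A B => [|k ih] A B hA hB; have cA := smo_rcont hA; have cB := smo_rcont hB.
  by split=> // z Vz; apply: rcontM; [exact: cA|exact: cB].
split; first by move=> z Vz; apply: rcontM; [exact: cA|exact: cB].
have [hA' hB'] := (smoW hA, smoW hB).
move: hA hB => [_ [A1 [A2 [dA s1 s2]]]] [_ [B1 [B2 [dB t1 t2]]]].
exists (fun w => A1 w * B w + A w * B1 w), (fun w => A2 w * B w + A w * B2 w).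
by split; [|apply: smoD; exact: ih|apply: smoD; exact: ih] => z Vz;
  apply: rdiffM; [exact: dA|exact: dB].
Qed.

(** By the Cauchy-Riemann equations the partial derivatives of [Re f] are [Re g] and [Re (i g)],
    again real parts of holomorphic functions, so the induction closes. *)
Lemma smo_Re k V f g : copen V -> hol V f g -> smo k V (fun w => Re (f w)).
Proof.
move=> oV; elim: k f g => [|k ih] f g hf;
  (split; first by move=> z /hf /cdiff_cont /rcont_Re) => //.
have [g' hg] := hol_deriv oV hf.
exists (fun w => Re (g w)), (fun w => Re ('i * g w)); split; [|exact: ih hg|].
  move=> z /hf /rdiff_Re; rewrite (_ : Re ('i * g z) = - Im (g z))//.
  by rewrite ReM /=; ring.
by apply: (ih _ (fun w => 0 * g w + 'i * g' w)) => z /hg; apply: cdiffM; exact: cdiff_cst.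
Qed.

Lemma smo_Im k V f g : copen V -> hol V f g -> smo k V (fun w => Im (f w)).
Proof.
move=> oV hf; have : smo k V (fun w => Re (- 'i * f w)).
  apply: (@smo_Re _ _ _ (fun w => 0 * f w + - 'i * g w)) => // z /hf.
  by apply: cdiffM; exact: cdiff_cst.
rewrite (_ : (fun w => Re _) = (fun w => Im (f w)))//.
by apply/funext => w; rewrite ReM /=; ring.
Qed.

Lemma smo_comp k V W A f g : copen V -> hol V f g -> (forall z, V z -> W (f z)) ->
  smo k W A -> smo k V (fun w => A (f w)).
Proof.
move=> oV hf fV; elim: k A => [|k ih] A hA;
  (split; first by move=> z Vz; apply: rcont_comp; [exact: cdiff_cont (hf _ Vz)|
    apply: smo_rcont hA _ _; exact: fV]) => //.
move: hA => [_ [A1 [A2 [dA s1 s2]]]]; have [g' hg] := hol_deriv oV hf.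
have sR := smo_Re k oV hg; have sI := smo_Im k oV hg.
exists (fun w => A1 (f w) * Re (g w) + A2 (f w) * Im (g w)),
  (fun w => A2 (f w) * Re (g w) + A1 (f w) * (- 1 * Im (g w))); split.
- move=> z Vz; have := rdiff_comp (hf _ Vz) (dA _ (fV _ Vz)).
  by rewrite mulN1r mulrN.
- by apply: smoD; apply: smoM => //; exact: ih.
- apply: smoD; apply: smoM; [exact: ih|exact: sR|exact: ih|].
  by apply: smoM => //; exact: smo_cst.
Qed.

Lemma Ck_cont k (F : R * R -> R) : Ck k F -> continuous F.
Proof. by case: k => [|k] []. Qed.

Lemma Ck_C1 k (F : R * R -> R) : Ck k.+1 F -> Ck 1 F.
Proof.
move=> [cF [d1 d2 /Ck_cont c1 /Ck_cont c2]].
exact: (conj cF (And4 d1 d2 (conj c1 I) (conj c2 I))).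
Qed.

Lemma Ck_smo k V (F : R * R -> R) : Ck k F -> smo k V (fun z => F (ofC z)).
Proof.
elim: k F => [|k ih] F hF; have cF := Ck_cont hF.
  split=> // z _; rewrite -[z]ofCK; apply/rcontP.
  by under [X in {for _, continuous X}]eq_fun do rewrite toCK; exact: cF.
split.
  move=> z _; rewrite -[z]ofCK; apply/rcontP.
  by under [X in {for _, continuous X}]eq_fun do rewrite toCK; exact: cF.
have C1 := Ck_C1 hF; move: hF => [_ [_ _ c1 c2]].
exists (fun z => 'D_(1, 0) F (ofC z)), (fun z => 'D_(0, 1) F (ofC z)).
split; [|exact: (ih _ c1)|exact: (ih _ c2)] => z _.
have := @C1_rdiff _ F (ofC z); rewrite ofCK; exact.
Qed.

Lemma smo_Ck k A : smo k setT A -> Ck k (fun p => A (toC p)).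
Proof.
elim: k A => [|k ih] A; first by move=> [cA _]; split=> // p; apply/rcontP; exact: cA.
move=> [cA [A1 [A2 [dA s1 s2]]]]; split; first by move=> p; apply/rcontP; exact: cA.
have d p := rdiff_is_derive (dA (toC p) I).
have e1 : 'D_(1, 0) (fun p => A (toC p)) = (fun p => A1 (toC p)).
  by apply/funext => p; have [h _] := d p; exact: (@derive_val _ _ _ _ _ _ _ h).
have e2 : 'D_(0, 1) (fun p => A (toC p)) = (fun p => A2 (toC p)).
  by apply/funext => p; have [_ h] := d p; exact: (@derive_val _ _ _ _ _ _ _ h).
split; [by move=> p; have [h _] := d p; exact: ex_derive|
  by move=> p; have [_ h] := d p; exact: ex_derive| |].
  by rewrite e1; exact: ih.
by rewrite e2; exact: ih.
Qed.

Definition ext V A z := if pselect (V z) then A z else 0.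

Lemma extE V A z : V z -> ext V A z = A z.
Proof. by rewrite /ext; case: pselect. Qed.

Lemma extN V A z : ~ V z -> ext V A z = 0.
Proof. by rewrite /ext; case: pselect. Qed.

Section extension.
Variables (V K : set R[i]).
Hypotheses (oV : copen V) (oK : copen (~` K)) (KV : K `<=` V).

Lemma ext_near A z : (forall w, V w -> ~ K w -> A w = 0) ->
  V z \/ ~ V z /\ exists2 r, 0 < r & forall w, nc (w - z) < r -> ext V A w = 0.
Proof.
move=> A0; have [Vz|nVz] := pselect (V z); [by left|right; split=> //].
have nK : (~` K) z by move=> /KV.
have [r r0 hr] := oK nK; exists r => // w /hr nKw; rewrite /ext.
by case: pselect => // Vw; exact: A0.
Qed.

(** A point outside [V] lies in the open complement of [K], where the extension vanishes
    identically. The partial derivatives also vanish on [V] off [K], so the induction applies to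
    them. *)
Lemma smo_ext k A : (forall w, V w -> ~ K w -> A w = 0) -> smo k V A -> smo k setT (ext V A).
Proof.
have cst0 z : rdiff (fun=> 0) z 0 0.
  exists (fun=> 0), (fun=> 0); split=> //; first by move=> w; ring.
    exact: rcont_cst.
  exact: rcont_cst.
elim: k A => [|k ih] A A0 sA; have cA := smo_rcont sA.
  split=> // z _; have [Vz|[nVz [r r0 hr]]] := ext_near z A0.
    have [r r0 hr] := oV Vz; apply: (rcont_near r0 _ (cA _ Vz)) => w /hr Vw.
    by rewrite extE.
  by apply: (rcont_near r0 _ (rcont_cst 0 z)) => w /hr.
split.
  move=> z _; have [Vz|[nVz [r r0 hr]]] := ext_near z A0.
    have [r r0 hr] := oV Vz; apply: (rcont_near r0 _ (cA _ Vz)) => w /hr Vw.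
    by rewrite extE.
  by apply: (rcont_near r0 _ (rcont_cst 0 z)) => w /hr.
move: sA => [_ [A1 [A2 [dA s1 s2]]]].
have z12 w : V w -> ~ K w -> A1 w = 0 /\ A2 w = 0.
  move=> Vw nKw; have [r r0 hr] := oV Vw; have [s s0 hs] := oK nKw.
  have d0 : 0 < Num.min r s by rewrite lt_min r0.
  apply: (rdiff_unique (dA _ Vw)); apply: (rdiff_near d0 _ (cst0 w)) => v.
  by rewrite lt_min => /andP[/hr Vv /hs nKv]; rewrite A0.
exists (ext V A1), (ext V A2); split; first last.
- by apply: ih => // w Vw /(z12 _ Vw)[].
- by apply: ih => // w Vw /(z12 _ Vw)[].
move=> z _; have [Vz|[nVz [r r0 hr]]] := ext_near z A0.
  have [r r0 hr] := oV Vz; rewrite !extE//.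
  by apply: (rdiff_near r0 _ (dA _ Vz)) => w /hr Vw; rewrite extE.
rewrite !extN//; by apply: (rdiff_near r0 _ (cst0 z)) => w /hr.
Qed.

End extension.

Lemma compact_copenC (K : set (R * R)) : compact K -> copen (~` (fun z => K (ofC z))).
Proof.
move=> cK; have : open (~` K).
  by rewrite openC; apply: compact_closed => //; exact: norm_hausdorff.
rewrite openE => oK z /oK /nbhs_ballP[r /= r0 hr]; exists r => // w wz.
by apply: (hr (ofC w)); split; rewrite /ball/= distrC; apply: le_lt_trans wz;
  [apply: le_trans (nc_Re _); rewrite ReB|apply: le_trans (nc_Im _); rewrite ImB].
Qed.

Lemma test_ext V A (K : set (R * R)) : copen V -> (forall k, smo k V A) ->
  compact K -> K `<=` region V -> (forall p, region V p -> ~ K p -> A (toC p) = 0) ->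
  test_function (region V) (fun p => ext V A (toC p)).
Proof.
move=> oV sA cK KV A0; split.
  move=> k; apply: smo_Ck; apply: (smo_ext oV (compact_copenC cK)) => // z.
    by move=> /KV; rewrite /region/= ofCK.
  by rewrite -{1 3}[z]ofCK; exact: A0.
exists K; split=> // p nK; have [Vp|nVp] := pselect (V (toC p)).
  by rewrite extE// A0.
by rewrite extN.
Qed.

Lemma ext_derive V A p a b : copen V -> region V p -> rdiff A (toC p) a b ->
  'D_(1, 0) (fun p => ext V A (toC p)) p = a /\ 'D_(0, 1) (fun p => ext V A (toC p)) p = b.
Proof.
move=> oV Vp dA; have [r r0 hr] := oV _ Vp.
have /rdiff_is_derive[h1 h2] : rdiff (ext V A) (toC p) a b.
  by apply: (rdiff_near r0 _ dA) => w /hr Vw; rewrite extE.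
split; [exact: (@derive_val _ _ _ _ _ _ _ h1)|exact: (@derive_val _ _ _ _ _ _ _ h2)].
Qed.

End smooth.

Lemma integral_subset_indic (R : realType)
    (K W : set (measurableTypeR R * measurableTypeR R))
    (F : measurableTypeR R * measurableTypeR R -> \bar R) : K `<=` W ->
  (\int[@area R]_(p in K) F p = \int[@area R]_(p in W) (F p * (\1_K p)%:E))%E.
Proof.
move=> KW; rewrite [LHS]integral_mkcond [RHS]integral_mkcond; apply: eq_integral => p _.
rewrite !patchE indicE; case: (pselect (K p)) => Kp.
  by rewrite !mem_set ?mule1//; exact: KW.
by rewrite (memNset Kp) mule0; case: ifP.
Qed.

(** * Local integrability and pairing with test functions *)

Section local_integrability.
Variable R : realType.
Local Notation MR := (measurableTypeR R).
Implicit Types (W : set R[i]) (K : set (R * R)) (u : R * R -> R).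

Lemma compact_measurable K : compact K -> measurable (K : set (MR * MR)).
Proof.
move=> /compact_copenC /measurable_region; rewrite (_ : region _ = ~` K).
  by rewrite -{2}(setCK K); exact: measurableC.
by apply/seteqP; split=> p; rewrite /region /setC /= toCK.
Qed.

Lemma rcont_compact_bounded W (m : R[i] -> R) K : (forall z, W z -> rcont m z) ->
  K `<=` region W -> compact K -> exists2 M, 0 < M & forall p, K p -> `|m (toC p)| <= M.
Proof.
move=> cm KW cK; have : compact ((fun p => m (toC p)) @` K).
  apply: continuous_compact => //; apply: continuous_in_subspaceT => p /set_mem /KW Wp.
  by apply/rcontP; exact: cm.
move=> /compact_bounded [M [_ hM]]; exists (`|M| + 1); first by rewrite ltr_wpDl.
move=> p Kp; apply: (hM (`|M| + 1)); last by exists p.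
by rewrite (le_lt_trans (ler_norm M))// ltrDl.
Qed.

Lemma locally_integrable2D W u v : copen W -> locally_integrable2 (region W) u ->
  locally_integrable2 (region W) v -> locally_integrable2 (region W) (fun p => u p + v p).
Proof.
move=> oW [mu fu] [mv fv]; have mW := measurable_region oW.
split; first exact: measurable_funD.
move=> K KW cK; have mK := compact_measurable cK.
have mu' : measurable_fun K (u : MR * MR -> R) by apply: measurable_funS mu.
have mv' : measurable_fun K (v : MR * MR -> R) by apply: measurable_funS mv.
apply: (@le_lt_trans _ _ (\int[@area R]_(p in K) (`|u p|%:E + `|v p|%:E))%E).
  apply: ge0_le_integral => //.
  - by apply/measurable_EFinP; apply: measurableT_comp => //; exact: measurable_funD.
  - by apply: emeasurable_funD; apply/measurable_EFinP; exact: measurableT_comp.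
  - by move=> p _; rewrite -EFinD lee_fin ler_normD.
rewrite ge0_integralD//; last 2 first.
- by apply/measurable_EFinP; exact: measurableT_comp.
- by apply/measurable_EFinP; exact: measurableT_comp.
by rewrite lte_add_pinfty//; [exact: fu|exact: fv].
Qed.

Lemma locally_integrable2M W (m : R[i] -> R) u : copen W -> (forall z, W z -> rcont m z) ->
  locally_integrable2 (region W) u ->
  locally_integrable2 (region W) (fun p => u p * m (toC p)).
Proof.
move=> oW cm [mu fu]; have mW := measurable_region oW; have mm := rcont_measurable oW cm.
split; first exact: measurable_funM.
move=> K KW cK; have mK := compact_measurable cK.
have [M M0 hM] := rcont_compact_bounded cm KW cK.
have mu' : measurable_fun K (u : MR * MR -> R) by apply: measurable_funS mu.
have mm' : measurable_fun K (fun p : MR * MR => m (toC p)) by apply: measurable_funS mm.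
apply: (@le_lt_trans _ _ (\int[@area R]_(p in K) (M%:E * `|u p|%:E))%E).
  apply: ge0_le_integral => //.
  - by apply/measurable_EFinP; apply: measurableT_comp => //; exact: measurable_funM.
  - by apply/measurable_EFinP; apply: measurable_funM => //; exact: measurableT_comp.
  - by move=> p Kp; rewrite -EFinM lee_fin normrM mulrC ler_wpM2r// hM.
rewrite ge0_integralZl//; last 2 first.
- by apply/measurable_EFinP; exact: measurableT_comp.
- by rewrite lee_fin ltW.
by rewrite lte_mul_pinfty ?lee_fin ?ltW//; exact: fu.
Qed.

Lemma integrable_test W u (m : R * R -> R) K : copen W ->
  locally_integrable2 (region W) u -> continuous m -> compact K -> K `<=` region W ->
  (forall p, ~ K p -> m p = 0) ->
  (@area R).-integrable (region W) (fun p => (u p * m p)%:E).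
Proof.
move=> oW lu cm cK KW m0; have mW := measurable_region oW; have mK := compact_measurable cK.
have cm' z : W z -> rcont (fun z => m (ofC z)) z.
  move=> _; rewrite -[z]ofCK; apply/rcontP.
  by under [X in {for _, continuous X}]eq_fun do rewrite toCK; exact: cm.
have := locally_integrable2M oW cm' lu.
rewrite [X in locally_integrable2 _ X](_ : _ = fun p => u p * m p); last first.
  by apply/funext => p; rewrite toCK.
move=> [mum /(_ K KW cK) fum]; apply/integrableP; split; first exact/measurable_EFinP.
rewrite (integral_subset_indic _ KW) in fum.
suff -> : (\int[@area R]_(p in region W) `|(u p * m p)%:E|)%E =
  (\int[@area R]_(p in region W) (`|u p * m p|%:E * (\1_K p)%:E))%E by [].
apply: eq_integral => p _; rewrite indicE; case: (pselect (K p)) => Kp.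
  by rewrite mem_set// mule1.
by rewrite m0// mulr0 abse0 normr0 mul0e.
Qed.

Lemma derive_out K eta : compact K -> Ck 1 eta -> (forall p, ~ K p -> eta p = 0) ->
  forall p, ~ K p -> 'D_(1, 0) eta p = 0 /\ 'D_(0, 1) eta p = 0.
Proof.
move=> cK c1 eta0 p nKp.
have [|r r0 hr] := compact_copenC cK (z := toC p); first by rewrite /setC /= toCK.
apply: (rdiff_unique (C1_rdiff p c1)).
have : rdiff (fun=> 0) (toC p) 0 0.
  exists (fun=> 0), (fun=> 0); split=> //; first by move=> w; ring.
    exact: rcont_cst.
  exact: rcont_cst.
by apply: (rdiff_near r0) => w /hr /eta0 ->.
Qed.

Lemma test_derive W eta : test_function (region W) eta ->
  test_function (region W) ('D_(1, 0) eta) /\ test_function (region W) ('D_(0, 1) eta).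
Proof.
move=> [sm [K [cK KW eta0]]]; have out := derive_out cK (sm 1) eta0.
split; split; try (by move=> k; have [_ []] := sm k.+1);
  by exists K; split=> // p /out [].
Qed.

Lemma test_integrable W u eta : copen W -> locally_integrable2 (region W) u ->
  test_function (region W) eta ->
  (@area R).-integrable (region W) (EFin \o (fun p => u p * eta p)).
Proof.
move=> oW lu [sm [K [cK KW eta0]]]; apply: (integrable_test oW lu _ cK KW eta0).
exact: (Ck_cont (sm 0%N)).
Qed.

End local_integrability.

Lemma rdiff_Im (R : realType) (f : R[i] -> R[i]) z l : cdiff f z l ->
  rdiff (fun w => Im (f w)) z (Im l) (Re l).
Proof.
move=> /(cdiffM (cdiff_cst (- 'i) z)) /rdiff_Re; rewrite mul0r add0r.
rewrite (_ : Re _ = Im l) 1?(_ : - Im _ = Re l); [|by rewrite ?ReM ?ImM /=; ring..].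
by apply: (rdiff_near ltr01) => w _; rewrite ReM /=; ring.
Qed.

(** * Transfer of weak gradients by univalent maps *)

Section transfer.
Variable R : realType.
Local Notation MR := (measurableTypeR R).
Variables (U : set R[i]) (f g chi : R[i] -> R[i]).
Hypotheses (oU : copen U) (hf : hol U f g).
Hypothesis chiK : forall z, U z -> chi (f z) = z.

Let V := f @` U.
Let oV : copen V. Proof. exact: univalent_copen oU hf chiK. Qed.
Let k w := (g (chi w))^-1.
Let hchi : hol V chi k. Proof. exact: univalent_inv oU hf chiK. Qed.
Let gc z : U z -> ccont g z.
Proof. by move=> Uz; have [h hh] := hol_deriv oU hf; exact: cdiff_cont (hh z Uz). Qed.
Let kc z : V z -> ccont k z.
Proof. by move=> Uz; have [h hh] := hol_deriv oV hchi; exact: cdiff_cont (hh z Uz). Qed.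
Let chiU v : V v -> U (chi v).
Proof. by move=> [z Uz <-]; rewrite chiK. Qed.
Let mU : measurable (region U : set (MR * MR)) := measurable_region oU.
Let mV : measurable (region V : set (MR * MR)) := measurable_region oV.
Let planeV p : region U p -> region V (plane f p).
Proof. by move=> Up; rewrite /region /plane /= ofCK; exists (toC p). Qed.
Let g_neq0 z : U z -> g z != 0.
Proof. exact: univalent_deriv_neq0 oU hf chiK z. Qed.
Let kf p : region U p -> k (toC (plane f p)) = (g (toC p))^-1.
Proof. by move=> Up; rewrite /plane ofCK /k chiK. Qed.

Lemma measurable_comp_plane d (T : measurableType d) (F : MR * MR -> T) :
  measurable_fun (region V) F ->
  measurable_fun (region U) (fun p : MR * MR => F (plane f p)).
Proof.
move=> mF; apply: (@eq_measurable_fun _ _ _ _ _ (F \o plane_on U f)).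
  by move=> p /set_mem Up /=; rewrite plane_onE.
apply: (measurable_comp mV) => //.
  by move=> _ [p Up <-]; rewrite plane_onE//; exact: planeV.
apply: (@measurable_funS _ _ _ _ setT) => //; apply: measurable_plane_on => // z /hf.
exact: cdiff_cont.
Qed.

(** Positive and negative parts are transformed separately and the Jacobian, being nonnegative,
    commutes with both; the identity thus covers every measurable [F]. *)
Lemma change_of_variables_signed (F : MR * MR -> \bar R) : measurable_fun (region V) F ->
  (\int[@area R]_(p in region V) F p)%E =
  (\int[@area R]_(p in region U) (F (plane f p) * (nc (g (toC p)) ^+ 2)%:E))%E.
Proof.
move=> mF; rewrite [LHS]integralE [RHS]integralE.
rewrite (change_of_variables oU hf chiK (measurable_funepos mF)) => [|p _]; last exact: funepos_ge0.
rewrite (change_of_variables oU hf chiK (measurable_funeneg mF)) => [|p _]; last exact: funeneg_ge0.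
rewrite (_ : (fun p => F (plane f p) * _)%E ^\+%E = (fun p => F^\+ (plane f p) * (nc (g (toC p)) ^+ 2)%:E)%E).
  rewrite (_ : (fun p => F (plane f p) * _)%E ^\-%E = (fun p => F^\- (plane f p) * (nc (g (toC p)) ^+ 2)%:E)%E)//.
  apply/funext => p; rewrite !funenegE ![(_ * (_ ^+ 2)%:E)%E]muleC -muleN maxe_pMr ?mule0//.
  by rewrite lee_fin sqr_ge0.
by apply/funext => p; rewrite !funeposE ![(_ * (_ ^+ 2)%:E)%E]muleC maxe_pMr ?mule0// lee_fin sqr_ge0.
Qed.

Lemma compact_plane K : K `<=` region U -> compact K -> compact (plane f @` K).
Proof.
move=> KU cK; apply: continuous_compact => //; apply: continuous_in_subspaceT => p /set_mem /KU Up.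
have cf := cdiff_cont (hf Up).
have /rcontP c1 := rcont_Re cf; have /rcontP c2 := rcont_Im cf.
exact: cvg_pair c1 c2.
Qed.

(** On a compact [K] the integral of [|u o f|] equals that of [|u| |k|^2] over the compact image of
    [K], where the continuous factor [|k|^2] is bounded. *)
Lemma locally_integrable2_comp u : locally_integrable2 (region V) u ->
  locally_integrable2 (region U) (fun p => u (plane f p)).
Proof.
move=> lu; split; first by apply: measurable_comp_plane; case: lu.
move=> K KU cK; pose L := plane f @` K.
have cL : compact L by exact: compact_plane.
have LV : L `<=` region V by move=> _ [p /KU Up <-]; exact: planeV.
have [muk /(_ L LV cL)] : locally_integrable2 (region V) (fun p => u p * (nc (k (toC p)) * nc (k (toC p)))).
  have ck z : V z -> rcont (fun z => nc (k z) * nc (k z)) z.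
    by move=> Vz; apply: rcontM; apply: rcont_nc; exact: kc.
  exact: locally_integrable2M oV ck lu.
rewrite (integral_subset_indic _ LV).
rewrite change_of_variables_signed; last first.
  apply: emeasurable_funM; first by apply/measurable_EFinP; exact: measurableT_comp.
  by apply/measurable_EFinP; apply: measurable_indic; exact: compact_measurable.
rewrite (integral_subset_indic _ KU).
suff -> : (\int[@area R]_(p in region U) (`|u (plane f p) * (nc (k (toC (plane f p))) * nc (k (toC (plane f p))))|%:E *
     (\1_L (plane f p))%:E * (nc (g (toC p)) ^+ 2)%:E))%E =
  (\int[@area R]_(p in region U) (`|u (plane f p)|%:E * (\1_K p)%:E))%E by [].
apply: eq_integral => p /set_mem Up; rewrite kf// Normc.normcV -expr2.
have n0 : nc (g (toC p)) != 0 by rewrite gt_eqF// nc_gt0 g_neq0.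
rewrite normrM (ger0_norm (sqr_ge0 _)) exprVn muleAC -EFinM divfK ?sqrf_eq0//.
suff -> : \1_L (plane f p) = \1_K p :> R by [].
rewrite !indicE; have -> // : (plane f p \in L) = (p \in K).
apply/idP/idP => /set_mem h; apply/mem_set; last by exists p.
move: h => [q Kq]; rewrite /plane => /(congr1 (@toC R)); rewrite !ofCK => /(congr1 chi).
by rewrite !chiK//; [move=> /(congr1 (@ofC R)); rewrite !toCK => <-|exact: KU].
Qed.

Lemma Rchange_of_variables (F : MR * MR -> R) : measurable_fun (region V) F ->
  \int[@area R]_(p in region V) F p =
  \int[@area R]_(p in region U) (F (plane f p) * nc (g (toC p)) ^+ 2).
Proof.
by move=> /measurable_EFinP mF; rewrite /Rintegral change_of_variables_signed.
Qed.

(* The weak gradient of [u] is tested against the real and imaginary parts of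
   [z1 + i z2 = k (eta \o chi)]: by the Cauchy-Riemann equations,
   [D_1 z1 - D_2 z2] and [D_1 z2 + D_2 z1] are [|k|^2] times the partial
   derivatives of [eta] at [chi]. *)
Lemma weak_gradient_comp u u1 u2 : weak_gradient (region V) u u1 u2 ->
  weak_gradient (region U) (fun p => u (plane f p))
    (fun p => u1 (plane f p) * Re (g (toC p)) + u2 (plane f p) * Im (g (toC p)))
    (fun p => u2 (plane f p) * Re (g (toC p)) + u1 (plane f p) * Re ('i * g (toC p))).
Proof.
move=> [lu lu1 lu2 hu].
have cR z : U z -> rcont (fun z => Re (g z)) z by move=> Uz; apply: rcont_Re; exact: gc.
have cI z : U z -> rcont (fun z => Im (g z)) z by move=> Uz; apply: rcont_Im; exact: gc.
have ciR z : U z -> rcont (fun z => Re ('i * g z)) z.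
  by move=> Uz; apply: rcont_Re; apply: ccontM; [exact: ccont_cst|exact: gc].
have lc1 := locally_integrable2_comp lu1; have lc2 := locally_integrable2_comp lu2.
split; first exact: locally_integrable2_comp.
- apply: locally_integrable2D => //.
    exact: (locally_integrable2M oU cR lc1).
  exact: (locally_integrable2M oU cI lc2).
- apply: locally_integrable2D => //.
    exact: (locally_integrable2M oU cR lc2).
  exact: (locally_integrable2M oU ciR lc1).
move=> eta [smooth_eta [K [cK KU eta0]]]; pose L := plane f @` K.
have cL : compact L by exact: compact_plane.
have LV : L `<=` region V by move=> _ [p /KU Up <-]; exact: planeV.
pose E w := eta (ofC (chi w)).
have sE j : smo j V E.
  exact: (smo_comp oV hchi (W := U) chiU (Ck_smo U (smooth_eta j))).
have [k' hk] := hol_deriv oV hchi.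
pose z1 w := Re (k w) * E w; pose z2 w := Im (k w) * E w.
have s1 j : smo j V z1 by apply: smoM => //; exact: smo_Re hk.
have s2 j : smo j V z2 by apply: smoM => //; exact: smo_Im hk.
have E0 p : region V p -> ~ L p -> E (toC p) = 0.
  move=> Vp nL; apply: eta0; apply: contra_not nL => Kp; exists (ofC (chi (toC p))) => //.
  rewrite /plane ofCK; move: Vp => [z Uz zp]; rewrite -[in chi _]zp chiK//.
  by rewrite zp toCK.
(* The functions [z1] and [z2] vanish off the compact image [L] of [K], so their extensions by zero
   are admissible test functions. *)
have t1 : test_function (region V) (fun p => ext V z1 (toC p)).
  by apply: (test_ext oV s1 cL LV) => p Vp nL; rewrite /z1 E0// mulr0.
have t2 : test_function (region V) (fun p => ext V z2 (toC p)).
  by apply: (test_ext oV s2 cL LV) => p Vp nL; rewrite /z2 E0// mulr0.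
set Z1 := (fun p => ext V z1 (toC p)) in t1; set Z2 := (fun p => ext V z2 (toC p)) in t2.
have Z1E p : region U p -> Z1 (plane f p) = Re (g (toC p))^-1 * eta p.
  move=> Up; rewrite /Z1 extE; last exact: planeV.
  by rewrite /z1 kf// /E {1}/plane ofCK chiK// toCK.
have Z2E p : region U p -> Z2 (plane f p) = Im (g (toC p))^-1 * eta p.
  move=> Up; rewrite /Z2 extE; last exact: planeV.
  by rewrite /z2 kf// /E {1}/plane ofCK chiK// toCK.
have dZ p : region U p -> let q := plane f p in
    'D_(1, 0) Z1 q - 'D_(0, 1) Z2 q = 'D_(1, 0) eta p / nc (g (toC p)) ^+ 2 /\
    'D_(1, 0) Z2 q + 'D_(0, 1) Z1 q = 'D_(0, 1) eta p / nc (g (toC p)) ^+ 2.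
  move=> Up q; have Vq : V (toC q) := planeV Up.
  have chiq : chi (toC q) = toC p by rewrite /q /plane ofCK chiK.
  have d0 : rdiff (fun z => eta (ofC z)) (chi (toC q)) ('D_(1, 0) eta p) ('D_(0, 1) eta p).
    by rewrite chiq; exact: C1_rdiff (smooth_eta 1).
  have dE := rdiff_comp (hchi Vq) d0; have dk := hk _ Vq.
  have [-> ->] := ext_derive oV Vq (rdiffM (rdiff_Re dk) dE).
  have [-> ->] := ext_derive oV Vq (rdiffM (rdiff_Im dk) dE).
  rewrite -exprVn -Normc.normcV -(kf Up) sqr_nc -/q; move: (k (toC q)) (k' (toC q)) => x y.
  by move: ('D_(1, 0) eta p) ('D_(0, 1) eta p) (eta (ofC (chi (toC q)))) => d e h; split; ring.
have := hu _ t1; have := hu _ t2 => -[b1 b2] [a1 a2].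
have mF F : locally_integrable2 (region V) F -> measurable_fun (region V) F by case.
have [[t11 t12] [t21 t22]] := (test_derive t1, test_derive t2).
have msr (h e : R * R -> R) (lh : locally_integrable2 (region V) h) (te : test_function (region V) e) :
    measurable_fun (region V) (fun p : MR * MR => h p * e p).
  by have /integrableP[/measurable_EFinP] := test_integrable oV lh te.
split.
- transitivity (\int[@area R]_(p in region V) (u p * 'D_(1, 0) Z1 p - u p * 'D_(0, 1) Z2 p)).
    have mF' : measurable_fun (region V) (fun p : MR * MR => u p * 'D_(1, 0) Z1 p - u p * 'D_(0, 1) Z2 p).
      exact: measurable_funB (msr _ _ lu t11) (msr _ _ lu t22).
    rewrite [RHS](Rchange_of_variables mF').
    apply: eq_Rintegral => p /set_mem Up; have [e1 _] := dZ _ Up.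
    by rewrite -mulrBr e1 -mulrA divfK// sqrf_eq0 gt_eqF// nc_gt0 g_neq0.
  rewrite RintegralB//; [|exact: test_integrable..].
  rewrite a1 b2 -opprB opprK addrC -[X in - X]RintegralB//; [|exact: test_integrable..].
  congr (- _); rewrite Rchange_of_variables; last by apply: measurable_funB; exact: msr.
  apply: eq_Rintegral => p /set_mem Up; rewrite Z1E// Z2E// ReV ImV.
  by field; rewrite gt_eqF// nc_gt0 g_neq0.
- transitivity (\int[@area R]_(p in region V) (u p * 'D_(1, 0) Z2 p + u p * 'D_(0, 1) Z1 p)).
    have mF' : measurable_fun (region V) (fun p : MR * MR => u p * 'D_(1, 0) Z2 p + u p * 'D_(0, 1) Z1 p).
      exact: measurable_funD (msr _ _ lu t21) (msr _ _ lu t12).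
    rewrite [RHS](Rchange_of_variables mF').
    apply: eq_Rintegral => p /set_mem Up; have [_ e1] := dZ _ Up.
    by rewrite -mulrDr e1 -mulrA divfK// sqrf_eq0 gt_eqF// nc_gt0 g_neq0.
  rewrite RintegralD//; [|exact: test_integrable..].
  rewrite b1 a2 -opprD -RintegralD//; [|exact: test_integrable..].
  congr (- _); rewrite Rchange_of_variables; last by apply: measurable_funD; exact: msr.
  apply: eq_Rintegral => p /set_mem Up; rewrite Z1E// Z2E// ReV ImV ReM /=.
  by field; rewrite gt_eqF// nc_gt0 g_neq0.
Qed.

End transfer.

Lemma rdiff_comp1 (R : realType) (G : R -> R) (A : R[i] -> R) z l a b :
  is_derive (A z) 1 G l -> rdiff A z a b -> rdiff (fun w => G (A w)) z (l * a) (l * b).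
Proof.
move=> dG dA; have cA := rdiff_cont dA.
pose q w := if A w == A z then l else (G (A w) - G (A z)) / (A w - A z).
have cq : rcont q z.
  move=> e e0; have [dGz GE] := dG; have h : h^-1 *: ((G \o shift (A z)) (h *: 1) - G (A z)) @[h --> 0^'] --> l.
    by move: dGz => /cvg_ex[l' hl']; rewrite -GE /derive (cvg_lim _ hl').
  have /cvgrPdist_lt/(_ e e0)/nbhs_ballP[r /= r0 hr] := h.
  have [s s0 hs] := cA _ r0; exists s => // w /hs ws; rewrite /q eqxx.
  have [_|n] := eqVneq (A w) (A z); first by rewrite subrr normr0.
  have := hr (A w - A z); rewrite /ball/= sub0r normrN subr_eq0 => /(_ ws n).
  by rewrite distrC /GRing.scale /= mulr1 subrK [_^-1 * _]mulrC.
move: dA => [a' [b' [hA ca cb [az bz]]]].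
exists (fun w => q w * a' w), (fun w => q w * b' w); split.
- move=> w; have e : A w - A z = a' w * Re (w - z) + b' w * Im (w - z) by rewrite [A w]hA; ring.
  transitivity (G (A z) + q w * (A w - A z)); last by rewrite e; ring.
  rewrite /q; have [->|n] := eqVneq (A w) (A z); first by rewrite subrr mulr0 addr0.
  by rewrite divfK ?subr_eq0//; ring.
- exact: rcontM.
- exact: rcontM.
- by rewrite /q eqxx az bz.
Qed.

(** * Smooth cutoff functions *)

Section bump.
Variable R : realType.
Implicit Types (P : {poly R}) (x t : R).

(* For [P = 1] this is the smooth function [exp (- 1 / x)] extended by [0]; the
   class is closed under derivation. *)
Definition flat P x : R := if 0 < x then P.[x^-1] * expR (- x^-1) else 0.

Lemma pow_expR n t : 0 <= t -> t ^+ n <= n`!%:R * expR t.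
Proof.
case: n => [|n] t0.
  by rewrite expr0 fact0 mul1r -[leLHS]addr0 (le_trans _ (expR_ge1Dx t))// lerD2l.
rewrite -ler_pdivrMl ?ltr0n ?fact_gt0// mulrC.
by apply: le_trans (expR_ge1Dxn n t0); rewrite lerDr.
Qed.

Lemma poly_expR P : exists2 C, 0 <= C & forall t, 0 <= t -> `|P.[t]| <= C * expR t.
Proof.
exists (\sum_(i < size P) `|P`_i| * (i`!)%:R) => [|t t0].
  by apply: sumr_ge0 => i _; rewrite mulr_ge0.
rewrite horner_coef; apply: le_trans (ler_norm_sum _ _ _) _; rewrite mulr_suml.
apply: ler_sum => i _; rewrite normrM -mulrA ler_wpM2l// ger0_norm ?exprn_ge0//.
exact: pow_expR.
Qed.

(** With [t = 1 / x] this is the domination of the polynomial [P * 'X^2] by the exponential. A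
    quadratic bound makes the derivative at 0 exist and vanish. *)
Lemma flat_le P : exists2 C, 0 < C & forall x, `|flat P x| <= C * x ^+ 2.
Proof.
have [C C0 hC] := poly_expR (P * 'X^2); exists (C + 1); first by rewrite ltr_wpDl.
move=> x; rewrite /flat; case: ifPn => [x0|_]; last by rewrite normr0 mulr_ge0 ?sqr_ge0 ?addr_ge0.
have := hC x^-1; rewrite invr_ge0 (ltW x0) => /(_ isT).
rewrite hornerM hornerXn normrM exprVn (@ger0_norm _ (x ^- 2)) ?invr_ge0 ?sqr_ge0//.
rewrite ler_pdivrMr ?exprn_gt0// => h.
rewrite normrM (ger0_norm (expR_ge0 _)) expRN ler_pdivrMr ?expR_gt0//.
apply: le_trans h _; rewrite mulrAC -!mulrA ler_wpM2r ?lerDl//.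
by rewrite !mulr_ge0 ?expR_ge0 ?ltW.
Qed.

(** Differentiating [P(1/x) exp(-1/x)] gives [x^-2 (P(1/x) - P'(1/x)) exp(-1/x)], and [x^-2] is the
    monomial ['X^2] at [1/x]. *)
Definition dflat P := (P - P^`()) * 'X^2.

Lemma is_derive_horner P t : is_derive t 1 (horner P) (P^`()).[t].
Proof.
elim/poly_ind: P => [|P c ih].
  by rewrite deriv0 horner0 (_ : horner 0 = cst 0); [exact: is_derive_cst|apply/funext => x; rewrite horner0].
rewrite derivD derivC addr0 derivM derivX mulr1 !hornerE.
rewrite (_ : horner _ = (fun x => horner P x * id x + cst c x)); last by apply/funext => x; rewrite !hornerE.
by apply: is_derive_eq; rewrite /GRing.scale/=; ring.
Qed.

Lemma is_derive_flat P x : is_derive x 1 (flat P) (flat (dflat P) x).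
Proof.
have [x0|x0|->] := ltgtP x 0.
- have -> : flat (dflat P) x = 0 by rewrite /flat ltNge (ltW x0).
  have := @is_derive_cst R R R 0 x 1; apply: near_eq_is_derive.
  near=> y; rewrite /flat ltNge (ltW (_ : y < 0))//; near: y; exact: lt_nbhsl.
- have -> : flat (dflat P) x = (P - P^`()).[x^-1] * x ^- 2 * expR (- x^-1).
    by rewrite /flat x0 /dflat hornerM hornerXn exprVn.
  have dV : is_derive x 1 (fun y : R => y^-1) (- x ^- 2).
    have := @is_deriveV R id x 1 1 (lt0r_neq0 x0) (is_derive_id _ _).
    by rewrite /GRing.scale/= mulr1.
  have d1 := is_derive1_comp (is_derive_horner P x^-1) dV.
  have dN : is_derive x 1 (fun y : R => - y^-1) (x ^- 2) by rewrite -[x ^- 2]opprK; exact: is_deriveN.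
  have d2 := @is_derive1_comp _ expR (fun y => - y^-1) _ _ _ (is_derive_expR (- x^-1)) dN.
  have := is_deriveM d1 d2; rewrite (_ : _ *: _ + _ = (P - P^`()).[x^-1] * x ^- 2 * expR (- x^-1)).
    by apply: near_eq_is_derive; near=> y; rewrite /flat (_ : 0 < y)//; near: y; exact: lt_nbhsr.
  by rewrite /GRing.scale/= hornerD hornerN; ring.
have [C C0 hC] := flat_le P.
have -> : flat (dflat P) 0 = 0 by rewrite /flat ltxx.
apply: is_derive_eps => e e0; exists (e / C); first by rewrite divr_gt0.
move=> s; rewrite subr0 mul0r subr0 {2}/flat ltxx subr0 => sC.
apply: le_trans (hC s) _; rewrite -real_normK ?num_real// expr2 mulrA ler_wpM2r//.
by rewrite mulrC -ler_pdivlMr// ltW.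
Unshelve. all: by end_near. Qed.

Lemma flat_smo k V P (A : R[i] -> R) (a b : R) : (forall z, rdiff A z a b) ->
  smo k V (fun z => flat P (A z)).
Proof.
move=> dA; have d Q z := rdiff_comp1 (is_derive_flat Q (A z)) (dA z).
elim: k P => [|k ih] P; (split; first by move=> z _; exact: rdiff_cont (d P z)) => //.
exists (fun z => flat (dflat P) (A z) * a), (fun z => flat (dflat P) (A z) * b).
by split; [move=> z _; exact: d|apply: smoM => //; exact: smo_cst..].
Qed.

Lemma rdiff_affine (p q r : R) z : rdiff (fun w => p * Re w + q * Im w + r) z p q.
Proof.
exists (fun=> p), (fun=> q); split=> //; first by move=> w; rewrite ReB ImB; ring.
  exact: rcont_cst.
exact: rcont_cst.
Qed.

End bump.

(** * The fundamental lemma of the calculus of variations *)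

Section fundamental.
Variable R : realType.
Local Notation MR := (measurableTypeR R).
Implicit Types (a b c d x : R) (U : set R[i]) (g : R * R -> R).

Lemma continuous_measurable (F : R * R -> R) : continuous F ->
  measurable_fun setT (F : MR * MR -> R).
Proof.
move=> cF; have oT : copen (@setT R[i]) by move=> ? _; exists 1.
have h z : setT z -> rcont (fun z => F (ofC z)) z.
  move=> _; rewrite -[z]ofCK; apply/rcontP.
  by under [X in {for _, continuous X}]eq_fun do rewrite toCK; exact: cF.
have := rcont_measurable oT h; under eq_fun do rewrite toCK.
by rewrite (_ : region setT = setT).
Qed.

Lemma flat1_bound x : 0 <= flat 1 x <= 1.
Proof.
rewrite /flat; case: ifPn => [x0|]; last by rewrite lexx ler01.
by rewrite hornerC mul1r expR_ge0 expR_le1 oppr_le0 invr_ge0 ltW.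
Qed.

Lemma flat1_le0 x : x <= 0 -> flat 1 x = 0.
Proof. by rewrite /flat ltNge => ->. Qed.

Lemma flat1_cvg x : 0 < x -> flat 1 (n.+1%:R * x) @[n --> \oo] --> (1 : R).
Proof.
move=> x0; have -> : (fun n => flat 1 (n.+1%:R * x)) = (fun n => expR (- (x^-1 * n.+1%:R^-1))).
  by apply/funext => n; rewrite /flat mulr_gt0// hornerC mul1r invfM mulrC.
rewrite -[X in _ --> X](@expR0 R); apply: continuous_cvg; first exact: continuous_expR.
rewrite -oppr0; apply: cvgN; rewrite -(mulr0 x^-1); apply: cvgM; first exact: cvg_cst.
exact: cvg_harmonic.
Qed.

(** A smooth function supported in a closed rectangle, with values in [[0, 1]], converging to the
    indicator of the open rectangle as [N] grows. *)
Definition bump a b c d (N : R) (p : R * R) : R :=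
  flat 1 (N * (p.1 - a)) * flat 1 (N * (b - p.1)) *
  (flat 1 (N * (p.2 - c)) * flat 1 (N * (d - p.2))).

Lemma bump_bound a b c d N p : 0 <= bump a b c d N p <= 1.
Proof.
rewrite /bump; move: (flat1_bound (N * (p.1 - a))) (flat1_bound (N * (b - p.1)))
  (flat1_bound (N * (p.2 - c))) (flat1_bound (N * (d - p.2))).
move: (flat _ _) (flat _ _) (flat _ _) (flat _ _) => q r s t.
move=> /andP[q0 q1] /andP[r0 r1] /andP[s0 s1] /andP[t0 t1].
by rewrite !mulr_ge0//= !mulr_ile1// mulr_ge0.
Qed.

Lemma bump_out a b c d N p : 0 <= N -> ~ (`]a, b[ `*` `]c, d[)%classic p -> bump a b c d N p = 0.
Proof.
move=> N0 h; rewrite /bump.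
have [pa|pa] := leP (p.1 - a) 0; first by rewrite (flat1_le0 (mulr_ge0_le0 N0 pa)) !mul0r.
have [pb|pb] := leP (b - p.1) 0; first by rewrite (flat1_le0 (mulr_ge0_le0 N0 pb)) mulr0 !mul0r.
have [pc|pc] := leP (p.2 - c) 0; first by rewrite (flat1_le0 (mulr_ge0_le0 N0 pc)) mul0r !mulr0.
have [pd|pd] := leP (d - p.2) 0; first by rewrite (flat1_le0 (mulr_ge0_le0 N0 pd)) !mulr0.
by case: h; split; rewrite /= in_itv/= -subr_gt0 ?pa ?pc/= -subr_gt0.
Qed.

Lemma bump_smo a b c d N k : Ck k (bump a b c d N).
Proof.
have s1 u : smo k setT (fun z => flat 1 (N * (Re z - u))).
  apply: (@flat_smo _ _ _ _ _ N 0) => z.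
  rewrite (_ : (fun w => _) = (fun w => N * Re w + 0 * Im w + - (N * u))); first exact: rdiff_affine.
  by apply/funext => w; ring.
have s2 u : smo k setT (fun z => flat 1 (N * (u - Re z))).
  apply: (@flat_smo _ _ _ _ _ (- N) 0) => z.
  rewrite (_ : (fun w => _) = (fun w => - N * Re w + 0 * Im w + N * u)); first exact: rdiff_affine.
  by apply/funext => w; ring.
have s3 u : smo k setT (fun z => flat 1 (N * (Im z - u))).
  apply: (@flat_smo _ _ _ _ _ 0 N) => z.
  rewrite (_ : (fun w => _) = (fun w => 0 * Re w + N * Im w + - (N * u))); first exact: rdiff_affine.
  by apply/funext => w; ring.
have s4 u : smo k setT (fun z => flat 1 (N * (u - Im z))).
  apply: (@flat_smo _ _ _ _ _ 0 (- N)) => z.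
  rewrite (_ : (fun w => _) = (fun w => 0 * Re w + - N * Im w + N * u)); first exact: rdiff_affine.
  by apply/funext => w; ring.
exact: (smo_Ck (smoM (smoM (s1 a) (s2 b)) (smoM (s3 c) (s4 d)))).
Qed.

Lemma compact_box a b c d : compact (`[a, b] `*` `[c, d] : set (R * R)).
Proof. by apply: compact_setX; exact: segment_compact. Qed.

Lemma bump_test U a b c d N : 0 <= N -> (forall z, rcl a b c d z -> U z) ->
  test_function (region U) (bump a b c d N).
Proof.
move=> N0 QU; split; first exact: bump_smo.
exists (`[a, b] `*` `[c, d])%classic; split; first exact: compact_box.
  move=> p [/=]; rewrite !in_itv/= => h1 h2; apply: QU; rewrite /rcl /=.
  by apply/andP.
move=> p h; apply: bump_out => // -[/= h1 h2]; apply: h; split; rewrite /= in_itv/=.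
  by move: h1; rewrite in_itv/= => /andP[/ltW -> /ltW].
by move: h2; rewrite in_itv/= => /andP[/ltW -> /ltW].
Qed.

Lemma negligible_lines b d :
  (@area R).-negligible [set p : MR * MR | p.1 = b \/ p.2 = d].
Proof.
exists (([set b] `*` setT) `|` (setT `*` [set d])); split.
- by apply: measurableU; apply: measurableX => //; exact: measurable_set1.
- have h1 : area ([set b] `*` setT : set (MR * MR)) = 0%E.
    by rewrite /area product_measure1E//= lebesgue_measure_set1 mul0e.
  have h2 : area (setT `*` [set d] : set (MR * MR)) = 0%E.
    by rewrite /area product_measure1E//= lebesgue_measure_set1 mule0.
  apply/eqP; rewrite -measure_le0; apply: le_trans (measureU2 _ _ _) _.
    by apply: measurableX.
    by apply: measurableX.
  by rewrite [X in (X + _)%E]h1 [X in (_ + X)%E]h2 adde0.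
- by move=> p [h|h]; [left|right].
Qed.

(** The bumps are test functions, so [g] integrates to zero against each of them; dominated
    convergence with majorant [|g|] passes to the indicator of the rectangle. *)
Lemma fundamental_cell U g a b c d : copen U -> locally_integrable2 (region U) g ->
  (forall z, rcl a b c d z -> U z) ->
  (forall eta, test_function (region U) eta ->
    \int[@area R]_(p in region U) (g p * eta p) = 0) ->
  (\int[@area R]_(p in cell a b c d) (g p)%:E)%E = 0%E /\
  (@area R).-integrable (cell a b c d) (EFin \o g).
Proof.
move=> oU lg QU hg; have mU := measurable_region oU.
pose Q := cell a b c d; have mQ : measurable Q := measurable_cell a b c d.
have QUr : Q `<=` region U.
  move=> p /cellP /andP[/andP[/ltW h1 h2] /andP[/ltW h3 h4]]; apply: QU.
  by rewrite /rcl /= h1 h2 h3 h4.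
have mg : measurable_fun Q g by apply: measurable_funS lg.1.
have ig : (@area R).-integrable Q (EFin \o g).
  apply/integrableP; split; first exact/measurable_EFinP.
  have KU : (`[a, b] `*` `[c, d] : set (R * R)) `<=` region U.
    move=> p [/=]; rewrite !in_itv/= => h1 h2; apply: QU; rewrite /rcl /=.
    by apply/andP.
  apply: (@le_lt_trans _ _ (\int[@area R]_(p in (`[a, b] `*` `[c, d] : set (MR * MR))) `|g p|%:E)%E);
    last by apply: (lg.2 _ KU); exact: compact_box.
  apply: ge0_subset_integral => //.
  - by apply: compact_measurable; exact: compact_box.
  - apply/measurable_EFinP; apply: measurableT_comp => //; apply: measurable_funS lg.1 => //.
  - move=> p /cellP /andP[/andP[/ltW h1 h2] /andP[/ltW h3 h4]].
    by split; rewrite /= in_itv/= ?h1 ?h3.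
split=> //; pose f_ n p : \bar R := (g p * bump a b c d n.+1%:R p)%:E.
have z n : (\int[@area R]_(p in Q) f_ n p = 0)%E.
  have tb : test_function (region U) (bump a b c d n.+1%:R) by exact: bump_test.
  have /integrableP[mgb _] := test_integrable oU lg tb.
  have -> : (\int[@area R]_(p in Q) f_ n p = \int[@area R]_(p in region U) f_ n p)%E.
    rewrite (integral_subset_indic _ QUr); apply: eq_integral => p _.
    rewrite indicE; case: (pselect (Q p)) => Qp; first by rewrite mem_set// mule1.
    rewrite /f_ bump_out ?mulr0 ?mul0e// => -[/=]; rewrite !in_itv/=.
    move=> /andP[h1 /ltW h2] /andP[h3 /ltW h4]; apply: Qp; apply/cellP.
    by rewrite h1 h2 h3 h4.
  have fin := integrable_fin_num mU (test_integrable oU lg tb).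
  by rewrite -(fineK fin); congr (_%:E); exact: hg _ tb.
have mf n : measurable_fun Q (f_ n).
  apply/measurable_EFinP; apply: measurable_funM => //.
  apply: (@measurable_funS _ _ _ _ setT) => //; apply: continuous_measurable.
  exact: Ck_cont (bump_smo a b c d n.+1%:R 0).
(* The bumps vanish on the right and upper edges, which belong to the half-open cell; these edges
   lie on two lines of area zero. *)
have cvg_f : {ae @area R, forall p, Q p -> f_ ^~ p @ \oo --> (g p)%:E}.
  apply: negligibleS (negligible_lines b d) => p /= h; apply: contrapT => nl; apply: h.
  move=> /cellP /andP[/andP[h1 h2] /andP[h3 h4]]; apply: cvg_EFin; first exact: nearW.
  have h2' : p.1 < b by rewrite lt_neqAle h2 andbT; apply/eqP => e; apply: nl; left.
  have h4' : p.2 < d by rewrite lt_neqAle h4 andbT; apply/eqP => e; apply: nl; right.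
  rewrite -[X in _ --> X]mulr1 /=; apply: cvgM; first exact: cvg_cst.
  rewrite -[X in _ --> X](_ : 1 * 1 * (1 * 1) = 1 :> R); last by ring.
  by apply: cvgM; apply: cvgM; apply: flat1_cvg; rewrite subr_gt0.
have ig' : (@area R).-integrable Q (fun p => `|g p|%:E) by exact: (integrable_abse ig).
have dom : {ae @area R, forall p n, Q p -> (`|f_ n p| <= `|g p|%:E)%E}.
  apply/aeW => p n _; rewrite lee_fin normrM ler_piMr// ger0_norm;
    by have /andP[] := bump_bound a b c d n.+1%:R p.
have [_ _] := dominated_convergence mQ mf (measurable_int _ ig) cvg_f ig' dom.
move/cvg_lim => <- //; under eq_fun do rewrite z.
by rewrite lim_cst.
Qed.

(** On each rational cell the positive and negative parts of [g] are densities of two finite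
    measures that agree on cells, hence on all measurable sets. So [g] has integral zero on every
    measurable subset of the cell and vanishes almost everywhere there. *)
Lemma fundamental_lemma U g : copen U -> locally_integrable2 (region U) g ->
  (forall eta, test_function (region U) eta ->
    \int[@area R]_(p in region U) (g p * eta p) = 0) ->
  {ae @area R, forall p, region U p -> g p = 0}.
Proof.
move=> oU lg hg; have [q [qU Uq]] := rat_cells oU.
pose Q n := cell (q n).1.1 (q n).1.2 (q n).2.1 (q n).2.2.
have mQ n : measurable (Q n) by exact: measurable_cell.
have cells n a b c d : (\int[@area R]_(p in Q n `&` cell a b c d) (g p)%:E)%E = 0%E /\
    (@area R).-integrable (Q n `&` cell a b c d) (EFin \o g).
  have -> : Q n `&` cell a b c d = cell (Num.max (q n).1.1 a) (Num.min (q n).1.2 b)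
      (Num.max (q n).2.1 c) (Num.min (q n).2.2 d).
    apply/seteqP; split => p /=.
      move=> [/cellP/= /andP[/andP[h1 h2] /andP[h3 h4]] /cellP/= /andP[/andP[k1 k2] /andP[k3 k4]]].
      by apply/cellP; rewrite !gt_max !le_min h1 h2 h3 h4 k1 k2 k3 k4.
    move=> /cellP; rewrite !gt_max !le_min.
    move=> /andP[/andP[/andP[h1 h2] /andP[h3 h4]] /andP[/andP[k1 k2] /andP[k3 k4]]].
    by split; apply/cellP; rewrite ?h1 ?h2 ?h3 ?h4 ?k1 ?k2 ?k3 ?k4.
  apply: (fundamental_cell oU lg) => // z; rewrite /rcl !ge_max !le_min => h; apply: (qU n).
  by move: h => /andP[/andP[/andP[h1 h2] /andP[h3 h4]] /andP[/andP[k1 k2] /andP[k3 k4]]];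
    rewrite /rcl h1 h3 k1 k3.
have key n : {ae @area R, forall p, Q n p -> g p = 0}.
  have ig : (@area R).-integrable (Q n) (EFin \o g).
    exact: (fundamental_cell oU lg (qU n) hg).2.
  pose h1 p := Num.max ((g \_ (Q n)) p) 0; pose h2 p := Num.max (- (g \_ (Q n)) p) 0.
  have mg : measurable_fun setT (g \_ (Q n)).
    by apply/(measurable_restrictT g (mQ n)); apply/measurable_EFinP; exact: measurable_int ig.
  have mh1 : measurable_fun setT h1 by exact: measurable_funrpos.
  have mh2 : measurable_fun setT h2 by exact: measurable_funrneg.
  have h10 p : 0 <= h1 p by rewrite le_max lexx orbT.
  have h20 p : 0 <= h2 p by rewrite le_max lexx orbT.
  pose m1 : {measure set (MR * MR) -> \bar R} := density_measure (@area R) mh1 h10.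
  pose m2 : {measure set (MR * MR) -> \bar R} := density_measure (@area R) mh2 h20.
  have m1E A : m1 A = (\int[@area R]_(p in Q n `&` A) (EFin \o g)^\+ p)%E.
    rewrite -[m1 A]/(\int[@area R]_(p in A) (h1 p)%:E)%E [LHS]integral_mkcond [RHS]integral_mkcond.
    apply: eq_integral => p _; rewrite !patchE in_setI /h1 patchE.
    case: (p \in A); case: (p \in Q n) => //=; rewrite ?maxxx//.
    by rewrite funeposE -EFin_max.
  have m2E A : m2 A = (\int[@area R]_(p in Q n `&` A) (EFin \o g)^\- p)%E.
    rewrite -[m2 A]/(\int[@area R]_(p in A) (h2 p)%:E)%E [LHS]integral_mkcond [RHS]integral_mkcond.
    apply: eq_integral => p _; rewrite !patchE in_setI /h2 patchE.
    case: (p \in A); case: (p \in Q n) => //=; rewrite ?oppr0 ?maxxx//.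
    by rewrite funenegE -EFinN -EFin_max.
  have fin A : measurable A -> m1 A \is a fin_num /\ m2 A \is a fin_num.
    move=> mA; have := integrableS (mQ n) (measurableI _ _ (mQ n) mA) (@subIsetl _ _ _) ig.
    move=> /[dup] /integrable_pos_fin_num h3 /integrable_neg_fin_num h4.
    by rewrite m1E m2E; split; [apply: h3|apply: h4]; exact: measurableI.
  have m12 : forall A, measurable A -> m1 A = m2 A.
    apply: measure_cells_unique => [a b c d|].
      have [+ _] := cells n a b c d; rewrite integralE -m1E -m2E => /eqP.
      have [h3 h4] := fin _ (measurable_cell a b c d).
      by rewrite sube_eq ?add0e; [move/eqP|exact: h3|exact: fin_num_adde_defr].
    by rewrite ltey_eq; have [-> _] := fin _ measurableT.
  have : ae_eq (@area R) (Q n) (EFin \o g) (cst 0%E).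
    apply: integral_ae_eq => // E EQ mE; rewrite integral_cst// mul0e integralE.
    by rewrite -(setIidr EQ) -m1E -m2E m12// subee//; have [] := fin _ mE.
  by apply: filterS => p h Qp; have [] := h Qp.
have := ae_foralln key; apply: filterS => p hp Up.
by have [n Qnp] := Uq _ Up; exact: hp Qnp.
Qed.

End fundamental.

(** * Weak gradients of smooth functions *)

Section smooth_gradient.
Variable R : realType.
Local Notation MR := (measurableTypeR R).
Local Notation mu := (@lebesgue_measure R).
Implicit Types (W : set R[i]) (u g eta : R * R -> R) (K : set (R * R)).

Lemma compact_in_box K : compact K -> exists2 M, 0 < M &
  forall p, K p -> - M < p.1 < M /\ - M < p.2 < M.
Proof.
move=> /compact_bounded [M [_ hM]]; exists (`|M| + 2); first by rewrite ltr_wpDl.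
move=> p Kp; have := hM (`|M| + 1) _ p Kp; rewrite (le_lt_trans (ler_norm M)) ?ltrDl// => /(_ isT) h.
have h' : Num.max `|p.1| `|p.2| <= `|M| + 1 by exact: h.
move: h'; rewrite ge_max !ler_norml => /andP[/andP[h1 h2] /andP[h3 h4]].
by split; apply/andP; split; lra.
Qed.

Lemma compact_area_lty K : compact K -> (@area R K < +oo)%E.
Proof.
move=> cK; have [M M0 hM] := compact_in_box cK.
apply: (@le_lt_trans _ _ (@area R (cell (- M) M (- M) M))).
  apply: le_measure; rewrite ?inE; first exact: compact_measurable.
    exact: measurable_cell.
  by move=> p /hM[/andP[h1 h2] /andP[h3 h4]]; apply/cellP; rewrite h1 h3 !ltW.
by rewrite area_cell ?ltry//; lra.
Qed.

Lemma locally_integrable2_cst W c : locally_integrable2 (region W) (fun=> c).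
Proof.
split; first exact: measurable_cst.
move=> K KW cK; rewrite integral_cst; last exact: compact_measurable.
by rewrite lte_mul_pinfty// ?lee_fin//; exact: compact_area_lty.
Qed.

Lemma locally_integrable2_cont W u : copen W -> continuous u ->
  locally_integrable2 (region W) u.
Proof.
move=> oW cu; have h z : W z -> rcont (fun z => u (ofC z)) z.
  move=> _; rewrite -[z]ofCK; apply/rcontP.
  by under [X in {for _, continuous X}]eq_fun do rewrite toCK; exact: cu.
have := locally_integrable2M oW h (locally_integrable2_cst W 1).
by under eq_fun do rewrite mul1r toCK.
Qed.

Lemma Ck_is_derive1 eta (x y : R) : Ck 1 eta ->
  is_derive x 1 (fun x => eta (x, y)) ('D_(1, 0) eta (x, y)) /\
  is_derive y 1 (fun y => eta (x, y)) ('D_(0, 1) eta (x, y)).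
Proof.
move=> [_ [d1 d2 _ _]]; split.
  have E : (fun h : R => h^-1 *: (((fun x => eta (x, y)) \o shift x) (h *: 1) - eta (x, y))) =
      (fun h : R => h^-1 *: ((eta \o shift (x, y)) (h *: (1, 0)) - eta (x, y))).
    apply/funext => h /=; congr (_ *: (eta _ - _)); apply: injective_projections => //=.
    by rewrite /GRing.scale/= mulr0 add0r.
  by apply: DeriveDef; [rewrite /derivable E; exact: d1|rewrite /derive E].
have E : (fun h : R => h^-1 *: (((fun y => eta (x, y)) \o shift y) (h *: 1) - eta (x, y))) =
    (fun h : R => h^-1 *: ((eta \o shift (x, y)) (h *: (0, 1)) - eta (x, y))).
  apply/funext => h /=; congr (_ *: (eta _ - _)); apply: injective_projections => //=.
  by rewrite /GRing.scale/= mulr0 add0r.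
by apply: DeriveDef; [rewrite /derivable E; exact: d2|rewrite /derive E].
Qed.

Lemma integral_derive_compact (F f : R -> R) (M : R) : 0 < M -> continuous f ->
  (forall t : R, is_derive t 1 F (f t)) -> (forall t : R, ~ (- M < t < M) -> F t = 0 /\ f t = 0) ->
  (\int[mu]_t (f t)%:E = 0)%E.
Proof.
move=> M0 cf dF out; have MM : - M <= M by lra.
have sc : segcont (- M) M f by move=> t _; exact: cf.
have -> : (\int[mu]_t (f t)%:E = \int[mu]_(t in `[(- M)%R, M]) (f t)%:E)%E.
  rewrite [RHS]integral_mkcond; apply: eq_integral => t _; rewrite patchE.
  case: ifPn => // /negP tn; rewrite (out t _).2//; apply: contra_not tn => /andP[/ltW h1 /ltW h2].
  by rewrite inE/= in_itv/= h1.
have fin : (\int[mu]_(t in `[(- M)%R, M]) (f t)%:E)%E \is a fin_num.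
  exact: integrable_fin_num _ (segcont_integrable sc).
rewrite -(fineK fin); congr (_%:E); have := rint_FTC MM sc (fun t _ => dF t).
rewrite /rint /Rintegral => ->.
by rewrite (out M _).1 ?(out (- M) _).1 ?subrr// => /andP[]; rewrite ltxx.
Qed.

(** By Fubini the integral is taken first along the lines in the direction of the derivative, where
    the fundamental theorem of calculus gives zero by compact support. *)
Lemma integral_test_derive W eta : copen W -> test_function (region W) eta ->
  \int[@area R]_(p in region W) ('D_(1, 0) eta p) = 0 /\
  \int[@area R]_(p in region W) ('D_(0, 1) eta p) = 0.
Proof.
move=> oW te; have oT : copen (@setT R[i]) by move=> ? _; exists 1.
have [sm [K [cK KW eta0]]] := te.
have teT : test_function (region setT) eta by split=> //; exists K; split.
have [td1 td2] := test_derive teT.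
have ext_int F : test_function (region setT) F -> (forall p, ~ K p -> F p = 0) ->
    (@area R).-integrable setT (EFin \o F) /\
    \int[@area R]_(p in region W) F p = fine (\int[@area R]_p (F p)%:E)%E.
  move=> tF F0; split.
    have := test_integrable oT (locally_integrable2_cst setT 1) tF.
    rewrite (_ : region setT = setT)//.
    by rewrite (_ : (fun p => 1 * F p) = F)//; apply/funext => p; rewrite mul1r.
  rewrite /Rintegral; congr fine; rewrite [LHS]integral_mkcond; apply: eq_integral => p _.
  rewrite patchE; case: ifPn => // /negP pW; rewrite F0// => /KW Wp; apply: pW.
  exact/mem_set.
have [M M0 hM] := compact_in_box cK.
have out := derive_out cK (sm 1) eta0.
have c1 := Ck_cont (td1.1 0%N); have c2 := Ck_cont (td2.1 0%N).
split.
  have [ii ->] := ext_int _ td1 (fun p h => (out p h).1).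
  rewrite -(integral21_prod_meas1 ii) /fubini_G.
  rewrite integral0_eq// => y _.
  apply: (@integral_derive_compact (fun x => eta (x, y)) _ M M0) => [t|t|t nt].
  - apply: (@continuous_comp _ _ _ (fun t => (t, y)) ('D_(1, 0) eta)); last exact: c1.
    have c3 : {for t, continuous (fun t : R => t)} by exact: cvg_id.
    have c4 : {for t, continuous (fun _ : R => (y : R))} by exact: cvg_cst.
    exact: cvg_pair c3 c4.
  - exact: (Ck_is_derive1 t y (sm 1)).1.
  - have nK : ~ K (t, y) by move=> /hM[].
    by rewrite eta0// (out _ nK).1.
have [ii ->] := ext_int _ td2 (fun p h => (out p h).2).
rewrite -(integral12_prod_meas1 ii) /fubini_F.
rewrite integral0_eq// => x _.
apply: (@integral_derive_compact (fun y => eta (x, y)) _ M M0) => [t|t|t nt].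
- apply: (@continuous_comp _ _ _ (fun t => (x, t)) ('D_(0, 1) eta)); last exact: c2.
  have c3 : {for t, continuous (fun t : R => t)} by exact: cvg_id.
  have c4 : {for t, continuous (fun _ : R => (x : R))} by exact: cvg_cst.
  exact: cvg_pair c4 c3.
- exact: (Ck_is_derive1 x t (sm 1)).2.
- have nK : ~ K (x, t) by move=> /hM[].
  by rewrite eta0// (out _ nK).2.
Qed.

(** Integration by parts: [u eta] is itself a test function, so its partial derivatives have
    integral zero. *)
Lemma weak_gradient_smooth W u : copen W -> (forall k, Ck k u) ->
  weak_gradient (region W) u ('D_(1, 0) u) ('D_(0, 1) u).
Proof.
move=> oW su; have [cu [_ _ c1 c2]] := su 1; have lu := locally_integrable2_cont oW cu.
have lu1 := locally_integrable2_cont oW c1.1.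
have lu2 := locally_integrable2_cont oW c2.1.
split=> // eta te; have [sm [K [cK KW eta0]]] := te.
have tm : test_function (region W) (fun p => u p * eta p).
  split; last by exists K; split=> // p /eta0 ->; rewrite mulr0.
  move=> k; have := smo_Ck (smoM (Ck_smo setT (su k)) (Ck_smo setT (sm k))).
  by under eq_fun do rewrite toCK.
have dm p : 'D_(1, 0) (fun p => u p * eta p) p = 'D_(1, 0) u p * eta p + u p * 'D_(1, 0) eta p /\
    'D_(0, 1) (fun p => u p * eta p) p = 'D_(0, 1) u p * eta p + u p * 'D_(0, 1) eta p.
  have := rdiffM (C1_rdiff p (su 1)) (C1_rdiff p (sm 1)); rewrite !toCK.
  by apply: rdiff_unique; exact: (C1_rdiff p (tm.1 1%N)).
have [t1 t2] := test_derive te; have [i1 i2] := integral_test_derive oW tm.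
have mW := measurable_region oW.
split.
  move: i1; under eq_Rintegral do rewrite (dm _).1.
  rewrite RintegralD//; [|exact: test_integrable..].
  by move/eqP; rewrite addrC addr_eq0 => /eqP.
move: i2; under eq_Rintegral do rewrite (dm _).2.
rewrite RintegralD//; [|exact: test_integrable..].
by move/eqP; rewrite addrC addr_eq0 => /eqP.
Qed.

End smooth_gradient.

(** * Weighted Sobolev spaces and eigenvalues *)

Section sobolev.
Variable R : realType.
Local Notation MR := (measurableTypeR R).
Variable U : set R[i].
Hypothesis oU : copen U.
Implicit Types (f g h k : R * R -> R).
Let mU : measurable (region U : set (MR * MR)) := measurable_region oU.

Lemma Rintegral_test_scale (k : R) f eta : locally_integrable2 (region U) f ->
  test_function (region U) eta ->
  \int[@area R]_(p in region U) (k * f p * eta p) = k * \int[@area R]_(p in region U) (f p * eta p).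
Proof.
move=> lf te; rewrite -RintegralZl//; last exact: test_integrable.
by apply: eq_Rintegral => p _; rewrite mulrA.
Qed.

Lemma locally_integrable2Z (k : R) f : locally_integrable2 (region U) f ->
  locally_integrable2 (region U) (fun p => k * f p).
Proof.
move=> lf; have := @locally_integrable2M R U (fun=> k) f oU (fun z _ => rcont_cst k z) lf.
by under eq_fun do rewrite mulrC.
Qed.

Lemma weak_gradientD f f1 f2 g g1 g2 :
  weak_gradient (region U) f f1 f2 -> weak_gradient (region U) g g1 g2 ->
  weak_gradient (region U) (fun p => f p + g p) (fun p => f1 p + g1 p) (fun p => f2 p + g2 p).
Proof.
move=> [lf lf1 lf2 hf] [lg lg1 lg2 hg].
split; [exact: locally_integrable2D..|move=> eta te].
have [t1 t2] := test_derive te; have [e1 e2] := hf _ te; have [e3 e4] := hg _ te.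
have D (a b e : R * R -> R) : locally_integrable2 (region U) a -> locally_integrable2 (region U) b ->
    test_function (region U) e ->
    \int[@area R]_(p in region U) ((a p + b p) * e p) =
    \int[@area R]_(p in region U) (a p * e p) + \int[@area R]_(p in region U) (b p * e p).
  move=> la lb tte; rewrite -RintegralD//; [|exact: test_integrable..].
  by apply: eq_Rintegral => p _; rewrite mulrDl.
split.
  apply: etrans (D _ _ _ lf lg t1) _; apply: etrans (f_equal2 +%R e1 e3) _.
  apply: etrans (esym (opprD _ _)) _; apply: (congr1 -%R).
  exact: esym (D _ _ _ lf1 lg1 te).
apply: etrans (D _ _ _ lf lg t2) _; apply: etrans (f_equal2 +%R e2 e4) _.
apply: etrans (esym (opprD _ _)) _; apply: (congr1 -%R).
exact: esym (D _ _ _ lf2 lg2 te).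
Qed.

Lemma weak_gradientZ (k : R) f f1 f2 : weak_gradient (region U) f f1 f2 ->
  weak_gradient (region U) (fun p => k * f p) (fun p => k * f1 p) (fun p => k * f2 p).
Proof.
move=> [lf lf1 lf2 hf]; split; [exact: locally_integrable2Z..|move=> eta te].
have [t1 t2] := test_derive te; have [e1 e2] := hf _ te.
split.
  apply: etrans (Rintegral_test_scale k lf t1) _; apply: etrans (congr1 (fun t => k * t) e1) _.
  apply: etrans (mulrN _ _) _; apply: (congr1 -%R); exact: esym (Rintegral_test_scale k lf1 te).
apply: etrans (Rintegral_test_scale k lf t2) _; apply: etrans (congr1 (fun t => k * t) e2) _.
apply: etrans (mulrN _ _) _; apply: (congr1 -%R); exact: esym (Rintegral_test_scale k lf2 te).
Qed.

Lemma weak_gradient_cst (k : R) : weak_gradient (region U) (fun=> k) (fun=> 0) (fun=> 0).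
Proof.
have sm j : Ck j (fun _ : R * R => k) by exact: (smo_Ck (smo_cst j setT k)).
have := weak_gradient_smooth oU sm.
have e v : 'D_v (fun _ : R * R => k) = (fun=> 0) by apply/funext => p; exact: derive_cst.
by rewrite !e.
Qed.

(** The differences of the components form a weak gradient of the zero function, to which
    [fundamental_lemma] applies. *)
Lemma weak_gradient_unique f f1 f2 g1 g2 :
  weak_gradient (region U) f f1 f2 -> weak_gradient (region U) f g1 g2 ->
  {ae @area R, forall p, region U p -> f1 p = g1 p /\ f2 p = g2 p}.
Proof.
move=> hf /(weak_gradientZ (-1)) /(weak_gradientD hf).
rewrite (_ : (fun p => f p + _) = fun=> 0); last by apply/funext => p; rewrite mulN1r subrr.
move=> [_ l1 l2 hz].
have z e : \int[@area R]_(p in region U) (0 * e p) = 0 :> R.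
  by under eq_Rintegral do rewrite mul0r; rewrite /Rintegral integral0.
have h1 : {ae @area R, forall p, region U p -> f1 p + -1 * g1 p = 0}.
  apply: (fundamental_lemma oU l1) => eta /hz[+ _]; rewrite z => /esym/eqP.
  by rewrite oppr_eq0 => /eqP.
have h2 : {ae @area R, forall p, region U p -> f2 p + -1 * g2 p = 0}.
  apply: (fundamental_lemma oU l2) => eta /hz[_ +]; rewrite z => /esym/eqP.
  by rewrite oppr_eq0 => /eqP.
apply: negligibleS (negligibleU h1 h2) => p /= np; apply: contrapT.
move=> /not_orP[/contrapT k1 /contrapT k2]; apply: np => Up.
have /eqP := k1 Up; have /eqP := k2 Up; rewrite !mulN1r !subr_eq0.
by move=> /eqP -> /eqP ->.
Qed.

(** Gradients are carried along and not selected, so a Dirichlet integral computed with one gradient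
    has to be valid for all of them. *)
Lemma dirichlet_unique f f1 f2 g1 g2 :
  weak_gradient (region U) f f1 f2 -> weak_gradient (region U) f g1 g2 ->
  dirichlet (region U) f1 f2 = dirichlet (region U) g1 g2.
Proof.
move=> hf hg; have := weak_gradient_unique hf hg.
move: hf hg => [_ [mf1 _] [mf2 _] _] [_ [mg1 _] [mg2 _] _] fg.
rewrite /dirichlet /Rintegral; congr fine.
apply: ge0_ae_eq_integral => //.
- by apply/measurable_EFinP; apply: measurable_funD; exact: measurable_funX.
- by apply/measurable_EFinP; apply: measurable_funD; exact: measurable_funX.
- by move=> p _; rewrite lee_fin addr_ge0// sqr_ge0.
- by move=> p _; rewrite lee_fin addr_ge0// sqr_ge0.
apply: negligibleS fg => p /= np hp; apply: np => Up.
by have [-> ->] := hp Up.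
Qed.

Section weight.
Variable h : R * R -> R.
Hypotheses (mh : measurable_fun (region U : set (MR * MR)) h)
  (h0 : forall p, region U p -> 0 <= h p).

Lemma sqr_integrableD f g k : measurable_fun (region U : set (MR * MR)) f ->
  measurable_fun (region U : set (MR * MR)) g ->
  measurable_fun (region U : set (MR * MR)) k -> (forall p, region U p -> 0 <= k p) ->
  (\int[@area R]_(p in region U) (f p ^+ 2 * k p)%:E < +oo)%E ->
  (\int[@area R]_(p in region U) (g p ^+ 2 * k p)%:E < +oo)%E ->
  (\int[@area R]_(p in region U) ((f p + g p) ^+ 2 * k p)%:E < +oo)%E.
Proof.
move=> mf mg mk k0 hf hg.
have m2 (e : R * R -> R) : measurable_fun (region U : set (MR * MR)) e ->
    measurable_fun (region U) (fun p : MR * MR => (e p ^+ 2 * k p)%:E).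
  by move=> me; apply/measurable_EFinP; apply: measurable_funM => //; exact: measurable_funX.
have nn (e : R * R -> R) p : region U p -> (0 <= (e p ^+ 2 * k p)%:E)%E.
  by move=> Up; rewrite lee_fin mulr_ge0 ?sqr_ge0// k0.
have nn2 (e : R * R -> R) p : region U p -> (0 <= 2%:E * (e p ^+ 2 * k p)%:E)%E.
  by move=> Up; apply: mule_ge0; [rewrite lee_fin|exact: nn].
apply: (@le_lt_trans _ _ (\int[@area R]_(p in region U)
    (2%:E * (f p ^+ 2 * k p)%:E + 2%:E * (g p ^+ 2 * k p)%:E))%E).
  apply: ge0_le_integral => //.
  - by move=> p; exact: (nn (fun p => f p + g p)).
  - by apply: m2; exact: measurable_funD.
  - by apply: emeasurable_funD; apply: emeasurable_funM => //; exact: m2.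
  - move=> p Up; rewrite -!EFinM -EFinD lee_fin !mulrA -mulrDl ler_wpM2r ?k0// -subr_ge0.
    by rewrite (_ : _ - _ = (f p - g p) ^+ 2) ?sqr_ge0//; ring.
rewrite ge0_integralD//; first last.
- by apply: emeasurable_funM => //; exact: m2.
- exact: nn2.
- by apply: emeasurable_funM => //; exact: m2.
- exact: nn2.
rewrite !ge0_integralZl//; first last.
- exact: nn.
- exact: m2.
- exact: nn.
- exact: m2.
by rewrite lte_add_pinfty// lte_mul_pinfty.
Qed.

Lemma sqr_integrableZ (c : R) f k : measurable_fun (region U : set (MR * MR)) f ->
  measurable_fun (region U : set (MR * MR)) k -> (forall p, region U p -> 0 <= k p) ->
  (\int[@area R]_(p in region U) (f p ^+ 2 * k p)%:E < +oo)%E ->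
  (\int[@area R]_(p in region U) ((c * f p) ^+ 2 * k p)%:E < +oo)%E.
Proof.
move=> mf mk k0 hf.
rewrite (_ : (\int[@area R]_(p in region U) ((c * f p) ^+ 2 * k p)%:E)%E =
    (\int[@area R]_(p in region U) ((c ^+ 2)%:E * (f p ^+ 2 * k p)%:E))%E); last first.
  by apply: eq_integral => p _; rewrite -EFinM; congr (_%:E); ring.
rewrite ge0_integralZl//; first by rewrite lte_mul_pinfty// lee_fin sqr_ge0.
- by apply/measurable_EFinP; apply: measurable_funM => //; exact: measurable_funX.
- by move=> p Up; rewrite lee_fin; apply: mulr_ge0; [exact: sqr_ge0|exact: k0].
- by rewrite lee_fin sqr_ge0.
Qed.

Let grad2 f1 f2 : measurable_fun (region U : set (MR * MR)) f1 ->
  measurable_fun (region U : set (MR * MR)) f2 ->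
  (\int[@area R]_(p in region U) (f1 p ^+ 2 + f2 p ^+ 2)%:E)%E =
  (\int[@area R]_(p in region U) (f1 p ^+ 2 * 1)%:E +
   \int[@area R]_(p in region U) (f2 p ^+ 2 * 1)%:E)%E.
Proof.
move=> m1 m2; rewrite -ge0_integralD//; first by apply: eq_integral => p _; rewrite !mulr1.
- by move=> p _; rewrite mulr1 lee_fin sqr_ge0.
- by apply/measurable_EFinP; apply: measurable_funM => //; exact: measurable_funX.
- by move=> p _; rewrite mulr1 lee_fin sqr_ge0.
- by apply/measurable_EFinP; apply: measurable_funM => //; exact: measurable_funX.
Qed.

Let grad2_lty f1 f2 : measurable_fun (region U : set (MR * MR)) f1 ->
  measurable_fun (region U : set (MR * MR)) f2 ->
  (\int[@area R]_(p in region U) (f1 p ^+ 2 + f2 p ^+ 2)%:E < +oo)%E <->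
  (\int[@area R]_(p in region U) (f1 p ^+ 2 * 1)%:E < +oo)%E /\
  (\int[@area R]_(p in region U) (f2 p ^+ 2 * 1)%:E < +oo)%E.
Proof.
move=> m1 m2; rewrite grad2//; split; last by case; exact: lte_add_pinfty.
have n1 : (0 <= \int[@area R]_(p in region U) (f1 p ^+ 2 * 1)%:E)%E.
  by apply: integral_ge0 => p _; rewrite mulr1 lee_fin sqr_ge0.
have n2 : (0 <= \int[@area R]_(p in region U) (f2 p ^+ 2 * 1)%:E)%E.
  by apply: integral_ge0 => p _; rewrite mulr1 lee_fin sqr_ge0.
by move=> hh; split; apply: le_lt_trans hh; [exact: leeDl|exact: leeDr].
Qed.

Lemma W12D f f1 f2 g g1 g2 : W12 (region U) h f f1 f2 -> W12 (region U) h g g1 g2 ->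
  W12 (region U) h (fun p => f p + g p) (fun p => f1 p + g1 p) (fun p => f2 p + g2 p).
Proof.
move=> [wf sf df] [wg sg dg].
have [[mf _] [mf1 _] [mf2 _] _] := wf; have [[mg _] [mg1 _] [mg2 _] _] := wg.
split; first exact: weak_gradientD; first exact: sqr_integrableD.
move: df dg => /grad2_lty[|//|d1 d2]; first by [].
move=> /grad2_lty[|//|d3 d4]; first by [].
by apply/grad2_lty; [exact: measurable_funD..|split; exact: sqr_integrableD].
Qed.

Lemma W12Z (k : R) f f1 f2 : W12 (region U) h f f1 f2 ->
  W12 (region U) h (fun p => k * f p) (fun p => k * f1 p) (fun p => k * f2 p).
Proof.
move=> [wf sf df]; have [[mf _] [mf1 _] [mf2 _] _] := wf.
split; first exact: weak_gradientZ; first exact: sqr_integrableZ.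
move: df => /grad2_lty[|//|d1 d2]; first by [].
by apply/grad2_lty; [exact: measurable_funM..|split; exact: sqr_integrableZ].
Qed.

Lemma W12_0 : W12 (region U) h (fun=> 0) (fun=> 0) (fun=> 0).
Proof.
split; first exact: weak_gradient_cst.
  by under eq_integral do rewrite expr0n mul0r; rewrite integral0.
by under eq_integral do rewrite expr0n addr0; rewrite integral0.
Qed.

Lemma W12_lin_comb n (c : 'I_n -> R) (u u1 u2 : 'I_n -> R * R -> R) :
  (forall i, W12 (region U) h (u i) (u1 i) (u2 i)) ->
  W12 (region U) h (lin_comb c u) (lin_comb c u1) (lin_comb c u2).
Proof.
move=> hu; rewrite /lin_comb; elim: (index_enum _) => [|i s ih].
  by under eq_fun do rewrite big_nil; under [X in W12 _ _ _ X]eq_fun do rewrite big_nil;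
    under [X in W12 _ _ _ _ X]eq_fun do rewrite big_nil; exact: W12_0.
under eq_fun do rewrite big_cons; under [X in W12 _ _ _ X]eq_fun do rewrite big_cons;
  under [X in W12 _ _ _ _ X]eq_fun do rewrite big_cons.
by apply: W12D => //; exact: W12Z.
Qed.

End weight.
End sobolev.

(** * Upper bounds for the eigenvalues *)

Section spectral.
Variable R : realType.
Local Notation MR := (measurableTypeR R).
Implicit Types (U : set R[i]) (f g h k : R * R -> R) (n : nat) (L : R).

(* [lambda_n <= L] for the weight [h], witnessed by the span of [u]. *)
Definition spectral_bound (A : set (R * R)) h n L := 0 <= L /\
  exists u : 'I_n -> R * R -> R, (forall i, exists g1 g2, W12 A h (u i) g1 g2) /\
  forall c : 'I_n -> R, (exists i, c i != 0) ->
    0 < \int[@area R]_(p in A) (lin_comb c u p ^+ 2 * h p) /\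
    forall g1 g2, W12 A h (lin_comb c u) g1 g2 ->
      dirichlet A g1 g2 <= L * \int[@area R]_(p in A) (lin_comb c u p ^+ 2 * h p).

Let mone U : measurable_fun (region U : set (MR * MR)) (cst 1 : R * R -> R).
Proof. exact: measurable_cst. Qed.

Lemma dirichlet_ge0 (A : set (R * R)) f g : 0 <= dirichlet A f g.
Proof. by apply: Rintegral_ge0 => p _; rewrite addr_ge0// sqr_ge0. Qed.

Lemma sqr_integral_eq0 (A : set (MR * MR)) f k : measurable A ->
  measurable_fun A (f : MR * MR -> R) -> measurable_fun A (k : MR * MR -> R) ->
  (forall p, A p -> 0 < k p) ->
  (\int[@area R]_(p in A) (f p ^+ 2 * k p)%:E < +oo)%E ->
  \int[@area R]_(p in A) (f p ^+ 2 * k p) = 0 <-> {ae @area R, forall p, A p -> f p = 0}.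
Proof.
move=> mA mf mk k0 fin.
have nn p : A p -> (0 <= (f p ^+ 2 * k p)%:E)%E.
  by move=> Ap; rewrite lee_fin mulr_ge0 ?sqr_ge0// ltW// k0.
have mF : measurable_fun A (fun p : MR * MR => (f p ^+ 2 * k p)%:E).
  by apply/measurable_EFinP; apply: measurable_funM => //; exact: measurable_funX.
have E : (\int[@area R]_(p in A) `|(f p ^+ 2 * k p)%:E| = \int[@area R]_(p in A) (f p ^+ 2 * k p)%:E)%E.
  by apply: eq_integral => p /set_mem Ap; rewrite gee0_abs// nn.
split.
  rewrite /Rintegral => /eqP; rewrite fine_eq0; last first.
    by rewrite ge0_fin_numE//; exact: integral_ge0.
  move=> /eqP i0; have /(ae_eq_integral_abs (@area R) mA mF) : (\int[@area R]_(p in A) `|(f p ^+ 2 * k p)%:E| = 0)%E by rewrite E.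
  apply: negligibleS => p /= np hp; apply: np => Ap.
  have /eqP := hp Ap; rewrite eqe mulf_eq0 sqrf_eq0 (gt_eqF (k0 _ Ap)) orbF.
  by move/eqP.
move=> f0; rewrite /Rintegral -E.
suff -> : (\int[@area R]_(p in A) `|(f p ^+ 2 * k p)%:E| = 0)%E by [].
apply/(ae_eq_integral_abs (@area R) mA mF).
apply: negligibleS f0 => p /= np hp; apply: np => Ap.
by rewrite hp// expr0n mul0r.
Qed.

Lemma W12_gradients (A : set (R * R)) h n (u : 'I_n -> R * R -> R) :
  (forall i, exists g1 g2, W12 A h (u i) g1 g2) ->
  exists u1 u2 : 'I_n -> R * R -> R, forall i, W12 A h (u i) (u1 i) (u2 i).
Proof.
move=> hu; have /choice[w hw] : forall i, exists w : (R * R -> R) * (R * R -> R), W12 A h (u i) w.1 w.2.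
  by move=> i; have [g1 [g2 hg]] := hu i; exists (g1, g2).
by exists (fun i => (w i).1), (fun i => (w i).2).
Qed.

(** The positivity of the norms in [spectral_bound] contains linear independence: a combination
    vanishing almost everywhere has norm zero. *)
Lemma spectral_bound_eigenvalue U n L : copen U ->
  spectral_bound (region U) (cst 1) n L -> (neumann_eigenvalue U n <= L%:E)%E.
Proof.
move=> oU [L0 [u [hu hL]]]; have mU := measurable_region oU.
apply: (@le_trans _ _ (ereal_sup (rayleigh_set (region U) u))).
  apply: ereal_inf_lbound; exists u => //; split=> // c c0 i.
  have [u1 [u2 hw]] := W12_gradients hu.
  have [[[mf _] _ _ _] fin _] := @W12_lin_comb R U oU (cst 1) (@mone U) (fun _ _ => ler01) n c _ _ _ hw.
  have [//|/eqP ci] := eqVneq (c i) 0; exfalso.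
  have [+ _] := hL c (ex_intro _ i (introN eqP ci)).
  have /(sqr_integral_eq0 mU mf (@mone U) (fun _ _ => ltr01) fin) -> := c0.
  by rewrite ltxx.
apply: ge_ereal_sup => _ [c [g1 [g2 [c0 hw ->]]]].
have [pos /(_ _ _ hw) le] := hL c c0; rewrite lee_fin.
have e : \int[@area R]_(p in region U) (lin_comb c u p ^+ 2 * cst 1 p) =
    \int[@area R]_(p in region U) (lin_comb c u p ^+ 2).
  by apply: eq_Rintegral => p _; rewrite mulr1.
by rewrite -e ler_pdivrMr.
Qed.

Lemma lin_comb_delta n (u : 'I_n -> R * R -> R) i :
  lin_comb (fun j => (j == i)%:R) u = u i.
Proof.
apply/funext => p; rewrite /lin_comb (bigD1 i)//= eqxx mul1r big1 ?addr0// => j /negPf ->.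
by rewrite mul0r.
Qed.

(** The point is that the set of quotients is nonempty for [n > 0]; the supremum of the empty set
    would be [-oo]. *)
Lemma rayleigh_sup_ge0 (A : set (R * R)) n (u : 'I_n -> R * R -> R) : (0 < n)%N ->
  (forall i, exists g1 g2, W12 A (cst 1) (u i) g1 g2) ->
  (0 <= ereal_sup (rayleigh_set A u))%E.
Proof.
case: n u => // n u _ hu; have [g1 [g2 hw]] := hu ord0.
apply: le_trans (ereal_sup_ubound _); last first.
  exists (fun j => (j == ord0)%:R), g1, g2; split; last by reflexivity.
    by exists ord0; rewrite eqxx oner_eq0.
  by rewrite lin_comb_delta.
rewrite lee_fin divr_ge0 ?dirichlet_ge0//.
by apply: Rintegral_ge0 => p _; exact: sqr_ge0.
Qed.

Lemma eigenvalue_ge0 U n : (0 < n)%N -> (0 <= neumann_eigenvalue U n)%E.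
Proof.
by move=> n0; apply: le_ereal_inf_tmp => _ [u [hu _] <-]; exact: rayleigh_sup_ge0.
Qed.

(** Any [x] above the infimum exceeds the supremum for some basis. That supremum is nonnegative and
    below [x], hence a real number, and serves as [L]. *)
Lemma eigenvalue_spectral_bound U n (x : \bar R) : copen U -> (0 < n)%N ->
  (neumann_eigenvalue U n < x)%E ->
  exists2 L, (L%:E < x)%E & spectral_bound (region U) (cst 1) n L.
Proof.
move=> oU n0 /ereal_inf_lt[_ [u [hu indep] <-] supx]; have mU := measurable_region oU.
have s0 := rayleigh_sup_ge0 n0 hu; set s := ereal_sup _ in s0 supx.
have fs : s \is a fin_num by rewrite ge0_fin_numE// (lt_le_trans supx)// leey.
exists (fine s); first by rewrite fineK.
split; first exact: fine_ge0.
exists u; split=> // c c0; have [u1 [u2 hw]] := W12_gradients hu.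
have [[[mf _] _ _ _] fin _] := @W12_lin_comb R U oU (cst 1) (@mone U) (fun _ _ => ler01) n c _ _ _ hw.
have pos : 0 < \int[@area R]_(p in region U) (lin_comb c u p ^+ 2 * cst 1 p).
  rewrite lt_neqAle; apply/andP; split; last first.
    by apply: Rintegral_ge0 => p _; rewrite mulr_ge0 ?sqr_ge0.
  rewrite eq_sym; apply/eqP => /(sqr_integral_eq0 mU mf (@mone U) (fun _ _ => ltr01) fin).
  by move=> /indep h; case: c0 => i; rewrite h eqxx.
split=> // g1 g2 hg; rewrite -ler_pdivrMr// -lee_fin fineK//.
apply: ereal_sup_ubound; exists c, g1, g2; split=> //.
by congr (_ / _)%:E; apply: eq_Rintegral => p _; rewrite mulr1.
Qed.

(** * Conformal invariance of the bounds *)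

Section conformal.
Variables (U : set R[i]) (F G chi : R[i] -> R[i]).
Hypotheses (oU : copen U) (hF : hol U F G).
Hypothesis chiK : forall z, U z -> chi (F z) = z.
Variable h : R * R -> R.
Let V := F @` U.
Hypotheses (mh : measurable_fun (region V : set (MR * MR)) h)
  (h0 : forall p, region V p -> 0 <= h p).

Let oV : copen V. Proof. exact: univalent_copen oU hF chiK. Qed.

Definition pull_weight p := h (plane F p) * nc (G (toC p)) ^+ 2.

Lemma sqr_integral_comp f : measurable_fun (region V : set (MR * MR)) f ->
  (\int[@area R]_(p in region U) (f (plane F p) ^+ 2 * pull_weight p)%:E)%E =
  (\int[@area R]_(p in region V) (f p ^+ 2 * h p)%:E)%E.
Proof.
move=> mf; rewrite (change_of_variables_signed oU hF chiK); last first.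
  by apply/measurable_EFinP; apply: measurable_funM => //; exact: measurable_funX.
by apply: eq_integral => p _; rewrite -EFinM /pull_weight mulrA.
Qed.

Lemma W12_comp u u1 u2 : W12 (region V) h u u1 u2 -> exists v1 v2,
  W12 (region U) pull_weight (fun p => u (plane F p)) v1 v2 /\
  dirichlet (region U) v1 v2 = dirichlet (region V) u1 u2.
Proof.
move=> [wu su du]; have := weak_gradient_comp oU hF chiK wu.
set v1 := (X in weak_gradient _ _ X _); set v2 := (X in weak_gradient _ _ _ X) => wv.
have [[mu _] [mu1 _] [mu2 _] _] := wu.
have e : (\int[@area R]_(p in region U) (v1 p ^+ 2 + v2 p ^+ 2)%:E)%E =
    (\int[@area R]_(p in region V) (u1 p ^+ 2 + u2 p ^+ 2)%:E)%E.
  rewrite [RHS](change_of_variables_signed oU hF chiK); last first.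
    by apply/measurable_EFinP; apply: measurable_funD; exact: measurable_funX.
  apply: eq_integral => p _; rewrite -EFinM; congr (_%:E); rewrite /v1 /v2 sqr_nc ReM /=.
  by ring.
exists v1, v2; split; last by rewrite /dirichlet /Rintegral e.
by split; [|rewrite sqr_integral_comp|rewrite e].
Qed.

Lemma spectral_bound_comp n L : spectral_bound (region V) h n L ->
  spectral_bound (region U) pull_weight n L.
Proof.
move=> [L0 [u [hu hL]]]; split=> //.
exists (fun i p => u i (plane F p)); split.
  move=> i; have [g1 [g2 /W12_comp[v1 [v2 [hv _]]]]] := hu i.
  by exists v1, v2.
move=> c c0; have [pos le] := hL c c0; have [u1 [u2 hw]] := W12_gradients hu.
have hc := @W12_lin_comb R V oV h mh h0 n c _ _ _ hw.
have [[[mf _] _ _ _] fin _] := hc.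
have -> : \int[@area R]_(p in region U) (lin_comb c (fun i p => u i (plane F p)) p ^+ 2 * pull_weight p)
    = \int[@area R]_(p in region V) (lin_comb c u p ^+ 2 * h p).
  by rewrite /Rintegral -sqr_integral_comp.
split=> // g1 g2 [wg _ _]; have [v1 [v2 [[wv _ _] dv]]] := W12_comp hc.
by rewrite (dirichlet_unique oU wg wv) dv; apply: le hc.
Qed.

End conformal.
End spectral.

(** * Finiteness of the eigenvalues *)

Section finiteness.
Variable R : realType.
Local Notation MR := (measurableTypeR R).
Implicit Types (U : set R[i]) (f g h k : R * R -> R) (n : nat) (a b c d L : R).

Lemma sqr_sum_disjoint n (x : 'I_n -> R) : (forall i j, i != j -> x i * x j = 0) ->
  (\sum_i x i) ^+ 2 = \sum_i x i ^+ 2.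
Proof.
move=> x0; rewrite expr2 mulr_suml; apply: eq_bigr => i _.
rewrite mulr_sumr (bigD1 i)//= big1 ?addr0 ?expr2// => j ji.
by rewrite x0// eq_sym.
Qed.

Lemma bump_gt0 a b c d (p : R * R) : a < p.1 < b -> c < p.2 < d -> 0 < bump a b c d 1 p.
Proof.
have pos t : 0 < t -> 0 < flat 1 (1 * t).
  by move=> t0; rewrite /flat mul1r t0 hornerC mul1r expR_gt0.
move=> /andP[h1 h2] /andP[h3 h4].
by rewrite /bump !mulr_gt0// pos// subr_gt0.
Qed.

Lemma integrable_sqr_test U f : copen U -> test_function (region U) f ->
  (@area R).-integrable (region U) (EFin \o (fun p => f p ^+ 2)).
Proof.
move=> oU tf; have lf := locally_integrable2_cont oU (Ck_cont (tf.1 0%N)).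
by have := test_integrable oU lf tf; under eq_fun do rewrite -expr2.
Qed.

Lemma dirichletE U f g : copen U ->
  (@area R).-integrable (region U) (EFin \o (fun p => f p ^+ 2)) ->
  (@area R).-integrable (region U) (EFin \o (fun p => g p ^+ 2)) ->
  dirichlet (region U) f g =
    \int[@area R]_(p in region U) (f p ^+ 2) + \int[@area R]_(p in region U) (g p ^+ 2).
Proof. by move=> oU i1 i2; rewrite -RintegralD//; exact: measurable_region. Qed.

Lemma test_W12 U f : copen U -> test_function (region U) f ->
  W12 (region U) (cst 1) f ('D_(1, 0) f) ('D_(0, 1) f).
Proof.
move=> oU tf; have [t1 t2] := test_derive tf; have mU := measurable_region oU.
have i0 := integrable_sqr_test oU tf.
have i1 := integrable_sqr_test oU t1; have i2 := integrable_sqr_test oU t2.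
split; first exact: weak_gradient_smooth tf.1.
  have /integrableP[_] := i0; apply: le_lt_trans.
  rewrite le_eqVlt; apply/orP; left; apply/eqP; apply: eq_integral => p _ /=.
  by rewrite mulr1 ger0_norm// sqr_ge0.
have /integrableP[_] := integrableD mU i1 i2; apply: le_lt_trans.
rewrite le_eqVlt; apply/orP; left; apply/eqP; apply: eq_integral => p _ /=.
by rewrite ger0_norm// addr_ge0// sqr_ge0.
Qed.

Lemma bump_integral_gt0 U a b c d : copen U -> a < b -> c < d ->
  (forall z, rcl a b c d z -> U z) ->
  0 < \int[@area R]_(p in region U) (bump a b c d 1 p ^+ 2 * cst 1 p).
Proof.
move=> oU ab cd QU; have mU := measurable_region oU.
have tb : test_function (region U) (bump a b c d 1) by exact: bump_test.
have [[[mb _] _ _ _] fin _] := test_W12 oU tb.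
have m1 : measurable_fun (region U : set (MR * MR)) (cst 1 : R * R -> R) by exact: measurable_cst.
rewrite lt_neqAle; apply/andP; split; last first.
  by apply: Rintegral_ge0 => p _; rewrite mulr_ge0 ?sqr_ge0.
rewrite eq_sym; apply/eqP => /(sqr_integral_eq0 mU mb m1 (fun _ _ => ltr01) fin).
pose a' := (a + b) / 2; pose c' := (c + d) / 2.
move=> neg; have : (@area R).-negligible (cell a a' c c').
  apply: negligibleS neg => p /cellP/andP[/andP[h1 h2] /andP[h3 h4]] /= h.
  have pb : p.1 < b by apply: le_lt_trans h2 _; rewrite /a'; lra.
  have pd : p.2 < d by apply: le_lt_trans h4 _; rewrite /c'; lra.
  have := @bump_gt0 a b c d p; rewrite h1 pb h3 pd => /(_ isT isT).
  rewrite h ?ltxx//; apply: QU; rewrite /rcl /= !ltW//.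
move/(negligibleP _ (measurable_cell a a' c c')).
have aa' : a <= a' by rewrite /a'; lra.
have cc' : c <= c' by rewrite /c'; lra.
rewrite [X in X = _](area_cell aa' cc') => /eqP; rewrite eqe mulf_eq0 /a' /c'.
by move=> /orP[|] /eqP; lra.
Qed.

(* Bumps with disjoint supports diagonalize both quadratic forms. *)
Lemma spectral_bound_exists U n : copen U -> U !=set0 ->
  exists L, spectral_bound (region U) (cst 1) n L.
Proof.
move=> oU [p Up]; have [s s0 sU] := copen_sqr oU Up; have mU := measurable_region oU.
(* A square of side [2 s] holds [n] strips of width [w] separated by gaps of width [w]; the gaps
   make even the closed supports disjoint. *)
pose w := s / n.+1%:R.
have w0 : 0 < w by rewrite divr_gt0.
pose A i := Re p - s + (2 * i)%:R * w; pose B i := A i + w.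
pose c := Im p - s; pose d := Im p + s.
have cd : c < d by rewrite /c /d; lra.
have AB i : A i < B i by rewrite /B ltrDl.
have AB_U (i : 'I_n) z : rcl (A i) (B i) c d z -> U z.
  move=> /andP[/andP[h1 h2] h3]; apply: sU; rewrite /sqr_cl /rcl h3 andbT.
  have hA : Re p - s <= A i by rewrite lerDl mulr_ge0// ltW.
  have hB : B i <= Re p + s.
    rewrite /B /A -[X in _ + X]mul1r -!addrA lerD2l -mulrDl.
    have : ((2 * i)%:R + 1) * w <= 2 * s.
      have -> : s = n.+1%:R * w by rewrite /w mulrC divfK// pnatr_eq0.
      rewrite mulrA ler_pM2r// -natr1 natrM.
      have : (i%:R : R) <= n%:R by rewrite ler_nat ltnW.
      by lra.
    by lra.
  by rewrite (le_trans hA h1) (le_trans h2 hB).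
pose u (i : 'I_n) := bump (A i) (B i) c d 1.
have tu i : test_function (region U) (u i) by apply: bump_test => // z; exact: AB_U.
pose K (i : 'I_n) : set (R * R) := `[A i, B i] `*` `[c, d].
have disj i j : i != j -> forall q, ~ (K i q /\ K j q).
  have lt (k l : 'I_n) q : (k < l)%N -> ~ (K k q /\ K l q).
    move=> kl [[/= + _] [/= + _]]; rewrite !in_itv/= => /andP[_ h1] /andP[h2 _].
    have : A l <= B k by exact: le_trans h2 h1.
    have : ((2 * k)%:R + 2) * w <= (2 * l)%:R * w.
      by rewrite ler_pM2r// -natrD ler_nat -[X in (_ + X <= _)%N]muln1 -mulnDr leq_mul2l addn1.
    by rewrite /B /A; lra.
  move=> ij q; have [k|k|/val_inj e] := ltngtP i j; [exact: lt| |by rewrite e eqxx in ij].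
  by move=> [h1 h2]; exact: (lt _ _ q k).
have u0 i q : ~ K i q -> [/\ u i q = 0, 'D_(1, 0) (u i) q = 0 & 'D_(0, 1) (u i) q = 0].
  have u0 r : ~ K i r -> u i r = 0.
    move=> nK; apply: bump_out => // -[/=]; rewrite !in_itv/= => /andP[/ltW h1 /ltW h2] /andP[/ltW h3 /ltW h4].
    by apply: nK; split; rewrite /= in_itv/= ?h1 ?h3.
  move=> nK; have cK : compact (K i) by exact: compact_box.
  by have [e1 e2] := derive_out cK ((tu i).1 1%N) u0 nK; rewrite u0.
pose X i := \int[@area R]_(q in region U) (u i q ^+ 2 * cst 1 q).
pose Y i := dirichlet (region U) ('D_(1, 0) (u i)) ('D_(0, 1) (u i)).
have X0 i : 0 < X i by apply: bump_integral_gt0 => // z; exact: AB_U.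
have Y0 i : 0 <= Y i by exact: dirichlet_ge0.
(* The largest of the quotients [Y i / X i] bounds the Rayleigh quotients on the span; their sum is
   a convenient upper bound of it. *)
exists (\sum_i Y i / X i); split; first by apply: sumr_ge0 => i _; rewrite divr_ge0// ltW.
exists u; split.
  by move=> i; exists ('D_(1, 0) (u i)), ('D_(0, 1) (u i)); exact: test_W12.
move=> v v0.
have quad (e : 'I_n -> R * R -> R) : (forall i, test_function (region U) (e i)) ->
    (forall i q, ~ K i q -> e i q = 0) ->
    \int[@area R]_(q in region U) (lin_comb v e q ^+ 2) =
    \sum_i v i ^+ 2 * \int[@area R]_(q in region U) (e i q ^+ 2) /\
    (@area R).-integrable (region U) (EFin \o (fun q => lin_comb v e q ^+ 2)).
  move=> te e0.
  have E q : lin_comb v e q ^+ 2 = \sum_i v i ^+ 2 * e i q ^+ 2.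
    rewrite /lin_comb sqr_sum_disjoint; first by apply: eq_bigr => i _; rewrite exprMn.
    move=> i j ij; have [Kq|/e0 ->] := pselect (K i q); last by rewrite mulr0 mul0r.
    by rewrite (e0 j) ?mulr0// => Kj; exact: (disj _ _ ij q).
  under eq_Rintegral do rewrite E; under [X in EFin \o X]eq_fun do rewrite E.
  elim: (index_enum _) => [|i l [ih1 ih2]].
    by under eq_Rintegral do rewrite big_nil; under [X in EFin \o X]eq_fun do rewrite big_nil;
      rewrite big_nil; split; [rewrite /Rintegral integral0|exact: integrable0].
  under eq_Rintegral do rewrite big_cons; under [X in EFin \o X]eq_fun do rewrite big_cons.
  have ii := integrable_sqr_test oU (te i).
  have iz : (@area R).-integrable (region U) (EFin \o (fun q => v i ^+ 2 * e i q ^+ 2)).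
    by have := integrableZl mU (v i ^+ 2) ii; under eq_fun do rewrite -EFinM.
  rewrite big_cons RintegralD// RintegralZl// ih1; split=> //.
  by have := integrableD mU iz ih2; under eq_fun do rewrite -EFinD.
have [qu iu] := quad u tu (fun i q nK => let: And3 h _ _ := u0 i q nK in h).
have [q1 i1] := quad _ (fun i => (test_derive (tu i)).1) (fun i q nK => let: And3 _ h _ := u0 i q nK in h).
have [q2 i2] := quad _ (fun i => (test_derive (tu i)).2) (fun i q nK => let: And3 _ _ h := u0 i q nK in h).
have XE : \int[@area R]_(q in region U) (lin_comb v u q ^+ 2 * cst 1 q) = \sum_i v i ^+ 2 * X i.
  transitivity (\int[@area R]_(q in region U) (lin_comb v u q ^+ 2)).
    by apply: eq_Rintegral => q _; rewrite mulr1.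
  rewrite qu; apply: eq_bigr => i _; congr (_ * _).
  by apply: eq_Rintegral => q _; rewrite mulr1.
have YE : dirichlet (region U) (lin_comb v (fun i => 'D_(1, 0) (u i))) (lin_comb v (fun i => 'D_(0, 1) (u i)))
    = \sum_i v i ^+ 2 * Y i.
  apply: etrans (dirichletE oU i1 i2) _; apply: etrans (f_equal2 +%R q1 q2) _.
  apply: etrans (esym (big_split _ _ _ _ _)) _; apply: eq_bigr => i _.
  have [t1 t2] := test_derive (tu i); apply: etrans (esym (mulrDr _ _ _)) _.
  apply: (congr1 (fun t => v i ^+ 2 * t)).
  exact: esym (dirichletE oU (integrable_sqr_test oU t1) (integrable_sqr_test oU t2)).
rewrite XE; split.
  have [j vj] := v0; have v2 : 0 < v j ^+ 2 by rewrite lt_def sqrf_eq0 vj sqr_ge0.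
  rewrite (bigD1 j)//=; apply: ltr_pwDl; first by rewrite mulr_gt0.
  by apply: sumr_ge0 => i _; rewrite mulr_ge0 ?sqr_ge0// ltW.
move=> g1 g2 [wg _ _].
have [wu _ _] := W12_lin_comb oU (@measurable_cst _ _ _ _ _ _ : measurable_fun (region U : set (MR * MR)) (cst 1 : R * R -> R))
  (fun _ _ => ler01) v (fun i => test_W12 oU (tu i)).
rewrite (dirichlet_unique oU wg wu) YE mulr_sumr; apply: ler_sum => i _.
rewrite mulrCA ler_wpM2l ?sqr_ge0// -ler_pdivrMr// (bigD1 i)//= lerDl.
by apply: sumr_ge0 => j _; rewrite divr_ge0// ltW.
Qed.

End finiteness.

(** * Square-integrable functions for an integrable weight *)

Section weighted.
Variable R : realType.
Local Notation MR := (measurableTypeR R).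
Variables (D : set (MR * MR)) (mD : measurable D).
Variable h : R * R -> R.
Hypotheses (mh : measurable_fun D (h : MR * MR -> R)) (h0 : forall p, D p -> 0 <= h p).
Hypothesis hoo : (\int[@area R]_(p in D) (h p)%:E < +oo)%E.
Implicit Types f : R * R -> R.

Lemma integrable_weight : (@area R).-integrable D (EFin \o h).
Proof.
apply/integrableP; split; first exact/measurable_EFinP.
apply: le_lt_trans hoo; rewrite le_eqVlt; apply/orP; left; apply/eqP.
by apply: eq_integral => p /set_mem Dp /=; rewrite ger0_norm// h0.
Qed.

Lemma integrable_sqr_weight f : measurable_fun D (f : MR * MR -> R) ->
  (\int[@area R]_(p in D) (f p ^+ 2 * h p)%:E < +oo)%E ->
  (@area R).-integrable D (EFin \o (fun p => f p ^+ 2 * h p)).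
Proof.
move=> mf fin; apply/integrableP; split.
  by apply/measurable_EFinP; apply: measurable_funM => //; exact: measurable_funX.
apply: le_lt_trans fin; rewrite le_eqVlt; apply/orP; left; apply/eqP.
by apply: eq_integral => p /set_mem Dp /=; rewrite ger0_norm// mulr_ge0 ?sqr_ge0// h0.
Qed.

(** Since [|f| <= f^2 + 1] and the weight is integrable, [f h] is dominated by [f^2 h + h]. *)
Lemma integrable_mul_weight f : measurable_fun D (f : MR * MR -> R) ->
  (\int[@area R]_(p in D) (f p ^+ 2 * h p)%:E < +oo)%E ->
  (@area R).-integrable D (EFin \o (fun p => f p * h p)).
Proof.
move=> mf fin; have i2 := integrable_sqr_weight mf fin; have i0 := integrable_weight.
apply: (le_integrable mD _ _ (integrableD mD i2 i0)).
  by apply/measurable_EFinP; exact: measurable_funM.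
move=> p Dp /=; have hp := h0 Dp; rewrite lee_fin normrM (ger0_norm hp).
rewrite [leRHS]ger0_norm; last by rewrite addr_ge0// mulr_ge0// sqr_ge0.
rewrite -[X in _ + X]mul1r -mulrDl ler_wpM2r//.
have : 0 <= (`|f p| - 1) ^+ 2 by exact: sqr_ge0.
rewrite -(real_normK (num_real (f p))) => e.
by have := normr_ge0 (f p); nra.
Qed.

Lemma weighted_sqr_expand f (c : R) : measurable_fun D (f : MR * MR -> R) ->
  (\int[@area R]_(p in D) (f p ^+ 2 * h p)%:E < +oo)%E ->
  \int[@area R]_(p in D) ((f p + c) ^+ 2 * h p) =
  \int[@area R]_(p in D) (f p ^+ 2 * h p) +
  2 * c * \int[@area R]_(p in D) (f p * h p) + c ^+ 2 * \int[@area R]_(p in D) h p.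
Proof.
move=> mf fin; have i2 := integrable_sqr_weight mf fin; have i0 := integrable_weight.
have i1 := integrable_mul_weight mf fin.
have Z (e : R * R -> R) (k : R) : (@area R).-integrable D (EFin \o e) ->
    (@area R).-integrable D (EFin \o (fun p => k * e p)).
  by move=> ie; have := integrableZl mD k ie; under eq_fun do rewrite -EFinM.
have i3 := Z _ (2 * c) i1; have i4 := Z _ (c ^+ 2) i0.
have i5 : (@area R).-integrable D (EFin \o (fun p => f p ^+ 2 * h p + 2 * c * (f p * h p))).
  by have := integrableD mD i2 i3; under eq_fun do rewrite -EFinD.
transitivity (\int[@area R]_(p in D) (f p ^+ 2 * h p + 2 * c * (f p * h p) + c ^+ 2 * h p)).
  by apply: eq_Rintegral => p _; ring.
apply: etrans (RintegralD mD i5 i4) _; apply: f_equal2; last exact: RintegralZl.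
apply: etrans (RintegralD mD i2 i3) _; apply: f_equal2 => //; exact: RintegralZl.
Qed.

Lemma weighted_lin_comb n (c : 'I_n -> R) (u : 'I_n -> R * R -> R) :
  (forall i, measurable_fun D (u i : MR * MR -> R)) ->
  (forall i, (\int[@area R]_(p in D) (u i p ^+ 2 * h p)%:E < +oo)%E) ->
  \int[@area R]_(p in D) (lin_comb c u p * h p) =
  \sum_i c i * \int[@area R]_(p in D) (u i p * h p).
Proof.
move=> mu fin.
suff H l : \int[@area R]_(p in D) ((\sum_(i <- l) c i * u i p) * h p) =
    \sum_(i <- l) c i * \int[@area R]_(p in D) (u i p * h p) /\
    (@area R).-integrable D (EFin \o (fun p => (\sum_(i <- l) c i * u i p) * h p)).
  exact: (H _).1.
elim: l => [|i l [ih1 ih2]].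
  by under eq_Rintegral do rewrite big_nil mul0r; under [X in EFin \o X]eq_fun do rewrite big_nil mul0r;
    rewrite big_nil; split; [rewrite /Rintegral integral0|exact: integrable0].
under eq_Rintegral do rewrite big_cons mulrDl -mulrA.
under [X in EFin \o X]eq_fun do rewrite big_cons mulrDl -mulrA.
have ii := integrable_mul_weight (mu i) (fin i).
have iz : (@area R).-integrable D (EFin \o (fun q => c i * (u i q * h q))).
  by have := integrableZl mD (c i) ii; under eq_fun do rewrite -EFinM.
rewrite big_cons (RintegralD mD iz ih2) (RintegralZl _ mD ii) ih1; split=> //.
by have := integrableD mD iz ih2; under eq_fun do rewrite -EFinD.
Qed.

End weighted.

(** * Comparison of two weights *)

Section comparison.
Variable R : realType.
Local Notation MR := (measurableTypeR R).
Variable W : set R[i].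
Hypothesis oW : copen W.
Let D : set (MR * MR) := region W.
Let mD : measurable D := measurable_region oW.
Implicit Types (f g h k : R * R -> R) (B L : R).

Definition weight h := [/\ measurable_fun D (h : MR * MR -> R), forall p, D p -> 0 < h p,
  (\int[@area R]_(p in D) (h p)%:E < +oo)%E & 0 < \int[@area R]_(p in D) h p].

(** The mean is subtracted because the Dirichlet integral does not see constants; it is the mean for
    [h], so the relation is not symmetric in the weights and is assumed in both directions below. *)
Definition close_weights B h k := forall f g1 g2, W12 D h f g1 g2 ->
  (\int[@area R]_(p in D) ((f p - weighted_mean D h f) ^+ 2 * `|h p - k p|)%:E <=
    (B * dirichlet D g1 g2)%:E)%E.

Lemma W12_cst h (c : R) : weight h -> W12 D h (fun=> c) (fun=> 0) (fun=> 0).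
Proof.
move=> [mh h0 hoo _]; split; first exact: weak_gradient_cst.
  rewrite (_ : (fun p : R * R => _) = (fun p => (c ^+ 2)%:E * (h p)%:E)%E)//.
  rewrite ge0_integralZl//; last by rewrite lee_fin sqr_ge0.
  - by rewrite lte_mul_pinfty// lee_fin sqr_ge0.
  - exact/measurable_EFinP.
  - by move=> p Dp; rewrite lee_fin ltW// h0.
by under eq_integral do rewrite expr0n addr0; rewrite integral0.
Qed.

(** From [k <= h + |h - k|], [f - m] is square-integrable for [k]; the constant [m] is added back
    since [k] is integrable. *)
Lemma W12_close B h k f g1 g2 : weight h -> weight k -> close_weights B h k ->
  W12 D h f g1 g2 -> W12 D k f g1 g2.
Proof.
move=> wh wk cl hf; have [mh h0 hoo _] := wh; have [mk k0 koo _] := wk.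
have lt := cl _ _ _ hf; set m := weighted_mean D h f in lt.
have hfm := W12D oW mh (fun p Dp => ltW (h0 p Dp)) hf (W12_cst (- m) wh).
have [wg fin dg] := hf; have [[[mfm _] _ _ _] finm _] := hfm.
split=> //; have [[mf _] _ _ _] := wg.
rewrite (_ : (fun p : R * R => (f p ^+ 2 * k p)%:E) = (fun p => ((f p - m + m) ^+ 2 * k p)%:E)); last first.
  by apply/funext => p; rewrite subrK.
apply: (@sqr_integrableD R W oW (fun p => f p - m) (fun=> m) k mfm) => //.
- by move=> p Dp; rewrite ltW// k0.
- apply: (@le_lt_trans _ _ (\int[@area R]_(p in D) (((f p - m) ^+ 2 * h p)%:E + ((f p - m) ^+ 2 * `|h p - k p|)%:E))%E).
    apply: ge0_le_integral => //.
    + by move=> p Dp; rewrite lee_fin mulr_ge0 ?sqr_ge0// ltW// k0.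
    + by apply/measurable_EFinP; apply: measurable_funM => //; exact: measurable_funX.
    + apply: emeasurable_funD; apply/measurable_EFinP; apply: measurable_funM => //; try exact: measurable_funX.
      by apply: measurableT_comp => //; exact: measurable_funB.
    + move=> p Dp; rewrite -EFinD lee_fin -mulrDr ler_wpM2l ?sqr_ge0//.
      by have := ler_norm (k p - h p); rewrite distrC; lra.
  rewrite ge0_integralD//.
  + by rewrite lte_add_pinfty//; apply: le_lt_trans lt _; rewrite ltry.
  + by move=> p Dp; rewrite lee_fin mulr_ge0 ?sqr_ge0// ltW// h0.
  + by apply/measurable_EFinP; apply: measurable_funM => //; exact: measurable_funX.
  + by move=> p Dp; rewrite lee_fin mulr_ge0 ?sqr_ge0.
  + apply/measurable_EFinP; apply: measurable_funM => //; first exact: measurable_funX.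
    by apply: measurableT_comp => //; exact: measurable_funB.
by have [_ fm _] := W12_cst m wk.
Qed.

Lemma weights_triangle h k f (b : R) : weight h -> weight k -> measurable_fun D (f : MR * MR -> R) ->
  (\int[@area R]_(p in D) (f p ^+ 2 * h p)%:E < +oo)%E ->
  (\int[@area R]_(p in D) (f p ^+ 2 * k p)%:E < +oo)%E ->
  (\int[@area R]_(p in D) (f p ^+ 2 * `|k p - h p|)%:E <= b%:E)%E ->
  \int[@area R]_(p in D) (f p ^+ 2 * h p) <= \int[@area R]_(p in D) (f p ^+ 2 * k p) + b.
Proof.
move=> [mh h0 _ _] [mk k0 _ _] mf fh fk fb.
have ih := integrable_sqr_weight mh (fun p Dp => ltW (h0 p Dp)) mf fh.
have ik := integrable_sqr_weight mk (fun p Dp => ltW (k0 p Dp)) mf fk.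
have md : measurable_fun D ((fun p => `|k p - h p|) : MR * MR -> R).
  by apply: measurableT_comp => //; exact: measurable_funB.
have id := integrable_sqr_weight md (fun p _ => normr_ge0 _) mf (le_lt_trans fb (ltry _)).
have isum := integrableD mD ik id.
apply: (@le_trans _ _ (\int[@area R]_(p in D) (f p ^+ 2 * k p + f p ^+ 2 * `|k p - h p|))).
  apply: (le_Rintegral mD ih isum) => p Dp; rewrite -mulrDr ler_wpM2l ?sqr_ge0//.
  by have := ler_norm (h p - k p); rewrite distrC; lra.
rewrite (RintegralD mD ik id) lerD2l -lee_fin fineK//.
exact: (integrable_fin_num mD id).
Qed.

(** Here [x] is the Dirichlet integral, [s] the squared norm for the old weight and [N] that for the
    new one; eliminating [s] gives the new bound [L / (1 - B L)]. *)
Lemma comparison_arith B L (x s N : R) : 0 <= B -> 0 <= L -> B * L < 1 -> x <= L * s ->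
  s <= N + B * x -> 0 < s -> 0 < N /\ x <= L / (1 - B * L) * N.
Proof.
move=> B0 L0 BL xs sN s0; have t0 : 0 < 1 - B * L by rewrite subr_gt0.
have h : B * x <= B * L * s by rewrite -mulrA ler_wpM2l.
have sN' : (1 - B * L) * s <= N by rewrite mulrBl mul1r; lra.
split; first by apply: lt_le_trans sN'; exact: mulr_gt0.
apply: le_trans xs _; rewrite -mulrA ler_wpM2l//.
by rewrite mulrC ler_pdivlMr// mulrC.
Qed.

(** Expanded squares for two facts: if [f] has [h]-mean zero, subtracting [m] can only increase its
    [h]-norm; and the [k]-norm of [f + c] is least when [- c] is the [k]-mean [m]. Both changes of
    constant go in the favourable direction. *)
Lemma mean_arith (s m H S K c b : R) : 0 <= H -> 0 <= K ->
  s + 2 * - m * 0 + (- m) ^+ 2 * H <= S + 2 * - m * (m * K) + (- m) ^+ 2 * K + b ->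
  s <= S + 2 * c * (m * K) + c ^+ 2 * K + b.
Proof.
move=> H0 K0; have h1 : 0 <= (c + m) ^+ 2 * K by rewrite mulr_ge0 ?sqr_ge0.
have h2 : 0 <= m ^+ 2 * H by rewrite mulr_ge0 ?sqr_ge0.
by rewrite sqrrN; nra.
Qed.

(* The test space for [k] is spanned by [1], in the place of some [u j], and by
   the [u i] corrected by a multiple of [u j] so that their [h]-means vanish. *)
Lemma spectral_bound_close B h k n L : (0 < n)%N -> 0 <= B -> weight h -> weight k ->
  close_weights B h k -> close_weights B k h -> B * L < 1 ->
  spectral_bound D h n L -> spectral_bound D k n (L / (1 - B * L)).
Proof.
case: n => // n _ B0 wh wk chk ckh BL [L0 [u [hu hL]]].
have [mh h0 hoo hpos] := wh; have [mk k0 koo kpos] := wk.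
have h0' p : D p -> 0 <= h p by move=> Dp; rewrite ltW// h0.
have k0' p : D p -> 0 <= k p by move=> Dp; rewrite ltW// k0.
have [u1 [u2 hw]] := W12_gradients hu.
pose M i := \int[@area R]_(p in D) (u i p * h p).
(* [j] is an index with nonzero mean. If all means vanish, no correction is called for and index 0
   with [t = 0] serves. *)
have [j [t ht]] : exists j : 'I_n.+1, exists t : 'I_n.+1 -> R, forall i, M i = t i * M j.
  have [[j Mj]|none] := pselect (exists j, M j != 0).
    by exists j, (fun i => M i / M j) => i; rewrite divfK.
  exists ord0, (fun=> 0) => i; rewrite mul0r; apply/eqP/negP => /negP Mi.
  by apply: none; exists i.
pose v i : R * R -> R := if i == j then fun=> 1 else fun p => u i p + - t i * u j p.
have t0 : 0 < 1 - B * L by rewrite subr_gt0.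
split; first by rewrite divr_ge0// ltW.
exists v; split.
  move=> i; rewrite /v; case: ifP => _.
    by exists (fun=> 0), (fun=> 0); exact: W12_cst.
  exists (fun p => u1 i p + - t i * u1 j p), (fun p => u2 i p + - t i * u2 j p).
  by apply: (W12_close wh wk chk); apply: W12D => //; exact: W12Z.
(* The coordinates in [u] of the nonconstant part [f] of the combination of the [v i]; the
   coefficient of the constant is [c j]. *)
move=> c c0; pose c' i := if i == j then - (\sum_(l | l != j) c l * t l) else c i.
pose f := lin_comb c' u.
have vE : lin_comb c v = fun p => f p + c j.
  apply/funext => p; rewrite /f /lin_comb (bigD1 j)//= [in RHS](bigD1 j)//= /v /c' eqxx mulr1.
  rewrite addrC; congr (_ + _); rewrite mulNr mulr_suml -sumrN -big_split/=.
  by apply: eq_bigr => i /negPf ->; ring.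
have hf : W12 D h f (lin_comb c' u1) (lin_comb c' u2) by exact: W12_lin_comb.
have kf : W12 D k f (lin_comb c' u1) (lin_comb c' u2) by exact: (W12_close wh wk chk).
have [[[mf _] _ _ _] hfin _] := hf; have [wf kfin _] := kf.
have I2 : \int[@area R]_(p in D) (f p * h p) = 0.
  rewrite (weighted_lin_comb mD mh h0' hoo); last 2 first.
  - by move=> i; have [[[]]] := hw i.
  - by move=> i; have [_] := hw i.
  rewrite (bigD1 j)//= /c' eqxx -/(M j) mulNr mulr_suml -sumrN -big_split/=.
  by apply: big1 => i /negPf ->; rewrite -/(M i) (ht i); ring.
pose X := dirichlet D (lin_comb c' u1) (lin_comb c' u2).
pose m := weighted_mean D k f.
have dX g1 g2 : W12 D k (lin_comb c v) g1 g2 -> dirichlet D g1 g2 = X.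
  move=> [wg _ _]; have [wf' _ _] := W12D oW mk k0' kf (W12_cst (c j) wk).
  rewrite -vE in wf'; rewrite (dirichlet_unique oW wg wf') /X.
  by apply: eq_Rintegral => p _; rewrite !addr0.
have NE : \int[@area R]_(p in D) (lin_comb c v p ^+ 2 * k p) =
    \int[@area R]_(p in D) ((f p + c j) ^+ 2 * k p) by rewrite vE.
have mkE : \int[@area R]_(p in D) (f p * k p) = m * \int[@area R]_(p in D) k p.
  by rewrite /m /weighted_mean mulrAC mulVf ?mul1r// gt_eqF.
have [[i0 c'i]|none] := pselect (exists i, c' i != 0).
  have [S0 /(_ _ _ hf) SL] := hL c' (ex_intro _ i0 c'i).
  have kc := ckh _ _ _ kf; rewrite -/m in kc.
  have fm : \int[@area R]_(p in D) ((f p + - m) ^+ 2 * h p) <=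
      \int[@area R]_(p in D) ((f p + - m) ^+ 2 * k p) + B * X.
    have [[[mfm _] _ _ _] hm _] := W12D oW mh h0' hf (W12_cst (- m) wh).
    have [_ km _] := W12D oW mk k0' kf (W12_cst (- m) wk).
    exact: weights_triangle.
  rewrite (weighted_sqr_expand mD mh h0' hoo _ mf hfin) I2 in fm.
  rewrite (weighted_sqr_expand mD mk k0' koo _ mf kfin) mkE in fm.
  have [N0 Nle] : 0 < \int[@area R]_(p in D) (lin_comb c v p ^+ 2 * k p) /\
      X <= L / (1 - B * L) * \int[@area R]_(p in D) (lin_comb c v p ^+ 2 * k p).
    apply: (comparison_arith B0 L0 BL SL) => //.
    rewrite NE (weighted_sqr_expand mD mk k0' koo _ mf kfin) mkE.
    exact: mean_arith (ltW hpos) (ltW kpos) fm.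
  by split=> // g1 g2 /dX ->.
(* In the remaining case the combination is a nonzero constant: its norm is positive and its
   Dirichlet integral zero. *)
have c'0 i : c' i = 0 by apply/eqP/negP => /negP ci; apply: none; exists i.
have c0j i : i != j -> c i = 0 by move=> /negPf ij; have := c'0 i; rewrite /c' ij.
have cj : c j != 0.
  by have [i ci] := c0; apply: contraNneq ci => cj; have [->|/c0j ->//] := eqVneq i j; rewrite cj.
have f0 p : f p = 0 by rewrite /f /lin_comb big1// => i _; rewrite c'0 mul0r.
have N0 : 0 < \int[@area R]_(p in D) (lin_comb c v p ^+ 2 * k p).
  have -> : \int[@area R]_(p in D) (lin_comb c v p ^+ 2 * k p) =
      \int[@area R]_(p in D) (c j ^+ 2 * k p).
    by rewrite NE; apply: eq_Rintegral => p _; rewrite f0 add0r.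
  rewrite (RintegralZl _ mD (integrable_weight mk k0' koo)) mulr_gt0//.
  by rewrite lt_def sqrf_eq0 cj sqr_ge0.
split=> // g1 g2 /dX ->; have -> : X = 0.
  have z (w : 'I_n.+1 -> R * R -> R) p : lin_comb c' w p = 0.
    by rewrite /lin_comb big1// => i _; rewrite c'0 mul0r.
  rewrite /X /dirichlet /Rintegral integral0_eq// => p _.
  by rewrite !z expr0n addr0.
by apply: mulr_ge0; [apply: divr_ge0 => //; exact: ltW|exact: ltW].
Qed.

End comparison.

(** * Energy estimate *)

Section hoelder_estimate.
Variable R : realType.
Local Notation MR := (measurableTypeR R).
Implicit Types (f g h k : R * R -> R).

Lemma hoelder_on (D : set (MR * MR)) (A B : MR * MR -> R) (p q : R) : measurable D ->
  measurable_fun D A -> measurable_fun D B ->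
  (forall x, D x -> 0 <= A x) -> (forall x, D x -> 0 <= B x) ->
  0 < p -> 0 < q -> p^-1 + q^-1 = 1 ->
  (\int[@area R]_(x in D) (A x * B x)%:E <=
   (\int[@area R]_(x in D) (A x `^ p)%:E) `^ p^-1 *
   (\int[@area R]_(x in D) (B x `^ q)%:E) `^ q^-1)%E.
Proof.
move=> mD mA mB A0 B0 p0 q0 pq.
have mA' : measurable_fun setT (A \_ D) by exact/(measurable_restrictT A mD).
have mB' : measurable_fun setT (B \_ D) by exact/(measurable_restrictT B mD).
have := hoelder (@area R) mA' mB' p0 q0 pq; rewrite Lnorm1.
have pw (F : MR * MR -> R) r : (forall x, D x -> 0 <= F x) -> 0 < r ->
    (Lnorm (@area R) r%:E (EFin \o (F \_ D)) = (\int[@area R]_(x in D) (F x `^ r)%:E) `^ r^-1)%E.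
  move=> F0 r0; rewrite unlock; suff -> : (\int[@area R]_x `|(EFin \o F \_ D) x| `^ r = \int[@area R]_(x in D) (F x `^ r)%:E)%E by [].
  rewrite [RHS]integral_mkcond; apply: eq_integral => x _ /=; rewrite !patchE.
  by case: ifPn => [/set_mem Dx|_] /=; rewrite ?normr0 ?powR0 ?gt_eqF// ger0_norm// F0.
rewrite !pw//; apply: le_trans; rewrite le_eqVlt; apply/orP; left; apply/eqP.
rewrite [LHS]integral_mkcond; apply: eq_integral => x _ /=; rewrite !patchE.
by case: ifPn => [/set_mem Dx|_]; rewrite ?mul0r ?normr0// ger0_norm// mulr_ge0 ?A0 ?B0.
Qed.

Definition energy_density (alpha a b : R) : R :=
  Num.max (a `^ alpha / b `^ (alpha - 2)) (b `^ alpha / a `^ (alpha - 2)).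

Lemma energy_densityC alpha a b : energy_density alpha a b = energy_density alpha b a.
Proof. by rewrite /energy_density maxC. Qed.

(** With [M] the larger of [a] and [b], [a + b <= 2 M] and [M^2 = a^(2 (alpha - 2) / alpha) (M^alpha
    / a^(alpha - 2))^(2 / alpha)]. The last quotient is below the energy density: it is one of its
    two entries if [M = b], and lowering the denominator to [b^(alpha - 2)] gives the other if
    [M = a]. *)
Lemma sqr_le_energy (alpha a b : R) : 2 < alpha -> 0 < a -> 0 < b ->
  (a + b) ^+ 2 <= 4 * (a `^ (2 * (alpha - 2) / alpha) * energy_density alpha a b `^ (2 / alpha)).
Proof.
move=> al a0 b0; have al0 : 0 < alpha by lra.
pose M := Num.max a b; have M0 : 0 < M by rewrite lt_max a0.
have ab : a + b <= 2 * M.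
  have h1 : a <= M by rewrite le_max lexx.
  have h2 : b <= M by rewrite le_max lexx orbT.
  by lra.
have ME : M `^ alpha / a `^ (alpha - 2) <= energy_density alpha a b.
  rewrite /energy_density le_max /M; have [ab'|ba] := leP a b; first by rewrite lexx orbT.
  apply/orP; left; rewrite ler_pM2l ?powR_gt0// lef_pV2 ?posrE ?powR_gt0//.
  by apply: ge0_ler_powR; rewrite ?nnegrE ?ltW//; lra.
have key : M ^+ 2 <= a `^ (2 * (alpha - 2) / alpha) * energy_density alpha a b `^ (2 / alpha).
  have -> : M ^+ 2 = a `^ (2 * (alpha - 2) / alpha) * (M `^ alpha / a `^ (alpha - 2)) `^ (2 / alpha).
    have na : alpha != 0 by rewrite gt_eqF.
    rewrite powRM ?powR_ge0 ?invr_ge0 ?powR_ge0// -powRrM (_ : alpha * (2 / alpha) = 2); last by field.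
    rewrite powR_mulrn ?ltW// -powRN -powRrM mulrCA -powRD; last first.
      by apply/implyP => _; rewrite gt_eqF.
    by rewrite (_ : 2 * (alpha - 2) / alpha + _ = 0) ?powRr0 ?mulr1//; field.
  rewrite ler_wpM2l ?powR_ge0//; apply: ge0_ler_powR => //.
  - by rewrite divr_ge0// ltW.
  - by rewrite nnegrE divr_ge0 ?powR_ge0.
  - by rewrite nnegrE; apply: le_trans ME; rewrite divr_ge0 ?powR_ge0.
apply: le_trans (_ : (2 * M) ^+ 2 <= _); last by rewrite exprMn -natrX ler_pM2l.
by rewrite lerXn2r// nnegrE ?addr_ge0 ?mulr_ge0 ?ltW.
Qed.

Section disc.
Variable W : set R[i].
Hypothesis oW : copen W.
Let D : set (MR * MR) := region W.
Let mD : measurable D := measurable_region oW.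

(** The infimum of the admissible constants is itself admissible: constants within [d = e / (S + 1)]
    of it change the right-hand side by at most [e]. *)
Lemma poincare_sobolev_le h (q C : R) f g1 g2 :
  (poincare_sobolev_const D h q <= C%:E)%E -> W12 D h f g1 g2 ->
  ((\int[@area R]_(p in D) (`|f p - weighted_mean D h f| `^ q * h p)%:E) `^ q^-1
    <= (C * Num.sqrt (dirichlet D g1 g2))%:E)%E.
Proof.
move=> hC hf; apply/lee_addgt0Pr => e e0.
pose S := Num.sqrt (dirichlet D g1 g2); have S0 : 0 <= S by exact: sqrtr_ge0.
pose d := e / (S + 1); have d0 : 0 < d by rewrite divr_gt0// ltr_wpDl.
have : (poincare_sobolev_const D h q < (C + d)%:E)%E.
  by apply: le_lt_trans hC _; rewrite lte_fin ltrDl.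
move=> /ereal_inf_lt[_ [K [K0 hK] <-]]; rewrite lte_fin => Kd.
apply: le_trans (hK _ _ _ hf) _; rewrite -EFinD lee_fin -/S.
apply: (@le_trans _ _ ((C + d) * S)); first by rewrite ler_wpM2r// ltW.
by rewrite mulrDl lerD2l /d mulrAC ler_pdivrMr ?ltr_wpDl// ler_wpM2l ?ltW ?ltrDl.
Qed.

Variables (a b : R * R -> R) (alpha : R).
Hypotheses (al : 2 < alpha).
Hypotheses (ma : measurable_fun D (a : MR * MR -> R)) (mb : measurable_fun D (b : MR * MR -> R)).
Hypotheses (a0 : forall p, D p -> 0 < a p) (b0 : forall p, D p -> 0 < b p).

(** [step1] is Cauchy-Schwarz applied to [|a^2 - b^2| = (a + b) |a - b|]. [step2] bounds [(a + b)^2]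
    by [sqr_le_energy] and applies Hoelder, which leaves the integral estimated by the
    Poincare-Sobolev inequality for the weight [a^2]. *)
Lemma close_weights_energy (C e d : R) : 0 <= C ->
  (poincare_sobolev_const D (fun p => (a p ^+ 2)%R) (4 * alpha / (alpha - 2)) <= C%:E)%E ->
  ((\int[@area R]_(p in D) (energy_density alpha (a p) (b p))%:E) `^ alpha^-1 = e%:E)%E ->
  ((\int[@area R]_(p in D) (`|a p - b p| ^+ 2)%:E) `^ 2^-1 = d%:E)%E ->
  close_weights W (2 * C ^+ 2 * e * d) (fun p => a p ^+ 2) (fun p => b p ^+ 2).
Proof.
move=> C0 hC eE dE f g1 g2 hf; have al0 : 0 < alpha by exact: lt_trans al.
have al2 : 0 < alpha - 2 by rewrite subr_gt0.
have e0 : 0 <= e by rewrite -lee_fin -eE poweR_ge0.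
have d0 : 0 <= d by rewrite -lee_fin -dE poweR_ge0.
have := poincare_sobolev_le hC hf; set m := weighted_mean _ _ _.
set q := 4 * alpha / (alpha - 2); set S := Num.sqrt _ => hP.
have S0 : 0 <= S by exact: sqrtr_ge0.
have [[[mf _] _ _ _] _ _] := hf.
have mF : measurable_fun D (fun p : MR * MR => f p - m) by exact: measurable_funB.
pose F2 p := (f p - m) ^+ 2.
have mF2 : measurable_fun D (F2 : MR * MR -> R) by exact: measurable_funX.
have F20 p : 0 <= F2 p by exact: sqr_ge0.
have mab : measurable_fun D (fun p : MR * MR => a p + b p) by exact: measurable_funD.
have mdab : measurable_fun D (fun p : MR * MR => `|a p - b p|).
  by apply: measurableT_comp => //; exact: measurable_funB.
(* The exponents [1 / th] and [alpha / 2] are conjugate. *)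
pose th := (alpha - 2) / alpha.
pose A p := F2 p ^+ 2 * a p `^ (2 * (alpha - 2) / alpha).
have A0 p : 0 <= A p by apply: mulr_ge0; [exact: sqr_ge0|exact: powR_ge0].
pose Mx p := energy_density alpha (a p) (b p).
have Mx0 p : 0 <= Mx p by rewrite le_max divr_ge0// powR_ge0.
have mA : measurable_fun D (A : MR * MR -> R).
  apply: measurable_funM; first exact: measurable_funX.
  exact: measurableT_comp (measurable_powR _) ma.
have mdiv (r1 r2 : MR * MR -> R) : measurable_fun D r1 -> measurable_fun D r2 ->
    measurable_fun D (fun p => r1 p `^ alpha / r2 p `^ (alpha - 2)).
  move=> m1 m2; under eq_fun do rewrite -powRN; apply: measurable_funM.
    exact: measurableT_comp (measurable_powR _) m1.
  exact: measurableT_comp (measurable_powR _) m2.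
have mMx : measurable_fun D (Mx : MR * MR -> R).
  by apply: measurable_maxr; exact: mdiv.
have mMx' : measurable_fun D (fun p : MR * MR => Mx p `^ (2 / alpha)).
  exact: measurableT_comp (measurable_powR _) mMx.
have step1 : (\int[@area R]_(p in D) (F2 p * (a p + b p) * `|a p - b p|)%:E <=
    (\int[@area R]_(p in D) ((F2 p * (a p + b p)) `^ 2)%:E) `^ 2^-1 *
    (\int[@area R]_(p in D) (`|a p - b p| `^ 2)%:E) `^ 2^-1)%E.
  apply: hoelder_on => //; [exact: measurable_funM| |lra].
  by move=> p Dp; rewrite mulr_ge0// addr_ge0// ltW// ?a0 ?b0.
have step2 : (\int[@area R]_(p in D) ((F2 p * (a p + b p)) `^ 2)%:E <=
    4%:E * ((\int[@area R]_(p in D) (A p `^ th^-1)%:E) `^ th *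
     (\int[@area R]_(p in D) ((Mx p `^ (2 / alpha)) `^ (alpha / 2))%:E) `^ (2 / alpha)))%E.
  apply: (@le_trans _ _ (\int[@area R]_(p in D) (4%:E * (A p * Mx p `^ (2 / alpha))%:E))%E).
    apply: ge0_le_integral => //.
    - by move=> p _; rewrite lee_fin powR_ge0.
    - apply/measurable_EFinP.
      have mFab : measurable_fun D (fun p : MR * MR => F2 p * (a p + b p)) by exact: measurable_funM.
      exact: measurableT_comp (measurable_powR _) mFab.
    - by apply: emeasurable_funM => //; apply/measurable_EFinP; exact: measurable_funM.
    - move=> p Dp; rewrite -EFinM lee_fin powR_mulrn; last first.
        by rewrite mulr_ge0// addr_ge0// ltW// ?a0 ?b0.
      have -> : 4 * (A p * Mx p `^ (2 / alpha)) =
          F2 p ^+ 2 * (4 * (a p `^ (2 * (alpha - 2) / alpha) * Mx p `^ (2 / alpha))).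
        by rewrite /A; ring.
      rewrite exprMn; apply: ler_wpM2l; first exact: sqr_ge0.
      exact: sqr_le_energy (a0 Dp) (b0 Dp).
  rewrite ge0_integralZl//; last 2 first.
  - by apply/measurable_EFinP; exact: measurable_funM.
  - by move=> p Dp; rewrite lee_fin mulr_ge0 ?powR_ge0.
  rewrite lee_pmul2l//.
  have thE : th = (th^-1)^-1 by rewrite invrK.
  have alE : 2 / alpha = (alpha / 2)^-1 by rewrite invf_div.
  rewrite [X in (_ `^ X * _)%E]thE [X in (_ * _ `^ X)%E]alE; apply: hoelder_on => //.
  - by move=> p Dp; exact: powR_ge0.
  - by rewrite invr_gt0 divr_gt0.
  - by rewrite divr_gt0.
  - by rewrite invrK invf_div /th; field; rewrite gt_eqF.
(* The exponent of the inequality is dictated here: the power [1 / th] takes [|f - m|^4] to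
   [|f - m|^q] with [q = 4 / th], and [a^(2 th)] to the weight [a^2]. *)
have pA : (\int[@area R]_(p in D) (A p `^ th^-1)%:E =
    \int[@area R]_(p in D) (`|f p - m| `^ q * a p ^+ 2)%:E)%E.
  apply: eq_integral => p /set_mem Dp; congr (_%:E).
  rewrite /A powRM ?sqr_ge0 ?powR_ge0//; congr (_ * _).
    rewrite /F2 -(real_normK (num_real (f p - m))) -exprM -powR_mulrn// -powRrM.
    by congr (_ `^ _); rewrite /th /q; field; rewrite !gt_eqF.
  rewrite -powRrM -powR_mulrn ?ltW ?a0//.
  by congr (_ `^ _); rewrite /th; field; rewrite !gt_eqF.
have pM : (\int[@area R]_(p in D) ((Mx p `^ (2 / alpha)) `^ (alpha / 2))%:E =
    \int[@area R]_(p in D) (Mx p)%:E)%E.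
  apply: eq_integral => p _; rewrite -powRrM (_ : _ * _ = 1) ?powRr1//.
  by field; rewrite gt_eqF.
rewrite pA pM in step2.
have q0 : q != 0 by rewrite gt_eqF// divr_gt0// mulr_gt0.
set P := (\int[@area R]_(p in D) (`|f p - m| `^ q * a p ^+ 2)%:E)%E in hP step2.
have P0 : (0 <= P)%E.
  by apply: integral_ge0 => p _; rewrite lee_fin mulr_ge0 ?powR_ge0 ?sqr_ge0.
have mono (x y : \bar R) r : 0 <= r -> (0 <= x)%E -> (x <= y)%E -> (x `^ r <= y `^ r)%E.
  move=> r0 x0 xy; apply: gt0_ler_poweR => //; rewrite in_itv/= ?x0 ?leey//.
  by rewrite (le_trans x0 xy).
have b1 : (P `^ th <= ((C * S) ^+ 4)%:E)%E.
  have -> : th = q^-1 * 4 by rewrite /th /q; field; rewrite !gt_eqF.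
  rewrite poweRrM -powR_mulrn ?mulr_ge0// -poweR_EFin; apply: mono => //.
  exact: poweR_ge0.
have b2 : ((\int[@area R]_(p in D) (Mx p)%:E) `^ (2 / alpha) = (e ^+ 2)%:E)%E.
  by rewrite mulrC poweRrM eE poweR_EFin powR_mulrn.
have b3 : ((\int[@area R]_(p in D) ((F2 p * (a p + b p)) `^ 2)%:E) `^ 2^-1 <= (2 * (C * S) ^+ 2 * e)%:E)%E.
  have -> : 2 * (C * S) ^+ 2 * e = ((2 * (C * S) ^+ 2 * e) `^ 2) `^ 2^-1.
    by rewrite -powRrM divff// powRr1// !mulr_ge0.
  rewrite -poweR_EFin; apply: mono => //.
    by apply: integral_ge0 => p _; rewrite lee_fin powR_ge0.
  apply: le_trans step2 _; rewrite b2.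
  have -> : (2 * (C * S) ^+ 2 * e) `^ 2 = 4 * ((C * S) ^+ 4 * e ^+ 2).
    by rewrite powR_mulrn ?mulr_ge0//; ring.
  have -> : (4 * ((C * S) ^+ 4 * e ^+ 2))%:E = (4%:E * (((C * S) ^+ 4)%:E * (e ^+ 2)%:E))%E.
    by rewrite -!EFinM.
  by rewrite lee_pmul2l// lee_wpmul2r// lee_fin sqr_ge0.
have b4 : ((\int[@area R]_(p in D) (`|a p - b p| `^ 2)%:E) `^ 2^-1 = d%:E)%E.
  by rewrite -dE; congr (_ `^ _)%E; apply: eq_integral => p _; rewrite powR_mulrn.
rewrite b4 in step1.
apply: (@le_trans _ _ (\int[@area R]_(p in D) (F2 p * (a p + b p) * `|a p - b p|)%:E)%E).
  rewrite le_eqVlt; apply/orP; left; apply/eqP; apply: eq_integral => p /set_mem Dp.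
  congr (_%:E); rewrite -mulrA; congr (_ * _).
  by rewrite subr_sqr normrM mulrC [X in X * _]ger0_norm// addr_ge0// ltW// ?a0 ?b0.
apply: le_trans step1 _; apply: (@le_trans _ _ ((2 * (C * S) ^+ 2 * e)%:E * d%:E)%E).
  by rewrite lee_wpmul2r.
rewrite -EFinM lee_fin le_eqVlt; apply/orP; left; apply/eqP.
have SE : S ^+ 2 = dirichlet D g1 g2 by rewrite sqr_sqrtr// dirichlet_ge0.
by rewrite -SE; ring.
Qed.

End disc.
End hoelder_estimate.

(** * Conformal maps of the disc and their weights *)

Section bridge.
Variable R : realType.
Local Notation MR := (measurableTypeR R).
Implicit Types (U Omega : set R[i]) (phi : R[i] -> R[i]).
Local Notation disc := (@unit_disc R).
Local Notation dphi phi := (derive1 (phi : R[i]^o -> R[i]^o)).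

Lemma open_copen Omega : open (Omega : set R[i]^o) -> copen Omega.
Proof.
rewrite openE => oO z /oO /nbhs_ballP[e /= e0 he].
have Re0 : 0 < Re e by rewrite -(ltc_real 0 e0) e0.
exists (Re e) => // w wz; apply: he; rewrite /ball/= distrC normE.
by rewrite (ltc_real _ e0).
Qed.

Lemma copen_disc : copen disc.
Proof.
move=> z z1; exists (1 - nc z); first by rewrite subr_gt0.
move=> w wz; rewrite /unit_disc /=; apply: le_lt_trans (nc_le_add w z) _.
by rewrite -ltrBrDl.
Qed.

Lemma conformal_hol U V phi : conformal U V phi -> hol U phi (dphi phi).
Proof. by move=> [d _ _] z Uz; apply: derivable_cdiff; exact: d. Qed.

Lemma conformal_inverse U V phi : conformal U V phi ->
  exists chi, forall z, U z -> chi (phi z) = z.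
Proof.
move=> [_ inj _]; exists (fun w => xget 0 [set z | U z /\ phi z = w]) => z Uz.
by case: xgetP => [y _ [Uy e]|/(_ z)[]//]; exact: inj.
Qed.

Lemma area_disc_lty : (@area R (region disc) < +oo)%E.
Proof.
apply: (@le_lt_trans _ _ (@area R (cell (-1) 1 (-1) 1))).
  apply: le_measure; rewrite ?inE; [exact: measurable_region copen_disc|exact: measurable_cell|].
  move=> p h; apply/cellP; have {}h : nc (toC p) < 1 by exact: h.
  have := le_lt_trans (nc_Re (toC p)) h; have := le_lt_trans (nc_Im (toC p)) h => /=.
  by rewrite !ltr_norml => /andP[h1 h2] /andP[h3 h4]; rewrite h1 h3 !ltW.
by rewrite area_cell ?ltry//; lra.
Qed.

Lemma cell_disc a b c d : -4^-1 <= a -> b <= 4^-1 -> -4^-1 <= c -> d <= 4^-1 ->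
  cell a b c d `<=` region disc.
Proof.
move=> h1 h2 h3 h4 p /cellP/andP[/andP[k1 k2] /andP[k3 k4]].
apply: (le_lt_trans (nc_le (toC p))) => /=.
have r : `|p.1| <= 4^-1 by rewrite ler_norml; apply/andP; split; lra.
have i : `|p.2| <= 4^-1 by rewrite ler_norml; apply/andP; split; lra.
by lra.
Qed.

Lemma cell_not_negligible a b c d : a < b -> c < d -> ~ (@area R).-negligible (cell a b c d).
Proof.
move=> ab cd /(negligibleP _ (measurable_cell a b c d)).
rewrite [X in X = _](area_cell (ltW ab) (ltW cd)) => /eqP; rewrite eqe mulf_eq0.
by rewrite !subr_eq0 !gt_eqF.
Qed.

Lemma weight_integral_gt0 (k : R * R -> R) :
  measurable_fun (region disc : set (MR * MR)) k -> (forall p, region disc p -> 0 < k p) ->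
  (\int[@area R]_(p in region disc) (k p)%:E < +oo)%E ->
  0 < \int[@area R]_(p in region disc) k p.
Proof.
move=> mk k0 fin; have mD := measurable_region copen_disc.
rewrite lt_neqAle; apply/andP; split; last first.
  by apply: Rintegral_ge0 => p Dp; rewrite ltW// k0.
rewrite eq_sym; apply/eqP => i0.
have e p : (cst 1 p : R) ^+ 2 * k p = k p by rewrite expr1n mul1r.
have m1 : measurable_fun (region disc : set (MR * MR)) (cst 1 : R * R -> R) by exact: measurable_cst.
have := @sqr_integral_eq0 R _ (cst 1) k mD m1 mk k0.
under eq_integral do rewrite e; under eq_Rintegral do rewrite e.
move=> /(_ fin) /iffLR /(_ i0) neg.
apply: (@cell_not_negligible 0 4^-1 0 4^-1); [lra|lra|].
apply: negligibleS neg => p Cp /= h.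
have Dp : region disc p by apply: cell_disc Cp; lra.
by have := h Dp; apply/eqP; rewrite oner_eq0.
Qed.

Section map.
Variables (Omega : set R[i]) (phi : R[i] -> R[i]).
Hypotheses (cphi : conformal disc Omega phi).

Lemma abs_deriv_gt0 p : region disc p -> 0 < abs_deriv phi p.
Proof.
move=> Dp; have [chi chiK] := conformal_inverse cphi.
by rewrite nc_gt0; exact: (univalent_deriv_neq0 copen_disc (conformal_hol cphi) chiK Dp).
Qed.

Lemma measurable_abs_deriv : measurable_fun (region disc : set (MR * MR)) (abs_deriv phi).
Proof.
have [k hk] := hol_deriv copen_disc (conformal_hol cphi).
apply: (@rcont_measurable R disc (fun z => nc (dphi phi z)) copen_disc) => z Dz.
by apply: rcont_nc; exact: cdiff_cont (hk z Dz).
Qed.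

(** The right-hand side is therefore the same for all conformal maps of the disc onto [Omega], which
    [regular_weight] exploits. *)
Lemma conformal_area : @area R (region Omega) =
  (\int[@area R]_(p in region disc) (conformal_weight phi p)%:E)%E.
Proof.
have [chi chiK] := conformal_inverse cphi; have [_ _ im] := cphi.
have mO : measurable (region Omega : set (MR * MR)).
  by rewrite -im; exact: measurable_region (univalent_copen copen_disc (conformal_hol cphi) chiK).
rewrite -[LHS]mul1e -(integral_cst (@area R) mO) -im.
rewrite (change_of_variables copen_disc (conformal_hol cphi) chiK)//.
by apply: eq_integral => p _; rewrite mul1e.
Qed.

Lemma spectral_bound_disc n L : spectral_bound (region Omega) (cst 1) n L ->
  spectral_bound (region disc) (conformal_weight phi) n L.
Proof.
have [chi chiK] := conformal_inverse cphi; have [_ _ im] := cphi.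
rewrite -im => /(spectral_bound_comp copen_disc (conformal_hol cphi) chiK).
rewrite (_ : pull_weight _ _ _ = conformal_weight phi); last first.
  by apply/funext => p; rewrite /pull_weight mul1r.
by apply=> //; exact: measurable_cst.
Qed.

Lemma spectral_bound_weight_eq (A : set (R * R)) (h k : R * R -> R) n L :
  (forall p, A p -> h p = k p) -> spectral_bound A h n L -> spectral_bound A k n L.
Proof.
move=> hk [L0 [u [hu hL]]].
have E f : (\int[@area R]_(p in A) (f p ^+ 2 * h p)%:E = \int[@area R]_(p in A) (f p ^+ 2 * k p)%:E)%E.
  by apply: eq_integral => p /set_mem Ap; rewrite hk.
have W f g1 g2 : W12 A h f g1 g2 <-> W12 A k f g1 g2 by rewrite /W12 E.
split=> //; exists u; split.
  by move=> i; have [g1 [g2 /W]] := hu i; exists g1, g2.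
move=> c /hL; rewrite /Rintegral E => -[pos le]; split=> // g1 g2 /W; exact: le.
Qed.

(** The converse of [spectral_bound_disc], by pulling back along the inverse map: the pulled-back
    weight [|phi' o chi|^2 |chi'|^2] is 1 on [Omega]. *)
Lemma spectral_bound_range n L : spectral_bound (region disc) (conformal_weight phi) n L ->
  spectral_bound (region Omega) (cst 1) n L.
Proof.
have [chi chiK] := conformal_inverse cphi; have [_ _ im] := cphi.
have hphi := conformal_hol cphi.
have oO : copen Omega by rewrite -im; exact: univalent_copen copen_disc hphi chiK.
have hchi : hol Omega chi (fun w => (dphi phi (chi w))^-1).
  by rewrite -im; exact: univalent_inv copen_disc hphi chiK.
have phiK z : Omega z -> phi (chi z) = z by rewrite -im => -[y Dy <-]; rewrite chiK.
have imchi : chi @` Omega = disc.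
  apply/seteqP; split => [_ [w Ow <-]|z Dz].
    by move: Ow; rewrite -im => -[z Dz <-]; rewrite chiK.
  by exists (phi z); rewrite ?chiK// -im; exists z.
move=> sb; have := @spectral_bound_comp R Omega chi _ phi oO hchi phiK (conformal_weight phi).
rewrite imchi => /(_ _ _ n L sb) sb'.
apply: (spectral_bound_weight_eq _ (sb' _ _)).
- move=> p Op; rewrite /pull_weight /conformal_weight /abs_deriv /plane ofCK Normc.normcV.
  have Dc : disc (chi (toC p)) by rewrite -imchi; exists (toC p).
  by rewrite -exprMn mulfV ?expr1n// gt_eqF// nc_gt0; exact: (univalent_deriv_neq0 copen_disc hphi chiK Dc).
- by apply: measurable_funX; exact: measurable_abs_deriv.
- by move=> p _; exact: sqr_ge0.
Qed.

End map.

(** Regularity supplies some map [psi] with [|psi'|^alpha] integrable. Then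
    [|psi'|^2 <= 1 + |psi'|^alpha] shows that [Omega] has finite area, and this area is the integral
    of [|phi'|^2]. *)
Lemma regular_weight alpha Omega phi : 2 < alpha -> conformal_regular alpha Omega ->
  conformal disc Omega phi -> weight disc (conformal_weight phi).
Proof.
move=> al [[_ oO _] [psi [cpsi hpsi]]] cphi.
have mD := measurable_region copen_disc.
have fin : (\int[@area R]_(p in region disc) (conformal_weight phi p)%:E < +oo)%E.
  rewrite -(conformal_area cphi) (conformal_area cpsi).
  apply: (@le_lt_trans _ _ (\int[@area R]_(p in region disc) (1 + (abs_deriv psi p `^ alpha)%:E))%E).
    apply: ge0_le_integral => //.
    - by move=> p _; rewrite lee_fin sqr_ge0.
    - by apply/measurable_EFinP; apply: measurable_funX; exact: measurable_abs_deriv cpsi.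
    - apply: emeasurable_funD => //; apply/measurable_EFinP.
      exact: measurableT_comp (measurable_powR _) (measurable_abs_deriv cpsi).
    - move=> p Dp; rewrite -EFinD lee_fin; have t0 := abs_deriv_gt0 cpsi Dp.
      rewrite /conformal_weight -(powR_mulrn 2 (ltW t0)).
      have [t1|t1] := leP (abs_deriv psi p) 1.
        apply: (@le_trans _ _ 1); last by rewrite lerDl powR_ge0.
        by rewrite (powR_mulrn 2 (ltW t0)) exprn_ile1// ltW.
      apply: (@le_trans _ _ (abs_deriv psi p `^ alpha)); last by rewrite lerDr.
      by apply: ler_powR; exact: ltW.
  rewrite ge0_integralD//.
  - rewrite lte_add_pinfty// integral_cst// mul1e; exact: area_disc_lty.
  - by move=> p _; rewrite lee_fin powR_ge0.
  - apply/measurable_EFinP.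
    exact: measurableT_comp (measurable_powR _) (measurable_abs_deriv cpsi).
split=> //.
- by apply: measurable_funX; exact: measurable_abs_deriv cphi.
- by move=> p Dp; rewrite exprn_gt0//; exact: abs_deriv_gt0 cphi p Dp.
apply: weight_integral_gt0 => //.
- by apply: measurable_funX; exact: measurable_abs_deriv cphi.
- by move=> p Dp; rewrite exprn_gt0//; exact: abs_deriv_gt0 cphi p Dp.
Qed.

End bridge.

(** * Comparison of the eigenvalues *)

Section final.
Variable R : realType.
Local Notation MR := (measurableTypeR R).
Implicit Types (Omega : set R[i]) (phi : R[i] -> R[i]).
Local Notation disc := (@unit_disc R).
Let oD : copen disc := @copen_disc R.

(** If [B l2 >= 1] then already [l1 <= B l1 l2]. Otherwise the hypothesis applies for all small [t],
    and [t] tends to 0. *)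
Lemma eigenvalue_arith (l1 l2 B : R) : 0 <= l1 -> 0 <= l2 -> 0 <= B ->
  (forall t, 0 < t -> B * (l2 + t) < 1 -> l1 <= (l2 + t) * (1 + B * l1)) ->
  l1 - l2 <= B * (l1 * l2).
Proof.
move=> l10 l20 B0 h; have [Bl|Bl] := leP 1 (B * l2).
  by have : l1 * 1 <= l1 * (B * l2) by [rewrite ler_wpM2l]; nra.
suff : l1 <= l2 * (1 + B * l1) by nra.
have K0 : 0 < 1 + B * l1 by rewrite ltr_pwDl// mulr_ge0.
apply/ler_addgt0Pr => e e0.
(* The first bound keeps the error below [e], the second keeps [B (l2 + t) < 1]; [B + 1] allows
   [B = 0]. *)
pose t := Num.min (e / (1 + B * l1)) ((1 - B * l2) / (2 * (B + 1))).
have s0 : 0 < 2 * (B + 1) by rewrite mulr_gt0// ltr_wpDl.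
have t0 : 0 < t by rewrite lt_min !divr_gt0// subr_gt0.
have t1 : t * (1 + B * l1) <= e by rewrite -ler_pdivlMr// ge_min lexx.
have t2 : t * (2 * (B + 1)) <= 1 - B * l2 by rewrite -ler_pdivlMr// ge_min lexx orbT.
have Bt : B * (l2 + t) < 1.
  have : 0 <= B * t by rewrite mulr_ge0// ltW.
  by nra.
by apply: le_trans (h t t0 Bt) _; rewrite mulrDl lerD2l.
Qed.

(** A bound [L] slightly above [l2] is carried to the disc, changed to the other weight and carried
    to [Omega1]. It becomes [l1 <= L / (1 - B L)], that is [l1 <= L (1 + B l1)]. *)
Lemma eigenvalue_close Omega1 Omega2 phi1 phi2 n (B l1 l2 : R) : (0 < n)%N ->
  copen Omega1 -> copen Omega2 ->
  conformal disc Omega1 phi1 -> conformal disc Omega2 phi2 ->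
  weight disc (conformal_weight phi1) -> weight disc (conformal_weight phi2) -> 0 <= B ->
  close_weights disc B (conformal_weight phi1) (conformal_weight phi2) ->
  close_weights disc B (conformal_weight phi2) (conformal_weight phi1) ->
  neumann_eigenvalue Omega1 n = l1%:E -> neumann_eigenvalue Omega2 n = l2%:E ->
  l1 - l2 <= B * (l1 * l2).
Proof.
move=> n0 o1 o2 c1 c2 w1 w2 B0 b12 b21 e1 e2.
have l10 : 0 <= l1 by rewrite -lee_fin -e1 eigenvalue_ge0.
have l20 : 0 <= l2 by rewrite -lee_fin -e2 eigenvalue_ge0.
apply: eigenvalue_arith => // t t0 Bt.
have : (neumann_eigenvalue Omega2 n < (l2 + t)%:E)%E by rewrite e2 lte_fin ltrDl.
move=> /(eigenvalue_spectral_bound o2 n0)[L]; rewrite lte_fin => Ll sb.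
have L0 : 0 <= L by case: sb.
have BL : B * L < 1 by apply: le_lt_trans Bt; rewrite ler_wpM2l// ltW.
have := spectral_bound_close oD n0 B0 w2 w1 b21 b12 BL (spectral_bound_disc c2 sb).
move=> /(spectral_bound_range c1) /(spectral_bound_eigenvalue o1).
rewrite e1 lee_fin ler_pdivlMr ?subr_gt0// => h.
have : L * (1 + B * l1) <= (l2 + t) * (1 + B * l1).
  by apply: ler_wpM2r; [rewrite addr_ge0 ?mulr_ge0|exact: ltW].
by nra.
Qed.

(* The inequality is tested on [p.1]. *)
Lemma poincare_sobolev_gt0 phi Omega q : 0 < q -> conformal disc Omega phi ->
  weight disc (conformal_weight phi) ->
  (0 < poincare_sobolev_const (region disc) (conformal_weight phi) q)%E.
Proof.
move=> q0 cphi [mh h0 hoo hpos]; rewrite ltNge; apply/negP => C0.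
have mD := measurable_region oD.
have hid : hol disc id (fun=> 1) by move=> z _; exact: cdiff_id.
pose f (p : R * R) := p.1.
have sf k : Ck k f by exact: (smo_Ck (@smo_Re R k setT id (fun=> 1) (fun _ _ => ex_intro2 _ _ 1 ltr01 (fun _ _ => I)) (fun z _ => cdiff_id z))).
have df p : 'D_(1, 0) f p = 1 /\ 'D_(0, 1) f p = 0.
  have := rdiff_Re (cdiff_id (toC p)); rewrite oppr0 => /rdiff_is_derive[d1 d2].
  split; [exact: (@derive_val _ _ _ _ _ _ _ d1)|exact: (@derive_val _ _ _ _ _ _ _ d2)].
have hW : W12 (region disc) (conformal_weight phi) f ('D_(1, 0) f) ('D_(0, 1) f).
  split; first exact: weak_gradient_smooth.
    apply: le_lt_trans hoo; apply: ge0_le_integral => //.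
    - by move=> p Dp; rewrite lee_fin mulr_ge0 ?sqr_ge0.
    - apply/measurable_EFinP; apply: measurable_funM => //; apply: measurable_funX.
      by apply: (@measurable_funS _ _ _ _ setT) => //; apply: continuous_measurable; exact: Ck_cont (sf 0%N).
    - exact/measurable_EFinP.
    - move=> p Dp; rewrite lee_fin; apply: ler_piMl; first exact: ltW (h0 _ Dp).
      rewrite -real_normK ?num_real// exprn_ile1//; apply: ltW.
      by apply: le_lt_trans (Dp : nc (toC p) < 1); exact: nc_Re (toC p).
  under eq_integral do rewrite (df _).1 (df _).2 expr0n addr0 expr1n.
  by rewrite integral_cst// mul1e; exact: area_disc_lty.
have := poincare_sobolev_le C0 hW; rewrite mul0r; set m := weighted_mean _ _ _.
set P := (\int[_]_(_ in _) _)%E => hP.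
have P0 : (0 <= P)%E by apply: integral_ge0 => p _; rewrite lee_fin mulr_ge0 ?powR_ge0 ?sqr_ge0.
have {}hP : P = 0%E.
  by apply: (poweR_eq0_eq0 P0 (r := q^-1)); apply/eqP; rewrite eq_le hP poweR_ge0.
(* The power [q / 2] turns the vanishing integral of [|f - m|^q] into a vanishing weighted square
   norm, so [p.1 = m] almost everywhere. *)
pose g (p : R * R) := `|f p - m| `^ (q / 2).
have mf : measurable_fun (region disc : set (MR * MR)) f.
  by apply: (@measurable_funS _ _ _ _ setT) => //; apply: continuous_measurable; exact: Ck_cont (sf 0%N).
have mfm : measurable_fun (region disc : set (MR * MR)) ((fun p => `|f p - m|) : MR * MR -> R).
  by apply: measurableT_comp => //; exact: measurable_funB.
have mg : measurable_fun (region disc : set (MR * MR)) (g : MR * MR -> R).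
  exact: measurableT_comp (measurable_powR _) mfm.
have gE : (\int[@area R]_(p in region disc) (g p ^+ 2 * conformal_weight phi p)%:E)%E = 0%E.
  rewrite -[RHS]hP; apply: eq_integral => p _; congr ((_ * _)%:E).
  by rewrite /g -powR_mulrn ?powR_ge0// -powRrM divfK.
have := @sqr_integral_eq0 R _ g _ mD mg mh h0; rewrite /Rintegral gE.
move=> /(_ (ltry _)) /iffLR /(_ erefl) neg.
have fm p : region disc p -> (region disc p -> g p = 0) -> p.1 = m.
  move=> Dp /(_ Dp) /eqP; rewrite powR_eq0 => /andP[+ _].
  by rewrite normr_eq0 subr_eq0 => /eqP.
(* A cell of positive area that misses the line [p.1 = m]: to the left of the imaginary axis if [m]
   lies in []0, 1/4]], to its right otherwise. *)
have [m0|m0] := boolP (0 < m <= 4^-1).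
  apply: (@cell_not_negligible R (-4^-1) 0 0 4^-1); [lra|lra|].
  apply: negligibleS neg => p Cp /= hp.
  have Dp : region disc p by apply: cell_disc Cp; lra.
  move: Cp m0 => /cellP/andP[/andP[k1 k2] _]; rewrite -(fm _ Dp hp) => /andP[k3 _].
  by move: (lt_le_trans k3 k2); rewrite ltxx.
apply: (@cell_not_negligible R 0 4^-1 0 4^-1); [lra|lra|].
apply: negligibleS neg => p Cp /= hp.
have Dp : region disc p by apply: cell_disc Cp; lra.
by move: Cp m0 => /cellP/andP[/andP[k1 k2] _]; rewrite -(fm _ Dp hp) k1 k2.
Qed.

(** With a zero energy an infinite Poincare-Sobolev constant would be annihilated in the final
    product. Positivity holds because both derivatives are nonzero on the disc. *)
Lemma energy_gt0 alpha phi1 phi2 Omega1 Omega2 :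
  conformal disc Omega1 phi1 -> conformal disc Omega2 phi2 -> (0 < energy alpha phi1 phi2)%E.
Proof.
move=> c1 c2; apply: poweR_gt0.
pose k p := energy_density alpha (abs_deriv phi1 p) (abs_deriv phi2 p).
have k0 p : region disc p -> 0 < k p.
  move=> Dp; have := abs_deriv_gt0 c1 Dp; have := abs_deriv_gt0 c2 Dp; rewrite /k.
  move: (abs_deriv phi1 p) (abs_deriv phi2 p) => x y y0 x0.
  by rewrite lt_max; apply/orP; left; apply: divr_gt0; exact: powR_gt0.
have mk : measurable_fun (region disc : set (MR * MR)) k.
  have mdiv (r1 r2 : MR * MR -> R) : measurable_fun (region disc) r1 -> measurable_fun (region disc) r2 ->
      measurable_fun (region disc) (fun p => r1 p `^ alpha / r2 p `^ (alpha - 2)).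
    move=> m1 m2; under eq_fun do rewrite -powRN; apply: measurable_funM.
      exact: measurableT_comp (measurable_powR _) m1.
    exact: measurableT_comp (measurable_powR _) m2.
  have m1 := measurable_abs_deriv c1; have m2 := measurable_abs_deriv c2.
  exact: measurable_maxr (mdiv _ _ m1 m2) (mdiv _ _ m2 m1).
have [fin|] := ltP (\int[@area R]_(p in region disc) (k p)%:E)%E +oo%E; last first.
  by move=> h; exact: lt_le_trans (ltry 0) h.
have i0 : (0 <= \int[@area R]_(p in region disc) (k p)%:E)%E.
  by apply: integral_ge0 => p Dp; rewrite lee_fin ltW// k0.
have := weight_integral_gt0 mk k0 fin.
by rewrite -lte_fin fineK// ge0_fin_numE.
Qed.

End final.

(** * Symmetry in the two maps *)

Section symmetry.
Variables (R : realType) (D : set (R * R)) (a b : R * R -> R).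

Lemma L2_distC :
  ((\int[@area R]_(p in D) (`|a p - b p| ^+ 2)%:E) `^ 2^-1 =
   (\int[@area R]_(p in D) (`|b p - a p| ^+ 2)%:E) `^ 2^-1)%E.
Proof.
have -> : (fun p => (`|a p - b p| ^+ 2)%:E) = (fun p => (`|b p - a p| ^+ 2)%:E) => //.
by apply/funext => p; rewrite distrC.
Qed.

Lemma energyC (alpha : R) :
  ((\int[@area R]_(p in D) (energy_density alpha (a p) (b p))%:E) `^ alpha^-1 =
   (\int[@area R]_(p in D) (energy_density alpha (b p) (a p))%:E) `^ alpha^-1)%E.
Proof.
have -> : (fun p => (energy_density alpha (a p) (b p))%:E) =
    (fun p => (energy_density alpha (b p) (a p))%:E) => //.
by apply/funext => p; rewrite energy_densityC.
Qed.

End symmetry.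

(** * The case of zero distance *)

Section zero_distance.
Variable R : realType.
Local Notation MR := (measurableTypeR R).
Variable W : set R[i].
Hypothesis oW : copen W.
Let D : set (MR * MR) := region W.
Let mD : measurable D := measurable_region oW.
Variables (a b : R * R -> R).
Hypotheses (ma : measurable_fun D (a : MR * MR -> R)) (mb : measurable_fun D (b : MR * MR -> R)).

(** For distance zero the right-hand side of the theorem is 0 even if another factor is infinite, so
    the eigenvalues have to coincide: the two weights agree almost everywhere. *)
Lemma close_weights0 :
  ((\int[@area R]_(p in D) (`|a p - b p| ^+ 2)%:E) `^ 2^-1 = 0%:E)%E ->
  close_weights W 0 (fun p => a p ^+ 2) (fun p => b p ^+ 2).
Proof.
move=> d0 f g1 g2 [[[mf _] _ _ _] _ _]; rewrite mul0r.
have mone : measurable_fun D (cst 1 : MR * MR -> R) by exact: measurable_cst.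
have md : measurable_fun D ((fun p => `|a p - b p|) : MR * MR -> R).
  by apply: measurableT_comp => //; exact: measurable_funB.
have dE : (\int[@area R]_(p in D) (`|a p - b p| ^+ 2 * cst 1 p)%:E)%E = 0%E.
  transitivity (\int[@area R]_(p in D) (`|a p - b p| ^+ 2)%:E)%E.
    by apply: eq_integral => p _; rewrite mulr1.
  apply: (poweR_eq0_eq0 _ d0).
  by apply: integral_ge0 => p _; rewrite lee_fin sqr_ge0.
have := @sqr_integral_eq0 R D _ _ mD md mone (fun _ _ => ltr01); rewrite /Rintegral dE.
move=> /(_ (ltry _)) /iffLR /(_ erefl) neg.
rewrite le_eqVlt; apply/orP; left; apply/eqP.
set m := weighted_mean _ _ _.
apply: etrans (integral0 (@area R) D); apply: ge0_ae_eq_integral => //.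
- apply/measurable_EFinP; apply: measurable_funM; first by apply: measurable_funX; exact: measurable_funB.
  by apply: measurableT_comp => //; apply: measurable_funB; exact: measurable_funX.
- by move=> p _; rewrite lee_fin mulr_ge0 ?sqr_ge0.
apply: negligibleS neg => p /= np hp; apply: np => Dp.
have /eqP := hp Dp; rewrite normr_eq0 subr_eq0 => /eqP e.
by rewrite e subrr normr0 mulr0.
Qed.

End zero_distance.

(** * Infinite factors in the final product *)

Section extended.
Variable R : realType.
Local Open Scope ereal_scope.
Implicit Types c C E d : \bar R.

Lemma mule5_ge0 c C E d : 0 <= c -> 0 <= C -> 0 <= E -> 0 <= d ->
  0 <= 2%:E * c * C ^+ 2 * E * d.
Proof. by move=> c0 C0 E0 d0; rewrite expe2 !mule_ge0. Qed.

Lemma mule5_pinfty c C E d : 0 < c -> 0 < C -> 0 < E -> 0 < d ->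
  [\/ C = +oo, E = +oo | d = +oo] -> 2%:E * c * C ^+ 2 * E * d = +oo.
Proof.
move=> c0 C0 E0 d0; have h2 : (0 : \bar R) < 2%:E by rewrite lte_fin.
have h2c : 0 < 2%:E * c by rewrite mule_gt0.
have hC : 0 < C ^+ 2 by rewrite expe2 mule_gt0.
case=> e; rewrite e.
- by rewrite expe2 mulyy gt0_muley// !gt0_mulye.
- by rewrite gt0_muley ?mule_gt0// gt0_mulye.
- by rewrite gt0_muley ?mule_gt0.
Qed.

(** Reduction to real factors. A zero distance is covered by the first implication, and a zero
    maximum forces [l1 = l2 = 0]. Apart from these cases all factors are positive, so an infinite
    one makes the product [+oo], and otherwise the real estimate applies. *)
Lemma real_cases (l1 l2 : R) C E d : (0 <= l1)%R -> (0 <= l2)%R ->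
  0 < C -> 0 < E -> 0 <= d -> (d = 0 -> (`|l1 - l2| <= 0)%R) ->
  (forall c e x : R, (0 <= c)%R -> (0 <= e)%R -> (0 <= x)%R -> C = c%:E -> E = e%:E -> d = x%:E ->
    (`|l1 - l2| <= 2 * c ^+ 2 * e * x * Num.max (l1 ^+ 2) (l2 ^+ 2))%R) ->
  `|(l1 - l2)%:E| <= 2%:E * (Num.max (l1 ^+ 2) (l2 ^+ 2))%:E * C ^+ 2 * E * d.
Proof.
move=> l10 l20 C0 E0 d0 h0 h.
have cn0 : (0 <= Num.max (l1 ^+ 2) (l2 ^+ 2))%R by rewrite le_max sqr_ge0.
have RHS0 : 0 <= 2%:E * (Num.max (l1 ^+ 2) (l2 ^+ 2))%:E * C ^+ 2 * E * d.
  by apply: mule5_ge0 => //; exact: ltW.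
have [/h0 z|dnz] := eqVneq d 0.
  by apply: le_trans RHS0; rewrite abse_EFin lee_fin.
have {}d0 : 0 < d by rewrite lt_def dnz.
have [cz|cnz] := eqVneq (Num.max (l1 ^+ 2) (l2 ^+ 2))%R 0%R.
  have z1 : l1 = 0%R by apply/eqP; rewrite -sqrf_eq0 eq_le sqr_ge0 andbT -cz le_max lexx.
  have z2 : l2 = 0%R by apply/eqP; rewrite -sqrf_eq0 eq_le sqr_ge0 andbT -cz le_max lexx orbT.
  have -> : `|(l1 - l2)%:E| = 0 by rewrite z1 z2 subrr abse_EFin normr0.
  exact: RHS0.
have {}cn0 : 0 < (Num.max (l1 ^+ 2) (l2 ^+ 2))%:E by rewrite lte_fin lt_def cnz.
have [inf|fin] := pselect [\/ C = +oo, E = +oo | d = +oo].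
  by rewrite mule5_pinfty// leey.
have real (x : \bar R) : 0 < x -> x <> +oo -> exists2 r, (0 <= r)%R & x = r%:E.
  by case: x => // r; rewrite lte_fin => r0 _; exists r => //; exact: ltW.
have [c c0 Cc] : exists2 r, (0 <= r)%R & C = r%:E by apply: real => // k; apply: fin; constructor 1.
have [e e0 Ee] : exists2 r, (0 <= r)%R & E = r%:E by apply: real => // k; apply: fin; constructor 2.
have [x x0 dx] : exists2 r, (0 <= r)%R & d = r%:E by apply: real => // k; apply: fin; constructor 3.
have := h _ _ _ c0 e0 x0 Cc Ee dx; rewrite Cc Ee dx -EFin_expe -!EFinM abse_EFin lee_fin => k.
by apply: le_trans k _; rewrite le_eqVlt; apply/orP; left; apply/eqP; ring.
Qed.

Lemma le_maxel (x y : \bar R) : x <= Order.max x y. Proof. by rewrite le_max lexx. Qed.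
Lemma le_maxer (x y : \bar R) : y <= Order.max x y. Proof. by rewrite le_max lexx orbT. Qed.

End extended.

Section eigenvalues.
Variable R : realType.
Local Notation disc := (@unit_disc R).

Lemma eigenvalue_fin_num (Omega : set R[i]) n : copen Omega -> Omega !=set0 -> (0 < n)%N ->
  exists2 l, 0 <= l & neumann_eigenvalue Omega n = l%:E.
Proof.
move=> oO ne n0; have [L /(spectral_bound_eigenvalue oO) lL] := spectral_bound_exists n oO ne.
have l0 := eigenvalue_ge0 Omega n0.
have fl : neumann_eigenvalue Omega n \is a fin_num.
  by rewrite ge0_fin_numE//; apply: le_lt_trans lL _; rewrite ltry.
by exists (fine (neumann_eigenvalue Omega n)); [exact: fine_ge0|rewrite fineK].
Qed.

End eigenvalues.

Theorem theorem1p4 (R : realType) (alpha : R) (halpha : 2 < alpha)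
    (Omega1 Omega2 : set R[i])
    (hpair : conformal_regular_pair alpha Omega1 Omega2)
    (phi1 phi2 : R[i] -> R[i])
    (hphi1 : conformal (@unit_disc R) Omega1 phi1)
    (hphi2 : conformal (@unit_disc R) Omega2 phi2)
    (n : nat) (hn : (0 < n)%N) :
  let c_n := Order.max (neumann_eigenvalue Omega1 n ^+ 2)%E
                       (neumann_eigenvalue Omega2 n ^+ 2)%E in
  (`| neumann_eigenvalue Omega1 n - neumann_eigenvalue Omega2 n |
    <= 2%:E * c_n * C_const phi1 phi2 (4 * alpha / (alpha - 2)) ^+ 2
       * energy alpha phi1 phi2 * deriv_L2_dist phi1 phi2)%E.
Proof.
cbv zeta; set c_n := Order.max (_ ^+ 2)%E (_ ^+ 2)%E; have [r1 r2 _] := hpair.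
have [[ne1 /open_copen o1 _] _] := r1; have [[ne2 /open_copen o2 _] _] := r2.
have [l1 l10 e1] := eigenvalue_fin_num o1 ne1 hn.
have [l2 l20 e2] := eigenvalue_fin_num o2 ne2 hn.
have w1 := regular_weight halpha r1 hphi1; have w2 := regular_weight halpha r2 hphi2.
have al2 : 0 < alpha - 2 by rewrite subr_gt0.
have q0 : 0 < 4 * alpha / (alpha - 2).
  by rewrite divr_gt0// mulr_gt0//; exact: lt_trans halpha.
have P1 := poincare_sobolev_gt0 q0 hphi1 w1; have P2 := poincare_sobolev_gt0 q0 hphi2 w2.
have E0 := energy_gt0 alpha hphi1 hphi2.
have C1 : (poincare_sobolev_const (region (@unit_disc R)) (conformal_weight phi1) (4 * alpha / (alpha - 2))
    <= C_const phi1 phi2 (4 * alpha / (alpha - 2)))%E by exact: le_maxel.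
have C2 : (poincare_sobolev_const (region (@unit_disc R)) (conformal_weight phi2) (4 * alpha / (alpha - 2))
    <= C_const phi1 phi2 (4 * alpha / (alpha - 2)))%E by exact: le_maxer.
have C0 := lt_le_trans P1 C1.
have d0 : (0 <= deriv_L2_dist phi1 phi2)%E by exact: poweR_ge0.
have cE : c_n = (Num.max (l1 ^+ 2) (l2 ^+ 2))%:E.
  by rewrite /c_n e1 e2 -!EFin_expe EFin_max.
have l12 : l1 * l2 <= Num.max (l1 ^+ 2) (l2 ^+ 2).
  have [h|h] := leP l1 l2.
    by rewrite le_max; apply/orP; right; rewrite expr2 ler_wpM2r.
  by rewrite le_max; apply/orP; left; rewrite expr2 ler_wpM2l// ltW.
(* Stated for an arbitrary [B]: it is used with [B = 2 c^2 e x] when all factors are finite and with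
   [B = 0] when the distance vanishes. *)
have main B : 0 <= B ->
    close_weights (@unit_disc R) B (conformal_weight phi1) (conformal_weight phi2) ->
    close_weights (@unit_disc R) B (conformal_weight phi2) (conformal_weight phi1) ->
    `|l1 - l2| <= B * Num.max (l1 ^+ 2) (l2 ^+ 2).
  move=> B0 b12 b21.
  have := eigenvalue_close hn o1 o2 hphi1 hphi2 w1 w2 B0 b12 b21 e1 e2.
  have := eigenvalue_close hn o2 o1 hphi2 hphi1 w2 w1 B0 b21 b12 e2 e1.
  have := ler_wpM2l B0 l12; rewrite [l2 * l1]mulrC.
  move: (B * (l1 * l2)) (B * _) => x y; clear => xy h1 h2.
  by rewrite ler_norml; apply/andP; split; lra.
have distC : deriv_L2_dist phi2 phi1 = deriv_L2_dist phi1 phi2.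
  exact: L2_distC.
have m1 := measurable_abs_deriv hphi1; have m2 := measurable_abs_deriv hphi2.
have E21 : ((\int[@area R]_(p in region (@unit_disc R))
    (energy_density alpha (abs_deriv phi2 p) (abs_deriv phi1 p))%:E) `^ alpha^-1 = energy alpha phi1 phi2)%E.
  exact: energyC.
have h0 : deriv_L2_dist phi1 phi2 = 0%E -> `|l1 - l2| <= 0.
  move=> dz; have := main 0 (lexx _) (close_weights0 (@copen_disc R) m1 m2 dz)
    (close_weights0 (@copen_disc R) m2 m1 (etrans distC dz)).
  by rewrite mul0r.
have hr (c e x : R) : 0 <= c -> 0 <= e -> 0 <= x -> C_const phi1 phi2 (4 * alpha / (alpha - 2)) = c%:E ->
    energy alpha phi1 phi2 = e%:E -> deriv_L2_dist phi1 phi2 = x%:E ->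
    `|l1 - l2| <= 2 * c ^+ 2 * e * x * Num.max (l1 ^+ 2) (l2 ^+ 2).
  move=> c0 e0 x0 Cc Ee dx; apply: main; first by rewrite !mulr_ge0 ?sqr_ge0.
    rewrite Cc in C1.
    exact: (close_weights_energy (@copen_disc R) halpha m1 m2 (abs_deriv_gt0 hphi1) (abs_deriv_gt0 hphi2) c0 C1 Ee dx).
  rewrite Cc in C2.
  exact: (close_weights_energy (@copen_disc R) halpha m2 m1 (abs_deriv_gt0 hphi2) (abs_deriv_gt0 hphi1) c0 C2 (etrans E21 Ee) (etrans distC dx)).
have fin := real_cases l10 l20 C0 E0 d0 h0 hr.
have -> : (neumann_eigenvalue Omega1 n - neumann_eigenvalue Omega2 n)%E = (l1 - l2)%:E.
  by rewrite e1 e2.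
by rewrite cE; exact: fin.
Qed.
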